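(* Let $H$ be a hereditary algebra and let $A=\begin{pmatrix} B & 0\\ M & H_1\end{pmatrix}$ be a silted algebra with respect to $(T,P)$ for $H$, where $(T,P)$ is a support $\tau$-tilting pair in $\operatorname{mod}H$, $B=\operatorname{End}_H(T)$, $H_1=\operatorname{End}_H(P)$ and $M=\operatorname{Ext}^1_H(T,P)$. If $\operatorname{Hom}_H(P,\tau_H^{-1}T)=0$, then the triangular matrix algebra $$\begin{pmatrix} B\ltimes \operatorname{Ext}^2_B(DB,B) & 0\\ M & H_1\end{pmatrix}$$ is a cluster-tilted algebra.
   Context: All algebras are finite dimensional over an algebraically closed field $k$; $\operatorname{mod}A$ is the category of finitely generated right $A$-modules, $\operatorname{proj}A$ its full subcategory of projectives, $\mathrm K^b(\operatorname{proj}A)$ the bounded homotopy category, $\mathcal D^b(A)$ the bounded derived category of $\operatorname{mod}A$. All modules are basic. $|X|$ is the number of pairwise non-isomorphic indecomposable direct summands of $X$ (and $|A|$ that of $A$ as a module over itself). $D=\operatorname{Hom}_k(-,k)$ is the standard duality. $\tau$ (or $\tau_A$) denotes the Auslander–Reiten translation of $\operatorname{mod}A$, and $\tau_H^{-1}$ the inverse translation in $\operatorname{mod}H$. Blocks of matrix algebras are allowed to be zero. A module $T\in\operatorname{mod}A$ is $\tau$-rigid if $\operatorname{Hom}_A(T,\tau T)=0$. A pair $(T,P)$ with $T\in\operatorname{mod}A$ and $P\in\operatorname{proj}A$ is a support $\tau$-tilting pair if $T$ is $\tau$-rigid, $\operatorname{Hom}_A(P,T)=0$ and $|T|+|P|=|A|$.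 A complex $\mathbf P\in\mathrm K^b(\operatorname{proj}A)$ is silting if $\operatorname{Hom}_{\mathrm K^b(\operatorname{proj}A)}(\mathbf P,\mathbf P[i])=0$ for all $i>0$ and $\mathbf P$ generates $\mathrm K^b(\operatorname{proj}A)$ as a triangulated category; it is 2-term if it has nonzero terms only in degrees $-1$ and $0$. The support $\tau$-tilting pair $(T,P)$ corresponds to the 2-term silting complex $P_1\oplus P\to P_0$, where $P_1\to P_0$ is a minimal projective presentation of $T$ and the map is zero on $P$. An algebra $A$ is a silted algebra with respect to $(T,P)$ for a hereditary algebra $H$ if $A\cong\operatorname{End}_{\mathcal D^b(H)}(\mathbf P)$, where $\mathbf P$ is the 2-term silting complex corresponding to the support $\tau$-tilting pair $(T,P)$ in $\operatorname{mod}H$. For such $A$, since $\mathbf P\cong T\oplus P[1]$ in $\mathcal D^b(H)$, one writes $A$ as the triangular matrix algebra $\begin{pmatrix} B & 0\\ M & H_1\end{pmatrix}$ with $B=\operatorname{End}_{\mathcal D^b(H)}(T)=\operatorname{End}_H(T)$, $H_1=\operatorname{End}_{\mathcal D^b(H)}(P[1])\cong\operatorname{End}_H(P)$, and $M=\operatorname{Hom}_{\mathcal D^b(H)}(T,P[1])\cong\operatorname{Ext}^1_H(T,P)$, which is an $H_1$-$B$-bimodule ($H_1$ acting by postcomposition, $B$ by precomposition). For a $B$-$B$-bimodule $E$, $B\ltimes E$ denotes the trivial extension: the vector space $B\oplus E$ with $(b,\xi)(b',\xi')=(bb',b\xi'+\xi b')$. $\operatorname{Ext}^2_B(DB,B)$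 carries its natural $B$-$B$-bimodule structure. In the matrix algebra of the claim, $M$ is regarded as an $H_1$-$(B\ltimes\operatorname{Ext}^2_B(DB,B))$-bimodule through the projection $B\ltimes\operatorname{Ext}^2_B(DB,B)\to B$. The cluster category $\mathcal C_H$ of a hereditary algebra $H$ is the orbit category $\mathcal D^b(H)/F$, $F=\tau_{\mathcal D}^{-1}[1]$, where $\tau_{\mathcal D}^{-1}$ is the inverse Auslander–Reiten translation of $\mathcal D^b(H)$; $\operatorname{Hom}_{\mathcal C_H}(\tilde X,\tilde Y)=\bigoplus_{i\in\mathbb Z}\operatorname{Hom}_{\mathcal D^b(H)}(X,F^iY)$. It is a triangulated category. An object $\tilde T$ of $\mathcal C_H$ is tilting if $\operatorname{Ext}^1_{\mathcal C_H}(\tilde T,\tilde T)=\operatorname{Hom}_{\mathcal C_H}(\tilde T,\tilde T[1])=0$ and the number of isomorphism classes of indecomposable summands of $\tilde T$ equals $|H|$. An algebra is cluster-tilted if it is isomorphic to $\operatorname{End}_{\mathcal C_{H}}(\tilde T)$ for some hereditary algebra $H$ and some (basic) tilting object $\tilde T$ of $\mathcal C_{H}$. *)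

(* Defs.v *)
From HB Require Import structures.
From mathcomp Require Import all_boot all_order all_algebra.
From mathcomp Require Import boolp classical_sets functions cardinality fsbigop.

Set Implicit Arguments.
Unset Strict Implicit.
Unset Printing Implicit Defensive.
Import GRing.Theory.
Local Open Scope ring_scope.

(* MathComp's [algType] and [falgType] require [1 != 0]; the zero algebra has
   to be allowed here, so unital associative algebras are introduced afresh. *)
HB.mixin Record Lmodule_isAlg (k : fieldType) A of GRing.Lmodule k A := {
  aone : A;
  amul : A -> A -> A;
  amulA : associative amul;
  amul1l : left_id aone amul;
  amul1r : right_id aone amul;
  amul_linl : forall y : A, linear (amul^~ y);
  amul_linr : forall x : A, linear (amul x)
}.
#[short(type="pzAlgType")]
HB.structure Definition PzAlg (k : fieldType) :=
  { A of GRing.Lmodule k A & Lmodule_isAlg k A }.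
#[short(type="fdAlgType")]
HB.structure Definition FDAlg (k : fieldType) := { A of PzAlg k A & Vector k A }.
Arguments aone {k} A : rename.
Infix "**" := amul (at level 40, left associativity) : ring_scope.

Record alghom (k : fieldType) (A B : pzAlgType k) := AlgHom {
  alghom_fun :> A -> B;
  alghom_linear : linear alghom_fun;
  alghom1 : alghom_fun (aone A) = aone B;
  alghomM : {morph alghom_fun : x y / x ** y}
}.
Definition alg_iso (k : fieldType) (A B : pzAlgType k) :=
  exists f : alghom A B, bijective f.

Section DependentProduct.
Variables (k : fieldType) (I : Type) (V : I -> lmodType k).

Definition dprod := forall i, V i.

HB.instance Definition _ := gen_eqMixin dprod.
HB.instance Definition _ := gen_choiceMixin dprod.

Let add (f g : dprod) : dprod := fun i => f i + g i.
Let opp (f : dprod) : dprod := fun i => - f i.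
Let zero : dprod := fun i => 0.
Let scale (c : k) (f : dprod) : dprod := fun i => c *: f i.

Fact dprod_addA : associative add.
Proof. by move=> f g h; apply: functional_extensionality_dep => i; apply: addrA. Qed.
Fact dprod_addC : commutative add.
Proof. by move=> f g; apply: functional_extensionality_dep => i; apply: addrC. Qed.
Fact dprod_add0 : left_id zero add.
Proof. by move=> f; apply: functional_extensionality_dep => i; apply: add0r. Qed.
Fact dprod_addN : left_inverse zero opp add.
Proof. by move=> f; apply: functional_extensionality_dep => i; apply: addNr. Qed.
HB.instance Definition _ :=
  GRing.isZmodule.Build dprod dprod_addA dprod_addC dprod_add0 dprod_addN.

Fact dprod_scaleA c d (f : dprod) : scale c (scale d f) = scale (c * d) f.
Proof. by apply: functional_extensionality_dep => i; apply: scalerA. Qed.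
Fact dprod_scale1 : left_id 1 scale.
Proof. by move=> f; apply: functional_extensionality_dep => i; apply: scale1r. Qed.
Fact dprod_scaleDr : right_distributive scale +%R.
Proof. by move=> c f g; apply: functional_extensionality_dep => i; apply: scalerDr. Qed.
Fact dprod_scaleDl (f : dprod) : {morph scale^~ f : c d / c + d}.
Proof. by move=> c d; apply: functional_extensionality_dep => i; apply: scalerDl. Qed.
HB.instance Definition _ := GRing.Zmodule_isLmodule.Build k dprod
  dprod_scaleA dprod_scale1 dprod_scaleDr dprod_scaleDl.

Lemma dprodDE (f g : dprod) i : (f + g) i = f i + g i. Proof. by []. Qed.
Lemma dprodZE c (f : dprod) i : (c *: f) i = c *: f i. Proof. by []. Qed.
Lemma dprod0E i : (0 : dprod) i = 0. Proof. by []. Qed.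
End DependentProduct.

Record klcat (k : fieldType) (obj : Type) := KLCat {
  Hom : obj -> obj -> lmodType k;
  idm : forall X, Hom X X;
  comp : forall X Y Z, Hom Y Z -> Hom X Y -> Hom X Z;
  comp_linl : forall X Y Z (f : Hom X Y), linear (fun g : Hom Y Z => comp g f);
  comp_linr : forall X Y Z (g : Hom Y Z), linear (fun f : Hom X Y => comp g f);
  compA : forall X Y Z W (h : Hom Z W) (g : Hom Y Z) (f : Hom X Y),
    comp h (comp g f) = comp (comp h g) f;
  comp1m : forall X Y (f : Hom X Y), comp (idm Y) f = f;
  compm1 : forall X Y (f : Hom X Y), comp f (idm X) = f
}.
Arguments idm {k obj} C X : rename.
Arguments comp {k obj} C {X Y Z} : rename.

Section LinearCategory.
Variables (k : fieldType) (obj : Type) (C : klcat k obj).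
Implicit Types X Y Z W : obj.

Lemma compDl X Y Z (f : Hom C X Y) (g g' : Hom C Y Z) :
  comp C (g + g') f = comp C g f + comp C g' f.
Proof. by have := comp_linl f 1 g g'; rewrite !scale1r. Qed.
Lemma compDr X Y Z (f f' : Hom C X Y) (g : Hom C Y Z) :
  comp C g (f + f') = comp C g f + comp C g f'.
Proof. by have := comp_linr g 1 f f'; rewrite !scale1r. Qed.
Lemma comp0m X Y Z (f : Hom C X Y) : comp C (0 : Hom C Y Z) f = 0.
Proof. by have := compDl f (0 : Hom C Y Z) 0; rewrite addr0 => /eqP; rewrite -subr_eq subrr => /eqP. Qed.
Lemma compm0 X Y Z (g : Hom C Y Z) : comp C g (0 : Hom C X Y) = 0.
Proof. by have := compDr (0 : Hom C X Y) 0 g; rewrite addr0 => /eqP; rewrite -subr_eq subrr => /eqP. Qed.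
Lemma compZl X Y Z c (f : Hom C X Y) (g : Hom C Y Z) :
  comp C (c *: g) f = c *: comp C g f.
Proof. by have := comp_linl f c g 0; rewrite !addr0 comp0m addr0. Qed.
Lemma compZr X Y Z c (f : Hom C X Y) (g : Hom C Y Z) :
  comp C g (c *: f) = c *: comp C g f.
Proof. by have := comp_linr g c f 0; rewrite !addr0 compm0 addr0. Qed.

Definition endo X : Type := Hom C X X.
HB.instance Definition _ X := GRing.Lmodule.on (endo X).

Definition isom X Y (f : Hom C X Y) :=
  exists g : Hom C Y X, comp C g f = idm C X /\ comp C f g = idm C Y.
Definition iso_obj X Y := exists f : Hom C X Y, isom f.

Definition zero_obj X := idm C X = 0.

Definition is_dsum X Y Z :=
  exists (i1 : Hom C Y X) (i2 : Hom C Z X) (p1 : Hom C X Y) (p2 : Hom C X Z),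
    [/\ comp C p1 i1 = idm C Y, comp C p2 i2 = idm C Z,
        comp C p1 i2 = 0, comp C p2 i1 = 0
      & comp C i1 p1 + comp C i2 p2 = idm C X].
Definition is_summand Y X := exists Z, is_dsum X Y Z.
Definition indecomposable X :=
  ~ zero_obj X /\ (forall Y Z, is_dsum X Y Z -> zero_obj Y \/ zero_obj Z).
Definition basic X := forall Y W Z, is_dsum X Y W -> is_dsum W Y Z -> zero_obj Y.
Definition nsummands X (n : nat) :=
  exists Y : 'I_n -> obj,
    [/\ forall i, indecomposable (Y i) /\ is_summand (Y i) X,
        forall i j, iso_obj (Y i) (Y j) -> i = j
      & forall Z, indecomposable Z -> is_summand Z X -> exists i, iso_obj Z (Y i)].

Section Endo.
Variable X : obj.
Let mul (f g : endo X) : endo X := comp C f g.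
Fact endo_mulA : associative mul. Proof. by move=> f g h; apply: compA. Qed.
Fact endo_mul1 : left_id (idm C X : endo X) mul. Proof. by move=> f; apply: comp1m. Qed.
Fact endo_mulr1 : right_id (idm C X : endo X) mul. Proof. by move=> f; apply: compm1. Qed.
Fact endo_mul_linl (g : endo X) : linear (mul^~ g). Proof. exact: comp_linl. Qed.
Fact endo_mul_linr (f : endo X) : linear (mul f). Proof. exact: comp_linr. Qed.
HB.instance Definition _ := Lmodule_isAlg.Build k (endo X)
  endo_mulA endo_mul1 endo_mulr1 endo_mul_linl endo_mul_linr.
End Endo.
End LinearCategory.

(* Finite-dimensional right modules; mhom M N is the space Hom_A(M, N). *)

Record rmod (k : fieldType) (A : fdAlgType k) := RMod {
  mcar :> vectType k;
  mact : mcar -> A -> mcar;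
  mact_linl : forall a, linear (mact^~ a);
  mact_linr : forall x, linear (mact x);
  mact1 : forall x, mact x (aone A) = x;
  mactM : forall x a b, mact x (a ** b) = mact (mact x a) b
}.
Arguments mact {k A} M : rename.

Section ModuleHom.
Variables (k : fieldType) (A : fdAlgType k).

Definition ractl (M : rmod A) (a : A) : {linear M -> M} :=
  HB.pack (mact M ^~ a) (GRing.isLinear.Build k M M *:%R _ (@mact_linl k A M a)).
Definition lactr (M : rmod A) (x : M) : {linear A -> M} :=
  HB.pack (mact M x) (GRing.isLinear.Build k A M *:%R _ (@mact_linr k A M x)).

Variables M N : rmod A.

Definition hom_defect (a : A) (f : 'Hom(M, N)) : 'Hom(M, N) :=
  (f \o linfun (ractl M a))%VF - (linfun (ractl N a) \o f)%VF.
Lemma hom_defectE a f x : hom_defect a f x = f (mact M x a) - mact N (f x) a.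
Proof.
rewrite /hom_defect add_lfunE opp_lfunE !comp_lfunE.
by rewrite (lfunE (ractl M a)) (lfunE (ractl N a)).
Qed.
Fact hom_defect_linear a : linear (hom_defect a).
Proof.
move=> c f g; rewrite /hom_defect comp_lfunDl -comp_lfunZl comp_lfunDr -comp_lfunZr.
by rewrite opprD addrACA scalerBr.
Qed.
HB.instance Definition _ a :=
  GRing.isLinear.Build k 'Hom(M, N) 'Hom(M, N) *:%R (hom_defect a) (@hom_defect_linear a).

Definition hom_vs : {vspace 'Hom(M, N)} :=
  (\bigcap_(i < \dim {:A}) lker (linfun (hom_defect (vbasis {:A})`_i)))%VS.

Lemma hom_vsP (f : 'Hom(M, N)) :
  reflect (forall x a, f (mact M x a) = mact N (f x) a) (f \in hom_vs).
Proof.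
rewrite /hom_vs memvE; apply: (iffP subv_bigcapP) => [h x a | h i _].
  have hb i : f (mact M x (vbasis {:A})`_i) = mact N (f x) (vbasis {:A})`_i.
    have [lti|gei] := ltnP i (\dim {:A}).
      have := h (Ordinal lti) isT; rewrite -memvE memv_ker (lfunE (hom_defect _)).
      by move=> /eqP/lfunP/(_ x); rewrite hom_defectE lfunE => /subr0_eq.
    rewrite nth_default ?size_tuple // -[mact M x 0]/(lactr x 0).
    by rewrite -[mact N (f x) 0]/(lactr (f x) 0) !linear0.
  have /coord_vbasis -> : a \in fullv by rewrite memvf.
  rewrite -[mact M x _]/(lactr x _) -[mact N (f x) _]/(lactr (f x) _) !linear_sum.
  by apply: eq_bigr => i _; rewrite !linearZ /= hb.
rewrite -memvE memv_ker (lfunE (hom_defect _)); apply/eqP/lfunP => x.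
by rewrite hom_defectE lfunE h subrr.
Qed.

Definition mhom : Type := subvs_of hom_vs.
HB.instance Definition _ := Vector.on mhom.
Definition mhom_lfun (f : mhom) : 'Hom(M, N) := vsval f.

End ModuleHom.
Coercion mhom_lfun : mhom >-> hom.

Section ModuleCategory.
Variables (k : fieldType) (A : fdAlgType k).
Implicit Types M N L : rmod A.

Lemma mhomP M N (f : mhom M N) x a : f (mact M x a) = mact N (f x) a.
Proof. by apply/hom_vsP: x a; apply: subvsP. Qed.
Lemma mhom_inj M N (f g : mhom M N) : (forall x, f x = g x) -> f = g.
Proof. by move=> h; apply: val_inj; apply/lfunP. Qed.

Lemma mk_mhom_mem M N (f : M -> N) (lf : linear f)
    (cf : forall x a, f (mact M x a) = mact N (f x) a) :
  linfun f \in hom_vs M N.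
Proof.
pose g : {linear M -> N} := HB.pack f (GRing.isLinear.Build k M N *:%R _ lf).
by apply/hom_vsP => x a; rewrite !(lfunE g); apply: cf.
Qed.
Definition mk_mhom M N (f : M -> N) lf cf : mhom M N :=
  Subvs (@mk_mhom_mem M N f lf cf).
Lemma mk_mhomE M N (f : M -> N) lf cf x : @mk_mhom M N f lf cf x = f x.
Proof.
pose g : {linear M -> N} := HB.pack f (GRing.isLinear.Build k M N *:%R _ lf).
exact: (lfunE g).
Qed.
Lemma mhomDE M N (f g : mhom M N) x : (f + g : mhom M N) x = f x + g x.
Proof. by rewrite /mhom_lfun (linearD vsval) add_lfunE. Qed.
Lemma mhomZE M N c (f : mhom M N) x : (c *: f : mhom M N) x = c *: f x.
Proof. by rewrite /mhom_lfun (linearZ_LR vsval) scale_lfunE. Qed.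
Lemma mhom0E M N x : (0 : mhom M N) x = 0.
Proof. by rewrite /mhom_lfun (linear0 vsval) lfunE. Qed.

Definition mid M : mhom M M :=
  @mk_mhom M M id (fun _ _ _ => erefl) (fun _ _ => erefl).
Fact mcomp_linear M N L (g : mhom N L) (f : mhom M N) : linear (fun x => g (f x)).
Proof. by move=> c x y; rewrite !linearP. Qed.
Fact mcomp_act M N L (g : mhom N L) (f : mhom M N) x a :
  g (f (mact M x a)) = mact L (g (f x)) a.
Proof. by rewrite !mhomP. Qed.
Definition mcomp M N L (g : mhom N L) (f : mhom M N) : mhom M L :=
  mk_mhom (mcomp_linear g f) (mcomp_act g f).

Lemma midE M x : mid M x = x. Proof. exact: mk_mhomE. Qed.
Lemma mcompE M N L (g : mhom N L) (f : mhom M N) x : mcomp g f x = g (f x).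
Proof. exact: mk_mhomE. Qed.

Fact mcomp_linl M N L (f : mhom M N) : linear (fun g : mhom N L => mcomp g f).
Proof. by move=> c g h; apply: mhom_inj => x; rewrite !(mcompE, mhomDE, mhomZE). Qed.
Fact mcomp_linr M N L (g : mhom N L) : linear (fun f : mhom M N => mcomp g f).
Proof.
by move=> c f h; apply: mhom_inj => x; rewrite !(mcompE, mhomDE, mhomZE) linearP.
Qed.
Fact mcompA M N L K (h : mhom L K) (g : mhom N L) (f : mhom M N) :
  mcomp h (mcomp g f) = mcomp (mcomp h g) f.
Proof. by apply: mhom_inj => x; rewrite !mcompE. Qed.
Fact mcomp1m M N (f : mhom M N) : mcomp (mid N) f = f.
Proof. by apply: mhom_inj => x; rewrite !mcompE midE. Qed.
Fact mcompm1 M N (f : mhom M N) : mcomp f (mid M) = f.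
Proof. by apply: mhom_inj => x; rewrite !mcompE midE. Qed.

Definition modcat : klcat k (rmod A) :=
  @KLCat k (rmod A) (fun M N => mhom M N) mid mcomp
    mcomp_linl mcomp_linr mcompA mcomp1m mcompm1.

End ModuleCategory.
Arguments modcat {k} A.

(* [endo (modcat A) M], remembering that it is finite dimensional *)
Definition mendo (k : fieldType) (A : fdAlgType k) (M : rmod A) : Type := mhom M M.
HB.instance Definition _ k A M := Vector.on (@mendo k A M).
HB.instance Definition _ k (A : fdAlgType k) (M : rmod A) :=
  Lmodule_isAlg.Build k (mendo M)
    (@endo_mulA k _ (modcat A) M) (@endo_mul1 k _ (modcat A) M)
    (@endo_mulr1 k _ (modcat A) M) (@endo_mul_linl k _ (modcat A) M)
    (@endo_mul_linr k _ (modcat A) M).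

Section ModuleConstructions.
Variables (k : fieldType) (A : fdAlgType k).

Definition regular : rmod A :=
  @RMod k A A (@amul k A) (@amul_linl k A) (@amul_linr k A) (@amul1r k A)
    (fun x a b => amulA x a b).

Section Zero.
Let act (x : 'rV[k]_0) (a : A) : 'rV[k]_0 := 0.
Fact zero_mod_linl a : linear (act^~ a).
Proof. by move=> c x y; rewrite /act scaler0 addr0. Qed.
Fact zero_mod_linr x : linear (act x).
Proof. by move=> c a b; rewrite /act scaler0 addr0. Qed.
Fact zero_mod1 x : act x (aone A) = x. Proof. by rewrite [x]thinmx0. Qed.
Fact zero_modM x a b : act x (a ** b) = act (act x a) b. Proof. by []. Qed.
Definition zero_mod : rmod A := RMod zero_mod_linl zero_mod_linr zero_mod1 zero_modM.
End Zero.

Section DirectSum.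
Variables M N : rmod A.
Let act (x : (M * N)%type) (a : A) : (M * N)%type := (mact M x.1 a, mact N x.2 a).
Fact dsum_mod_linl a : linear (act^~ a).
Proof. by move=> c x y; rewrite /act /= !mact_linl. Qed.
Fact dsum_mod_linr x : linear (act x).
Proof. by move=> c a b; rewrite /act /= !mact_linr. Qed.
Fact dsum_mod1 x : act x (aone A) = x.
Proof. by case: x => x y; rewrite /act /= !mact1. Qed.
Fact dsum_modM x a b : act x (a ** b) = act (act x a) b.
Proof. by rewrite /act /= !mactM. Qed.
Definition dsum_mod : rmod A := RMod dsum_mod_linl dsum_mod_linr dsum_mod1 dsum_modM.
End DirectSum.

Section RowMap.
Variables (M N L : rmod A) (f : mhom M L) (g : mhom N L).
Let h (x : dsum_mod M N) : L := f x.1 + g x.2.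
Fact row_mhom_linear : linear h.
Proof. by move=> c x y; rewrite /h /= !linearP scalerDr addrACA. Qed.
Fact row_mhom_act x a : h (mact (dsum_mod M N) x a) = mact L (h x) a.
Proof. 
by rewrite /h /= !mhomP -[mact L (_ + _) a]/(ractl L a _) linearD.
Qed.
Definition row_mhom : mhom (dsum_mod M N) L := mk_mhom row_mhom_linear row_mhom_act.
End RowMap.

(* Left multiplication identifies A with the endomorphism algebra of A_A. *)
Section LeftMul.
Fact lmul_act b (x a : A) : amul b (mact regular x a) = mact regular (amul b x) a.
Proof. exact: amulA. Qed.
Definition lmul (b : A) : mendo regular :=
  @mk_mhom k A regular regular (amul b) (@amul_linr k A b) (lmul_act b).
Lemma lmulE b (x : A) : mhom_lfun (lmul b) x = b ** x.
Proof. exact: (@mk_mhomE k A regular regular). Qed.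
Fact lmul_linear : linear lmul.
Proof.
move=> c a b; apply: mhom_inj => x.
by rewrite lmulE mhomDE mhomZE !lmulE amul_linl.
Qed.
Fact lmul1 : lmul (aone A) = aone (mendo regular).
Proof. by apply: mhom_inj => x; rewrite lmulE midE amul1l. Qed.
Fact lmulM : {morph lmul : a b / a ** b}.
Proof.
by move=> a b; apply: mhom_inj => x; rewrite lmulE mcompE !lmulE amulA.
Qed.
Definition lmul_hom : alghom A (mendo regular) := AlgHom lmul_linear lmul1 lmulM.
End LeftMul.

(* DA = Hom_k(A, k) with (phi . a)(x) = phi (a x) and (b . phi)(x) = phi (x b) *)
Section Dual.
Definition amul_l (a : A) : 'End(A) :=
  linfun (HB.pack_for {linear A -> A} (amul a)
    (GRing.isLinear.Build k A A *:%R _ (@amul_linr k A a))).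
Definition amul_r (a : A) : 'End(A) :=
  linfun (HB.pack_for {linear A -> A} (amul^~ a)
    (GRing.isLinear.Build k A A *:%R _ (@amul_linl k A a))).
Lemma amul_lE a x : amul_l a x = a ** x. Proof. by rewrite /amul_l lfunE. Qed.
Lemma amul_rE a x : amul_r a x = x ** a. Proof. by rewrite /amul_r lfunE. Qed.

Let act (phi : 'Hom(A, k^o)) (a : A) : 'Hom(A, k^o) := (phi \o amul_l a)%VF.
Fact dual_linl a : linear (act^~ a).
Proof. by move=> c x y; rewrite /act comp_lfunDl comp_lfunZl. Qed.
Fact dual_linr x : linear (act x).
Proof.
move=> c a b; apply/lfunP => y.
rewrite /act add_lfunE scale_lfunE !comp_lfunE !amul_lE.
by rewrite (amul_linl y c a b) linearP.
Qed.
Fact dual1 x : act x (aone A) = x.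
Proof. by apply/lfunP => y; rewrite comp_lfunE amul_lE amul1l. Qed.
Fact dualM x a b : act x (a ** b) = act (act x a) b.
Proof. by apply/lfunP => y; rewrite !comp_lfunE !amul_lE amulA. Qed.
Definition dual : rmod A := @RMod k A 'Hom(A, k^o) act dual_linl dual_linr dual1 dualM.

Fact dual_lmul_linear b : linear (fun phi : dual => (phi \o amul_r b)%VF : dual).
Proof. by move=> c x y; rewrite /= comp_lfunDl comp_lfunZl. Qed.
Fact dual_lmul_act b (phi : dual) a :
  ((mact dual phi a) \o amul_r b)%VF = mact dual (phi \o amul_r b)%VF a.
Proof. 
by apply/lfunP => y; rewrite !comp_lfunE !amul_rE !amul_lE amulA.
Qed.
Definition dual_lmul (b : A) : mendo dual :=
  @mk_mhom k A dual dual _ (dual_lmul_linear b) (dual_lmul_act b).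
Lemma dual_lmulE b (phi : dual) : mhom_lfun (dual_lmul b) phi = (phi \o amul_r b)%VF.
Proof. exact: (@mk_mhomE k A dual dual). Qed.
Fact dual_lmul_lin : linear dual_lmul.
Proof.
move=> c a b; apply: mhom_inj => phi; rewrite dual_lmulE mhomDE mhomZE !dual_lmulE.
apply/lfunP => y; rewrite add_lfunE scale_lfunE !comp_lfunE !amul_rE.
by rewrite (amul_linr y c a b) linearP.
Qed.
Fact dual_lmul1 : dual_lmul (aone A) = aone (mendo dual).
Proof.
apply: mhom_inj => phi; rewrite dual_lmulE midE.
by apply/lfunP => y; rewrite comp_lfunE amul_rE amul1r.
Qed.
Fact dual_lmulM : {morph dual_lmul : a b / a ** b}.
Proof.
move=> a b; apply: mhom_inj => phi; rewrite mcompE !dual_lmulE.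
by apply/lfunP => y; rewrite !comp_lfunE !amul_rE amulA.
Qed.
Definition dual_lmul_hom : alghom A (mendo dual) :=
  AlgHom dual_lmul_lin dual_lmul1 dual_lmulM.
End Dual.

(* Nakayama functors: nu P = D Hom_A(P, A) and nuinv I = Hom_A(DA, I) *)
Section Nakayama.
Definition postcomp (M N L : rmod A) (g : mhom N L) : 'Hom(mhom M N, mhom M L) :=
  linfun (HB.pack_for {linear mhom M N -> mhom M L} (fun f => mcomp g f)
    (GRing.isLinear.Build k (mhom M N) (mhom M L) *:%R _ (@mcomp_linr k A M N L g))).
Definition precomp (M N L : rmod A) (f : mhom M N) : 'Hom(mhom N L, mhom M L) :=
  linfun (HB.pack_for {linear mhom N L -> mhom M L} (fun g => mcomp g f)
    (GRing.isLinear.Build k (mhom N L) (mhom M L) *:%R _ (@mcomp_linl k A M N L f))).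
Lemma postcompE M N L (g : mhom N L) (f : mhom M N) : postcomp M g f = mcomp g f.
Proof. by rewrite /postcomp lfunE. Qed.
Lemma precompE M N L (g : mhom N L) (f : mhom M N) : precomp L f g = mcomp g f.
Proof. by rewrite /precomp lfunE. Qed.

Section Nu.
Variable P : rmod A.
Let car := 'Hom(mhom P regular, k^o).
Let act (phi : car) (a : A) : car := (phi \o postcomp P (lmul a))%VF.
Fact nu_linl a : linear (act^~ a).
Proof. by move=> c x y; rewrite /act comp_lfunDl comp_lfunZl. Qed.
Fact nu_linr x : linear (act x).
Proof.
move=> c a b; apply/lfunP => y.
rewrite /act add_lfunE scale_lfunE !comp_lfunE !postcompE.
by rewrite lmul_linear (mcomp_linl y c (lmul a) (lmul b)) linearP.
Qed.
Fact nu_1 x : act x (aone A) = x.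
Proof. by apply/lfunP => y; rewrite comp_lfunE postcompE lmul1 mcomp1m. Qed.
Fact nu_M x a b : act x (a ** b) = act (act x a) b.
Proof.
by apply/lfunP => y; rewrite !comp_lfunE !postcompE lmulM mcompA.
Qed.
Definition nu : rmod A := @RMod k A car act nu_linl nu_linr nu_1 nu_M.
End Nu.

Section NuMap.
Variables (P Q : rmod A) (p : mhom P Q).
Fact nu_map_linear : linear (fun phi : nu P => (phi \o precomp regular p)%VF : nu Q).
Proof. by move=> c x y; rewrite /= comp_lfunDl comp_lfunZl. Qed.
Fact nu_map_act (phi : nu P) a :
  (mact (nu P) phi a \o precomp regular p)%VF = mact (nu Q) (phi \o precomp regular p)%VF a.
Proof.
by apply/lfunP => y; rewrite !comp_lfunE !(precompE, postcompE) mcompA.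
Qed.
Definition nu_map : mhom (nu P) (nu Q) := mk_mhom nu_map_linear nu_map_act.
End NuMap.

Section NuInv.
Variable J : rmod A.
Let act (f : mhom dual J) (a : A) : mhom dual J := mcomp f (dual_lmul a).
Fact nuinv_linl a : linear (act^~ a). Proof. exact: mcomp_linl. Qed.
Fact nuinv_linr x : linear (act x).
Proof. by move=> c a b; rewrite /act dual_lmul_lin mcomp_linr. Qed.
Fact nuinv_1 x : act x (aone A) = x. Proof. by rewrite /act dual_lmul1 mcompm1. Qed.
Fact nuinv_M x a b : act x (a ** b) = act (act x a) b.
Proof. by rewrite /act dual_lmulM mcompA. Qed.
Definition nuinv : rmod A := @RMod k A (mhom dual J) act nuinv_linl nuinv_linr nuinv_1 nuinv_M.
End NuInv.

Section NuInvMap.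
Variables (J L : rmod A) (f : mhom J L).
Fact nuinv_map_act (g : nuinv J) a :
  mcomp f (mact (nuinv J) g a) = mact (nuinv L) (mcomp f g) a.
Proof. exact: mcompA. Qed.
Definition nuinv_map : mhom (nuinv J) (nuinv L) :=
  @mk_mhom k A (nuinv J) (nuinv L) _ (@mcomp_linr k A dual J L f) nuinv_map_act.
End NuInvMap.
End Nakayama.
End ModuleConstructions.
Arguments regular {k} A.
Arguments dual {k} A.
Arguments zero_mod {k} A.
Arguments lmul_hom {k} A.
Arguments dual_lmul_hom {k} A.

Section Homological.
Variables (k : fieldType) (A : fdAlgType k).
Implicit Types M N P J K : rmod A.

Definition surj M N (f : mhom M N) := forall y, exists x, f x = y.

Definition projective P := forall M N (p : mhom M N) (f : mhom P N),
  surj p -> exists g : mhom P M, mcomp p g = f.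
Definition injective_mod J := forall M N (i : mhom M N) (f : mhom M J),
  injective i -> exists g : mhom N J, mcomp g i = f.

Definition hereditary := forall P M (i : mhom M P),
  projective P -> injective i -> projective M.

Definition is_kernel K M N (i : mhom K M) (f : mhom M N) :=
  injective i /\ forall x, f x = 0 <-> exists y, i y = x.
Definition is_cokernel M N K (q : mhom N K) (f : mhom M N) :=
  surj q /\ forall y, q y = 0 <-> exists x, f x = y.

Definition proj_cover P M (p : mhom P M) :=
  [/\ projective P, surj p
    & forall N (g : mhom N P), surj (mcomp p g) -> surj g].
Definition inj_envelope M J (i : mhom M J) :=
  [/\ injective_mod J, injective i
    & forall N (g : mhom J N), injective (mcomp g i) -> injective g].

Definition min_proj_pres P1 P0 M (p1 : mhom P1 P0) (p0 : mhom P0 M) :=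
  proj_cover p0 /\ exists K (i : mhom K P0) (q : mhom P1 K),
    [/\ is_kernel i p0, proj_cover q & p1 = mcomp i q].
Definition min_inj_copres M J0 J1 (i0 : mhom M J0) (i1 : mhom J0 J1) :=
  inj_envelope i0 /\ exists K (q : mhom J0 K) (j : mhom K J1),
    [/\ is_cokernel q i0, inj_envelope j & i1 = mcomp j q].

(* N = tau M = D Tr M: for a minimal presentation p1 : P1 -> P0 of M, D Tr M is
   the dual of the cokernel of Hom_A(p1, A), i.e. the kernel of nu p1.  Dually,
   tau^-1 M = Tr D M is the cokernel of nuinv of a minimal injective
   copresentation of M. *)
Definition is_tau M N :=
  exists P1 P0 (p1 : mhom P1 P0) (p0 : mhom P0 M) (i : mhom N (nu P1)),
    min_proj_pres p1 p0 /\ is_kernel i (nu_map p1).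
Definition is_tauinv M N :=
  exists J0 J1 (i0 : mhom M J0) (i1 : mhom J0 J1) (q : mhom (nuinv J1) N),
    min_inj_copres i0 i1 /\ is_cokernel q (nuinv_map i1).

Definition tau_rigid M := exists N, is_tau M N /\ forall f : mhom M N, f = 0.

Definition support_tau_tilting T P :=
  [/\ tau_rigid T, projective P, forall f : mhom P T, f = 0
    & exists a b, [/\ nsummands (modcat A) T a, nsummands (modcat A) P b
                    & nsummands (modcat A) (regular A) (a + b)]].
End Homological.
Arguments hereditary {k} A.


Record cplx (k : fieldType) (A : fdAlgType k) := Cplx {
  cob :> int -> rmod A;
  cd : forall i, mhom (cob i) (cob (i + 1));
  cdd : forall i, mcomp (cd (i + 1)) (cd i) = 0;
  cbounded : exists n : nat, forall i : int, (n < absz i)%N -> forall x : cob i, x = 0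
}.
Arguments cd {k A} X i : rename.

Section ChainMaps.
Variables (k : fieldType) (A : fdAlgType k) (X Y : cplx A).

Definition is_chain_map (f : dprod (fun i => mhom (X i) (Y i))) :=
  forall i, mcomp (f (i + 1)) (cd X i) = mcomp (cd Y i) (f i).
Definition chain_pred : {pred dprod (fun i => mhom (X i) (Y i))} :=
  fun f => `[< is_chain_map f >].

Fact chain_pred_submod : submod_closed chain_pred.
Proof.
split=> [|c f g /asboolP hf /asboolP hg]; apply/asboolP => i.
  by rewrite -[LHS]/(comp (modcat A) _ _) -[RHS]/(comp (modcat A) _ _) comp0m compm0.
rewrite (mcomp_linl (cd X i) c (f (i + 1)) (g (i + 1))).
by rewrite (mcomp_linr (cd Y i) c (f i) (g i)) hf hg.
Qed.
HB.instance Definition _ :=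
  GRing.isSubmodClosed.Build k _ chain_pred chain_pred_submod.

Record chain_map := ChainMap {
  chain_val : dprod (fun i => mhom (X i) (Y i));
  chain_valP : chain_val \in chain_pred
}.
Definition chain_fun (f : chain_map) : forall i, mhom (X i) (Y i) := chain_val f.
Coercion chain_fun : chain_map >-> Funclass.
HB.instance Definition _ := [isSub for chain_val].
HB.instance Definition _ := [Choice of chain_map by <:].
HB.instance Definition _ := [SubChoice_isSubLmodule of chain_map by <:].

Lemma chainP (f : chain_map) : is_chain_map f.
Proof. by apply/asboolP; apply: chain_valP. Qed.
Definition mk_chain f (hf : is_chain_map f) : chain_map := ChainMap (introT (asboolP _) hf).
Lemma chain_inj (f g : chain_map) : (forall i, f i = g i) -> f = g.
Proof. by move=> h; apply: val_inj; apply: functional_extensionality_dep. Qed.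

Definition nullhomotopic (f : chain_map) :=
  exists h : forall i, mhom (X (i + 1)) (Y i),
    forall i, f (i + 1) = mcomp (cd Y i) (h i) + mcomp (h (i + 1)) (cd X (i + 1)).

(* f induces a bijection on cohomology in every degree i + 1. *)
Definition quasi_iso (f : chain_map) := forall i,
  (forall (x : X (i + 1)) (y : Y i), cd X (i + 1) x = 0 -> f (i + 1) x = cd Y i y ->
     exists x' : X i, x = cd X i x') /\
  (forall y : Y (i + 1), cd Y (i + 1) y = 0 ->
     exists (x : X (i + 1)) (y' : Y i), cd X (i + 1) x = 0 /\ y = f (i + 1) x + cd Y i y').
End ChainMaps.

Section ComplexCategory.
Variables (k : fieldType) (A : fdAlgType k).
Implicit Types X Y Z W : cplx A.

Fact chain_id_proof X : @is_chain_map k A X X (fun i => mid (X i)).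
Proof. by move=> i; rewrite mcompm1 mcomp1m. Qed.
Definition chain_id X : chain_map X X := mk_chain (@chain_id_proof X).
Fact chain_comp_proof X Y Z (g : chain_map Y Z) (f : chain_map X Y) :
  @is_chain_map k A X Z (fun i => mcomp (g i) (f i)).
Proof. by move=> i; rewrite -mcompA chainP !mcompA chainP. Qed.
Definition chain_comp X Y Z (g : chain_map Y Z) (f : chain_map X Y) : chain_map X Z :=
  mk_chain (chain_comp_proof g f).

Fact chain_linl X Y Z (f : chain_map X Y) : linear (fun g : chain_map Y Z => chain_comp g f).
Proof. by move=> c g h; apply: chain_inj => i; apply: mcomp_linl. Qed.
Fact chain_linr X Y Z (g : chain_map Y Z) : linear (fun f : chain_map X Y => chain_comp g f).
Proof. by move=> c f h; apply: chain_inj => i; apply: mcomp_linr. Qed.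
Fact chain_compA X Y Z W (h : chain_map Z W) (g : chain_map Y Z) (f : chain_map X Y) :
  chain_comp h (chain_comp g f) = chain_comp (chain_comp h g) f.
Proof. by apply: chain_inj => i; apply: mcompA. Qed.
Fact chain_comp1m X Y (f : chain_map X Y) : chain_comp (chain_id Y) f = f.
Proof. by apply: chain_inj => i; apply: mcomp1m. Qed.
Fact chain_compm1 X Y (f : chain_map X Y) : chain_comp f (chain_id X) = f.
Proof. by apply: chain_inj => i; apply: mcompm1. Qed.

Definition cplxcat : klcat k (cplx A) :=
  @KLCat k (cplx A) (fun X Y => chain_map X Y) chain_id chain_comp
    chain_linl chain_linr chain_compA chain_comp1m chain_compm1.

(* Shift: X[1]^i = X^(i+1) with differential -d *)
Section Shift.
Variable X : cplx A.
Fact shift_dd i : mcomp (- cd X (i + 1 + 1)) (- cd X (i + 1)) = 0.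
Proof.
apply: mhom_inj => x; have := cdd X (i + 1) => /(congr1 (fun f : mhom _ _ => f x)).
rewrite !mcompE mhom0E -![- cd X _]scaleN1r !mhomZE => h.
by rewrite linearZ /= h !scaler0.
Qed.
Fact shift_bounded :
  exists n : nat, forall i : int, (n < absz i)%N -> forall x : X (i + 1), x = 0.
Proof.
have [n hn] := cbounded X; exists n.+1 => i hi; apply: hn.
case: i hi => [m|[|m]] // hi.
  by rewrite -[X in absz X]/(Posz (m + 1)) absz_nat addn1; apply: (leqW (ltnW hi)).
have -> : Negz m.+1 + 1 = Negz m by rewrite !NegzE -[m.+2]addn1 PoszD opprD addrNK.
exact: hi.
Qed.
Definition shift : cplx A := Cplx shift_dd shift_bounded.
End Shift.

Fact shift_map_proof X Y (f : chain_map X Y) :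
  @is_chain_map k A (shift X) (shift Y) (fun i => f (i + 1)).
Proof.
move=> i /=; have := chainP f (i + 1) => h.
apply: mhom_inj => x; move/(congr1 (fun f : mhom _ _ => f x)): h.
rewrite !mcompE -![- cd _ _]scaleN1r !mhomZE => h.
by rewrite linearZ /= h.
Qed.
Definition shift_map X Y (f : chain_map X Y) : chain_map (shift X) (shift Y) :=
  mk_chain (shift_map_proof f).

Section TwoTerm.
Variables (P1 P0 : rmod A) (p : mhom P1 P0).
Definition two_term_ob (i : int) : rmod A :=
  match i with Posz 0 => P0 | Negz 0 => P1 | _ => zero_mod A end.
Definition two_term_d (i : int) : mhom (two_term_ob i) (two_term_ob (i + 1)) :=
  match i with Negz 0 => p | _ => 0 end.
Fact two_term_dd i : mcomp (two_term_d (i + 1)) (two_term_d i) = 0.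
Proof.
case: i => [n|[|n]]; apply: mhom_inj => x; rewrite mcompE ?mhom0E //= ?mhom0E //.
all: by rewrite linear0.
Qed.
Fact two_term_bounded :
  exists n : nat, forall i : int, (n < absz i)%N -> forall x : two_term_ob i, x = 0.
Proof. by exists 1%N => -[[|n]|[|n]] //= _ x; apply: thinmx0. Qed.
Definition two_term : cplx A := Cplx two_term_dd two_term_bounded.
End TwoTerm.

Definition stalk_ob (M : rmod A) (i : int) : rmod A :=
  match i with Posz 0 => M | _ => zero_mod A end.
Fact stalk_dd M i :
  mcomp (0 : mhom (stalk_ob M (i + 1)) (stalk_ob M (i + 1 + 1)))
        (0 : mhom (stalk_ob M i) (stalk_ob M (i + 1))) = 0.
Proof. by apply: mhom_inj => x; rewrite mcompE !mhom0E. Qed.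
Fact stalk_bounded M :
  exists n : nat, forall i : int, (n < absz i)%N -> forall x : stalk_ob M i, x = 0.
Proof. by exists 0%N => -[[|n]|n] //= _ x; apply: thinmx0. Qed.
Definition stalk M : cplx A := Cplx (stalk_dd M) (stalk_bounded M).

Definition stalk_map_fun M N (f : mhom M N) (i : int) : mhom (stalk M i) (stalk N i) :=
  match i with Posz 0 => f | _ => 0 end.
Fact stalk_map_proof M N (f : mhom M N) :
  @is_chain_map k A (stalk M) (stalk N) (stalk_map_fun f).
Proof. by move=> i; apply: mhom_inj => x; rewrite !mcompE !mhom0E linear0. Qed.
Definition stalk_map M N (f : mhom M N) : chain_map (stalk M) (stalk N) :=
  mk_chain (stalk_map_proof f).
End ComplexCategory.
Arguments cplxcat {k} A.

Record functor (k : fieldType) (O1 O2 : Type) (C : klcat k O1) (D : klcat k O2)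
    (F : O1 -> O2) := Functor {
  fmap :> forall X Y, Hom C X Y -> Hom D (F X) (F Y);
  fmap_linear : forall X Y, linear (@fmap X Y);
  fmap_id : forall X, fmap (idm C X) = idm D (F X);
  fmap_comp : forall X Y Z (g : Hom C Y Z) (f : Hom C X Y),
    fmap (comp C g f) = comp D (fmap g) (fmap f)
}.
Arguments fmap {k O1 O2 C D F} _ {X Y}.

Section FunctorTheory.
Variables (k : fieldType) (O1 O2 : Type) (C : klcat k O1) (D : klcat k O2).
Variables (F : O1 -> O2) (Phi : functor C D F).

Lemma fmapD X Y (f g : Hom C X Y) : Phi _ _ (f + g) = Phi _ _ f + Phi _ _ g.
Proof. by have := fmap_linear Phi 1 f g; rewrite !scale1r. Qed.
Lemma fmap0 X Y : Phi _ _ (0 : Hom C X Y) = 0.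
Proof. by have := fmapD (0 : Hom C X Y) 0; rewrite addr0 => /eqP; rewrite -subr_eq subrr => /eqP. Qed.

Definition functor_id : functor C C (fun X => X) :=
  @Functor k O1 O1 C C (fun X => X) (fun X Y f => f) (fun _ _ _ _ _ => erefl)
    (fun _ => erefl) (fun _ _ _ _ _ => erefl).

Variables (O3 : Type) (E : klcat k O3) (G : O2 -> O3) (Psi : functor D E G).
Fact functor_comp_linear X Y :
  linear (fun f : Hom C X Y => Psi _ _ (Phi _ _ f) : Hom E (G (F X)) (G (F Y))).
Proof. by move=> c f g; rewrite !fmap_linear. Qed.
Fact functor_comp_id X : Psi _ _ (Phi _ _ (idm C X)) = idm E (G (F X)).
Proof. by rewrite !fmap_id. Qed.
Fact functor_comp_comp X Y Z (g : Hom C Y Z) (f : Hom C X Y) :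
  Psi _ _ (Phi _ _ (comp C g f)) = comp E (Psi _ _ (Phi _ _ g)) (Psi _ _ (Phi _ _ f)).
Proof. by rewrite !fmap_comp. Qed.
Definition functor_comp : functor C E (fun X => G (F X)) :=
  Functor functor_comp_linear functor_comp_id functor_comp_comp.

Definition fmap_endo X : alghom (endo C X) (endo D (F X)) :=
  @AlgHom k (endo C X) (endo D (F X)) (@fmap _ _ _ _ _ _ Phi X X)
    (@fmap_linear _ _ _ _ _ _ Phi X X) (@fmap_id _ _ _ _ _ _ Phi X)
    (@fmap_comp _ _ _ _ _ _ Phi X X X).
End FunctorTheory.
Arguments functor_id {k O1} C.

Section Equivalences.
Variables (k : fieldType) (O1 O2 : Type) (C : klcat k O1) (D : klcat k O2).

Record nat_iso (F G : O1 -> O2) (Phi : functor C D F) (Psi : functor C D G) := NatIso {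
  nat_map :> forall X, Hom D (F X) (G X);
  nat_isom : forall X, isom (nat_map X);
  nat_comm : forall X Y (f : Hom C X Y),
    comp D (nat_map Y) (fmap Phi f) = comp D (fmap Psi f) (nat_map X)
}.
End Equivalences.

(* A quasi-inverse G of F, with F G = 1 and G F = 1 up to natural isomorphisms
   that form an adjoint equivalence *)
Record quasi_inverse (k : fieldType) (O : Type) (C : klcat k O) (F0 : O -> O)
    (F : functor C C F0) := QuasiInverse {
  qinv0 : O -> O;
  qinv : functor C C qinv0;
  qinv_counit : nat_iso (functor_comp qinv F) (functor_id C);
  qinv_unit : nat_iso (functor_comp F qinv) (functor_id C);
  qinv_triangleF : forall X, fmap F (qinv_unit X) = qinv_counit (F0 X);
  qinv_triangleG : forall X, fmap qinv (qinv_counit X) = qinv_unit (qinv0 X)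
}.

(* A Serre functor S: Hom(X, Y) = D Hom(Y, S X), naturally in X and Y *)
Record serre_duality (k : fieldType) (O : Type) (C : klcat k O) (S0 : O -> O)
    (S : functor C C S0) := SerreDuality {
  spair : forall X Y, Hom C X Y -> Hom C Y (S0 X) -> k^o;
  spair_linl : forall X Y (g : Hom C Y (S0 X)), linear (fun f : Hom C X Y => spair f g);
  spair_linr : forall X Y (f : Hom C X Y), linear (@spair X Y f);
  spair_inj : forall X Y (f : Hom C X Y), (forall g, spair f g = 0) -> f = 0;
  spair_surj : forall X Y (phi : Hom C Y (S0 X) -> k^o), linear phi ->
    exists f : Hom C X Y, forall g, spair f g = phi g;
  spair_natr : forall X Y Y' (f : Hom C X Y) (h : Hom C Y Y') (g : Hom C Y' (S0 X)),
    spair (comp C h f) g = spair f (comp C g h);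
  spair_natl : forall X X' Y (f : Hom C X Y) (h : Hom C X' X) (g : Hom C Y (S0 X')),
    spair (comp C f h) g = spair f (comp C (fmap S h) g)
}.

Section OrbitCategory.
Variables (k : fieldType) (O : Type) (C : klcat k O) (F0 : O -> O).
Variables (F : functor C C F0) (Q : quasi_inverse F).
Let G0 := qinv0 Q.
Let G : functor C C G0 := qinv Q.
Let eps X : Hom C (F0 (G0 X)) X := qinv_counit Q X.
Let eta X : Hom C (G0 (F0 X)) X := qinv_unit Q X.

Definition fpow (i : int) (X : O) : O :=
  match i with Posz n => iter n F0 X | Negz n => iter n.+1 G0 X end.
Definition zpred (i : int) : int :=
  match i with Posz 0 => Negz 0 | Posz n.+1 => Posz n | Negz n => Negz n.+1 end.
Definition zsucc (i : int) : int :=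
  match i with Posz n => Posz n.+1 | Negz 0 => Posz 0 | Negz n.+1 => Negz n end.

(* the canonical isomorphisms F F^(i-1) X = F^i X and F^-1 F^(i+1) X = F^i X *)
Definition fpow_up (i : int) (X : O) : Hom C (F0 (fpow (zpred i) X)) (fpow i X) :=
  match i with
  | Posz 0 => eps X
  | Posz n.+1 => idm C _
  | Negz n => eps (fpow (Negz n) X)
  end.
Definition fpow_down (i : int) (X : O) : Hom C (G0 (fpow (zsucc i) X)) (fpow i X) :=
  match i with
  | Posz n => eta (fpow (Posz n) X)
  | Negz 0 => idm C _
  | Negz n.+1 => idm C _
  end.

(* For g = (g_i : X -> F^i Y)_i, orbit_ext g m n is the component
   F^m(g_(n-m)) : F^m X -> F^n Y. *)
Fixpoint ext_pos X Y (g : forall i, Hom C X (fpow i Y)) (m : nat) :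
    forall n : int, Hom C (iter m F0 X) (fpow n Y) :=
  match m with
  | 0 => g
  | m'.+1 => fun n => comp C (fpow_up n Y) (fmap F (ext_pos g m' (zpred n)))
  end.
Fixpoint ext_neg X Y (g : forall i, Hom C X (fpow i Y)) (m : nat) :
    forall n : int, Hom C (iter m G0 X) (fpow n Y) :=
  match m with
  | 0 => g
  | m'.+1 => fun n => comp C (fpow_down n Y) (fmap G (ext_neg g m' (zsucc n)))
  end.
Definition orbit_ext X Y (g : forall i, Hom C X (fpow i Y)) (m n : int) :
    Hom C (fpow m X) (fpow n Y) :=
  match m with
  | Posz m' => ext_pos g m' n
  | Negz m' => ext_neg g m'.+1 n
  end.

(* Hom_{C/F}(X, Y) = \bigoplus_i Hom_C(X, F^i Y) *)
Section OrbitHom.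
Variables X Y : O.
Definition fin_supp : {pred dprod (fun i => Hom C X (fpow i Y))} :=
  fun f => `[< exists s : seq int, forall i, i \notin s -> f i = 0 >].
Fact fin_supp_submod : submod_closed fin_supp.
Proof.
split=> [|c f g /asboolP[s hs] /asboolP[t ht]]; apply/asboolP; first by exists [::].
exists (s ++ t) => i; rewrite mem_cat negb_or => /andP[si ti].
by rewrite -[LHS]/(c *: f i + g i) hs // ht // scaler0 addr0.
Qed.
HB.instance Definition _ := GRing.isSubmodClosed.Build k _ fin_supp fin_supp_submod.
Record orbit_hom := OrbitHom {
  orbit_val : dprod (fun i => Hom C X (fpow i Y));
  orbit_valP : orbit_val \in fin_supp
}.
Definition orbit_fun (f : orbit_hom) : forall i, Hom C X (fpow i Y) := orbit_val f.
HB.instance Definition _ := [isSub for orbit_val].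
HB.instance Definition _ := [Choice of orbit_hom by <:].
HB.instance Definition _ := [SubChoice_isSubLmodule of orbit_hom by <:].
End OrbitHom.
Coercion orbit_fun : orbit_hom >-> Funclass.

Lemma orbit_inj X Y (f g : orbit_hom X Y) : (forall i, f i = g i) -> f = g.
Proof. by move=> h; apply: val_inj; apply: functional_extensionality_dep. Qed.
Lemma orbit_supp X Y (f : orbit_hom X Y) :
  exists s : seq int, uniq s /\ forall i, i \notin s -> f i = 0.
Proof.
have /asboolP[s hs] := orbit_valP f.
by exists (undup s); split=> [|i]; rewrite ?undup_uniq // mem_undup; apply: hs.
Qed.

Lemma zpredK : cancel zpred zsucc. Proof. by do 2![case]. Qed.
Lemma zsuccK : cancel zsucc zpred. Proof. by do 2![case]. Qed.

Lemma fsumE (V : lmodType k) (f : int -> V) (s : seq int) :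
  uniq s -> (forall i, i \notin s -> f i = 0) ->
  \sum_(i \in [set: int]%classic) f i = \sum_(i <- s) f i.
Proof.
move=> us hs; rewrite (fsbigE s) // => [|i _]; last exact: hs.
by apply: eq_bigl => i; rewrite in_setT.
Qed.

Lemma fsum_eq (V : lmodType k) (f : int -> V) (s t : seq int) :
  uniq s -> (forall i, i \notin s -> f i = 0) ->
  uniq t -> (forall i, i \notin t -> f i = 0) ->
  \sum_(i <- s) f i = \sum_(i <- t) f i.
Proof. by move=> us hs ut ht; rewrite -(fsumE us hs) -(fsumE ut ht). Qed.

Lemma comp_suml (I : Type) (s : seq I) X Y Z (g : I -> Hom C Y Z) (f : Hom C X Y) :
  comp C (\sum_(i <- s) g i) f = \sum_(i <- s) comp C (g i) f.
Proof.
elim: s => [|i s ih]; first by rewrite !big_nil comp0m.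
by rewrite !big_cons compDl ih.
Qed.
Lemma comp_sumr (I : Type) (s : seq I) X Y Z (g : Hom C Y Z) (f : I -> Hom C X Y) :
  comp C g (\sum_(i <- s) f i) = \sum_(i <- s) comp C g (f i).
Proof.
elim: s => [|i s ih]; first by rewrite !big_nil compm0.
by rewrite !big_cons compDr ih.
Qed.
Lemma fmap_sum (H0 : O -> O) (H : functor C C H0) (I : Type) (s : seq I) X Y
    (f : I -> Hom C X Y) : fmap H (\sum_(i <- s) f i) = \sum_(i <- s) fmap H (f i).
Proof.
elim: s => [|i s ih]; first by rewrite !big_nil fmap0.
by rewrite !big_cons fmapD ih.
Qed.

Lemma ext_supp X Y (f : orbit_hom X Y) m :
  exists s : seq int, uniq s /\ forall n, n \notin s -> orbit_ext f m n = 0.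
Proof.
have [s [us hs]] := orbit_supp f.
case: m => m /=; rewrite -?/(ext_neg f m.+1 _).
  elim: m => [|m [t [ut ht]]] /=; first by exists s.
  exists (map zsucc t); split=> [|n nt]; first by rewrite (map_inj_uniq (can_inj zsuccK)).
  rewrite ht ?fmap0 ?compm0 //; apply: contraNN nt => nt.
  by apply/mapP; exists (zpred n); rewrite ?zpredK.
have : exists s : seq int, uniq s /\ forall n, n \notin s -> ext_neg f m.+1 n = 0.
  elim: m.+1 => [|m' [t [ut ht]]] /=; first by exists s.
  exists (map zpred t); split=> [|n nt]; first by rewrite (map_inj_uniq (can_inj zpredK)).
  rewrite ht ?fmap0 ?compm0 //; apply: contraNN nt => nt.
  by apply/mapP; exists (zsucc n); rewrite ?zsuccK.
by [].
Qed.

(* (g f)_n = \sum_i F^i(g_(n-i)) f_i *)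
Definition orbit_comp_fun X Y Z (g : orbit_hom Y Z) (f : orbit_hom X Y) :
    dprod (fun i => Hom C X (fpow i Z)) :=
  fun n => \sum_(i \in [set: int]%classic) comp C (orbit_ext g i n) (f i).
Fact orbit_comp_supp X Y Z (g : orbit_hom Y Z) (f : orbit_hom X Y) :
  orbit_comp_fun g f \in @fin_supp X Z.
Proof.
apply/asboolP; have [s [us hs]] := orbit_supp f.
have [t ht] : exists t : seq int, forall i n, i \in s -> n \notin t -> orbit_ext g i n = 0.
  elim: s {us hs} => [|j s [t ht]]; first by exists [::].
  have [u [_ hu]] := ext_supp g j; exists (u ++ t) => i n.
  rewrite inE mem_cat negb_or => /orP[/eqP->|si] /andP[nu nt]; first exact: hu.
  exact: ht.
exists t => n nt; rewrite /orbit_comp_fun (fsumE us) => [|i si].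
  by rewrite big_seq big1 // => i si; rewrite ht ?comp0m.
by rewrite hs ?compm0.
Qed.
Definition orbit_comp X Y Z (g : orbit_hom Y Z) (f : orbit_hom X Y) : orbit_hom X Z :=
  OrbitHom (orbit_comp_supp g f).

Definition orbit_id_fun X : dprod (fun i => Hom C X (fpow i X)) :=
  fun i => match i with Posz 0 => idm C X | _ => 0 end.
Fact orbit_id_supp X : orbit_id_fun X \in @fin_supp X X.
Proof. by apply/asboolP; exists [:: 0] => -[[|n]|n]. Qed.
Definition orbit_id X : orbit_hom X X := OrbitHom (orbit_id_supp X).

Lemma orbit_compE X Y Z (g : orbit_hom Y Z) (f : orbit_hom X Y) (s : seq int) n :
  uniq s -> (forall i, i \notin s -> f i = 0) ->
  orbit_comp g f n = \sum_(i <- s) comp C (orbit_ext g i n) (f i).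
Proof.
move=> us hs; rewrite -[LHS]/(orbit_comp_fun g f n) /orbit_comp_fun (fsumE us) // => i si.
by rewrite hs ?compm0.
Qed.

Lemma ext_linear X Y c (f g : orbit_hom X Y) m n :
  orbit_ext (c *: f + g : orbit_hom X Y) m n = c *: orbit_ext f m n + orbit_ext g m n.
Proof.
case: m => m /=.
  elim: m n => [|m ih] n //=.
  by rewrite ih fmap_linear (comp_linr (fpow_up n Y) c).
have : forall n, ext_neg (c *: f + g : orbit_hom X Y) m.+1 n =
    c *: ext_neg f m.+1 n + ext_neg g m.+1 n.
  elim: m.+1 => [|m' ih] n' //=.
  by rewrite ih fmap_linear (comp_linr (fpow_down n' Y) c).
exact.
Qed.

Fact orbit_linl X Y Z (f : orbit_hom X Y) : linear (fun g : orbit_hom Y Z => orbit_comp g f).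
Proof.
move=> c g h; apply: orbit_inj => n; have [s [us hs]] := orbit_supp f.
rewrite -[RHS]/(c *: orbit_comp g f n + orbit_comp h f n) !(orbit_compE _ _ us hs).
rewrite scaler_sumr -big_split; apply: eq_bigr => i _ /=.
by rewrite ext_linear (comp_linl (f i) c).
Qed.
Fact orbit_linr X Y Z (g : orbit_hom Y Z) : linear (fun f : orbit_hom X Y => orbit_comp g f).
Proof.
move=> c f h; apply: orbit_inj => n.
have [s [us hs]] := orbit_supp f; have [t [ut ht]] := orbit_supp h.
have ust := undup_uniq (s ++ t).
have hf i : i \notin undup (s ++ t) -> f i = 0.
  by rewrite mem_undup mem_cat negb_or => /andP[/hs].
have hh i : i \notin undup (s ++ t) -> h i = 0.
  by rewrite mem_undup mem_cat negb_or => /andP[_ /ht].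
rewrite -[RHS]/(c *: orbit_comp g f n + orbit_comp g h n).
rewrite (orbit_compE _ _ ust hf) (orbit_compE _ _ ust hh).
rewrite (orbit_compE _ _ ust) => [|i si]; last first.
  by rewrite -[LHS]/(c *: f i + h i) hf // hh // scaler0 addr0.
rewrite scaler_sumr -big_split; apply: eq_bigr => i _ /=.
exact: (comp_linr (orbit_ext g i n) c).
Qed.

Lemma orbit_ext_id X m : orbit_ext (orbit_id X) m m = idm C (fpow m X).
Proof.
case: m => m /=.
  by elim: m => [|m ih] //=; rewrite ih fmap_id comp1m.
have : ext_neg (orbit_id X) m.+1 (Negz m) = idm C (iter m.+1 G0 X); last by [].
elim: m => [|m ih]; first by rewrite /= fmap_id comp1m.
rewrite -[LHS]/(comp C (fpow_down (Negz m.+1) X)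
  (fmap G (ext_neg (orbit_id X) m.+1 (Negz m)))).
by rewrite ih fmap_id comp1m.
Qed.
Lemma orbit_ext_id0 X m n : m != n -> orbit_ext (orbit_id X) m n = 0.
Proof.
case: m n => m.
  elim: m => [|m ih] n /=; first by case: n => [[]|].
  move=> mn; rewrite -[ext_pos _ _ _]/(orbit_ext (orbit_id X) m (zpred n)) ih.
    by rewrite fmap0 compm0.
  by apply: contraNneq mn => mn; rewrite -(zpredK n) -mn.
have : forall n, zpred (Posz 0) != n -> ext_neg (orbit_id X) 1 n = 0.
  move=> n' mn.
  rewrite -[LHS]/(comp C (fpow_down n' X) (fmap G (orbit_id_fun X (zsucc n')))).
  have -> : orbit_id_fun X (zsucc n') = 0 by move: mn; case: n' => [n'|[|n']].
  by rewrite fmap0 compm0.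
move=> h1; suff: forall n, Negz m != n -> ext_neg (orbit_id X) m.+1 n = 0 by [].
elim: m => [|m ih] n mn; first exact: h1.
rewrite -[LHS]/(comp C (fpow_down n X)
  (fmap G (ext_neg (orbit_id X) m.+1 (zsucc n)))) ih.
  by rewrite fmap0 compm0.
by apply: contraNneq mn => mn; rewrite -(zsuccK n) -mn.
Qed.

Fact orbit_comp1m X Y (f : orbit_hom X Y) : orbit_comp (orbit_id Y) f = f.
Proof.
apply: orbit_inj => n; have [s [us hs]] := orbit_supp f.
have hs' i : i \notin undup (n :: s) -> f i = 0.
  by rewrite mem_undup inE negb_or => /andP[_ /hs].
have nin : n \in undup (n :: s) by rewrite mem_undup inE eqxx.
rewrite (orbit_compE _ _ (undup_uniq _) hs') (bigD1_seq n nin (undup_uniq _)).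
rewrite orbit_ext_id comp1m big1 => [|i ni]; first exact: addr0.
by rewrite orbit_ext_id0 ?comp0m.
Qed.
Fact orbit_compm1 X Y (f : orbit_hom X Y) : orbit_comp f (orbit_id X) = f.
Proof.
apply: orbit_inj => n; rewrite (@orbit_compE _ _ _ _ _ [:: 0]) //.
  by rewrite big_seq1 compm1.
by move=> [[|i]|i].
Qed.

Let epsN X Y (f : Hom C X Y) : comp C f (eps X) = comp C (eps Y) (fmap F (fmap G f)).
Proof. by rewrite /eps; have := nat_comm (qinv_counit Q) f => /= <-. Qed.
Let etaN X Y (f : Hom C X Y) : comp C f (eta X) = comp C (eta Y) (fmap G (fmap F f)).
Proof. by rewrite /eta; have := nat_comm (qinv_unit Q) f => /= <-. Qed.

Lemma down_eps Z Y (f : forall i, Hom C Z (fpow i Y)) n :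
  comp C (f n) (eps Z) =
  comp C (fpow_up n Y) (fmap F (comp C (fpow_down (zpred n) Y) (fmap G (f (zsucc (zpred n)))))).
Proof.
rewrite epsN fmap_comp; case: n => [[|n]|n] /=.
- by rewrite fmap_id comp1m.
- by rewrite comp1m (qinv_triangleF Q).
- by rewrite fmap_id comp1m.
Qed.
Lemma up_eta Z Y (f : forall i, Hom C Z (fpow i Y)) n :
  comp C (f n) (eta Z) =
  comp C (fpow_down n Y) (fmap G (comp C (fpow_up (zsucc n) Y) (fmap F (f (zpred (zsucc n)))))).
Proof.
rewrite etaN fmap_comp; case: n => [n|[|n]] /=.
- by rewrite fmap_id comp1m.
- by rewrite comp1m (qinv_triangleG Q).
- by rewrite comp1m (qinv_triangleG Q).
Qed.

Lemma orbit_ext_up X Y (f : forall i, Hom C X (fpow i Y)) m n :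
  comp C (orbit_ext f m n) (fpow_up m X) =
  comp C (fpow_up n Y) (fmap F (orbit_ext f (zpred m) (zpred n))).
Proof.
case: m => [[|m]|m] /=; first exact: down_eps.
  by rewrite compm1.
exact: (down_eps (ext_neg f m.+1)).
Qed.
Lemma orbit_ext_down X Y (f : forall i, Hom C X (fpow i Y)) m n :
  comp C (orbit_ext f m n) (fpow_down m X) =
  comp C (fpow_down n Y) (fmap G (orbit_ext f (zsucc m) (zsucc n))).
Proof.
case: m => [m|[|m]] /=; first exact: (up_eta (ext_pos f m)).
  by rewrite compm1.
by rewrite compm1.
Qed.

Lemma orbit_ext_comp X Y Z (g : orbit_hom Y Z) (f : orbit_hom X Y) m n s :
  uniq s -> (forall i, i \notin s -> orbit_ext f m i = 0) ->
  orbit_ext (orbit_comp g f) m n = \sum_(i <- s) comp C (orbit_ext g i n) (orbit_ext f m i).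
Proof.
case: m => m.
  elim: m n s => [|m ih] n s us hs; first exact: orbit_compE.
  have [t [ut ht]] := ext_supp f (Posz m).
  rewrite -[LHS]/(comp C (fpow_up n Z)
    (fmap F (orbit_ext (orbit_comp g f) (Posz m) (zpred n)))).
  rewrite (ih _ t) // fmap_sum comp_sumr.
  have e i : comp C (fpow_up n Z)
      (fmap F (comp C (orbit_ext g i (zpred n)) (ext_pos f m i))) =
      comp C (orbit_ext g (zsucc i) n) (orbit_ext f (Posz m.+1) (zsucc i)).
    rewrite fmap_comp compA /= compA orbit_ext_up.
    by case: i => [i|[|i]].
  rewrite (eq_bigr _ (fun i _ => e i)) -(big_map zsucc xpredT
    (fun i => comp C (orbit_ext g i n) (orbit_ext f (Posz m.+1) i))).
  apply: fsum_eq => // [|i hi|i hi]; rewrite ?(map_inj_uniq (can_inj zsuccK)) //.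
    2: by rewrite hs ?compm0.
  rewrite -[orbit_ext f (Posz m.+1) i]/(comp C (fpow_up i Y)
    (fmap F (orbit_ext f (Posz m) (zpred i)))) ht ?fmap0 ?compm0 //; apply: contraNN hi => hi.
  by apply/mapP; exists (zpred i); rewrite ?zpredK.
have base: forall n s, uniq s -> (forall i, i \notin s -> ext_neg f 0 i = 0) ->
  ext_neg (orbit_comp g f) 0 n = \sum_(i <- s) comp C (orbit_ext g i n) (ext_neg f 0 i).
  by move=> *; apply: orbit_compE.
have supp m' : exists t : seq int, uniq t /\ forall n, n \notin t -> ext_neg f m' n = 0.
  by case: m' => [|m']; [exact: (ext_supp f (Posz 0)) | exact: (ext_supp f (Negz m'))].
suff gen m' : forall n s, uniq s -> (forall i, i \notin s -> ext_neg f m' i = 0) ->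
    ext_neg (orbit_comp g f) m' n = \sum_(i <- s) comp C (orbit_ext g i n) (ext_neg f m' i).
  exact: (gen m.+1).
elim: m' => [|m' ih] n' {}s us hs; first exact: base.
have [t [ut ht]] := supp m'.
rewrite -[LHS]/(comp C (fpow_down n' Z)
  (fmap G (ext_neg (orbit_comp g f) m' (zsucc n')))).
rewrite (ih _ t) // fmap_sum comp_sumr.
have e i : comp C (fpow_down n' Z)
    (fmap G (comp C (orbit_ext g i (zsucc n')) (ext_neg f m' i))) =
    comp C (orbit_ext g (zpred i) n') (ext_neg f m'.+1 (zpred i)).
  rewrite fmap_comp compA /= compA orbit_ext_down.
  by case: i => [[|i]|i].
rewrite (eq_bigr _ (fun i _ => e i)) -(big_map zpred xpredT
  (fun i => comp C (orbit_ext g i n') (ext_neg f m'.+1 i))).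
apply: fsum_eq => // [|i hi|i hi]; rewrite ?(map_inj_uniq (can_inj zpredK)) //.
  2: by rewrite hs ?compm0.
rewrite -[ext_neg f m'.+1 i]/(comp C (fpow_down i Y)
  (fmap G (ext_neg f m' (zsucc i)))) ht ?fmap0 ?compm0 //; apply: contraNN hi => hi.
by apply/mapP; exists (zsucc i); rewrite ?zsuccK.
Qed.

Fact orbit_compA X Y Z W (h : orbit_hom Z W) (g : orbit_hom Y Z) (f : orbit_hom X Y) :
  orbit_comp h (orbit_comp g f) = orbit_comp (orbit_comp h g) f.
Proof.
apply: orbit_inj => n; have [s [us hs]] := orbit_supp f.
have [r [ur hr]] := orbit_supp (orbit_comp g f).
have [t ht] : exists t : seq int, forall i j, i \in s -> j \notin t -> orbit_ext g i j = 0.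
  elim: s {us hs} => [|j s [t ht]]; first by exists [::].
  have [u [_ hu]] := ext_supp g j; exists (u ++ t) => i l.
  rewrite inE mem_cat negb_or => /orP[/eqP->|si] /andP[nu nt]; first exact: hu.
  exact: ht.
have ut := undup_uniq (r ++ t); set v := undup _ in ut.
have hrv i : i \notin v -> orbit_comp g f i = 0.
  by rewrite mem_undup mem_cat negb_or => /andP[/hr].
have htv i j : i \in s -> j \notin v -> orbit_ext g i j = 0.
  by rewrite mem_undup mem_cat negb_or => si /andP[_ /ht]; apply.
rewrite (orbit_compE _ _ ut hrv) (orbit_compE _ _ us hs).
under eq_bigr do rewrite (orbit_compE _ _ us hs) comp_sumr.
rewrite exchange_big; rewrite big_seq [RHS]big_seq; apply: eq_bigr => i si.
rewrite (@orbit_ext_comp _ _ _ h g i n _ ut) => [|j]; last exact: htv.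
by rewrite comp_suml; apply: eq_bigr => j _; rewrite compA.
Qed.

Definition orbit_cat : klcat k O :=
  @KLCat k O (fun X Y => orbit_hom X Y) orbit_id orbit_comp
    orbit_linl orbit_linr orbit_compA orbit_comp1m orbit_compm1.
End OrbitCategory.

Section StalkFunctor.
Variables (k : fieldType) (A : fdAlgType k).
Fact stalk_linear (M N : rmod A) : linear (@stalk_map k A M N).
Proof.
move=> c f g; apply: chain_inj => i.
rewrite -[RHS]/(c *: stalk_map_fun f i + stalk_map_fun g i).
by case: i => [[|i]|i] //=; apply: mhom_inj => x; rewrite !(mhomDE, mhomZE, mhom0E) scaler0 addr0.
Qed.
Fact stalk_id (M : rmod A) : stalk_map (mid M) = chain_id (stalk M).
Proof.
by apply: chain_inj => -[[|i]|i] //; apply: mhom_inj => x; rewrite [LHS]thinmx0 [RHS]thinmx0.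
Qed.
Fact stalk_comp (M N L : rmod A) (g : mhom N L) (f : mhom M N) :
  stalk_map (mcomp g f) = chain_comp (stalk_map g) (stalk_map f).
Proof.
by apply: chain_inj => -[[|i]|i] //; apply: mhom_inj => x; rewrite [LHS]thinmx0 [RHS]thinmx0.
Qed.
Definition stalk_functor : functor (modcat A) (cplxcat A) (@stalk k A) :=
  @Functor k _ _ (modcat A) (cplxcat A) _ (@stalk_map k A) stalk_linear stalk_id stalk_comp.
End StalkFunctor.

(* The bounded derived category of mod A: the localisation of the homotopy
   category of bounded complexes at the quasi-isomorphisms, described by its
   calculus of fractions, together with the induced shift functor.  These data
   determine it up to a unique isomorphism that is the identity on objects. *)
Record derived (k : fieldType) (A : fdAlgType k) := Derived {
  dcat :> klcat k (cplx A);
  dloc : functor (cplxcat A) dcat (fun X => X);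
  dloc_isom : forall X Y (s : chain_map X Y), quasi_iso s -> isom (fmap dloc s);
  dloc_frac : forall X Y (h : Hom dcat X Y),
    exists X' (s : chain_map X' X) (f : chain_map X' Y),
      quasi_iso s /\ comp dcat h (fmap dloc s) = fmap dloc f;
  dloc_eq0 : forall X Y (f : chain_map X Y),
    fmap dloc f = 0 <->
    exists X' (s : chain_map X' X), quasi_iso s /\ nullhomotopic (chain_comp f s);
  dshift : functor dcat dcat (@shift k A);
  dshiftE : forall X Y (f : chain_map X Y),
    fmap dshift (fmap dloc f) = fmap dloc (shift_map f)
}.

(* The cluster category of H is D^b(H)/F.  The Auslander-Reiten translation tau
   of D^b(H) is characterised by tau[1] being a Serre functor, which determines
   it up to natural isomorphism, and F = tau^-1[1]. *)
Record cluster_data (k : fieldType) (H : fdAlgType k) (D : derived H) := ClusterData {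
  ctau0 : cplx H -> cplx H;
  ctau : functor D D ctau0;
  ctau_serre : serre_duality (functor_comp ctau (dshift D));
  ctau_inv : quasi_inverse ctau;
  cF_inv : quasi_inverse (functor_comp (qinv ctau_inv) (dshift D))
}.
Definition cluster_cat (k : fieldType) (H : fdAlgType k) (D : derived H)
    (S : cluster_data D) : klcat k (cplx H) :=
  orbit_cat (cF_inv S).

Definition cluster_tilting (k : fieldType) (H : fdAlgType k) (D : derived H)
    (S : cluster_data D) (T : cplx H) :=
  (forall f : Hom (cluster_cat S) T (shift T), f = 0) /\
  exists n, nsummands (cluster_cat S) T n /\ nsummands (modcat H) (regular H) n.

Definition cluster_tilted (k : fieldType) (A : pzAlgType k) :=
  exists (H : fdAlgType k) (D : derived H) (S : cluster_data D) (T : cplx H),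
    [/\ hereditary H, cluster_tilting S T, basic (cluster_cat S) T
      & alg_iso A (endo (cluster_cat S) T)].

(* two_term (row_mhom p1 0) is the complex (p1, 0) : P1 + P -> P0. *)
Definition silted_wrt (k : fieldType) (H : fdAlgType k) (D : derived H)
    (T P : rmod H) (A : pzAlgType k) :=
  exists P1 P0 (p1 : mhom P1 P0) (p0 : mhom P0 T),
    min_proj_pres p1 p0 /\
    alg_iso A (endo D (two_term (row_mhom p1 (0 : mhom P P0)))).

Record bimod (k : fieldType) (L R : pzAlgType k) := Bimod {
  bcar :> lmodType k;
  lact : L -> bcar -> bcar;
  ract : bcar -> R -> bcar;
  lact_linl : forall x, linear (lact^~ x);
  lact_linr : forall a, linear (lact a);
  ract_linl : forall b, linear (ract^~ b);
  ract_linr : forall x, linear (ract x);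
  lact1 : forall x, lact (aone L) x = x;
  ract1 : forall x, ract x (aone R) = x;
  lactM : forall a a' x, lact (a ** a') x = lact a (lact a' x);
  ractM : forall x b b', ract x (b ** b') = ract (ract x b) b';
  lractA : forall a x b, ract (lact a x) b = lact a (ract x b)
}.
Arguments lact {k L R} M : rename.
Arguments ract {k L R} M : rename.

Section BimoduleTheory.
Variables (k : fieldType) (L R : pzAlgType k) (M : bimod L R).
Lemma lactDr a (x y : M) :
  lact M a (x + y) = lact M a x + lact M a y.
Proof. by have := @lact_linr k L R M a 1 x y; rewrite !scale1r. Qed.
Lemma ractDl b (x y : M) :
  ract M (x + y) b = ract M x b + ract M y b.
Proof. by have := @ract_linl k L R M b 1 x y; rewrite !scale1r. Qed.
Lemma lact0 a : lact M a 0 = 0.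
Proof. by have := lactDr a (0 : M) 0; rewrite addr0 => /eqP; rewrite -subr_eq subrr => /eqP. Qed.
Lemma ract0 b : ract M 0 b = 0.
Proof. by have := ractDl b (0 : M) 0; rewrite addr0 => /eqP; rewrite -subr_eq subrr => /eqP. Qed.
End BimoduleTheory.

Section AlgHom.
Variables (k : fieldType) (A B C : pzAlgType k).
Definition alghom_id : alghom A A :=
  @AlgHom k A A id (fun _ _ _ => erefl) erefl (fun _ _ => erefl).
Variables (g : alghom B C) (f : alghom A B).
Fact alghom_comp_linear : linear (fun x => g (f x)).
Proof. by move=> c x y; rewrite !alghom_linear. Qed.
Fact alghom_comp1 : g (f (aone A)) = aone C. Proof. by rewrite !alghom1. Qed.
Fact alghom_compM : {morph (fun x => g (f x)) : x y / x ** y}.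
Proof. by move=> x y /=; rewrite !alghomM. Qed.
Definition alghom_comp : alghom A C := AlgHom alghom_comp_linear alghom_comp1 alghom_compM.
End AlgHom.
Arguments alghom_id {k} A.

Section RestrictRight.
Variables (k : fieldType) (L R R' : pzAlgType k) (M : bimod L R) (p : alghom R' R).
Let act (x : M) (b : R') : M := ract M x (p b).
Fact restr_linl b : linear (act^~ b). Proof. exact: ract_linl. Qed.
Fact restr_linr x : linear (act x).
Proof. by move=> c a b; rewrite /act alghom_linear ract_linr. Qed.
Fact restr1 x : act x (aone R') = x. Proof. by rewrite /act alghom1 ract1. Qed.
Fact restrM x b b' : act x (b ** b') = act (act x b) b'.
Proof. by rewrite /act alghomM ractM. Qed.
Fact restrA a x b : act (lact M a x) b = lact M a (act x b).
Proof. exact: lractA. Qed.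
Definition bimod_restr : bimod L R' :=
  @Bimod k L R' M (lact M) act (@lact_linl _ _ _ M) (@lact_linr _ _ _ M)
    restr_linl restr_linr (@lact1 _ _ _ M) restr1 (@lactM _ _ _ M) restrM restrA.
End RestrictRight.

Section HomBimodule.
Variables (k : fieldType) (O : Type) (C : klcat k O) (X Y : O) (L R : pzAlgType k).
Variables (l : alghom L (endo C Y)) (r : alghom R (endo C X)).
Let lac (a : L) (f : Hom C X Y) : Hom C X Y := comp C (l a) f.
Let rac (f : Hom C X Y) (b : R) : Hom C X Y := comp C f (r b).
Fact hb_lact_linl f : linear (lac^~ f).
Proof. by move=> c a b; rewrite /lac alghom_linear (comp_linl f c). Qed.
Fact hb_lact_linr a : linear (lac a). Proof. exact: comp_linr. Qed.
Fact hb_ract_linl b : linear (rac^~ b). Proof. exact: comp_linl. Qed.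
Fact hb_ract_linr f : linear (rac f).
Proof. by move=> c a b; rewrite /rac alghom_linear (comp_linr f c). Qed.
Fact hb_lact1 f : lac (aone L) f = f. Proof. by rewrite /lac alghom1 comp1m. Qed.
Fact hb_ract1 f : rac f (aone R) = f. Proof. by rewrite /rac alghom1 compm1. Qed.
Fact hb_lactM a a' f : lac (a ** a') f = lac a (lac a' f).
Proof. by rewrite /lac alghomM compA. Qed.
Fact hb_ractM f b b' : rac f (b ** b') = rac (rac f b) b'.
Proof. by rewrite /rac alghomM -compA. Qed.
Fact hb_lractA a f b : rac (lac a f) b = lac a (rac f b).
Proof. by rewrite /rac /lac compA. Qed.
Definition hom_bimod : bimod L R :=
  Bimod hb_lact_linl hb_lact_linr hb_ract_linl hb_ract_linr
    hb_lact1 hb_ract1 hb_lactM hb_ractM hb_lractA.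
End HomBimodule.

(* Ext^n_A(M, N) = Hom_{D^b(A)}(M, N[n]), with L acting through endomorphisms of
   N (postcomposition) and R through endomorphisms of M (precomposition) *)
Section Ext.
Variables (k : fieldType) (A : fdAlgType k) (D : derived A).

Definition dstalk : functor (modcat A) D (@stalk k A) :=
  functor_comp (stalk_functor A) (dloc D).
Fixpoint dstalk_shift (n : nat) :
    functor (modcat A) D (fun N => iter n (@shift k A) (stalk N)) :=
  match n with
  | 0 => dstalk
  | n'.+1 => functor_comp (dstalk_shift n') (dshift D)
  end.

Definition ext_bimod (n : nat) (M N : rmod A) (L R : pzAlgType k)
    (l : alghom L (mendo N)) (r : alghom R (mendo M)) : bimod L R :=
  hom_bimod (alghom_comp (fmap_endo (dstalk_shift n) N) l)
            (alghom_comp (fmap_endo dstalk M) r).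
End Ext.

Section TrivialExtension.
Variables (k : fieldType) (B : pzAlgType k) (E : bimod B B).
Definition triv_ext : Type := (B * E)%type.
HB.instance Definition _ := GRing.Lmodule.on triv_ext.
Let mul (x y : triv_ext) : triv_ext :=
  (x.1 ** y.1, lact E x.1 y.2 + ract E x.2 y.1).
Let one : triv_ext := (aone B, 0).

Fact te_linl y : linear (mul^~ y).
Proof.
move=> c a b; rewrite /mul /= (amul_linl _ c) (lact_linl _ c) (ract_linl _ c).
by congr pair; rewrite /= scalerDr addrACA.
Qed.
Fact te_linr x : linear (mul x).
Proof.
move=> c a b; rewrite /mul /= (amul_linr _ c) (lact_linr _ c) (ract_linr _ c).
by congr pair; rewrite /= scalerDr addrACA.
Qed.
Fact te_mulA : associative mul.
Proof.
move=> x y z; rewrite /mul /= amulA lactDr ractDl lactM ractM lractA.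
by rewrite addrA.
Qed.
Fact te_mul1 : left_id one mul.
Proof. by case=> b e; rewrite /mul /= amul1l lact1 ract0 addr0. Qed.
Fact te_mulr1 : right_id one mul.
Proof. by case=> b e; rewrite /mul /= amul1r lact0 ract1 add0r. Qed.
HB.instance Definition _ := Lmodule_isAlg.Build k triv_ext
  te_mulA te_mul1 te_mulr1 te_linl te_linr.

Definition triv_ext_proj : alghom triv_ext B :=
  @AlgHom k triv_ext B (fun x => x.1) (fun _ _ _ => erefl) erefl (fun _ _ => erefl).
End TrivialExtension.

(* (b, m, h) stands for the matrix with rows (b, 0) and (m, h). *)
Section Triangular.
Variables (k : fieldType) (B H1 : pzAlgType k) (M : bimod H1 B).
Definition tri_alg : Type := (B * M * H1)%type.
HB.instance Definition _ := GRing.Lmodule.on tri_alg.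
Let mul (x y : tri_alg) : tri_alg :=
  (x.1.1 ** y.1.1, ract M x.1.2 y.1.1 + lact M x.2 y.1.2, x.2 ** y.2).
Let one : tri_alg := (aone B, 0, aone H1).

Fact tri_linl y : linear (mul^~ y).
Proof.
move=> c a b; rewrite /mul /= !(amul_linl _ c) (lact_linl _ c) (ract_linl _ c).
by congr (_, _, _); rewrite /= scalerDr addrACA.
Qed.
Fact tri_linr x : linear (mul x).
Proof.
move=> c a b; rewrite /mul /= !(amul_linr _ c) (lact_linr _ c) (ract_linr _ c).
by congr (_, _, _); rewrite /= scalerDr addrACA.
Qed.
Fact tri_mulA : associative mul.
Proof.
move=> x y z; rewrite /mul /= !amulA lactDr ractDl lactM ractM lractA.
by rewrite addrA.
Qed.
Fact tri_mul1 : left_id one mul.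
Proof. by move=> [[b m] h]; rewrite /mul /= !amul1l lact1 ract0 add0r. Qed.
Fact tri_mulr1 : right_id one mul.
Proof. by move=> [[b m] h]; rewrite /mul /= !amul1r lact0 ract1 addr0. Qed.
HB.instance Definition _ := Lmodule_isAlg.Build k tri_alg
  tri_mulA tri_mul1 tri_mulr1 tri_linl tri_linr.
End Triangular.

Definition ext1_bimod (k : fieldType) (H : fdAlgType k) (D : derived H)
    (T P : rmod H) : bimod (mendo P) (mendo T) :=
  ext_bimod D 1 (alghom_id (mendo P)) (alghom_id (mendo T)).

(* B acts on the left of B_B and DB_B by lmul_hom and dual_lmul_hom. *)
Definition ext2_bimod (k : fieldType) (B : fdAlgType k) (D : derived B) : bimod B B :=
  ext_bimod D 2 (lmul_hom B) (dual_lmul_hom B).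

(* Main.v *)
From HB Require Import structures.
From mathcomp Require Import all_boot all_order all_algebra.
From mathcomp Require Import boolp zify ring.
Require Import Defs.

(* Write F = tau^-1[1]. In the cluster category of H consider the object X = T + P[1]. Placing the
   complexes F^i T, F^i P[1] in the standard t-structure and using Serre duality, one sees that
   Hom(X, F^i X[1]) = 0 for all i, and that Hom(X, F^i X) is nonzero only for i = 0, where it is the
   silted algebra, and for i = 1, where Hom(P, tau^-1 T) = 0 leaves just Hom(T, F T). The latter is a
   square-zero ideal which P[1] does not see, so End(X) is the triangular algebra of the trivial
   extension of B by Hom(T, F T).

   It remains to identify the bimodule Hom(T, F T) with Ext^2_B(DB, B). Let Q1 -> Q0 -> T be the
   minimal projective presentation and T -> J0 -> J1 the minimal injective copresentation. By Serre
   duality Hom(T, F T) = Hom(S T, T[2]), where S T is the cone of nu Q1 -> nu Q0 and T[2] that of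
   J0[1] -> J1[1]; hence it is Hom(nu Q1, J1) modulo the maps through nu Q0 or J0. Since T is
   tau-rigid, the functor Hom(T, -) turns the two complexes into exact sequences of B-modules
   0 -> Hom(T, nu Q1) -> Hom(T, nu Q0) -> DB -> 0 and 0 -> B -> Hom(T, J0) -> Hom(T, J1) -> 0, and the
   groups Ext^i_B(Hom(T, Y), Hom(T, J)) vanish for J injective and i = 1, 2, so Ext^2_B(DB, B) has the
   same description by B-linear maps. As Hom(T, -) is full on maps to injectives, the two quotients
   agree once the maps nu Q1 -> J1 that vanish on the trace of T are known to lift to J0, which is
   again the hypothesis Hom(P, tau^-1 T) = 0.

   The indecomposable summands of X are counted by lifting idempotents modulo the square-zero kernel
   of End(X) -> End(T) x End(P). *)

Set Implicit Arguments.
Unset Strict Implicit.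
Unset Printing Implicit Defensive.
Import GRing.Theory Num.Theory.

#[global] Arguments mhom_lfun : simpl never.
#[global] Arguments mcar : simpl never.
#[global] Arguments dsum_mod : simpl never.
#[global] Arguments zero_mod : simpl never.
#[global] Arguments regular : simpl never.
#[global] Arguments dual : simpl never.
#[global] Arguments nu : simpl never.
#[global] Arguments nuinv : simpl never.

(** * Modules *)

Section Modules.
Local Open Scope ring_scope.
Variables (k : fieldType) (A : fdAlgType k).
Implicit Types M N L K Q J X Y Z : rmod A.

(** Besides fixing the number of summands of X, the equality |T| + |P| = |H| is used through
    orthogonality. By a theorem of Happel and Ringel, nonzero maps between the indecomposable
    summands are injective or surjective, so the matrix of Hom-dimensions can be made triangular;
    hence the classes of the summands of T and P in the Grothendieck group are independent, and
    their number makes them a basis. Two consequences carry the proof: a module orthogonal to T and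
    P is zero, which gives the fullness of Hom(T, -), and Hom(P, N) = 0 forces Hom(Q, N) = 0 for
    each projective Q with Hom(Q, T) = 0. The derived category is given by fractions and a shift
    only, and the Auslander-Reiten translation by Serre duality only. Statements about F are
    therefore reduced to S(F Y) = Y[2], and Serre duality is handled through trace forms th on
    Hom(X, S X): vanishing of Hom passes across the pairing th(g f), and the effect of S on a
    morphism is its transpose. Transposes keep both actions of B visible when Hom(T, F T) is
    compared with Ext^2_B(DB, B). *)

Lemma mactDl M (a : A) (x y : M) : mact M (x + y) a = mact M x a + mact M y a.
Proof. exact: (linearD (ractl M a)). Qed.
Lemma mactZl M (a : A) c (x : M) : mact M (c *: x) a = c *: mact M x a.
Proof. exact: (linearZ_LR (ractl M a)). Qed.
Lemma mact0l M (a : A) : mact M 0 a = 0.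
Proof. exact: (linear0 (ractl M a)). Qed.
Lemma mactBl M (a : A) (x y : M) : mact M (x - y) a = mact M x a - mact M y a.
Proof. exact: (linearB (ractl M a)). Qed.
Lemma mact_suml M (a : A) (I : Type) (r : seq I) (F : I -> M) :
  mact M (\sum_(i <- r) F i) a = \sum_(i <- r) mact M (F i) a.
Proof. exact: (linear_sum (ractl M a)). Qed.
Lemma mactDr M (x : M) (a b : A) : mact M x (a + b) = mact M x a + mact M x b.
Proof. exact: (linearD (lactr x)). Qed.
Lemma mactZr M (x : M) c (a : A) : mact M x (c *: a) = c *: mact M x a.
Proof. exact: (linearZ_LR (lactr x)). Qed.
Lemma mact_sumr M (x : M) (I : Type) (r : seq I) (F : I -> A) :
  mact M x (\sum_(i <- r) F i) = \sum_(i <- r) mact M x (F i).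
Proof. exact: (linear_sum (lactr x)). Qed.

Lemma mhomNE M N (f : mhom M N) x : (- f : mhom M N) x = - f x.
Proof. by rewrite -scaleN1r mhomZE scaleN1r. Qed.
Lemma mhomBE M N (f g : mhom M N) x : (f - g : mhom M N) x = f x - g x.
Proof. by rewrite mhomDE mhomNE. Qed.
Lemma mhom_sumE M N (I : Type) (r : seq I) (F : I -> mhom M N) x :
  (\sum_(i <- r) F i : mhom M N) x = \sum_(i <- r) F i x.
Proof.
by elim: r => [|i r ih]; rewrite ?big_nil ?mhom0E // !big_cons mhomDE ih.
Qed.
Lemma mcomp0 M N L (g : mhom N L) : mcomp g (0 : mhom M N) = 0.
Proof. exact: (@compm0 _ _ (modcat A)). Qed.
Lemma mcomp0l M N L (f : mhom M N) : mcomp (0 : mhom N L) f = 0.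
Proof. exact: (@comp0m _ _ (modcat A)). Qed.
Lemma mcompDl M N L (f : mhom M N) (g g' : mhom N L) :
  mcomp (g + g') f = mcomp g f + mcomp g' f.
Proof. exact: (@compDl _ _ (modcat A)). Qed.
Lemma mcompDr M N L (f f' : mhom M N) (g : mhom N L) :
  mcomp g (f + f') = mcomp g f + mcomp g f'.
Proof. exact: (@compDr _ _ (modcat A)). Qed.
Lemma mcompNl M N L (f : mhom M N) (g : mhom N L) : mcomp (- g) f = - mcomp g f.
Proof. by apply: mhom_inj => x; rewrite mcompE !mhomNE mcompE. Qed.
Lemma mcompNr M N L (f : mhom M N) (g : mhom N L) : mcomp g (- f) = - mcomp g f.
Proof. by apply: mhom_inj => x; rewrite mcompE !mhomNE mcompE linearN. Qed.
Lemma mcompBl M N L (f : mhom M N) (g g' : mhom N L) :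
  mcomp (g - g') f = mcomp g f - mcomp g' f.
Proof. by rewrite mcompDl mcompNl. Qed.
Lemma mcompBr M N L (f f' : mhom M N) (g : mhom N L) :
  mcomp g (f - f') = mcomp g f - mcomp g f'.
Proof. by rewrite mcompDr mcompNr. Qed.
Lemma mcompZl M N L c (f : mhom M N) (g : mhom N L) : mcomp (c *: g) f = c *: mcomp g f.
Proof. exact: (@compZl _ _ (modcat A)). Qed.
Lemma mcompZr M N L c (f : mhom M N) (g : mhom N L) : mcomp g (c *: f) = c *: mcomp g f.
Proof. exact: (@compZr _ _ (modcat A)). Qed.
Lemma mcomp_suml (I : Type) (r : seq I) M N L (f : mhom M N) (F : I -> mhom N L) :
  mcomp (\sum_(i <- r) F i) f = \sum_(i <- r) mcomp (F i) f.
Proof. by apply: mhom_inj => x; rewrite mcompE !mhom_sumE; apply: eq_bigr => i _; rewrite mcompE. Qed.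
Lemma mhom_app M N (f g : mhom M N) x : f = g -> f x = g x. Proof. by move->. Qed.

Section LfunMorphism.
Variables (U V : vectType k) (f : 'Hom(U, V)).
Lemma lf0 : f 0 = 0. Proof. exact: linear0. Qed.
Lemma lfD x y : f (x + y) = f x + f y. Proof. exact: linearD. Qed.
Lemma lfN x : f (- x) = - f x. Proof. exact: linearN. Qed.
Lemma lfB x y : f (x - y) = f x - f y. Proof. exact: linearB. Qed.
Lemma lfZ c x : f (c *: x) = c *: f x. Proof. exact: linearZ. Qed.
Lemma lf_sum (I : Type) (r : seq I) (F : I -> U) :
  f (\sum_(i <- r) F i) = \sum_(i <- r) f (F i).
Proof. exact: linear_sum. Qed.
End LfunMorphism.

Lemma linear_inj0 (U V : vectType k) (f : 'Hom(U, V)) :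
  (forall x, f x = 0 -> x = 0) -> injective f.
Proof. by move=> h x y e; apply/eqP; rewrite -subr_eq0; apply/eqP/h; rewrite lfB e subrr. Qed.
Lemma mhom_inj0 M N (f : mhom M N) : injective f <-> (forall x, f x = 0 -> x = 0).
Proof.
split=> [fi x fx|]; last exact: linear_inj0.
by apply: fi; rewrite fx lf0.
Qed.

Lemma factor_surj M N L (p : mhom M N) (f : mhom M L) : surj p ->
  (forall x, p x = 0 -> f x = 0) -> exists g : mhom N L, mcomp g p = f.
Proof.
move=> /choice[s sE] kf.
have fE x y : p x = p y -> f x = f y.
  by move=> e; apply/subr0_eq; rewrite -lfB kf // lfB e subrr.
have lin : linear (fun y => f (s y)).
  by move=> c x y; rewrite -lfZ -lfD; apply: fE; rewrite lfD lfZ !sE.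
have act y a : f (s (mact N y a)) = mact L (f (s y)) a.
  by rewrite -mhomP; apply: fE; rewrite mhomP !sE.
by exists (mk_mhom lin act); apply: mhom_inj => x; rewrite mcompE mk_mhomE; apply: fE.
Qed.

Lemma factor_inj M N L (i : mhom M N) (f : mhom L N) : injective i ->
  (forall x, exists y, i y = f x) -> exists g : mhom L M, mcomp i g = f.
Proof.
move=> ii /choice[s sE].
have lin : linear s by move=> c x y; apply: ii; rewrite !(lfD, lfZ, sE).
have act x a : s (mact L x a) = mact M (s x) a by apply: ii; rewrite mhomP !sE mhomP.
by exists (mk_mhom lin act); apply: mhom_inj => x; rewrite mcompE mk_mhomE.
Qed.

Lemma misomP M N (f : mhom M N) : isom (C := modcat A) f <->
  exists g : mhom N M, mcomp g f = mid M /\ mcomp f g = mid N.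
Proof. by []. Qed.
Lemma mhom_isom M N (f : mhom M N) : injective f -> surj f -> isom (C := modcat A) f.
Proof.
move=> fi fs; have [|g gf] := factor_surj (f := mid M) fs.
  by move=> x fx; rewrite midE; apply: fi; rewrite fx lf0.
apply/misomP; exists g; split=> //.
apply: mhom_inj => y; have [x <-] := fs y.
by rewrite mcompE -[g (f x)]mcompE gf !midE.
Qed.
Lemma isom_inj M N (f : mhom M N) : isom (C := modcat A) f -> injective f.
Proof.
by case/misomP=> g [gf _]; apply: (can_inj (g := g)) => x; rewrite -mcompE gf midE.
Qed.
Lemma isom_surj M N (f : mhom M N) : isom (C := modcat A) f -> surj f.
Proof. by case/misomP=> g [_ fg] y; exists (g y); rewrite -mcompE fg midE. Qed.

Lemma submodule M (U : {vspace M}) : (forall x a, x \in U -> mact M x a \in U) ->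
  exists (K : rmod A) (i : mhom K M), injective i /\ forall x, x \in U <-> exists y, i y = x.
Proof.
move=> st; pose act (x : subvs_of U) a := Subvs (st (vsval x) a (subvsP x)).
have l1 a : linear (act^~ a).
  by move=> c x y; apply: val_inj; rewrite /= mactDl mactZl.
have l2 x : linear (act x).
  by move=> c a b; apply: val_inj; rewrite /= mactDr mactZr.
have a1 x : act x (aone A) = x by apply: val_inj; rewrite /= mact1.
have am x a b : act x (a ** b) = act (act x a) b by apply: val_inj; rewrite /= mactM.
pose K := RMod l1 l2 a1 am.
have li : linear (fun x : K => vsval (x : subvs_of U) : M) by move=> c x y; rewrite linearP.
exists K, (@mk_mhom k A K M _ li (fun _ _ => erefl)).
split=> [x y|x]; first by rewrite !mk_mhomE => /val_inj.
split=> [xU|[y <-]]; last by rewrite mk_mhomE subvsP.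
by exists (Subvs xU : K); rewrite mk_mhomE.
Qed.

Lemma kernel_exists M N (f : mhom M N) : exists K (i : mhom K M), is_kernel i f.
Proof.
have [|K [i [ii iE]]] := @submodule M (lker f).
  by move=> x a; rewrite !memv_ker mhomP => /eqP->; rewrite mact0l.
exists K, i; split=> // x; rewrite -iE memv_ker.
by split=> /eqP.
Qed.

Lemma image_exists M N (f : mhom M N) :
  exists I (q : mhom M I) (m : mhom I N), [/\ surj q, injective m & mcomp m q = f].
Proof.
have [|I [m [mi mE]]] := @submodule N (limg f).
  by move=> x a /memv_imgP[y _ ->]; rewrite -mhomP memv_img ?memvf.
have [|q qE] := @factor_inj I N M m f mi.
  by move=> x; apply/mE; rewrite memv_img ?memvf.
exists I, q, m; split=> // y; have /mE/memv_imgP[x _ e] : exists z, m z = m y by exists y.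
by exists x; apply: mi; rewrite e -mcompE qE.
Qed.

(** The quotient is realised on a complement [W] of the image: [r] projects onto [W] along the
    image, and [A] acts by acting in [N] and projecting back. *)
Lemma cokernel_exists M N (f : mhom M N) : exists C (q : mhom N C), is_cokernel q f.
Proof.
pose U := limg f; pose W := (U^C)%VS.
have d1 : (W :&: U = 0)%VS by rewrite capvC capv_compl.
pose r := daddv_pi W U; pose pi (x : N) : subvs_of W := vsproj W (r x).
have rW x : r x \in W by apply: memv_pi.
have rU x : x - r x \in U.
  have /(_ x) := daddv_pi_add d1; rewrite addvC addv_complf memvf => /(_ isT) e.
  by rewrite -{1}e -/r addrC addKr memv_pi.
have r0 x : x \in U -> r x = 0.
  move=> xU; have : r x \in (W :&: U)%VS.
    by rewrite memv_cap rW -[r x](subKr x) memvB.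
  by rewrite d1 memv0 => /eqP.
have actU x a : x \in U -> mact N x a \in U.
  by case/memv_imgP=> y _ ->; rewrite -mhomP memv_img ?memvf.
have rE x y : x - y \in U -> r x = r y.
  by move=> h; apply/subr0_eq; rewrite -lfB r0.
have ract x a : r (mact N (r x) a) = r (mact N x a).
  by apply: rE; rewrite -mactBl actU // -opprB memvN.
have pil : linear pi by move=> c x y; rewrite /pi !linearP.
have piK x : vsval (pi x) = r x by rewrite vsprojK.
have piV (w : subvs_of W) : pi (vsval w) = w.
  apply: subvs_inj; rewrite piK; apply/subr0_eq; rewrite -opprB.
  have : vsval w - r (vsval w) \in (W :&: U)%VS.
    by rewrite memv_cap rU memvB ?subvsP.
  by rewrite d1 memv0 => /eqP->; rewrite oppr0.
pose act (w : subvs_of W) a := pi (mact N (vsval w) a).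
have l1 a : linear (act^~ a).
  by move=> c x y; rewrite /act linearP mactDl mactZl pil.
have l2 x : linear (act x).
  by move=> c a b; rewrite /act mactDr mactZr pil.
have a1 x : act x (aone A) = x by rewrite /act mact1 piV.
have am x a b : act x (a ** b) = act (act x a) b.
  by apply: subvs_inj; rewrite /act !piK mactM ract.
pose C := RMod l1 l2 a1 am.
have pa x a : pi (mact N x a) = mact C (pi x) a.
  by apply: subvs_inj; rewrite /= /act !piK ract.
exists C, (@mk_mhom k A N C pi pil pa); split=> [w|y].
  by exists (vsval w); rewrite mk_mhomE; apply: piV.
rewrite mk_mhomE; split=> [py|[x <-]].
  have ry : r y = 0 by rewrite -piK py linear0.
  have : y \in U by rewrite -[y]subr0 -ry.
  by case/memv_imgP=> x _ ->; exists x.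
by apply: subvs_inj; rewrite piK r0 ?linear0 // memv_img ?memvf.
Qed.

End Modules.

(** * Direct sums, powers, projective and injective modules *)

Section SumsAndFree.
Local Open Scope ring_scope.
Variables (k : fieldType) (A : fdAlgType k).
Implicit Types M N L K Q J P X Y Z : rmod A.

Definition mzero M := forall x : M, x = 0.
Lemma mzero_hom_to M N (f : mhom M N) : mzero N -> f = 0.
Proof. by move=> h; apply: mhom_inj => x; rewrite (h (f x)) mhom0E. Qed.
Lemma mzero_hom_from M N (f : mhom M N) : mzero M -> f = 0.
Proof. by move=> h; apply: mhom_inj => x; rewrite (h x) lf0 mhom0E. Qed.
Lemma mzero_zero_mod : mzero (zero_mod A). Proof. by move=> x; apply: thinmx0. Qed.
Lemma mzeroP M : zero_obj (modcat A) M <-> mzero M.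
Proof.
split=> [h x|h]; last exact: mzero_hom_to.
by rewrite -[LHS]midE -[mid M]/(idm (modcat A) M) h mhom0E.
Qed.

Fact dinl_linear M N : linear (fun x : M => (x, 0) : dsum_mod M N).
Proof. by move=> c x y; congr pair; rewrite /= scaler0 addr0. Qed.
Fact dinl_act M N (x : M) a : ((mact M x a, 0) : dsum_mod M N) = mact (dsum_mod M N) (x, 0) a.
Proof. by congr pair; rewrite /= mact0l. Qed.
Definition dinl M N : mhom M (dsum_mod M N) := mk_mhom (@dinl_linear M N) (@dinl_act M N).
Fact dinr_linear M N : linear (fun x : N => (0, x) : dsum_mod M N).
Proof. by move=> c x y; congr pair; rewrite /= scaler0 addr0. Qed.
Fact dinr_act M N (x : N) a : ((0, mact N x a) : dsum_mod M N) = mact (dsum_mod M N) (0, x) a.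
Proof. by congr pair; rewrite /= mact0l. Qed.
Definition dinr M N : mhom N (dsum_mod M N) := mk_mhom (@dinr_linear M N) (@dinr_act M N).
Definition dfst M N : mhom (dsum_mod M N) M :=
  @mk_mhom _ _ (dsum_mod M N) M (fun x => x.1) (fun _ _ _ => erefl) (fun _ _ => erefl).
Definition dsnd M N : mhom (dsum_mod M N) N :=
  @mk_mhom _ _ (dsum_mod M N) N (fun x => x.2) (fun _ _ _ => erefl) (fun _ _ => erefl).
Lemma dinlE M N x : dinl M N x = (x, 0). Proof. exact: mk_mhomE. Qed.
Lemma dinrE M N x : dinr M N x = (0, x). Proof. exact: mk_mhomE. Qed.
Lemma dfstE M N x : dfst M N x = x.1. Proof. exact: mk_mhomE. Qed.
Lemma dsndE M N x : dsnd M N x = x.2. Proof. exact: mk_mhomE. Qed.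
Lemma row_mhomE M N L (f : mhom M L) (g : mhom N L) x : row_mhom f g x = f x.1 + g x.2.
Proof. exact: mk_mhomE. Qed.
Definition col_mhom M N L (f : mhom L M) (g : mhom L N) : mhom L (dsum_mod M N) :=
  mcomp (dinl M N) f + mcomp (dinr M N) g.
Lemma col_mhomE M N L (f : mhom L M) (g : mhom L N) x : col_mhom f g x = (f x, g x).
Proof. by rewrite mhomDE !mcompE dinlE dinrE; congr pair; rewrite /= ?addr0 ?add0r. Qed.

(** The surjection to which projectivity is applied is the one from [M] onto the image of [g]. *)
Lemma proj_lift P M N (g : mhom M N) (f : mhom P N) : projective P ->
  (forall x, exists y, g y = f x) -> exists h : mhom P M, mcomp g h = f.
Proof.
move=> pP hf; have [I [q [m [qs mi mq]]]] := image_exists g.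
have [x|f' f'E] := factor_inj (f := f) mi.
  by have [y <-] := hf x; exists (q y); rewrite -mcompE mq.
by have [h hE] := pP _ _ _ f' qs; exists h; rewrite -mq -mcompA hE.
Qed.

Lemma inj_extend J M N (i : mhom M N) (f : mhom M J) : injective_mod J ->
  (forall x, i x = 0 -> f x = 0) -> exists h : mhom N J, mcomp h i = f.
Proof.
move=> jJ hf; have [I [q [m [qs mi mq]]]] := image_exists i.
have [x qx|f' f'E] := factor_surj (f := f) qs.
  by apply: hf; rewrite -mq mcompE qx lf0.
by have [h hE] := jJ _ _ _ f' mi; exists h; rewrite -mq mcompA hE.
Qed.

Lemma proj_retract P Q (i : mhom Q P) (p : mhom P Q) :
  projective P -> mcomp p i = mid Q -> projective Q.
Proof.
move=> pP pi M N g f gs; have [h hE] := pP _ _ g (mcomp f p) gs.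
by exists (mcomp h i); rewrite mcompA hE -mcompA pi mcompm1.
Qed.
Lemma proj_dsum P Q : projective P -> projective Q -> projective (dsum_mod P Q).
Proof.
move=> pP pQ M N g f gs.
have [h1 h1E] := pP _ _ g (mcomp f (dinl P Q)) gs.
have [h2 h2E] := pQ _ _ g (mcomp f (dinr P Q)) gs.
exists (row_mhom h1 h2); apply: mhom_inj => -[x y].
rewrite mcompE row_mhomE lfD -!mcompE h1E h2E !mcompE dinlE dinrE -lfD.
by congr (f _); congr pair; rewrite /= ?addr0 ?add0r.
Qed.
Lemma inj_dsum P Q : injective_mod P -> injective_mod Q -> injective_mod (dsum_mod P Q).
Proof.
move=> pP pQ M N g f gi.
have [h1 h1E] := pP _ _ g (mcomp (dfst P Q) f) gi.
have [h2 h2E] := pQ _ _ g (mcomp (dsnd P Q) f) gi.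
exists (col_mhom h1 h2); apply: mhom_inj => x.
by rewrite mcompE col_mhomE -!mcompE h1E h2E !mcompE dfstE dsndE; case: (f x).
Qed.
Lemma proj_mzero P : mzero P -> projective P.
Proof. by move=> h M N g f _; exists 0; rewrite mcomp0 (mzero_hom_from f h). Qed.
Section Power.
Variables (M : rmod A) (m : nat).
Let act (x : {ffun 'I_m -> M}) a : {ffun 'I_m -> M} := [ffun i => mact M (x i) a].
Fact mpow_l1 a : linear (act^~ a).
Proof. by move=> c x y; apply/ffunP => i; rewrite !ffunE mactDl mactZl. Qed.
Fact mpow_l2 x : linear (act x).
Proof. by move=> c a b; apply/ffunP => i; rewrite !ffunE mactDr mactZr. Qed.
Fact mpow_a1 x : act x (aone A) = x.
Proof. by apply/ffunP => i; rewrite !ffunE mact1. Qed.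
Fact mpow_am x a b : act x (a ** b) = act (act x a) b.
Proof. by apply/ffunP => i; rewrite !ffunE mactM. Qed.
Definition mpow : rmod A := RMod mpow_l1 mpow_l2 mpow_a1 mpow_am.
Arguments mpow : simpl never.
Fact ppr_lin i : linear (fun x : mpow => (x : {ffun 'I_m -> M}) i).
Proof. by move=> c x y; rewrite !ffunE. Qed.
Fact ppr_act i (x : mpow) a : (mact mpow x a : {ffun 'I_m -> M}) i = mact M ((x : {ffun 'I_m -> M}) i) a.
Proof. by rewrite ffunE. Qed.
Definition ppr i : mhom mpow M := mk_mhom (ppr_lin i) (ppr_act i).
Lemma pprE i (x : mpow) : ppr i x = (x : {ffun 'I_m -> M}) i. Proof. exact: mk_mhomE. Qed.
Definition ptuple (F : 'I_m -> M) : mpow := [ffun i => F i].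
Lemma ppr_ptuple F i : ppr i (ptuple F) = F i. Proof. by rewrite pprE ffunE. Qed.
Lemma mpowP (x y : mpow) : (forall i, ppr i x = ppr i y) -> x = y.
Proof. by move=> h; apply/ffunP => i; rewrite -!pprE h. Qed.
Lemma mpow_map_exists L (F : 'I_m -> mhom L M) : exists f : mhom L mpow, forall i, mcomp (ppr i) f = F i.
Proof.
have l : linear (fun x : L => ptuple (fun i => F i x)).
  by move=> c x y; apply: mpowP => i; rewrite lfD lfZ !ppr_ptuple lfD lfZ.
have a x b : ptuple (fun i => F i (mact L x b)) = mact mpow (ptuple (fun i => F i x)) b.
  by apply: mpowP => i; rewrite mhomP !ppr_ptuple mhomP.
by exists (mk_mhom l a) => i; apply: mhom_inj => x; rewrite mcompE mk_mhomE ppr_ptuple.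
Qed.
Definition prow L (F : 'I_m -> mhom M L) : mhom mpow L := \sum_i mcomp (F i) (ppr i).
Lemma prowE L (F : 'I_m -> mhom M L) x : prow F x = \sum_i F i (ppr i x).
Proof. by rewrite mhom_sumE; apply: eq_bigr => i _; rewrite mcompE. Qed.
Definition pin i : mhom M mpow := sval (cid (mpow_map_exists (fun j => if j == i then mid M else 0))).
Lemma ppr_pin i j : mcomp (ppr j) (pin i) = if j == i then mid M else 0.
Proof. by rewrite /pin; case: cid. Qed.
End Power.
End SumsAndFree.
#[global] Arguments mpow : simpl never.

(** * Functorial free covers and coinduced injective modules *)

Section FreeModules.
Local Open Scope ring_scope.
Variables (k : fieldType) (A : fdAlgType k).
Implicit Types M N L K Q J P X Y Z : rmod A.

Definition hmap Z (z : Z) : mhom (regular A) Z :=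
  @mk_mhom _ _ (regular A) Z (fun a => mact Z z a) (@mact_linr _ _ Z z) (fun a b => mactM z a b).
Lemma hmapE Z (z : Z) a : hmap z a = mact Z z a. Proof. exact: (@mk_mhomE _ _ (regular A) Z). Qed.
Lemma hmap_app Z (f : mhom (regular A) Z) : f = hmap (f (aone A)).
Proof. by apply: mhom_inj => a; rewrite hmapE -mhomP /= amul1l. Qed.
Lemma comp_hmap Y Z (f : mhom Y Z) y : mcomp f (hmap y) = hmap (f y).
Proof. by apply: mhom_inj => a; rewrite mcompE !hmapE mhomP. Qed.

Lemma proj_regular : projective (regular A).
Proof.
move=> M N p f ps; have [x xE] := ps (f (aone A)).
by exists (hmap x); rewrite comp_hmap xE -hmap_app.
Qed.

Lemma proj_mpow P m : projective P -> projective (mpow P m).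
Proof.
move=> pP M N p f ps.
have /choice[g gE] : forall i, exists g : mhom P M, mcomp p g = mcomp f (pin P i).
  by move=> i; apply: pP.
exists (prow (M := P) (m := m) g).
have -> : f = \sum_i mcomp (mcomp f (pin P i)) (ppr P i).
  apply: mhom_inj => x; rewrite mhom_sumE; under eq_bigr do rewrite !mcompE.
  rewrite -lf_sum; congr (f _); apply: mpowP => j; rewrite lf_sum (bigD1 j) //=.
  rewrite -!mcompE ppr_pin eqxx mcomp1m big1 ?addr0 // => i /negbTE ij.
  by rewrite -!mcompE ppr_pin eq_sym ij mcomp0l mhom0E.
by apply: mhom_inj => x; rewrite mcompE prowE lf_sum mhom_sumE; apply: eq_bigr => i _; rewrite -gE !mcompE.
Qed.

(** The rank is the dimension over the field rather than a minimal number of generators. With bases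
    fixed, [free_map] is the matrix of a morphism, so the cover is functorial and applies degreewise
    to complexes. *)
Definition free M := mpow (regular A) (\dim {:M}).
Arguments free : simpl never.
Lemma proj_free M : projective (free M). Proof. exact/proj_mpow/proj_regular. Qed.
Definition free_ev M : mhom (free M) M := prow (M := regular A) (fun i : 'I_(\dim {:M}) => hmap (vbasis {:M})`_i).
Lemma free_evE M x : free_ev M x = \sum_(i < \dim {:M}) mact M (vbasis {:M})`_i (ppr (regular A) i x).
Proof. by rewrite prowE; apply: eq_bigr => i _; rewrite hmapE. Qed.
Lemma vbasisE M (x : M) : x = \sum_(i < _) coord (vbasis {:M}) i x *: (vbasis {:M})`_i.
Proof. by apply: coord_vbasis; rewrite memvf. Qed.
Lemma free_ev_surj M : surj (free_ev M).
Proof.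
move=> y; exists (ptuple (M := regular A) (fun i => coord (vbasis {:M}) i y *: aone A)).
rewrite free_evE {2}[y]vbasisE; apply: eq_bigr => i _.
by rewrite ppr_ptuple mactZr mact1.
Qed.

Fact free_map_exists M N (f : mhom M N) : exists g : mhom (free M) (free N),
  forall j, mcomp (ppr _ j) g = \sum_(i < _) coord (vbasis {:N}) j (f (vbasis {:M})`_i) *: ppr _ i.
Proof. exact: mpow_map_exists. Qed.
Definition free_map M N (f : mhom M N) := sval (cid (free_map_exists f)).
Lemma free_mapE M N (f : mhom M N) j : mcomp (ppr _ j) (free_map f) =
  \sum_(i < _) coord (vbasis {:N}) j (f (vbasis {:M})`_i) *: ppr _ i.
Proof. by rewrite /free_map; case: cid. Qed.
Lemma mpow_inj L M m (f g : mhom L (mpow M m)) :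
  (forall j, mcomp (ppr M j) f = mcomp (ppr M j) g) -> f = g.
Proof. by move=> h; apply: mhom_inj => x; apply: mpowP => j; rewrite -!mcompE h. Qed.
Lemma free_map_comp M N L (g : mhom N L) (f : mhom M N) :
  free_map (mcomp g f) = mcomp (free_map g) (free_map f).
Proof.
apply: mpow_inj => l; rewrite mcompA !free_mapE mcomp_suml.
under [RHS]eq_bigr => j _.
  rewrite mcompZl free_mapE scaler_sumr; under eq_bigr do rewrite scalerA; over.
rewrite exchange_big /=; apply: eq_bigr => i _.
rewrite -scaler_suml; congr (_ *: _).
rewrite mcompE {1}[f _]vbasisE lf_sum linear_sum /=; apply: eq_bigr => j _.
by rewrite lfZ linearZ /= mulrC.
Qed.
Lemma free_map0 M N : free_map (0 : mhom M N) = 0.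
Proof.
by apply: mpow_inj => l; rewrite free_mapE mcomp0 big1 // => i _; rewrite mhom0E linear0 scale0r.
Qed.
Lemma free_ev_nat M N (f : mhom M N) : mcomp f (free_ev M) = mcomp (free_ev N) (free_map f).
Proof.
apply: mhom_inj => x; rewrite !mcompE !free_evE lf_sum.
under [RHS]eq_bigr => j _.
  rewrite -mcompE free_mapE mhom_sumE mact_sumr.
  under eq_bigr do rewrite mhomZE mactZr -mactZl; over.
rewrite exchange_big /=; apply: eq_bigr => i _.
by rewrite -mact_suml mhomP {1}[f _]vbasisE.
Qed.
Lemma free_mzero M : mzero M -> mzero (free M).
Proof.
move=> h; have d0 : \dim {:M} = 0%N.
  by apply/eqP; rewrite dimv_eq0 -subv0; apply/subvP => x _; rewrite (h x) mem0v.
by move=> x; apply: mpowP => i; have := ltn_ord i; rewrite {2}d0.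
Qed.

Section Coinduced.
Variable M : rmod A.
Let act (phi : 'Hom(A, M)) (a : A) : 'Hom(A, M) := (phi \o amul_l a)%VF.
Fact coind_l1 a : linear (act^~ a).
Proof. by move=> c x y; rewrite /act comp_lfunDl comp_lfunZl. Qed.
Fact coind_l2 x : linear (act x).
Proof.
move=> c a b; apply/lfunP => y.
rewrite /act add_lfunE scale_lfunE !comp_lfunE !amul_lE.
by rewrite (amul_linl y c a b) linearP.
Qed.
Fact coind_1 x : act x (aone A) = x.
Proof. by apply/lfunP => y; rewrite comp_lfunE amul_lE amul1l. Qed.
Fact coind_M x a b : act x (a ** b) = act (act x a) b.
Proof. by apply/lfunP => y; rewrite !comp_lfunE !amul_lE amulA. Qed.
Definition coind : rmod A := @RMod k A 'Hom(A, M) act coind_l1 coind_l2 coind_1 coind_M.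
Arguments coind : simpl never.
Lemma coind_actE (phi : coind) a b : (mact coind phi a : 'Hom(A, M)) b = (phi : 'Hom(A, M)) (a ** b).
Proof. by rewrite comp_lfunE amul_lE. Qed.
End Coinduced.

Section CoindHom.
Variables (N M : rmod A) (f : 'Hom(N, M)).
Let g (x : N) : coind M := (f \o linfun (lactr x))%VF.
Let gE x a : (g x : 'Hom(A, M)) a = f (mact N x a).
Proof. by rewrite /g comp_lfunE (lfunE (lactr x)). Qed.
Fact coind_hom_lin : linear g.
Proof.
move=> c x y; apply/lfunP => a.
by rewrite add_lfunE scale_lfunE !gE mactDl mactZl lfD lfZ.
Qed.
Fact coind_hom_act x a : g (mact N x a) = mact (coind M) (g x) a.
Proof. by apply/lfunP => b; rewrite coind_actE !gE mactM. Qed.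
Definition coind_hom : mhom N (coind M) := mk_mhom coind_hom_lin coind_hom_act.
Lemma coind_homE x a : (coind_hom x : 'Hom(A, M)) a = f (mact N x a).
Proof. by rewrite mk_mhomE gE. Qed.
End CoindHom.

Lemma coind_hom_app N M (f : mhom N (coind M)) x a :
  (f x : 'Hom(A, M)) a = (f (mact N x a) : 'Hom(A, M)) (aone A).
Proof. by rewrite mhomP coind_actE amul1r. Qed.

(** Morphisms to [coind M] are linear maps to [M], by evaluation at 1, and a linear map extends
    along [i] through a linear left inverse. *)
Lemma inj_coind M : injective_mod (coind M).
Proof.
move=> L N i f ii.
have l1 : linear (fun x : L => (f x : 'Hom(A, M)) (aone A)).
  by move=> c x y; rewrite lfD lfZ add_lfunE scale_lfunE.
pose f1 := linfun (HB.pack_for {linear L -> M} (fun x : L => (f x : 'Hom(A, M)) (aone A)) (GRing.isLinear.Build k L M *:%R _ l1)).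
exists (coind_hom (f1 \o (i : 'Hom(_,_))^-1)%VF); apply: mhom_inj => x; apply/lfunP => a.
rewrite mcompE coind_homE comp_lfunE -mhomP.
have -> : ((i : 'Hom(L, N))^-1)%VF (i (mact L x a)) = mact L x a.
  by apply: lker0_lfunK; apply/lker0P.
by rewrite lfunE /= -coind_hom_app.
Qed.

Definition coind_unit M : mhom M (coind M) := coind_hom (\1%VF : 'Hom(M, M)).
Lemma coind_unitE M x a : (coind_unit M x : 'Hom(A, M)) a = mact M x a.
Proof. by rewrite coind_homE lfunE. Qed.
Lemma coind_unit_inj M : injective (coind_unit M).
Proof. by move=> x y e; rewrite -[x]mact1 -[y]mact1 -!coind_unitE e. Qed.
Fact coind_map_lin M N (f : mhom M N) : linear (fun phi : coind M => ((f : 'Hom(M, N)) \o phi)%VF : coind N).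
Proof. by move=> c x y; rewrite /= comp_lfunDr comp_lfunZr. Qed.
Fact coind_map_act M N (f : mhom M N) (phi : coind M) a :
  ((f : 'Hom(M, N)) \o (mact (coind M) phi a : 'Hom(A, M)))%VF = mact (coind N) ((f : 'Hom(M, N)) \o (phi : 'Hom(A, M)))%VF a.
Proof. by rewrite /= comp_lfunA. Qed.
Definition coind_map M N (f : mhom M N) : mhom (coind M) (coind N) :=
  @mk_mhom _ _ (coind M) (coind N) _ (coind_map_lin f) (coind_map_act f).
Lemma coind_mapE M N (f : mhom M N) (phi : coind M) a :
  (coind_map f phi : 'Hom(A, N)) a = f ((phi : 'Hom(A, M)) a).
Proof.
by rewrite (@mk_mhomE _ _ (coind M) (coind N) _ (coind_map_lin f)) comp_lfunE.
Qed.
Lemma coindP M (x y : coind M) :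
  (forall a : A, (x : 'Hom(A, M)) a = (y : 'Hom(A, M)) a) -> x = y.
Proof. by move=> h; apply/lfunP. Qed.
Lemma coind_map_comp M N L (g : mhom N L) (f : mhom M N) :
  coind_map (mcomp g f) = mcomp (coind_map g) (coind_map f).
Proof.
by apply: mhom_inj => x; apply: coindP => a; rewrite mcompE !coind_mapE mcompE.
Qed.
Lemma coind_map0 M N : coind_map (0 : mhom M N) = 0.
Proof.
by apply: mhom_inj => x; apply: coindP => a; rewrite mhom0E coind_mapE mhom0E lfunE.
Qed.
Lemma coind_unit_nat M N (f : mhom M N) : mcomp (coind_unit N) f = mcomp (coind_map f) (coind_unit M).
Proof.
by apply: mhom_inj => x; apply: coindP => a; rewrite !mcompE coind_mapE !coind_unitE mhomP.
Qed.
Lemma coind_mzero M : mzero M -> mzero (coind M).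
Proof. by move=> h x; apply/lfunP => a; rewrite (h (_ a)) lfunE. Qed.

Hypothesis hA : hereditary A.

(* Pull the surjection N <- F back along i: the preimage of M in the free module F is
   projective, so a map M -> J' lifts there to J and extends to F by injectivity of J. *)
Lemma hereditary_inj_quot J J' (q : mhom J J') : injective_mod J -> surj q -> injective_mod J'.
Proof.
move=> jJ qs M N i f ii.
have [K [r rK]] := kernel_exists (row_mhom i (- free_ev N)).
have [C [j jE]] := kernel_exists (mcomp (dfst M (free N)) r).
pose r2 := mcomp (dsnd M (free N)) r.
have [ri rE] := rK.
have eqr x : i (r x).1 = free_ev N (r x).2.
  have /rE : exists y, r y = r x by exists x.
  by rewrite row_mhomE mhomNE => /subr0_eq.
have r2i : injective r2.
  apply/mhom_inj0 => x; rewrite mcompE dsndE => e2; apply: ri; rewrite lf0.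
  case: (r x) (eqr x) e2 => a b /= e2 e3; congr pair => //.
  by apply: ii; rewrite e2 e3 !lf0.
have pK : projective K by apply: hA r2i; apply: proj_free.
have [g gE] := pK _ _ q (mcomp f (mcomp (dfst M (free N)) r)) qs.
have [h hE] := jJ _ _ r2 g r2i.
have [y hy|h' h'E] := @factor_surj _ _ _ _ _ (free_ev N) (mcomp q h) (@free_ev_surj N).
  have /rE[z zE] : row_mhom i (- free_ev N) (0, y) = 0.
    by rewrite row_mhomE mhomNE /= lf0 hy oppr0 addr0.
  have -> : y = r2 z by rewrite mcompE dsndE zE.
  by rewrite mcompE -[h _]mcompE hE -mcompE gE !mcompE dfstE zE /= lf0.
exists h'; apply: mhom_inj => x; rewrite mcompE.
have [y yE] := @free_ev_surj N (i x).
have /rE[z zE] : row_mhom i (- free_ev N) (x, y) = 0.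
  by rewrite row_mhomE mhomNE /= yE subrr.
rewrite -yE -mcompE h'E mcompE.
have -> : y = r2 z by rewrite mcompE dsndE zE.
by rewrite -[h _]mcompE hE -mcompE gE !mcompE dfstE zE.
Qed.
End FreeModules.
#[global] Arguments free : simpl never.
#[global] Arguments coind : simpl never.

(** * Dimension arguments, idempotents and Fitting's lemma *)

Section Decomposition.
Local Open Scope ring_scope.
Variables (k : fieldType) (A : fdAlgType k).
Implicit Types M N L K Q J P X Y Z : rmod A.

Lemma surj_cancel M N L (p : mhom M N) (f g : mhom N L) :
  surj p -> mcomp f p = mcomp g p -> f = g.
Proof. by move=> ps e; apply: mhom_inj => y; have [x <-] := ps y; rewrite -!mcompE e. Qed.
Lemma inj_cancel M N L (i : mhom N L) (f g : mhom M N) :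
  injective i -> mcomp i f = mcomp i g -> f = g.
Proof. by move=> ii e; apply: mhom_inj => x; apply: ii; rewrite -!mcompE e. Qed.

Lemma dim_exact (U V W : vectType k) (f : 'Hom(U, V)) (g : 'Hom(V, W)) :
  injective f -> (forall v, g v = 0 <-> exists u, f u = v) ->
  (forall w, exists v, g v = w) -> \dim {:V} = (\dim {:U} + \dim {:W})%N.
Proof.
move=> fi ex gs; rewrite -(limg_ker_dim g fullv) capfv; congr (_ + _)%N.
  have -> : lker g = limg f.
    apply/vspaceP => v; rewrite memv_ker; apply/eqP/memv_imgP => [/ex[u <-]|[u _ ->]].
      by exists u; rewrite ?memvf.
    by apply/ex; exists u.
  by apply: limg_dim_eq; have /lker0P/eqP-> := fi; rewrite capv0.
by congr (\dim _); apply/vspaceP => w; rewrite memvf; have [v <-] := gs w; rewrite memv_img ?memvf.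
Qed.
Lemma dim_leq_inj (U V : vectType k) (f : 'Hom(U, V)) : injective f -> (\dim {:U} <= \dim {:V})%N.
Proof.
move=> /lker0P/eqP e; have <- : \dim (limg f) = \dim {:U} by apply: limg_dim_eq; rewrite e capv0.
by apply/dimvS/subvf.
Qed.
Lemma dim_inj_surj (U V : vectType k) (f : 'Hom(U, V)) :
  injective f -> (\dim {:V} <= \dim {:U})%N -> forall y, exists x, f x = y.
Proof.
move=> /lker0P/eqP e le y; have d : \dim (limg f) = \dim {:U} by apply: limg_dim_eq; rewrite e capv0.
have /eqP h : (limg f == fullv)%VS by rewrite eqEdim subvf d.
by have : y \in limg f; [rewrite h memvf | case/memv_imgP=> x _ ->; exists x].
Qed.
Lemma dim_leq_surj (U V : vectType k) (f : 'Hom(U, V)) :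
  (forall y, exists x, f x = y) -> (\dim {:V} <= \dim {:U})%N.
Proof.
move=> fs; have <- : limg f = fullv.
  by apply/vspaceP => y; have [x <-] := fs y; rewrite memvf memv_img ?memvf.
by rewrite -(limg_ker_dim f fullv) leq_addl.
Qed.
Lemma dim_surj_inj (U V : vectType k) (f : 'Hom(U, V)) :
  (forall y, exists x, f x = y) -> (\dim {:U} <= \dim {:V})%N -> injective f.
Proof.
move=> fs le; apply/lker0P; have e : limg f = fullv.
  by apply/vspaceP => y; have [x <-] := fs y; rewrite memvf memv_img ?memvf.
have := limg_ker_dim f fullv; rewrite capfv e => h.
by rewrite -dimv_eq0; lia.
Qed.
Lemma endo_inj_isom M (f : mhom M M) : injective f -> isom (C := modcat A) f.
Proof. by move=> fi; apply: mhom_isom (fi) (dim_inj_surj fi _). Qed.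

Definition mdsum X Y Z (i1 : mhom Y X) (i2 : mhom Z X) (p1 : mhom X Y) (p2 : mhom X Z) :=
  [/\ mcomp p1 i1 = mid Y, mcomp p2 i2 = mid Z, mcomp p1 i2 = 0, mcomp p2 i1 = 0
    & mcomp i1 p1 + mcomp i2 p2 = mid X].
Lemma is_dsumP X Y Z : is_dsum (modcat A) X Y Z <->
  exists (i1 : mhom Y X) (i2 : mhom Z X) (p1 : mhom X Y) (p2 : mhom X Z), mdsum i1 i2 p1 p2.
Proof. by []. Qed.

Lemma idem_image M (e : mhom M M) : mcomp e e = e ->
  exists Y (i : mhom Y M) (p : mhom M Y), mcomp p i = mid Y /\ mcomp i p = e.
Proof.
move=> ee; have [Y [p [i [ps ii ip]]]] := image_exists e; exists Y, i, p; split=> //.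
apply: (surj_cancel ps); apply: (inj_cancel ii).
by rewrite mcomp1m ip -mcompA mcompA ip.
Qed.
Lemma idem_compl M (e : mhom M M) : mcomp e e = e -> mcomp (mid M - e) (mid M - e) = mid M - e.
Proof. by move=> ee; rewrite mcompBl !mcompBr ee !mcompm1 !mcomp1m subrr subr0. Qed.

Lemma retract_mdsum M Y (i : mhom Y M) (p : mhom M Y) : mcomp p i = mid Y ->
  exists Z (i2 : mhom Z M) (p2 : mhom M Z), mdsum i i2 p p2.
Proof.
move=> pi; have ee : mcomp (mcomp i p) (mcomp i p) = mcomp i p.
  by rewrite mcompA -(mcompA i) pi mcompm1.
have [Z [i2 [p2 [pi2 ip2]]]] := idem_image (idem_compl ee).
exists Z, i2, p2; split=> //; last by rewrite ip2 addrC subrK.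
  rewrite -[i2]mcompm1 -pi2 (mcompA i2) ip2 mcompA mcompBr mcompm1 (mcompA p) pi mcomp1m subrr.
  by rewrite mcomp0l.
rewrite -[p2]mcomp1m -pi2 -(mcompA p2) ip2 -mcompA mcompBl mcomp1m -(mcompA i) pi mcompm1 subrr.
by rewrite mcomp0.
Qed.
Lemma retract_summand M Y (i : mhom Y M) (p : mhom M Y) : mcomp p i = mid Y ->
  is_summand (modcat A) Y M.
Proof. by move=> /retract_mdsum[Z [i2 [p2 h]]]; exists Z, i, i2, p, p2. Qed.

Lemma indec_idem M (e : mhom M M) : indecomposable (modcat A) M -> mcomp e e = e -> e = 0 \/ e = mid M.
Proof.
case=> _ h ee; have [Y [i [p [pi ip]]]] := idem_image ee.
have [Z [i2 [p2 D]]] := retract_mdsum pi.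
have [|/mzeroP z|/mzeroP z] := h Y Z; first by exists i, i2, p, p2.
  by left; rewrite -ip (mzero_hom_to p z) mcomp0.
by right; case: D => _ _ _ _; rewrite ip (mzero_hom_to p2 z) mcomp0 addr0.
Qed.

Definition mexp M (f : mhom M M) n : mhom M M := iter n (mcomp f) (mid M).
Lemma mexpD M (f : mhom M M) m n : mexp f (m + n) = mcomp (mexp f m) (mexp f n).
Proof. by elim: m => [|m ih]; rewrite ?mcomp1m // addSn /mexp /= -!/(mexp _ _) ih mcompA. Qed.
Lemma mexpSr M (f : mhom M M) n : mexp f n.+1 = mcomp (mexp f n) f.
Proof. by rewrite -addn1 mexpD /mexp /= mcompm1. Qed.

(** The kernels of the powers of [f] have bounded dimension. At a largest one, [g = f^(N+1)]
    satisfies ker g^2 = ker g, so [q m] is an automorphism of the image of [g] and [m (q m)^-1 q] is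
    an idempotent of the indecomposable module [M], hence 0 or 1. *)
Lemma fitting M (f : mhom M M) : indecomposable (modcat A) M ->
  isom (C := modcat A) f \/ exists n, mexp f n = 0.
Proof.
move=> iM; pose d n := \dim (lker (mexp f n)).
have : exists N : nat, forall n, (d n.+1 <= d N.+1)%N.
  have exd : exists v, `[< exists n, d n.+1 = v >] by exists (d 1%N); apply/asboolP; exists 0%N.
  have ub v : `[< exists n, d n.+1 = v >] -> (v <= \dim {:M})%N.
    by move=> /asboolP[n <-]; apply/dimvS/subvf.
  have [v /asboolP[N <-] h] := ex_maxnP exd ub; exists N => n.
  by apply: h; apply/asboolP; exists n.
case=> N hN; set g := mexp f N.+1.
have gg x : g (g x) = 0 -> g x = 0.
  have sub : (lker (mexp f N.+1) <= lker (mexp f (N.+1 + N.+1)))%VS.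
    by apply/subvP => y; rewrite !memv_ker mexpD mcompE => /eqP->; rewrite lf0.
  have /eqP e : lker (mexp f N.+1) == lker (mexp f (N.+1 + N.+1)) by rewrite eqEdim sub hN.
  move=> h; apply/eqP; rewrite -memv_ker e memv_ker mexpD mcompE.
  by apply/eqP.
have [I [q [m [qs mi mq]]]] := image_exists g.
have vi : isom (C := modcat A) (mcomp q m).
  apply: endo_inj_isom; apply/mhom_inj0 => y; have [x <-] := qs y.
  rewrite mcompE -[m (q x)]mcompE mq => h; apply: mi; rewrite lf0 -mcompE mq; apply: gg.
  by rewrite -{1}mq mcompE h lf0.
have [v [vqm qmv]] := (misomP _).1 vi.
have ee : mcomp (mcomp m (mcomp v q)) (mcomp m (mcomp v q)) = mcomp m (mcomp v q).
  by rewrite -mcompA -(mcompA v) (mcompA q) (mcompA (mcomp q m)) qmv mcomp1m.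
have [e0|e1] := indec_idem iM ee.
  right; exists N.+1; rewrite -/g -mq -[q]mcomp1m -qmv -(mcompA _ v) -(mcompA q) e0.
  by rewrite !mcomp0.
left; apply: endo_inj_isom; apply/mhom_inj0 => x fx.
have qx : q x = 0.
  by apply: mi; rewrite lf0 -mcompE mq /g mexpSr mcompE fx lf0.
by rewrite -[x]midE -e1 !mcompE qx !lf0.
Qed.
End Decomposition.

(** * Extensions and exceptional families *)

Section ExtAndExceptional.
Local Open Scope ring_scope.
Variables (k : fieldType) (A : fdAlgType k).
Implicit Types M N L K Q J P X Y Z : rmod A.

Lemma nilp_isom M (f : mhom M M) n : mexp f n = 0 -> isom (C := modcat A) (mid M - f).
Proof.
move=> fn; apply: endo_inj_isom; apply/mhom_inj0 => x.
rewrite mhomBE midE => /subr0_eq e.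
have : x = mexp f n x; last by rewrite fn mhom0E.
elim: n {fn} => [|n ih]; first by rewrite /mexp /= midE.
by rewrite mexpSr mcompE -e.
Qed.

Lemma indec_local M (f g : mhom M M) : indecomposable (modcat A) M -> f + g = mid M ->
  isom (C := modcat A) f \/ isom (C := modcat A) g.
Proof.
move=> iM e; have [|[n fn]] := fitting f iM; first by left.
by right; have -> : g = mid M - f; [rewrite -e addrAC subrr add0r | apply: nilp_isom fn].
Qed.

Lemma indec_local_sum (I : Type) (r : seq I) M (F : I -> mhom M M) : indecomposable (modcat A) M ->
  isom (C := modcat A) (\sum_(i <- r) F i) -> exists i, isom (C := modcat A) (F i).
Proof.
move=> iM; elim: r => [|i r ih].
  rewrite big_nil => /isom_inj h; case: iM => nz _; case: nz; apply/mzeroP => x.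
  by apply: h; rewrite !mhom0E.
rewrite big_cons => /misomP[w [h _]]; move: h; rewrite mcompDr => e.
have inj_of (u : mhom M M) : isom (C := modcat A) (mcomp w u) -> isom (C := modcat A) u.
  by move=> /isom_inj h; apply: endo_inj_isom => x y xy; apply: h; rewrite !mcompE xy.
by have [/inj_of|/inj_of] := indec_local iM e; [exists i | apply: ih].
Qed.

Lemma retract_trans M N L (i : mhom N M) (p : mhom M N) (j : mhom L N) (q : mhom N L) :
  mcomp p i = mid N -> mcomp q j = mid L -> mcomp (mcomp q p) (mcomp i j) = mid L.
Proof. by move=> pi qj; rewrite mcompA -(mcompA q p) pi mcompm1. Qed.

(** This takes the place of a decomposition into indecomposables: a nonzero map on a decomposable
    module is nonzero on one of two proper summands, and the dimension drops. With [f] the identity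
    it splits off an indecomposable summand. *)
Lemma indec_retract_nonzero M N (f : mhom M N) : f != 0 ->
  exists Y (i : mhom Y M) (p : mhom M Y),
    [/\ indecomposable (modcat A) Y, mcomp p i = mid Y & mcomp f i != 0].
Proof.
have [n] := ubnP (\dim {:M}); elim: n M f => // n ih M f; rewrite ltnS => dM fn0.
have nzM : ~ zero_obj (modcat A) M.
  by move/mzeroP=> z; move: fn0; rewrite (mzero_hom_from f z) eqxx.
have [iM|] := pselect (indecomposable (modcat A) M).
  by exists M, (mid M), (mid M); split; rewrite ?mcompm1.
move=> nind; have [Y [Z [D nY nZ]]] : exists Y Z, [/\ is_dsum (modcat A) M Y Z,
    ~ zero_obj (modcat A) Y & ~ zero_obj (modcat A) Z].
  apply: contrapT => h; apply: nind; split=> // Y Z D; apply: contrapT => /not_orP[nY nZ].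
  by apply: h; exists Y, Z.
have {D}[i1 [i2 [p1 [p2 [p1i1 p2i2 p1i2 p2i1 e]]]]] := (is_dsumP _ _ _).1 D.
have small (U V : rmod A) (i : mhom U M) (p : mhom M U) (i' : mhom V M) (p' : mhom M V) :
    mcomp p i = mid U -> mcomp p' i' = mid V -> mcomp p' i = 0 -> ~ zero_obj (modcat A) V ->
    (\dim {:U} < \dim {:M})%N.
  move=> pi pi' pi0 nV; have ii : injective i.
    by apply: (can_inj (g := p)) => x; rewrite -mcompE pi midE.
  rewrite ltn_neqAle (dim_leq_inj ii) andbT; apply/negP => /eqP d; apply: nV; apply/mzeroP => v.
  have [|u uE] := dim_inj_surj ii _ (i' v); first by rewrite d.
  by rewrite -[v]midE -pi' mcompE -uE -mcompE pi0 mhom0E.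
have [f1|f1] := eqVneq (mcomp f i1) 0; last first.
  have [|Y' [j [q [iY' qj fj]]]] := ih Y _ _ f1; first by apply: leq_trans dM; exact: (small Y Z i1 p1 i2 p2).
  by exists Y', (mcomp i1 j), (mcomp q p1); split; rewrite ?(retract_trans p1i1) ?mcompA.
have f2 : mcomp f i2 != 0.
  by apply: contraNneq fn0 => f2; rewrite -[f]mcompm1 -e mcompDr !mcompA f1 f2 !mcomp0l addr0.
have [|Y' [j [q [iY' qj fj]]]] := ih Z _ _ f2; first by apply: leq_trans dM; exact: (small Z Y i2 p2 i1 p1).
by exists Y', (mcomp i2 j), (mcomp q p2); split; rewrite ?(retract_trans p2i2) ?mcompA.
Qed.

Definition hdim M N := \dim {:mhom M N}.

Lemma hdim_exact M N L Z (f : mhom M N) (g : mhom N L) : surj g ->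
  (forall y, g y = 0 <-> exists x, f x = y) ->
  (forall c : mhom M Z, exists e : mhom N Z, mcomp e f = c) ->
  hdim N Z = (hdim L Z + hdim M Z)%N.
Proof.
move=> gs ex ext; apply: (@dim_exact _ _ _ _ (precomp Z g) (precomp Z f)) => [u v|v|w].
- by rewrite !precompE; apply: surj_cancel.
- rewrite precompE; split=> [vf|[u <-]]; last first.
    rewrite precompE -mcompA; apply: mhom_inj => x; rewrite !mcompE mhom0E.
    by rewrite (_ : g (f x) = 0) ?lf0 //; apply/ex; exists x.
  have [y /ex[x <-]|u <-] := factor_surj (f := v) gs; last by exists u; rewrite precompE.
  by rewrite -mcompE vf mhom0E.
by have [e <-] := ext w; exists e; rewrite precompE.
Qed.
Lemma hdim_dsum X Y Z W : is_dsum (modcat A) X Y Z -> hdim X W = (hdim Y W + hdim Z W)%N.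
Proof.
case/is_dsumP=> i1 [i2 [p1 [p2 [p1i1 p2i2 p1i2 p2i1 e]]]].
apply: (@hdim_exact _ _ _ _ i2 p1) => [y|y|c].
- by exists (i1 y); rewrite -mcompE p1i1 midE.
- split=> [h|[x <-]]; last by rewrite -mcompE p1i2 mhom0E.
  by exists (p2 y); rewrite -[RHS]midE -e mhomDE !mcompE h lf0 add0r.
by exists (mcomp c p2); rewrite -mcompA p2i2 mcompm1.
Qed.
Lemma hdim_iso X Y W : iso_obj (modcat A) X Y -> hdim X W = hdim Y W.
Proof.
case=> f /misomP[g [gf fg]]; rewrite /hdim.
have fs : surj f by apply/isom_surj/misomP; exists g.
have gs : surj g by apply/isom_surj/misomP; exists f.
by apply/eqP; rewrite eqn_leq (dim_leq_inj (f := precomp W g)) ?(dim_leq_inj (f := precomp W f)) // => u v;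
  rewrite !precompE; apply: surj_cancel.
Qed.
Lemma hdim0 M N : hdim M N = 0%N <-> (forall f : mhom M N, f = 0).
Proof.
split=> [/eqP|h].
  by rewrite dimv_eq0 => /eqP e f; have := memvf f; rewrite e memv0 => /eqP.
by apply/eqP; rewrite dimv_eq0 -subv0; apply/subvP => x _; rewrite (h x) mem0v.
Qed.

(* Ext^1(M, N) = 0, in terms of projective presentations *)
Definition extz M N := forall K Q (i : mhom K Q) (p : mhom Q M), projective Q ->
  is_kernel i p -> surj p -> forall c : mhom K N, exists e : mhom Q N, mcomp e i = c.

(** One presentation suffices, even one of a module that has [M'] as a retract: [a] and [b] compare
    the two presentations, and [1 - a b] maps [Q'] into [K'], which gives the homotopy [s]. *)
Lemma extz_retract M M' N K Q (i : mhom K Q) (p : mhom Q M) (io : mhom M' M) (pr : mhom M M') :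
  mcomp pr io = mid M' -> projective Q -> is_kernel i p -> surj p ->
  (forall c : mhom K N, exists e : mhom Q N, mcomp e i = c) -> extz M' N.
Proof.
move=> prio pQ [ii iE] ps ext K' Q' i' p' pQ' [ii' iE'] ps' c.
have [b bE] := pQ' _ _ p (mcomp io p') ps.
have [a aE] := pQ _ _ p' (mcomp pr p) ps'.
have pab : mcomp p' (mcomp a b) = p' by rewrite mcompA aE -mcompA bE mcompA prio mcomp1m.
have [x|bK bKE] := factor_inj (f := mcomp b i') ii.
  by apply/iE; rewrite mcompE -mcompE bE mcompE (_ : p' (i' x) = 0) ?lf0 //; apply/iE'; exists x.
have [x|aK aKE] := factor_inj (f := mcomp a i) ii'.
  by apply/iE'; rewrite mcompE -mcompE aE mcompE (_ : p (i x) = 0) ?lf0 //; apply/iE; exists x.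
have [x|s sE] := factor_inj (f := mid Q' - mcomp a b) ii'.
  by apply/iE'; rewrite mhomBE midE lfB -[p' (mcomp _ _ _)]mcompE pab subrr.
have [e eE] := ext (mcomp c aK); exists (mcomp e b + mcomp c s).
rewrite mcompDl -mcompA -bKE mcompA eE -mcompA -(mcompA c) -mcompDr.
rewrite (_ : _ + _ = mid K') ?mcompm1 //; apply: (inj_cancel ii').
by rewrite mcompDr mcompA aKE mcompA sE -mcompA bKE mcompBl mcompA addrC subrK mcomp1m mcompm1.
Qed.

Lemma extz_proj P N : projective P -> extz P N.
Proof.
move=> pP; apply: (@extz_retract P P N (zero_mod A) P 0 (mid P) (mid P) (mid P)) => //.
- exact: mcompm1.
- split=> [x y _|x]; first by rewrite (mzero_zero_mod x) (mzero_zero_mod y).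
  by rewrite midE; split=> [->|[y <-]]; [exists 0; rewrite lf0 | rewrite mhom0E].
- by move=> y; exists y; rewrite midE.
by move=> c; exists 0; rewrite mcomp0 (mzero_hom_from c) //; apply: mzero_zero_mod.
Qed.

Lemma extz_retract_r M N N' (io : mhom N' N) (pr : mhom N N') :
  mcomp pr io = mid N' -> extz M N -> extz M N'.
Proof.
move=> prio h K Q i p pQ ki ps c; have [e eE] := h _ _ _ _ pQ ki ps (mcomp io c).
by exists (mcomp pr e); rewrite -mcompA eE mcompA prio mcomp1m.
Qed.
Lemma extz_retract_l M M' N (io : mhom M' M) (pr : mhom M M') :
  mcomp pr io = mid M' -> extz M N -> extz M' N.
Proof.
move=> prio h; have [K [i ki]] := kernel_exists (free_ev M).
by apply: (extz_retract prio (@proj_free _ _ M) ki (@free_ev_surj _ _ M)); apply: h (@proj_free _ _ M) ki (@free_ev_surj _ _ M).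
Qed.

Hypothesis hA : hereditary A.

Lemma extz_quot M N N' (q : mhom N N') : surj q -> extz M N -> extz M N'.
Proof.
move=> qs h K Q i p pQ ki ps c.
have pK : projective K := hA pQ ki.1.
have [c' <-] := pK _ _ q c qs.
by have [e <-] := h _ _ _ _ pQ ki ps c'; exists (mcomp q e); rewrite mcompA.
Qed.

Lemma extz_mpow M N m : extz M N -> extz M (mpow N m).
Proof.
move=> h K Q i p pQ ki ps c.
have /choice[e eE] : forall j, exists e : mhom Q N, mcomp e i = mcomp (ppr N j) c by move=> j; apply: h ki ps _.
have [f fE] := @mpow_map_exists _ _ N m Q e.
by exists f; apply: mpow_inj => j; rewrite mcompA fE eE.
Qed.

(** Injectivity of [j] is replaced by heredity: the obstruction to lifting [g] is a map from the
    projective module [K] to the image of [j], so it comes from a map to [N], and that map extends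
    to the cover. *)
Lemma extz_lift M N X Y (j : mhom N X) (s : mhom X Y) : extz M N -> surj s ->
  (forall x, s x = 0 <-> exists y, j y = x) -> forall g : mhom M Y, exists g' : mhom M X, mcomp s g' = g.
Proof.
move=> h ss ex g; have [K [i ki]] := kernel_exists (free_ev M).
have pQ := @proj_free _ _ M; have ps := @free_ev_surj _ _ M; have pK : projective K := hA pQ ki.1.
have [a aE] := pQ _ _ s (mcomp g (free_ev M)) ss.
have pi0 : mcomp (free_ev M) i = 0.
  by apply: mhom_inj => x; rewrite mcompE mhom0E; apply/ki.2; exists x.
have [x|c cE] := @proj_lift _ _ K _ _ j (mcomp a i) pK.
  by apply/ex; rewrite -mcompE mcompA aE -mcompA pi0 mcomp0 mhom0E.
have [e eE] := h _ _ _ _ pQ ki ps c.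
have [x /ki.2[y <-]|a' a'E] := @factor_surj _ _ _ _ _ _ (a - mcomp j e) ps.
  by rewrite -mcompE mcompBl -mcompA eE cE subrr mhom0E.
exists a'; apply: (surj_cancel ps); rewrite -mcompA a'E mcompBr aE mcompA.
rewrite (_ : mcomp s j = 0) ?mcomp0l ?subr0 //.
by apply: mhom_inj => x; rewrite mcompE mhom0E; apply/ex; exists x.
Qed.

(* With [u] the endomorphism of Y and [s f'] that of X constructed below, f (s f') = (1 - u) f:
   either one of them is invertible, or both are nilpotent and f = 0. *)
Lemma happel_ringel X Y (f : mhom X Y) : indecomposable (modcat A) X -> indecomposable (modcat A) Y ->
  extz Y X -> f != 0 -> injective f \/ surj f.
Proof.
move=> iX iY eYX fn0.
have [I [f' [m [f's mi mf]]]] := image_exists f.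
have [C [c [cs cE]]] := cokernel_exists f.
have [K [i ki]] := kernel_exists (free_ev Y); set p := free_ev Y in ki.
have pQ : projective (free Y) := @proj_free _ _ Y; have ps : surj p := @free_ev_surj _ _ Y.
(* [K'] is the preimage of the image of [f] under the cover [p]. It is projective, so [p i'] lifts
   along [f] to [g]; the vanishing of Ext^1(Y, X) provides [h] such that [g - h i'] vanishes on [K]
   and descends to [s] on the image of [f]. *)
have [K' [i' ki']] := kernel_exists (mcomp c p).
have pK' : projective K' := hA pQ ki'.1.
have [x|g gE] := @proj_lift _ _ K' _ _ f (mcomp p i') pK'.
  by apply/cE; rewrite mcompE -mcompE; apply/ki'.2; exists x.
have [x|j jE] := factor_inj (f := i) ki'.1.
  by apply/ki'.2; rewrite mcompE (_ : p (i x) = 0) ?lf0 //; apply/ki.2; exists x.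
have [h hE] := eYX _ _ _ _ pQ ki ps (mcomp g j).
have pi0 : mcomp p i = 0.
  by apply: mhom_inj => x; rewrite mcompE mhom0E; apply/ki.2; exists x.
have [x|t tE] := factor_inj (f := mcomp p i') mi.
  have /cE[y <-] : c (mcomp p i' x) = 0 by rewrite mcompE -mcompE; apply/ki'.2; exists x.
  by exists (f' y); rewrite -mcompE mf.
have ts : surj t.
  move=> y; have [x xE] := f's y; have [q qE] := ps (f x).
  have /ki'.2[z zE] : mcomp c p q = 0 by rewrite mcompE qE; apply/cE; exists x.
  by exists z; apply: mi; rewrite -mcompE tE mcompE zE qE -xE -mcompE mf.
have [x tx|s sE] := @factor_surj _ _ _ _ _ _ (g - mcomp h i') ts.
  have /ki.2[y yE] : p (i' x) = 0 by rewrite -mcompE -tE mcompE tx lf0.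
  have <- : j y = x by apply: ki'.1; rewrite -mcompE jE.
  by rewrite -mcompE mcompBl -mcompA jE hE subrr mhom0E.
have [x /ki.2[y <-]|u uE] := @factor_surj _ _ _ _ _ _ (mcomp f h) ps.
  by rewrite -mcompE -mcompA hE mcompA gE -mcompA jE pi0 mhom0E.
have fs : mcomp f s = mcomp (mid Y - u) m.
  apply: (surj_cancel ts); rewrite -mcompA sE mcompBr gE -mcompA tE mcompBl mcomp1m.
  by rewrite (mcompA u) uE mcompA.
have fn : mcomp f (mcomp s f') = mcomp (mid Y - u) f by rewrite mcompA fs -mcompA mf.
have [/isom_inj ni|[n nn]] := fitting (mcomp s f') iX.
  by left=> x y e; apply: ni; rewrite !mcompE (_ : f' x = f' y) //; apply: mi; rewrite -!mcompE mf.
have [/isom_surj us|[n' un]] := fitting u iY.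
  right=> y; have [z <-] := us y; have [x <-] := ps z.
  by exists (h x); rewrite -!mcompE uE.
have vi := isom_inj (nilp_isom un).
have fexp r : mcomp f (mexp (mcomp s f') r) = mcomp (mexp (mid Y - u) r) f.
  elim: r => [|r ih]; first by rewrite mcompm1 mcomp1m.
  by rewrite !mexpSr mcompA ih -mcompA fn mcompA.
case/eqP: fn0; apply: mhom_inj => x; rewrite mhom0E.
have : mexp (mid Y - u) n (f x) = 0 by rewrite -mcompE -fexp nn mcomp0 mhom0E.
elim: n {nn} => [|n ih]; first by rewrite /mexp /= midE.
by rewrite /mexp /= -/(mexp _ _) mcompE => e; apply: ih; apply: vi; rewrite e lf0.
Qed.

End ExtAndExceptional.

(** * Independence of exceptional families in the Grothendieck group *)

Section ExceptionalFamilies.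
Local Open Scope ring_scope.
Variables (k : fieldType) (A : fdAlgType k).
Implicit Types M N L K Q J P X Y Z : rmod A.
Hypothesis hA : hereditary A.

Section Source.
Variables (I : finType) (W : I -> rmod A).
Hypotheses (iW : forall i, indecomposable (modcat A) (W i))
  (nW : forall i j, iso_obj (modcat A) (W i) (W j) -> i = j).

(** Nonzero maps between members are injective or surjective. If some member embeds in another one,
    take a smallest such member: an injection into it would come from a smaller one of the same
    kind, and a surjection onto it, followed by its embedding, would be neither injective nor
    surjective. Otherwise all nonzero maps between different members are surjective, and a largest
    member receives none. *)
Lemma hom_source (S : {set I}) : (forall i j, i \in S -> j \in S -> extz (W i) (W j)) ->
  S != finset.set0 -> exists2 i, i \in S & forall j, j \in S -> j != i -> forall f : mhom (W j) (W i), f = 0.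
Proof.
move=> eS /finset.set0Pn[i0 i0S].
have mono_lt l j (f : mhom (W l) (W j)) : injective f -> l != j -> (\dim {:W l} < \dim {:W j})%N.
  move=> fi lj; rewrite ltn_neqAle (dim_leq_inj fi) andbT; apply: contraNneq lj => d.
  apply/eqP/nW; exists f; apply: mhom_isom (fi) _.
  by apply: dim_inj_surj fi _; rewrite d.
have epi_lt l j (f : mhom (W l) (W j)) : surj f -> l != j -> (\dim {:W j} < \dim {:W l})%N.
  move=> fs lj; rewrite ltn_neqAle (dim_leq_surj fs) andbT; apply: contraNneq lj => d.
  by apply/eqP/nW; exists f; apply: mhom_isom (fs); apply: dim_surj_inj fs _; rewrite d.
pose mono l := `[< exists j, [/\ j \in S, l != j & exists f : mhom (W l) (W j), injective f] >].
have [[l lS ml]|nm] := pselect (exists2 l, l \in S & mono l).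
  pose R l := (l \in S) && mono l.
  have R0 : R l by rewrite /R lS.
  case: (arg_minnP (fun l => \dim {:W l}) R0) => {lS ml R0}l /andP[lS /asboolP[j [jS lj [g gi]]]] lmin.
  exists l => // m mS ml f; apply/eqP; case: eqVneq => // fn0.
  have [fi|fs] := happel_ringel hA (iW m) (iW l) (eS _ _ lS mS) fn0.
    have := mono_lt _ _ f fi ml; rewrite ltnNge lmin // /R mS; apply/asboolP.
    by exists l; split=> //; exists f.
  have gf0 : mcomp g f != 0.
    by apply: contraNneq fn0 => gf; apply/eqP/(inj_cancel gi); rewrite gf mcomp0.
  have [gfi|gfs] := happel_ringel hA (iW m) (iW j) (eS _ _ jS mS) gf0.
    have fi : injective f by move=> x y xy; apply: gfi; rewrite !mcompE xy.
    by have := epi_lt _ _ f fs ml; rewrite ltnNge ltnW // (mono_lt _ _ f).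
  have gs : surj g by move=> y; have [x <-] := gfs y; exists (f x); rewrite mcompE.
  by have := epi_lt _ _ g gs lj; rewrite ltnNge ltnW // (mono_lt _ _ g).
case: (arg_maxnP (fun l => \dim {:W l}) i0S) => i iS imax.
exists i => // j jS ji f; apply/eqP; case: eqVneq => // fn0.
have [fi|fs] := happel_ringel hA (iW j) (iW i) (eS _ _ iS jS) fn0.
  by case: nm; exists j => //; apply/asboolP; exists i; split=> //; exists f.
by have := epi_lt _ _ f fs ji; rewrite ltnNge => /negP[]; apply: imax.
Qed.
End Source.

Section Gram.
Variables (n : nat) (E : 'I_n -> rmod A).
Hypothesis E_proj : forall Q, projective Q -> indecomposable (modcat A) Q ->
  exists l, iso_obj (modcat A) Q (E l).

(** The numbers [g l] are the multiplicities of the [E l] in a decomposition of [P]; only their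
    effect on Hom-dimensions is kept. *)
Lemma proj_multiplicity P : projective P ->
  exists g : 'I_n -> nat, forall Z, hdim P Z = (\sum_l g l * hdim (E l) Z)%N.
Proof.
have [m] := ubnP (\dim {:P}); elim: m P => // m ih P; rewrite ltnS => dP pP.
have [/mzeroP zP|nzP] := pselect (zero_obj (modcat A) P).
  exists (fun=> 0%N) => Z; rewrite big1 ?mul0n //.
  by apply/hdim0 => f; apply: mzero_hom_from.
have nid : mid P != 0 by apply/eqP.
have [Y [i [p [iY pi _]]]] := indec_retract_nonzero nid.
have [Z [i2 [p2 D]]] := retract_mdsum pi.
have PD : is_dsum (modcat A) P Y Z by apply/is_dsumP; exists i, i2, p, p2.
have [p1i1 p2i2 p1i2 p2i1 e] := D.
have i2i : injective i2 by apply: (can_inj (g := p2)) => x; rewrite -mcompE p2i2 midE.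
have [|g gE] := ih Z _ (proj_retract pP p2i2).
  apply: leq_trans dP; rewrite ltn_neqAle (dim_leq_inj i2i) andbT; apply/negP => /eqP d.
  case: iY => nY _; apply/nY/mzeroP => y.
  have [|z zE] := dim_inj_surj i2i _ (i y); first by rewrite d.
  by rewrite -[y]midE -p1i1 mcompE -zE -mcompE p1i2 mhom0E.
have [l lE] := E_proj (proj_retract pP pi) iY.
exists (fun j => (j == l) + g j)%N => W; rewrite (hdim_dsum W PD) gE (hdim_iso W lE).
under [RHS]eq_bigr do rewrite mulnDl.
rewrite big_split; congr (_ + _)%N; rewrite (bigD1 l) // eqxx mul1n big1 => [|j /negbTE->]; last exact: mul0n.
by rewrite -[RHS]/(_ + 0)%N addn0.
Qed.

Variables (I : finType) (W : I -> rmod A) (B : pred I).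
Hypotheses (iW : forall i, indecomposable (modcat A) (W i))
  (nW : forall i j, iso_obj (modcat A) (W i) (W j) -> i = j)
  (eB : forall i j, B i -> B j -> extz (W i) (W j))
  (pB : forall i, ~~ B i -> projective (W i))
  (hB : forall i j, ~~ B i -> B j -> forall f : mhom (W i) (W j), f = 0).

(** [g] is the class of [W i] in the Grothendieck group, in terms of the indecomposable projectives:
    the multiplicities in a free cover minus those in its kernel. The right-hand side is the Euler
    form, which reduces to the dimension of Hom where Ext^1 vanishes. *)
Let euler_exists i : exists g : 'I_n -> rat, forall Z, extz (W i) Z ->
  (hdim (W i) Z)%:R = \sum_l g l * (hdim (E l) Z)%:R.
Proof.
have [K [j kj]] := kernel_exists (free_ev (W i)).
have pQ := @proj_free _ _ (W i); have ps := @free_ev_surj _ _ (W i).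
have pK : projective K := hA pQ kj.1.
have [g1 h1] := proj_multiplicity pQ; have [g2 h2] := proj_multiplicity pK.
exists (fun l => (g1 l)%:R - (g2 l)%:R) => Z eZ.
have := hdim_exact ps kj.2 (eZ _ _ _ _ pQ kj ps); rewrite h1 h2 => e.
under eq_bigr do rewrite mulrBl -!natrM.
by rewrite big_split /= sumrN -!natr_sum e natrD addrK.
Qed.
Let eu i := sval (cid (euler_exists i)).
Let euE i Z : extz (W i) Z -> (hdim (W i) Z)%:R = \sum_l eu i l * (hdim (E l) Z)%:R.
Proof. by rewrite /eu; case: cid => g /= h; apply: h. Qed.

Let extW i j : (B i -> B j) -> extz (W i) (W j).
Proof.
have [Bi /(_ isT)|nBi _] := boolP (B i); first exact: eB.
exact/extz_proj/pB.
Qed.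

(** Pairing a relation with a member [W i] that receives no map from the rest of the support [S]
    leaves [x i] times dim End(W i). Members in [B] are removed first, because Ext^1 from them to
    the other members is not assumed to vanish. *)
Let eu_free (x : I -> rat) : (forall l, \sum_i x i * eu i l = 0) -> forall i, x i = 0.
Proof.
move=> x0; suff gen m (S : {set I}) : (#|S| < m)%N -> (forall i, i \notin S -> x i = 0) -> forall i, x i = 0.
  by apply: (gen #|[set: I]%SET|.+1 [set: I]%SET) => // i; rewrite finset.in_setT.
elim: m S => // m ih S; rewrite ltnS => Sm xS.
have step i : i \in S -> (forall j, j \in S -> j != i -> extz (W j) (W i)) ->
   (forall j, j \in S -> j != i -> forall f : mhom (W j) (W i), f = 0) -> forall j, x j = 0.
  move=> iS eS hS; apply: (ih (S :\ i)).
    by apply: leq_trans Sm; rewrite [in leqRHS](cardsD1 i) iS.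
  move=> j; rewrite finset.in_setD1 negb_and negbK => /orP[/eqP->|]; last exact: xS.
  have : \sum_j x j * (hdim (W j) (W i))%:R = 0.
    have eq r : x r * (hdim (W r) (W i))%:R = \sum_l x r * eu r l * (hdim (E l) (W i))%:R.
      have [jS|/xS->] := boolP (r \in S); last first.
        by rewrite mul0r big1 // => l _; rewrite !mul0r.
      rewrite euE ?mulr_sumr; first by apply: eq_bigr => l _; rewrite mulrA.
      by have [->|ri] := eqVneq r i; [apply: extW | apply: eS].
    under eq_bigr do rewrite eq.
    by rewrite exchange_big big1 //= => l _; rewrite -mulr_suml x0 mul0r.
  rewrite (bigD1 i) //= big1 ?addr0 => [|j' ji].
    move=> /eqP; rewrite mulf_eq0 => /orP[/eqP//|]; rewrite pnatr_eq0 => /eqP/hdim0 h.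
    by case: (iW i) => nz _; case: nz; apply: h.
  have [j'S|/xS->] := boolP (j' \in S); last by rewrite mul0r.
  by rewrite (_ : hdim _ _ = 0%N) ?mulr0 //; apply/hdim0/hS.
pose SB := [set i in S | B i]%SET.
have SBP i : (i \in SB) = (i \in S) && B i by rewrite finset.inE.
have [SB0|SBn] := eqVneq SB finset.set0; last first.
  have [i j|i] := hom_source iW nW (S := SB) _ SBn.
  - by rewrite !SBP => /andP[_ bi] /andP[_ bj]; apply: eB.
  rewrite SBP => /andP[iS bi] src; apply: (step i) => // j jS ji; first exact: extW.
  have [bj|nbj] := boolP (B j); last exact: hB.
  by apply: src ji; rewrite SBP jS.
have nB i : i \in S -> ~~ B i.
  move=> iS; apply/negP => bi; have : i \in SB by rewrite SBP iS.
  by rewrite SB0 finset.inE.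
have [S0|Sn] := eqVneq S finset.set0; first by move=> i; apply: xS; rewrite S0 finset.inE.
have [i j|i iS src] := hom_source iW nW (S := S) _ Sn.
- by move=> /nB ni _; apply: extz_proj; apply: pB.
by apply: (step i) => // j jS ji; apply: extz_proj; apply/pB/nB.
Qed.

Let G := (\matrix_(i < #|I|, l < n) eu (enum_val i) l).
Let G_free : row_free G.
Proof.
apply: inj_row_free => v vG; apply/rowP => i; rewrite mxE.
pose x j := v 0 (enum_rank j); rewrite -[i]enum_valK -/(x (enum_val i)).
apply: eu_free => l; have /rowP/(_ l) := vG; rewrite !mxE => e; rewrite -[RHS]e.
rewrite (reindex (@enum_val I predT)) /=; last by exists enum_rank => y _; rewrite ?enum_valK ?enum_rankK.
by apply: eq_bigr => j _; rewrite mxE /x enum_valK.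
Qed.

Lemma exceptional_leq : (#|I| <= n)%N.
Proof. by have := G_free; rewrite -row_leq_rank => h; apply: leq_trans h (rank_leq_col _). Qed.

(** All Euler pairings with [Z] are zero, so its dimension vector [d] is killed by the square matrix
    [G] of full rank; then there is no nonzero map from the regular module to [Z]. *)
Lemma exceptional_complete Z : #|I| = n -> (forall i, extz (W i) Z) ->
  (forall i (f : mhom (W i) Z), f = 0) -> mzero Z.
Proof.
move=> In eZ hZ; have GF : row_full G.
  by rewrite -col_leq_rank; have := G_free; rewrite -row_leq_rank {1}In.
pose d : 'cV[rat]_n := \col_l (hdim (E l) Z)%:R.
have Gd : G *m d = 0.
  apply/colP => i; rewrite !mxE; have := euE (eZ (enum_val i)).
  rewrite (_ : hdim _ _ = 0%N) => [e|]; last by apply/hdim0/hZ.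
  by rewrite [RHS]e; apply: eq_bigr => l _; rewrite !mxE.
have [C CG] := row_fullP GF.
have d0 : d = 0 by rewrite -[d]mul1mx -CG -mulmxA Gd mulmx0.
have [g gE] := proj_multiplicity (@proj_regular _ A).
have /hdim0 h : hdim (regular A) Z = 0%N.
  rewrite gE big1 // => l _; have /colP/(_ l) := d0; rewrite !mxE => /eqP.
  by rewrite pnatr_eq0 => /eqP->; rewrite muln0.
by move=> z; rewrite -[z]mact1 -hmapE (h (hmap z)) mhom0E.
Qed.
End Gram.
End ExceptionalFamilies.

(** * Orthogonality for support tau-tilting pairs *)

Section SupportTilting.
Local Open Scope ring_scope.
Variables (k : fieldType) (A : fdAlgType k).
Implicit Types M N L K Q J X Y Z : rmod A.

Lemma summand_retract Y X : is_summand (modcat A) Y X ->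
  exists (i : mhom Y X) (p : mhom X Y), mcomp p i = mid Y.
Proof. by case=> Z /is_dsumP[i1 [i2 [p1 [p2 []]]]] h _ _ _ _; exists i1, p1. Qed.

(** The identity of [Q] is a sum of endomorphisms that factor through [A]; since End(Q) is local,
    one of them is invertible. *)
Lemma indec_proj_summand Q : projective Q -> indecomposable (modcat A) Q ->
  is_summand (modcat A) Q (regular A).
Proof.
move=> pQ iQ; have [s sE] := pQ _ _ (free_ev Q) (mid Q) (@free_ev_surj _ _ Q).
have : isom (C := modcat A) (mcomp (free_ev Q) s).
  by rewrite sE; apply/misomP; exists (mid Q); rewrite !mcomp1m.
rewrite mcomp_suml => /(indec_local_sum iQ)[i /misomP[w [wE _]]].
by apply: retract_summand; rewrite -wE -[mcomp (mcomp _ _) s]mcompA mcompA.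
Qed.

Lemma approximation T K : exists m (g : mhom (mpow T m) K),
  forall f : mhom T K, exists f' : mhom T (mpow T m), mcomp g f' = f.
Proof.
exists (\dim {:mhom T K}), (prow (fun i : 'I__ => (vbasis {:mhom T K})`_i)) => f.
have [f' f'E] := @mpow_map_exists _ _ T (\dim {:mhom T K}) T
  (fun i => coord (vbasis {:mhom T K}) i f *: mid T).
exists f'; rewrite mcomp_suml [RHS](coord_vbasis (memvf f)); apply: eq_bigr => i _.
by rewrite -mcompA f'E mcompZr mcompm1.
Qed.

Lemma hom0_retract_l M M' N (i : mhom M' M) (p : mhom M M') : mcomp p i = mid M' ->
  (forall f : mhom M N, f = 0) -> forall f : mhom M' N, f = 0.
Proof. by move=> pi h f; rewrite -[f]mcompm1 -pi mcompA (h (mcomp f p)) mcomp0l. Qed.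
Lemma hom0_retract_r M N N' (i : mhom N' N) (p : mhom N N') : mcomp p i = mid N' ->
  (forall f : mhom M N, f = 0) -> forall f : mhom M N', f = 0.
Proof. by move=> pi h f; rewrite -[f]mcomp1m -pi -mcompA (h (mcomp i f)) mcomp0. Qed.

Variables T P : rmod A.
Hypotheses (hA : hereditary A) (eT : extz T T) (pP : projective P)
  (hPT : forall f : mhom P T, f = 0).
Variables a b : nat.
Hypotheses (nT : nsummands (modcat A) T a) (nP : nsummands (modcat A) P b)
  (nA : nsummands (modcat A) (regular A) (a + b)).

Let family : exists W : 'I_a + 'I_b -> rmod A,
  [/\ forall i, indecomposable (modcat A) (W i),
      forall i j, iso_obj (modcat A) (W i) (W j) -> i = j,
      forall i, is_summand (modcat A) (W (inl i)) T
    & forall i, is_summand (modcat A) (W (inr i)) P].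
Proof.
have [U [iU nU _]] := nT; have [V [iV nV _]] := nP.
have UV i j : ~ iso_obj (modcat A) (V j) (U i).
  move=> [f /misomP[g [gf _]]]; have [[nz _] sV] := iV j; have [_ sU] := iU i.
  have [i1 [p1 e1]] := summand_retract sV; have [i2 [p2 e2]] := summand_retract sU.
  apply: nz; rewrite /zero_obj -[idm _ _]gf (hom0_retract_l e1 (hom0_retract_r e2 hPT) f).
  exact: mcomp0.
have iso_sym M N : iso_obj (modcat A) M N -> iso_obj (modcat A) N M.
  by move=> [f /misomP[g [gf fg]]]; exists g; apply/misomP; exists f.
exists (fun i => match i with inl i => U i | inr j => V j end); split.
- by case=> i; [have [] := iU i | have [] := iV i].
- case=> i [] j //= h; [by congr inl; apply: nU| | |by congr inr; apply: nV].
    by case: (UV i j); apply: iso_sym.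
  by case: (UV j i).
- by move=> i; have [] := iU i.
by move=> i; have [] := iV i.
Qed.

Let E_exists : exists E : 'I_(a + b) -> rmod A, forall Q, projective Q ->
  indecomposable (modcat A) Q -> exists l, iso_obj (modcat A) Q (E l).
Proof.
have [E [_ _ h]] := nA; exists E => Q pQ iQ; apply: h => //.
exact: indec_proj_summand.
Qed.

Definition isT_summand (i : 'I_a + 'I_b) := if i is inl _ then true else false.

Lemma tilting_orthogonal Z : extz T Z -> (forall f : mhom T Z, f = 0) ->
  (forall f : mhom P Z, f = 0) -> mzero Z.
Proof.
move=> eZ hTZ hPZ; have [W [iW nW sT sP]] := family; have [E hE] := E_exists.
apply: (@exceptional_complete _ _ hA _ E hE _ W isT_summand iW nW).
- move=> [i|i] [j|j] // _ _; have [i1 [p1 e1]] := summand_retract (sT i).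
  have [i2 [p2 e2]] := summand_retract (sT j).
  exact: extz_retract_l e1 (extz_retract_r e2 eT).
- by move=> [i|i] // _; have [i1 [p1 e1]] := summand_retract (sP i); apply: proj_retract pP e1.
- move=> [i|i] [j|j] // _ _; have [i1 [p1 e1]] := summand_retract (sP i).
  have [i2 [p2 e2]] := summand_retract (sT j).
  exact: hom0_retract_l e1 (hom0_retract_r e2 hPT).
- by rewrite card_sum !card_ord.
- move=> [i|i]; last first.
    by have [i1 [p1 e1]] := summand_retract (sP i); apply/extz_proj/(proj_retract pP e1).
  by have [i1 [p1 e1]] := summand_retract (sT i); apply: extz_retract_l e1 eZ.
case=> i; [have [i1 [p1 e1]] := summand_retract (sT i) | have [i1 [p1 e1]] := summand_retract (sP i)].
  exact: hom0_retract_l e1 hTZ.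
exact: hom0_retract_l e1 hPZ.
Qed.

(** The cokernel [C] is orthogonal to [T] and [P]. For [T], the vanishing of Ext^1(T, T^m) lifts a
    map to [C] first to [K] and then, by the approximation property, through [g], so it is zero. *)
Lemma tilting_generated K m (g : mhom (mpow T m) K) : extz T K -> (forall f : mhom P K, f = 0) ->
  (forall f : mhom T K, exists f' : mhom T (mpow T m), mcomp g f' = f) -> surj g.
Proof.
move=> eK hPK gE; have [C [c [cs cE]]] := cokernel_exists g.
suff z : mzero C by move=> y; apply/cE; apply: z.
apply: tilting_orthogonal => [|f|f]; first exact: extz_quot cs eK.
  have [f' <-] := extz_lift hA (@extz_mpow _ _ _ _ m eT) cs cE f.
  have [f'' <-] := gE f'; apply: mhom_inj => x; rewrite !mcompE mhom0E.
  by apply/cE; exists (f'' x).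
by have [f' <-] := pP f cs; rewrite (hPK f') mcomp0.
Qed.

(** Otherwise an indecomposable summand [Y] of [Q] has a nonzero map to [N]. It is isomorphic to no
    summand of [T] or [P], and adding it to them would give a + b + 1 independent classes. *)
Lemma proj_orthogonal Q N : projective Q -> (forall f : mhom Q T, f = 0) ->
  (forall f : mhom P N, f = 0) -> forall f : mhom Q N, f = 0.
Proof.
move=> pQ hQT hPN f; apply/eqP; case: eqVneq => // fn0.
have [Y [i [p [iY pi fi]]]] := indec_retract_nonzero fn0.
have pY := proj_retract pQ pi; have hYT := hom0_retract_l pi hQT.
have [W [iW nW sT sP]] := family; have [E hE] := E_exists.
have nY j : ~ iso_obj (modcat A) Y (W j).
  case: j => j [h /misomP[h' [h'h _]]].
    have [i1 [p1 e1]] := summand_retract (sT j).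
    have [nz _] := iY; apply: nz; rewrite /zero_obj -[idm _ _]h'h.
    by rewrite (hom0_retract_r e1 hYT h); apply: mcomp0.
  have [i1 [p1 e1]] := summand_retract (sP j).
  case/eqP: fi; rewrite -[LHS]mcompm1 -h'h mcompA.
  by rewrite (hom0_retract_l e1 hPN (mcomp (mcomp f i) h')) mcomp0l.
pose W' j := if j is Some j then W j else Y; pose B' j := if j is Some j then isT_summand j else false.
have := @exceptional_leq _ _ hA _ E hE _ W' B'.
rewrite card_option card_sum !card_ord ltnn => h.
suff : false by []; apply: h.
- by case.
- case=> [j|] [j'|] //= h; first by congr Some; apply: nW.
    by case: h => u /misomP[v [vu uv]]; case: (nY j); exists v; apply/misomP; exists u.
  by case: (nY j').
- case=> [[i'|i']|] [[j|j]|] //= _ _; have [i1 [p1 e1]] := summand_retract (sT i').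
  have [i2 [p2 e2]] := summand_retract (sT j).
  exact: extz_retract_l e1 (extz_retract_r e2 eT).
- case=> [[i'|i']|] //= _.
  by have [i1 [p1 e1]] := summand_retract (sP i'); apply: proj_retract pP e1.
case=> [[i'|i']|] [[j|j]|] //= _ _; have [i2 [p2 e2]] := summand_retract (sT j); last first.
  exact: hom0_retract_r e2 hYT.
have [i1 [p1 e1]] := summand_retract (sP i').
exact: hom0_retract_l e1 (hom0_retract_r e2 hPT).
Qed.
End SupportTilting.

(** * Nakayama functors *)

Section NakayamaPairs.
Local Open Scope ring_scope.
Variables (k : fieldType) (A : fdAlgType k).
Implicit Types M N L K Q J P X Y Z : rmod A.

Lemma lfun_of (U V : vectType k) (f : U -> V) : linear f -> exists g : 'Hom(U, V), forall x, g x = f x.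
Proof.
move=> lf; exists (linfun (HB.pack_for {linear U -> V} f (GRing.isLinear.Build k U V *:%R _ lf))) => x.
by rewrite lfunE.
Qed.

Lemma functional_eq0 (V : vectType k) (v : V) : (forall l : 'Hom(V, k^o), l v = 0) -> v = 0.
Proof.
move=> h; rewrite (coord_vbasis (memvf v)) big1 // => i _.
have [|l lE] := @lfun_of V k^o (fun x => coord (vbasis {:V}) i x); first exact: linearP.
by rewrite -lE h scale0r.
Qed.

Section Duality.
Variables (U V : vectType k) (bil : U -> V -> k^o).
Hypotheses (linl : forall v, linear (bil^~ v)) (linr : forall u, linear (bil u))
  (injl : forall u, (forall v, bil u v = 0) -> u = 0)
  (injr : forall v, (forall u, bil u v = 0) -> v = 0).
Let one_side (U' V' : vectType k) (b : U' -> V' -> k^o) :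
  (forall v, linear (b^~ v)) -> (forall u, linear (b u)) ->
  (forall u, (forall v, b u v = 0) -> u = 0) ->
  exists F : 'Hom(U', 'Hom(V', k^o)), injective F /\ forall u v, F u v = b u v.
Proof.
move=> ll lr ij; have /choice[f fE] u := lfun_of (lr u).
have lf : linear f.
  by move=> c x y; apply/lfunP => v; rewrite add_lfunE scale_lfunE !fE ll.
have [F FE] := lfun_of lf; exists F; split=> [|u v]; last by rewrite FE fE.
by apply: linear_inj0 => u Fu; apply: ij => v; rewrite -fE -FE Fu lfunE.
Qed.
Let dim_dual (W : vectType k) : \dim {:'Hom(W, k^o)} = \dim {:W}.
Proof. by rewrite !dimvf /dim /= muln1. Qed.
Lemma duality_surj (phi : 'Hom(V, k^o)) : exists u, forall v, bil u v = phi v.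
Proof.
have [F [Fi FE]] := one_side linl linr injl.
have [G [Gi _]] := @one_side V U (fun v u => bil u v) linr linl injr.
have [|u uE] := dim_inj_surj Fi _ phi; last by exists u => v; rewrite -FE uE.
by have := dim_leq_inj Gi; rewrite !dim_dual.
Qed.
End Duality.

(* A trace form: Hom(P, Z) and Hom(Z, J) are dual through th for all Z. Then P is projective, J is
   injective and J = nu P. *)
Definition npair P J (th : 'Hom(mhom P J, k^o)) :=
  (forall Z (f : mhom P Z), (forall g : mhom Z J, th (mcomp g f) = 0) -> f = 0) /\
  (forall Z (g : mhom Z J), (forall f : mhom P Z, th (mcomp g f) = 0) -> g = 0).

Section PairTheory.
Variables (P J : rmod A) (th : 'Hom(mhom P J, k^o)).
Hypothesis np : npair th.

Lemma npair_eql Z (f f' : mhom P Z) : (forall g, th (mcomp g f) = th (mcomp g f')) -> f = f'.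
Proof. by move=> h; apply/subr0_eq/np.1 => g; rewrite mcompBr lfB h subrr. Qed.
Lemma npair_eqr Z (g g' : mhom Z J) : (forall f, th (mcomp g f) = th (mcomp g' f)) -> g = g'.
Proof. by move=> h; apply/subr0_eq/np.2 => f; rewrite mcompBl lfB h subrr. Qed.
Lemma npair_repl Z (phi : 'Hom(mhom Z J, k^o)) : exists f : mhom P Z, forall g, th (mcomp g f) = phi g.
Proof.
apply: (@duality_surj _ _ (fun (f : mhom P Z) (g : mhom Z J) => th (mcomp g f))).
- by move=> v c x y; rewrite mcompDr mcompZr lfD lfZ.
- by move=> v c x y; rewrite mcompDl mcompZl lfD lfZ.
- exact: np.1.
exact: np.2.
Qed.
Lemma npair_repr Z (phi : 'Hom(mhom P Z, k^o)) : exists g : mhom Z J, forall f, th (mcomp g f) = phi f.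
Proof.
apply: (@duality_surj _ _ (fun (g : mhom Z J) (f : mhom P Z) => th (mcomp g f))).
- by move=> v c x y; rewrite mcompDl mcompZl lfD lfZ.
- by move=> v c x y; rewrite mcompDr mcompZr lfD lfZ.
- exact: np.2.
exact: np.1.
Qed.

(** Hom(-, J) is the dual of Hom(P, -), and Hom(P, -) preserves injective maps for every [P];
    dualising gives the extension property. *)
Lemma npair_inj : injective_mod J.
Proof.
move=> M N i f ii.
have pi : injective (postcomp P i).
  by move=> u v; rewrite !postcompE => /(inj_cancel ii).
have [g gE] := npair_repr ((th \o postcomp P f) \o (postcomp P i)^-1)%VF.
exists g; apply: npair_eqr => p; rewrite -mcompA gE !comp_lfunE -postcompE lker0_lfunK ?postcompE //.
exact/lker0P.
Qed.
Lemma npair_proj : projective P.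
Proof.
move=> M N p f ps.
have pi : injective (precomp J p).
  by move=> u v; rewrite !precompE => /(surj_cancel ps).
have [g gE] := npair_repl ((th \o precomp J f) \o (precomp J p)^-1)%VF.
exists g; apply: npair_eql => q; rewrite mcompA gE !comp_lfunE -precompE lker0_lfunK ?precompE //.
exact/lker0P.
Qed.
End PairTheory.

(** [a'] is what the Nakayama functor does to [a], obtained from the forms alone. *)
Lemma npair_hatr P J P' J' (th : 'Hom(mhom P J, k^o)) (th' : 'Hom(mhom P' J', k^o)) (a : mhom P P') :
  npair th' -> exists a' : mhom J J', forall b : mhom P' J, th (mcomp b a) = th' (mcomp a' b).
Proof.
move=> np'; have [a' aE] := npair_repr np' (th \o precomp J a)%VF.
by exists a' => b; rewrite aE comp_lfunE precompE.
Qed.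
Lemma npair_hatl P J P' J' (th : 'Hom(mhom P J, k^o)) (th' : 'Hom(mhom P' J', k^o)) (a' : mhom J J') :
  npair th -> exists a : mhom P P', forall b : mhom P' J, th (mcomp b a) = th' (mcomp a' b).
Proof.
move=> np; have [a aE] := npair_repl np (th' \o postcomp P' a')%VF.
by exists a => b; rewrite aE comp_lfunE postcompE.
Qed.

Lemma npair_mzero P J : mzero P -> mzero J -> npair (0 : 'Hom(mhom P J, k^o)).
Proof. by move=> zP zJ; split=> Z f _; [apply: mzero_hom_from|apply: mzero_hom_to]. Qed.

Section PairDsum.
Variables (P J P' J' : rmod A) (th : 'Hom(mhom P J, k^o)) (th' : 'Hom(mhom P' J', k^o)).
Let f b := th (mcomp (dfst J J') (mcomp b (dinl P P'))) + th' (mcomp (dsnd J J') (mcomp b (dinr P P'))).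
Fact pair_dsum_lin : linear f.
Proof.
move=> c x y; rewrite /f !(mcompDl, mcompZl, mcompDr, mcompZr) !(lfD, lfZ) scalerDr.
by rewrite addrACA.
Qed.
Definition pair_dsum : 'Hom(mhom (dsum_mod P P') (dsum_mod J J'), k^o) :=
  sval (cid (lfun_of pair_dsum_lin)).
Lemma pair_dsumE (b : mhom (dsum_mod P P') (dsum_mod J J')) : pair_dsum b =
  th (mcomp (dfst J J') (mcomp b (dinl P P'))) + th' (mcomp (dsnd J J') (mcomp b (dinr P P'))).
Proof. by rewrite /pair_dsum; case: cid. Qed.
Lemma npair_dsum : npair th -> npair th' -> npair pair_dsum.
Proof.
move=> np np'; split=> Z g h.
  have g1 : mcomp g (dinl P P') = 0.
    apply: np.1 => u; have := h (mcomp (dinl J J') u); rewrite pair_dsumE.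
    have -> : mcomp (dsnd J J') (mcomp (mcomp (mcomp (dinl J J') u) g) (dinr P P')) = 0.
      by apply: mhom_inj => x; rewrite !mcompE !dinlE dsndE mhom0E.
    rewrite lf0 addr0 => <-; congr (th _).
    by apply: mhom_inj => x; rewrite !mcompE !dinlE dfstE.
  have g2 : mcomp g (dinr P P') = 0.
    apply: np'.1 => u; have := h (mcomp (dinr J J') u); rewrite pair_dsumE.
    have -> : mcomp (dfst J J') (mcomp (mcomp (mcomp (dinr J J') u) g) (dinl P P')) = 0.
      by apply: mhom_inj => x; rewrite !mcompE !dinrE dfstE mhom0E.
    rewrite lf0 add0r => <-; congr (th' _).
    by apply: mhom_inj => x; rewrite !mcompE !dinrE dsndE.
  apply: mhom_inj => -[x y].
  have -> : (x, y) = dinl P P' x + dinr P P' y.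
    by rewrite dinlE dinrE; congr pair; rewrite /= ?addr0 ?add0r.
  by rewrite lfD -!mcompE g1 g2 !mhom0E addr0.
have g1 : mcomp (dfst J J') g = 0.
  apply: np.2 => u; have := h (mcomp u (dfst P P')); rewrite pair_dsumE.
  have -> : mcomp (dsnd J J') (mcomp (mcomp g (mcomp u (dfst P P'))) (dinr P P')) = 0.
    by apply: mhom_inj => x; rewrite !mcompE !dinrE dfstE /= !lf0 mhom0E.
  rewrite lf0 addr0 => <-; congr (th _).
  by apply: mhom_inj => x; rewrite !mcompE !dinlE (dfstE (N := P')).
have g2 : mcomp (dsnd J J') g = 0.
  apply: np'.2 => u; have := h (mcomp u (dsnd P P')); rewrite pair_dsumE.
  have -> : mcomp (dfst J J') (mcomp (mcomp g (mcomp u (dsnd P P'))) (dinl P P')) = 0.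
    by apply: mhom_inj => x; rewrite !mcompE !dinlE dsndE /= !lf0 mhom0E.
  rewrite lf0 add0r => <-; congr (th' _).
  by apply: mhom_inj => x; rewrite !mcompE !dinrE (dsndE (M := P)).
apply: mhom_inj => x; have := mhom_app x g1; have := mhom_app x g2.
by rewrite !mcompE dfstE dsndE !mhom0E; case: (g x) => u v /= -> ->.
Qed.
End PairDsum.

Section Nu.
Variable P : rmod A.
Hypothesis pP : projective P.
Let n := \dim {:P}.
Let pi (i : 'I_n) : P := (vbasis {:P})`_i.
Lemma dual_basis_exists : exists io : 'I_n -> mhom P (regular A),
  forall x, \sum_i mact P (pi i) (io i x) = x.
Proof.
have [s sE] := pP (mid P) (@free_ev_surj _ _ P).
exists (fun i => mcomp (ppr (regular A) i) s) => x.
rewrite -[RHS]midE -sE mcompE free_evE; apply: eq_bigr => i _.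
by rewrite mcompE.
Qed.
Definition dual_basis := sval (cid dual_basis_exists).
Local Notation io := dual_basis.
Lemma dual_basisE x : \sum_i mact P (pi i) (io i x) = x.
Proof. by rewrite /dual_basis; case: cid => io h; apply: h. Qed.
(** A map from [P] to D Hom(P, A) is a functional on the tensor product of [P] and Hom(P, A) over
    [A], which is End(P); this is its value at the identity, written in a dual basis. *)
Let f (b : mhom P (nu P)) : k^o := \sum_i (b (pi i) : 'Hom(mhom P (regular A), k^o)) (io i).
Fact nu_theta_lin : linear f.
Proof.
move=> c x y; rewrite /f scaler_sumr -big_split; apply: eq_bigr => i _ /=.
by rewrite mhomDE mhomZE add_lfunE scale_lfunE.
Qed.
Definition nu_theta : 'Hom(mhom P (nu P), k^o) := sval (cid (lfun_of nu_theta_lin)).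
Lemma nu_thetaE (b : mhom P (nu P)) : nu_theta b = \sum_i (b (pi i) : 'Hom(mhom P (regular A), k^o)) (io i).
Proof. by rewrite /nu_theta; case: cid => g gE; apply: gE. Qed.

Lemma nu_actE (phi : nu P) a (h : mhom P (regular A)) :
  (mact (nu P) phi a : 'Hom(mhom P (regular A), k^o)) h =
  (phi : 'Hom(mhom P (regular A), k^o)) (mcomp (lmul a) h).
Proof. by rewrite comp_lfunE postcompE. Qed.
Lemma dual_basis_expand (h : mhom P (regular A)) : \sum_i mcomp (lmul (h (pi i))) (io i) = h.
Proof.
apply: mhom_inj => x; rewrite mhom_sumE -{2}[x]dual_basisE lf_sum; apply: eq_bigr => i _.
by rewrite mcompE lmulE mhomP.
Qed.
Lemma nu_theta_expand (phi : nu P) (h : mhom P (regular A)) :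
  \sum_i (mact (nu P) phi (h (pi i)) : 'Hom(mhom P (regular A), k^o)) (io i) =
  (phi : 'Hom(mhom P (regular A), k^o)) h.
Proof.
by rewrite -[in RHS](dual_basis_expand h) lf_sum; apply: eq_bigr => i _; rewrite nu_actE.
Qed.

(** A map [g] out of [P] is tested against the maps that send [z] to the functional
    [q |-> l (z q(x))]; the trace is [l (g x)]. A map [g] into [nu P] is tested against
    [p |-> z q(p)]; the trace is the value of [g z] at [q]. *)
Lemma npair_nu : npair nu_theta.
Proof.
split=> Z g h.
  apply: mhom_inj => x; rewrite mhom0E; apply: functional_eq0 => l.
  have H z : exists phi : 'Hom(mhom P (regular A), k^o), 
      forall q : mhom P (regular A), phi q = l (mact Z z (q x)).
    by apply: lfun_of => c u v; rewrite mhomDE mhomZE mactDr mactZr lfD lfZ.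
  have [F FE] := choice H.
  have lF : linear (F : Z -> nu P).
    by move=> c u v; apply/lfunP => q; rewrite add_lfunE scale_lfunE !FE mactDl mactZl lfD lfZ.
  have aF z a : F (mact Z z a) = mact (nu P) (F z) a.
    by apply/lfunP => q; rewrite nu_actE !FE mcompE lmulE mactM.
  have := h (mk_mhom lF aF); rewrite nu_thetaE => <-.
  rewrite -{1}[x]dual_basisE !lf_sum; apply: eq_bigr => i _.
  by rewrite mcompE mk_mhomE FE mhomP.
apply: mhom_inj => z; rewrite mhom0E; apply/lfunP => q; rewrite zero_lfunE.
rewrite -(nu_theta_expand (g z) q); have := h (mcomp (hmap z) q); rewrite nu_thetaE => e.
by rewrite -[RHS]e; apply: eq_bigr => i _; rewrite !mcompE hmapE mhomP.
Qed.
End Nu.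

Lemma nu_mapE P Q (p : mhom P Q) (phi : nu P) (h : mhom Q (regular A)) :
  (nu_map p phi : 'Hom(mhom Q (regular A), k^o)) h =
  (phi : 'Hom(mhom P (regular A), k^o)) (mcomp h p).
Proof.
by rewrite (@mk_mhomE _ _ (nu P) (nu Q) _ (nu_map_linear p)) comp_lfunE precompE.
Qed.
Lemma nu_map_comp P Q R (q : mhom Q R) (p : mhom P Q) :
  nu_map (mcomp q p) = mcomp (nu_map q) (nu_map p).
Proof. by apply: mhom_inj => x; apply/lfunP => h; rewrite mcompE !nu_mapE mcompA. Qed.
Lemma nu_map0 P Q : nu_map (0 : mhom P Q) = 0.
Proof.
by apply: mhom_inj => x; apply/lfunP => h; rewrite nu_mapE mcomp0 lf0 mhom0E zero_lfunE.
Qed.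
Lemma nu_theta_nat P Q (pP : projective P) (pQ : projective Q) (p : mhom P Q) (b : mhom Q (nu P)) :
  nu_theta pP (mcomp b p) = nu_theta pQ (mcomp (nu_map p) b).
Proof.
rewrite !nu_thetaE; under eq_bigr do rewrite mcompE -[p _](dual_basisE pQ) lf_sum.
under [RHS]eq_bigr do rewrite mcompE nu_mapE.
under eq_bigr do rewrite sum_lfunE.
rewrite exchange_big; apply: eq_bigr => j _; rewrite -(nu_theta_expand pP).
by apply: eq_bigr => i _; rewrite mcompE mhomP.
Qed.
End NakayamaPairs.

(** * The inverse Nakayama functor and its trace form *)

Section NuInverse.
Local Open Scope ring_scope.
Variables (k : fieldType) (A : fdAlgType k).
Implicit Types M N L K Q J P X Y Z : rmod A.
Local Notation DA := (dual A).

Lemma dual_actE (phi : DA) a b : (mact DA phi a : 'Hom(A, k^o)) b = (phi : 'Hom(A, k^o)) (a ** b).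
Proof. by rewrite comp_lfunE amul_lE. Qed.
Lemma dual_lmul_appE b (phi : DA) a :
  (mhom_lfun (dual_lmul b) phi : 'Hom(A, k^o)) a = (phi : 'Hom(A, k^o)) (a ** b).
Proof. by rewrite dual_lmulE comp_lfunE amul_rE. Qed.
Lemma dual_act_one a (phi : DA) :
  (mact DA phi a : 'Hom(A, k^o)) (aone A) = (mhom_lfun (dual_lmul a) phi : 'Hom(A, k^o)) (aone A).
Proof. by rewrite dual_actE dual_lmul_appE amul1l amul1r. Qed.
Lemma dualP (phi psi : DA) : (forall a, (phi : 'Hom(A, k^o)) a = (psi : 'Hom(A, k^o)) a) -> phi = psi.
Proof. by move=> h; apply/lfunP. Qed.

Lemma dual_sumE (I : Type) (r : seq I) (F : I -> DA) a :
  ((\sum_(i <- r) F i : DA) : 'Hom(A, k^o)) a = \sum_(i <- r) (F i : 'Hom(A, k^o)) a.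
Proof. exact: (@sum_lfunE _ _ k^o I r xpredT). Qed.

Let ebasis_exists : exists F : 'I_(\dim {:A}) -> DA,
  forall i a, (F i : 'Hom(A, k^o)) a = coord (vbasis {:A}) i a.
Proof.
have /choice[F FE] (i : 'I_(\dim {:A})) : exists G : 'Hom(A, k^o), forall a, G a = coord (vbasis {:A}) i a.
  by apply: lfun_of; apply: linearP.
by exists F.
Qed.
Let edual := sval (cid ebasis_exists).
Let edualE i a : (edual i : 'Hom(A, k^o)) a = coord (vbasis {:A}) i a.
Proof. by rewrite /edual; case: cid => F h; apply: h. Qed.

(** The inverse of the isomorphism [dual_lmul] from [A] to End(DA): the element [a] with
    [phi(a) = (e phi)(1)] for all [phi], read off on the coordinate functionals. *)
Definition dual_endo_elt (e : mhom DA DA) : A :=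
  \sum_i (e (edual i) : 'Hom(A, k^o)) (aone A) *: (vbasis {:A})`_i.
Lemma dual_endo_lin : linear dual_endo_elt.
Proof.
move=> c x y; rewrite /dual_endo_elt scaler_sumr -big_split; apply: eq_bigr => i _ /=.
by rewrite mhomDE mhomZE add_lfunE scale_lfunE scalerDl scalerA.
Qed.
Lemma dual_endo_eltE (e : mhom DA DA) : dual_lmul (dual_endo_elt e) = e.
Proof.
have ev (phi : DA) : (phi : 'Hom(A, k^o)) (dual_endo_elt e) = (e phi : 'Hom(A, k^o)) (aone A).
  have eq : phi = \sum_(i < \dim {:A}) (phi : 'Hom(A, k^o)) (vbasis {:A})`_i *: edual i.
    apply: dualP => a; rewrite dual_sumE {1}(coord_vbasis (memvf a)) lf_sum.
    by apply: eq_bigr => i _; rewrite scale_lfunE edualE lfZ [LHS]mulrC.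
  rewrite [in RHS]eq [in RHS]lf_sum dual_sumE /dual_endo_elt lf_sum; apply: eq_bigr => i _.
  by rewrite !lfZ scale_lfunE [LHS]mulrC.
apply: mhom_inj => phi; apply: dualP => a.
by rewrite dual_lmul_appE -dual_actE ev mhomP dual_actE amul1r.
Qed.
Lemma dual_lmul_inj (a b : A) : dual_lmul a = dual_lmul b -> a = b.
Proof.
move=> e; rewrite (coord_vbasis (memvf a)) (coord_vbasis (memvf b)); apply: eq_bigr => i _.
by rewrite -!edualE -[a]amul1l -[b]amul1l -!dual_lmul_appE e.
Qed.
Lemma dual_endo_eltM (e : mhom DA DA) a : dual_endo_elt (mcomp e (dual_lmul a)) = dual_endo_elt e ** a.
Proof. by apply: dual_lmul_inj; rewrite dual_lmulM !dual_endo_eltE. Qed.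

Section Injective.
Variable J : rmod A.
Hypothesis jJ : injective_mod J.
Let n := \dim {:J}.
(** The embedding of [J] into [coind J] splits, and [coind J] is a power of DA; the components of
    the embedding and of its retraction form the analogue of a dual basis. *)
Lemma codual_basis_exists : exists (io : 'I_n -> mhom J DA) (pi : 'I_n -> mhom DA J),
  \sum_i mcomp (pi i) (io i) = mid J.
Proof.
have [r rE] := jJ (mid J) (@coind_unit_inj _ _ J).
have /choice[io ioE] (i : 'I_n) : exists io : mhom J DA,
    forall x a, (io x : 'Hom(A, k^o)) a = coord (vbasis {:J}) i (mact J x a).
  have [c cE] : exists c : 'Hom(J, k^o), forall x, c x = coord (vbasis {:J}) i x.
    by apply: lfun_of; apply: linearP.
  have H (x : J) : exists phi : 'Hom(A, k^o), forall a, phi a = c (mact J x a).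
    by apply: lfun_of => d a b; rewrite mactDr mactZr lfD lfZ.
  have [F FE] := choice H.
  have lF : linear (F : J -> DA).
    by move=> d x y; apply: dualP => a; rewrite add_lfunE scale_lfunE !FE mactDl mactZl lfD lfZ.
  have aF x a : F (mact J x a) = mact DA (F x) a.
    by apply: dualP => b; rewrite dual_actE !FE mactM.
  by exists (mk_mhom lF aF) => x a; rewrite mk_mhomE FE cE.
have /choice[pi piE] (i : 'I_n) : exists pi : mhom DA (coind J),
    forall (phi : DA) a, (pi phi : 'Hom(A, J)) a = (phi : 'Hom(A, k^o)) a *: (vbasis {:J})`_i.
  have H (phi : DA) : exists u : 'Hom(A, J), forall a, u a = (phi : 'Hom(A, k^o)) a *: (vbasis {:J})`_i.
    by apply: lfun_of => d a b; rewrite lfD lfZ scalerDl scalerA.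
  have [F FE] := choice H.
  have lF : linear (F : DA -> coind J).
    by move=> d x y; apply: coindP => a; rewrite add_lfunE scale_lfunE !FE add_lfunE scale_lfunE scalerDl scalerA.
  have aF x a : F (mact DA x a) = mact (coind J) (F x) a.
    by apply: coindP => b; rewrite coind_actE !FE dual_actE.
  by exists (mk_mhom lF aF) => x a; rewrite mk_mhomE FE.
exists io, (fun i => mcomp r (pi i)).
under eq_bigr do rewrite -mcompA.
transitivity (mcomp r (\sum_i mcomp (pi i) (io i))).
  by apply: mhom_inj => x; rewrite mcompE !mhom_sumE lf_sum; apply: eq_bigr => i _; rewrite mcompE.
rewrite -[RHS]rE; congr mcomp; apply: mhom_inj => x; rewrite mhom_sumE.
apply: coindP => a; rewrite sum_lfunE coind_unitE [RHS](coord_vbasis (memvf _)).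
by apply: eq_bigr => i _; rewrite mcompE piE ioE.
Qed.
Definition cobasis_io := sval (cid codual_basis_exists).
Definition cobasis_pi := sval (cid (svalP (cid codual_basis_exists))).
Local Notation io := cobasis_io.
Local Notation pi := cobasis_pi.
Lemma cobasisE : \sum_i mcomp (pi i) (io i) = mid J.
Proof. exact: (svalP (cid (svalP (cid codual_basis_exists)))). Qed.
Lemma cobasis_app x : \sum_i pi i (io i x) = x.
Proof. by rewrite -[RHS]midE -cobasisE mhom_sumE; apply: eq_bigr => i _; rewrite mcompE. Qed.

Let f (b : mhom (nuinv J) J) : k^o := \sum_i (io i (b (pi i : nuinv J)) : 'Hom(A, k^o)) (aone A).
Fact nuinv_theta_lin : linear f.
Proof.
move=> c x y; rewrite /f scaler_sumr -big_split; apply: eq_bigr => i _ /=.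
by rewrite mhomDE mhomZE lfD lfZ add_lfunE scale_lfunE.
Qed.
Definition nuinv_theta : 'Hom(mhom (nuinv J) J, k^o) := sval (cid (lfun_of nuinv_theta_lin)).
Lemma nuinv_thetaE (b : mhom (nuinv J) J) :
  nuinv_theta b = \sum_i (io i (b (pi i : nuinv J)) : 'Hom(A, k^o)) (aone A).
Proof. by rewrite /nuinv_theta; case: cid => g gE; apply: gE. Qed.

Lemma cobasis_expand (phi : mhom DA J) :
  \sum_i mact (nuinv J) (pi i : nuinv J) (dual_endo_elt (mcomp (io i) phi)) = phi.
Proof.
rewrite -[RHS]mcomp1m -cobasisE mcomp_suml; apply: eq_bigr => i _.
by rewrite -[LHS]/(mcomp (pi i) (dual_lmul (dual_endo_elt (mcomp (io i) phi)))) dual_endo_eltE mcompA.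
Qed.
Lemma io_expand (u : mhom J DA) (x : J) :
  \sum_i (io i (mact J x (dual_endo_elt (mcomp u (pi i)))) : 'Hom(A, k^o)) (aone A) =
  (u x : 'Hom(A, k^o)) (aone A).
Proof.
under eq_bigr => i _ do rewrite mhomP dual_act_one dual_endo_eltE.
by rewrite -[in RHS](cobasis_app x) lf_sum dual_sumE; apply: eq_bigr => i _; rewrite mcompE.
Qed.

Lemma npair_nuinv : npair nuinv_theta.
Proof.
split=> Z g h.
  have g0 i : g (pi i : nuinv J) = 0.
    apply: functional_eq0 => l.
    have H z : exists phi : 'Hom(A, k^o), forall a, phi a = l (mact Z z a).
      by apply: lfun_of => c u v; rewrite mactDr mactZr lfD lfZ.
    have [F FE] := choice H.
    have lF : linear (F : Z -> DA).
      by move=> c u v; apply: dualP => q; rewrite add_lfunE scale_lfunE !FE mactDl mactZl lfD lfZ.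
    have aF z a : F (mact Z z a) = mact DA (F z) a.
      by apply: dualP => q; rewrite dual_actE !FE mactM.
    have := h (mcomp (pi i) (mk_mhom lF aF)); rewrite nuinv_thetaE => <-.
    rewrite -{1}(cobasis_expand (pi i)) !lf_sum; apply: eq_bigr => j _.
    by rewrite mhomP !mcompE -[io j (pi i _)]mcompE -[in RHS](dual_endo_eltE (mcomp _ (pi i)))
      dual_lmul_appE amul1l mk_mhomE FE.
  apply: mhom_inj => phi; rewrite mhom0E -(cobasis_expand phi) lf_sum big1 // => i _.
  by rewrite mhomP g0 mact0l.
apply: mhom_inj => z; rewrite mhom0E -(cobasis_app (g z)) big1 // => i _.
suff -> : io i (g z) = 0 by rewrite lf0.
apply: dualP => a; rewrite zero_lfunE.
(* [phi] goes to [z a] times the element of [A] that represents the endomorphism [io i phi] of DA;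
   by [io_expand] the trace of the composite with [g] is the value of [io i (g z)] at [a]. *)
pose F (phi : nuinv J) := mact Z (mact Z z a) (dual_endo_elt (mcomp (io i) phi)).
have lF : linear F.
  by move=> c x y; rewrite /F mcompDr mcompZr dual_endo_lin mactDr mactZr.
have aF x b : F (mact (nuinv J) x b) = mact Z (F x) b.
  by rewrite /F -[mact (nuinv J) x b]/(mcomp (x : mhom DA J) (dual_lmul b)) mcompA dual_endo_eltM mactM.
have := h (@mk_mhom _ _ (nuinv J) Z F lF aF); rewrite nuinv_thetaE.
under eq_bigr => j _ do rewrite mcompE (@mk_mhomE _ _ (nuinv J) Z F) /F mhomP.
by rewrite io_expand !mhomP dual_actE amul1r.
Qed.
End Injective.

Lemma nuinv_mapE J L (f : mhom J L) (g : mhom DA J) : nuinv_map f (g : nuinv J) = mcomp f g.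
Proof. exact: (@mk_mhomE _ _ (nuinv J) (nuinv L)). Qed.
Lemma nuinv_map_comp J L M (q : mhom L M) (p : mhom J L) :
  nuinv_map (mcomp q p) = mcomp (nuinv_map q) (nuinv_map p).
Proof. by apply: mhom_inj => x; rewrite mcompE !nuinv_mapE mcompA. Qed.
Lemma nuinv_map0 J L : nuinv_map (0 : mhom J L) = 0.
Proof. by apply: mhom_inj => x; rewrite nuinv_mapE mcomp0l mhom0E. Qed.
Lemma nuinv_theta_nat J L (jJ : injective_mod J) (jL : injective_mod L) (u : mhom J L)
    (b : mhom (nuinv L) J) :
  nuinv_theta jJ (mcomp b (nuinv_map u)) = nuinv_theta jL (mcomp u b).
Proof.
rewrite !nuinv_thetaE.
under eq_bigr => i _ do rewrite mcompE nuinv_mapE -(cobasis_expand jL (mcomp u _)) !lf_sum dual_sumE.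
rewrite exchange_big; apply: eq_bigr => j _ /=.
rewrite mcompE -[cobasis_io jL j _]mcompE -(io_expand jJ).
apply: eq_bigr => i _; rewrite mcompA.
by rewrite -[b (mcomp _ _)]/(b (mact (nuinv L) (cobasis_pi jL j : nuinv L) _)) mhomP.
Qed.
End NuInverse.

#[global] Arguments cob : simpl never.
#[global] Arguments cd : simpl never.
#[global] Arguments chain_fun : simpl never.
#[global] Arguments chain_val : simpl never.

(** * Complexes and the derived category *)

Section IntegerFamilies.
Local Open Scope ring_scope.

Lemma int_succ_ind (Q : int -> Prop) : (forall i, Q (i + 1)) -> forall j, Q j.
Proof. by move=> h j; rewrite -(subrK 1 j). Qed.

(** Differentials and homotopies produce data in degree [i + 1], while [j - 1 + 1] is not
    convertible to [j]. The transport is harmless since proofs of equality of integers are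
    unique. *)
Lemma reindex_succ (V : int -> Type) (g : forall i, V (i + 1)) :
  exists f : forall j, V j, forall i, f (i + 1) = g i.
Proof.
have e (j : int) : (j - 1) + 1 = j by rewrite subrK.
exists (fun j => eq_rect _ V (g (j - 1)) _ (e j)) => i.
have gen m (e' : m + 1 = i + 1) : eq_rect _ V (g m) _ e' = g i.
  have em : m = i by apply: (addIr 1).
  by move: e'; rewrite em => e'; rewrite (eq_axiomK e').
exact: gen.
Qed.

Lemma dep_choice (I : Type) (V : I -> Type) (Q : forall i, V i -> Prop) :
  (forall i, exists x, Q i x) -> exists f : forall i, V i, forall i, Q i (f i).
Proof. by move=> h; exists (fun i => sval (cid (h i))) => i; case: cid. Qed.

(** The relation holds for [v0] above a bounded range and for any values below it, so finitely many
    corrections, each in a single degree, turn [v0] into the required family. *)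
Lemma descending_choice (V : int -> Type) (R : forall i, V i -> V (i + 1) -> Prop)
    (v0 : forall i, V i) (n : nat) :
  (forall i, n%:Z <= i -> R i (v0 i) (v0 (i + 1))) ->
  (forall i a b, i < - n%:Z -> R i a b) ->
  (forall i b c, R (i + 1) b c -> exists a, R i a b) ->
  exists v : forall i, V i, forall i, R i (v i) (v (i + 1)).
Proof.
move=> hi lo step.
suff [v hv] : exists v : forall i, V i, forall i, n%:Z - (n + n)%:Z <= i -> R i (v i) (v (i + 1)).
  by exists v => i; have [/lo|] := ltrP i (- n%:Z); [apply | move=> h; apply: hv; lia].
elim: (n + n)%N => [|m [v hv]]; first by exists v0 => i h; apply: hi; lia.
pose i0 := n%:Z - m.+1%:Z.
have [a ha] := step i0 _ _ (hv (i0 + 1) ltac:(rewrite /i0; lia)).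
exists (dfwith v a) => i ih.
have [ei|ne] := eqVneq i0 i; last first.
  have ne' : i0 != i + 1 by move: ne ih; rewrite /i0; lia.
  by rewrite (dfwith_out _ _ ne) (dfwith_out _ _ ne'); apply: hv; move: ne ih; rewrite /i0; lia.
have ne' : i0 != i0 + 1 by lia.
by rewrite -ei dfwith_in (dfwith_out _ _ ne').
Qed.

Lemma ascending_choice (V : int -> Type) (R : forall i, V i -> V (i + 1) -> Prop)
    (v0 : forall i, V i) (n : nat) :
  (forall i, i <= - n%:Z -> R i (v0 i) (v0 (i + 1))) ->
  (forall i a b, n%:Z < i -> R i a b) ->
  (forall i a b, R i a b -> exists c, R (i + 1) b c) ->
  exists v : forall i, V i, forall i, R i (v i) (v (i + 1)).
Proof.
move=> lo hi step.
suff [v hv] : exists v : forall i, V i, forall i, i <= - n%:Z + (n + n)%:Z -> R i (v i) (v (i + 1)).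
  by exists v => i; have [/hi|] := ltrP n%:Z i; [apply | move=> h; apply: hv; lia].
elim: (n + n)%N => [|m [v hv]]; first by exists v0 => i h; apply: lo; lia.
pose i0 := - n%:Z + m%:Z.
have [c hc] := step i0 _ _ (hv i0 ltac:(rewrite /i0; lia)).
exists (dfwith v c) => i ih.
have [ei|ne] := eqVneq (i0 + 1) i.
  have ne' : i0 + 1 + 1 != i0 + 1 by lia.
  by rewrite -ei dfwith_in (dfwith_out _ _ ne').
have ne1 : i0 + 1 + 1 != i by move: ih; rewrite /i0; lia.
have ne2 : i0 + 1 + 1 != i + 1 by move: ne ih; rewrite /i0; lia.
by rewrite (dfwith_out _ _ ne1) (dfwith_out _ _ ne2); apply: hv; move: ne ih; rewrite /i0; lia.
Qed.
End IntegerFamilies.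

Section ChainComplexes.
Local Open Scope ring_scope.
Variables (k : fieldType) (A : fdAlgType k).
Implicit Types (W X Y Z : cplx A) (M N : rmod A).

Lemma chainE X Y (f : chain_map X Y) i x : f (i + 1) (cd X i x) = cd Y i (f i x).
Proof. by rewrite -!mcompE chainP. Qed.
Lemma cddE X i x : cd X (i + 1) (cd X i x) = 0.
Proof. by rewrite -mcompE cdd mhom0E. Qed.
Lemma chain_compE X Y Z (g : chain_map Y Z) (f : chain_map X Y) i x :
  chain_comp g f i x = g i (f i x).
Proof. by rewrite mcompE. Qed.
Lemma chainDE X Y (f g : chain_map X Y) i x : (f + g : chain_map X Y) i x = f i x + g i x.
Proof. exact: mhomDE. Qed.
Lemma chainZE X Y c (f : chain_map X Y) i x : (c *: f : chain_map X Y) i x = c *: f i x.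
Proof. exact: mhomZE. Qed.
Lemma chainNE X Y (f : chain_map X Y) i x : (- f : chain_map X Y) i x = - f i x.
Proof. exact: mhomNE. Qed.
Lemma chainBE X Y (f g : chain_map X Y) i x : (f - g : chain_map X Y) i x = f i x - g i x.
Proof. by rewrite chainDE chainNE. Qed.
Lemma chain_ext X Y (f g : chain_map X Y) : (forall i x, f i x = g i x) -> f = g.
Proof. by move=> h; apply: chain_inj => i; apply: mhom_inj => x; apply: h. Qed.
Lemma shift_dE X i (x : X (i + 1)) : cd (shift X) i x = - cd X (i + 1) x :> X (i + 1 + 1).
Proof. exact: mhomNE. Qed.

Lemma nullP X Y (f : chain_map X Y) : nullhomotopic f <->
  exists h : forall i, mhom (X (i + 1)) (Y i),
    forall i x, f (i + 1) x = cd Y i (h i x) + h (i + 1) (cd X (i + 1) x).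
Proof.
split=> -[h hE]; exists h => i; first by move=> x; rewrite hE mhomDE !mcompE.
by apply: mhom_inj => x; rewrite hE mhomDE !mcompE.
Qed.
Lemma nullD X Y (f g : chain_map X Y) : nullhomotopic f -> nullhomotopic g -> nullhomotopic (f + g).
Proof.
move=> /nullP[h hE] /nullP[h' hE']; apply/nullP; exists (fun i => h i + h' i) => i x.
by rewrite chainDE hE hE' !mhomDE lfD addrACA.
Qed.
Lemma null_compl X Y Z (g : chain_map Y Z) (f : chain_map X Y) :
  nullhomotopic f -> nullhomotopic (chain_comp g f).
Proof.
move=> /nullP[h hE]; apply/nullP; exists (fun i => mcomp (g i) (h i)) => i x.
by rewrite chain_compE hE !mcompE lfD chainE.
Qed.
Lemma null_compr X Y Z (g : chain_map Y Z) (f : chain_map X Y) :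
  nullhomotopic g -> nullhomotopic (chain_comp g f).
Proof.
move=> /nullP[h hE]; apply/nullP; exists (fun i => mcomp (h i) (f (i + 1))) => i x.
by rewrite chain_compE hE !mcompE chainE.
Qed.

Definition acyclic X := forall i (x : X (i + 1)), cd X (i + 1) x = 0 -> exists y, x = cd X i y.
Definition proj_cplx X := forall i, projective (X i).
Definition inj_cplx X := forall i, injective_mod (X i).

(** The homotopy is built from high degrees downwards: once [b] satisfies the relation in the next
    degree, [f - b d] takes values in cycles, hence in boundaries, and lifts along the differential
    of [Y]. *)
Lemma null_of_proj X Y (f : chain_map X Y) : proj_cplx X -> acyclic Y -> nullhomotopic f.
Proof.
move=> pX aY; have [n hn] := cbounded X.
pose R i (h : mhom (X (i + 1)) (Y i)) (h' : mhom (X (i + 1 + 1)) (Y (i + 1))) :=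
  f (i + 1) = mcomp (cd Y i) h + mcomp h' (cd X (i + 1)).
have zR i a b : mzero (X (i + 1)) -> R i a b by move=> z; rewrite /R [RHS]mzero_hom_from // [LHS]mzero_hom_from.
have [i ni|i a b ni|i b c Rbc|h hE] := @descending_choice _ R (fun=> 0) n.+1; last by exists h.
- by apply: zR; apply: hn; lia.
- by apply: zR; apply: hn; lia.
have [|a aE] := @proj_lift _ _ (X (i + 1)) _ _ (cd Y i) (f (i + 1) - mcomp b (cd X (i + 1))) (pX _).
  move=> x; rewrite mhomBE mcompE.
  have [|y yE] := aY i (f (i + 1) x - b (cd X (i + 1) x)); last by exists y.
  rewrite lfB -chainE; have := mhom_app (cd X (i + 1) x) Rbc.
  by rewrite mhomDE !mcompE cddE lf0 addr0 => ->; rewrite subrr.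
by exists a; rewrite /R aE subrK.
Qed.

Lemma null_of_inj X Y (f : chain_map X Y) : acyclic X -> inj_cplx Y -> nullhomotopic f.
Proof.
move=> aX jY; have [n hn] := cbounded Y.
pose R i (h : mhom (X (i + 1)) (Y i)) (h' : mhom (X (i + 1 + 1)) (Y (i + 1))) :=
  f (i + 1) = mcomp (cd Y i) h + mcomp h' (cd X (i + 1)).
have zR i a b : mzero (Y (i + 1)) -> R i a b by move=> z; rewrite /R [RHS]mzero_hom_to // [LHS]mzero_hom_to.
have [i ni|i a b ni|i a b Rab|h hE] := @ascending_choice _ R (fun=> 0) n.+2; last by exists h.
- by apply: zR; apply: hn; lia.
- by apply: zR; apply: hn; lia.
have [|c cE] := @inj_extend _ _ (Y (i + 1 + 1)) _ _ (cd X (i + 1 + 1)) (f (i + 1 + 1) - mcomp (cd Y (i + 1)) b) (jY _).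
  move=> x /aX[y ->]; rewrite mhomBE mcompE chainE -lfB.
  by have := mhom_app y Rab; rewrite mhomDE !mcompE => ->; rewrite addrK cddE.
by exists c; rewrite /R cE [RHS]addrC subrK.
Qed.

Section Cone.
Variables (X Y : cplx A) (f : chain_map X Y).
Definition cone_ob (i : int) : rmod A := dsum_mod (X (i + 1)) (Y i).
Definition cone_d i : mhom (cone_ob i) (cone_ob (i + 1)) :=
  col_mhom (row_mhom (- cd X (i + 1)) 0) (row_mhom (f (i + 1)) (cd Y i)).
Lemma cone_dE i x : cone_d i x = (- cd X (i + 1) x.1, f (i + 1) x.1 + cd Y i x.2).
Proof. by rewrite col_mhomE !row_mhomE mhom0E addr0 mhomNE. Qed.
Fact cone_dd i : mcomp (cone_d (i + 1)) (cone_d i) = 0.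
Proof.
apply: mhom_inj => x; rewrite mcompE !cone_dE /= mhom0E; congr pair.
  by rewrite lfN cddE !oppr0.
by rewrite lfN lfD chainE cddE addr0 addNr.
Qed.
Fact cone_bounded :
  exists n : nat, forall i : int, (n < absz i)%N -> forall x : cone_ob i, x = 0.
Proof.
have [n hn] := cbounded X; have [m hm] := cbounded Y.
exists (n + m + 1)%N => i hi [x y]; rewrite (hn (i + 1) _ x) ?(hm i _ y) //; lia.
Qed.
Definition cone : cplx A := Cplx cone_dd cone_bounded.
Lemma cone_cdE i (x : cone i) : cd cone i x = (- cd X (i + 1) x.1, f (i + 1) x.1 + cd Y i x.2).
Proof. exact: cone_dE. Qed.

Fact cincl_proof : @is_chain_map k A Y cone (fun i => dinr _ _).
Proof.
move=> i; apply: mhom_inj => y; rewrite !mcompE !dinrE cone_cdE /=.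
by rewrite !lf0 oppr0 add0r.
Qed.
Definition cincl : chain_map Y cone := mk_chain cincl_proof.
Lemma cinclE i y : cincl i y = (0, y). Proof. exact: dinrE. Qed.
Fact cproj_proof : @is_chain_map k A cone (shift X) (fun i => dfst _ _).
Proof. by move=> i; apply: mhom_inj => y; rewrite !mcompE !dfstE cone_cdE shift_dE. Qed.
Definition cproj : chain_map cone (shift X) := mk_chain cproj_proof.
Lemma cprojE i (x : cone i) : cproj i x = x.1. Proof. exact: dfstE. Qed.

Lemma cincl_null : nullhomotopic (chain_comp cincl f).
Proof.
apply/nullP; exists (fun i => dinl _ _) => i x; rewrite chain_compE cinclE !dinlE cone_cdE /=.
by congr pair; rewrite /= ?addNr // lf0 !addr0.
Qed.
Lemma cproj_null : nullhomotopic (chain_comp (shift_map f) cproj).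
Proof.
apply/nullP; exists (fun i => dsnd _ _) => i x.
by rewrite chain_compE cprojE !dsndE shift_dE cone_cdE /= [RHS]addrC addrK.
Qed.

Variable Z : cplx A.

(** This and the following lemmas are the exactness of Hom along X -> Y -> cone -> X[1], up to
    homotopy. Each time the components of a null-homotopy are the missing chain map and the missing
    homotopy. *)
Lemma cone_extend (u : chain_map Y Z) : nullhomotopic (chain_comp u f) ->
  exists c : chain_map cone Z, chain_comp c cincl = u.
Proof.
case/nullP=> h hE.
have cP : @is_chain_map k A cone Z (fun i => row_mhom (h i) (u i)).
  move=> i; apply: mhom_inj => x; rewrite !mcompE !row_mhomE cone_cdE /=.
  by rewrite !lfD lfN -(chain_compE u f) hE chainE [LHS]addrC addrAC addrK.
exists (mk_chain cP); apply: chain_ext => i x.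
by rewrite chain_compE cinclE -[LHS]/(row_mhom (h i) (u i) (0, x)) row_mhomE lf0 add0r.
Qed.

Lemma cone_lift (u : chain_map Z Y) : nullhomotopic (chain_comp cincl u) ->
  exists t : chain_map Z X, nullhomotopic (u - chain_comp f t).
Proof.
case/nullP=> h hE.
pose a i := mcomp (dfst _ _) (h i) : mhom (Z (i + 1)) (X (i + 1)).
pose b i := mcomp (dsnd _ _) (h i) : mhom (Z (i + 1)) (Y i).
have hab i z : h i z = (a i z, b i z) by rewrite !mcompE dfstE dsndE; case: (h i z).
have [t tE] := @reindex_succ (fun j => mhom (Z j) (X j)) a.
have H i z : a (i + 1) (cd Z (i + 1) z) = cd X (i + 1) (a i z) /\
    u (i + 1) z = f (i + 1) (a i z) + cd Y i (b i z) + b (i + 1) (cd Z (i + 1) z).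
  have := hE i z; rewrite chain_compE cinclE !hab cone_cdE /= => -[/= e1 e2]; split=> //.
  by apply/subr0_eq; rewrite [LHS]addrC.
have tP : is_chain_map t.
  apply: int_succ_ind => i; apply: mhom_inj => z; rewrite !mcompE !tE.
  by have [] := H i z.
exists (mk_chain tP); apply/nullP; exists b => i z.
have [_] := H i z; rewrite chainBE chain_compE -[mk_chain tP (i + 1)]/(t (i + 1)) tE => ->.
by rewrite -[X in X - _]addrA [LHS]addrC addKr.
Qed.

Lemma cone_desc_null (c : chain_map Z cone) : nullhomotopic (chain_comp cproj c) ->
  exists w : chain_map Z Y, nullhomotopic (c - chain_comp cincl w).
Proof.
case/nullP=> h hE.
pose c2 i := mcomp (dsnd _ _) (c i) : mhom (Z i) (Y i).
have h1 i z : (c (i + 1) z).1 = - cd X (i + 1) (h i z) + h (i + 1) (cd Z (i + 1) z).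
  by rewrite -cprojE -(chain_compE cproj c) hE shift_dE.
have dc2 i z : (c (i + 1) (cd Z i z)).2 = f (i + 1) (c i z).1 + cd Y i (c i z).2.
  by rewrite chainE cone_cdE.
have [w wE] := @reindex_succ (fun j => mhom (Z j) (Y j)) (fun i => c2 (i + 1) - mcomp (f (i + 1)) (h i)).
have wP : is_chain_map w.
  apply: int_succ_ind => i; apply: mhom_inj => z; rewrite !mcompE !wE !mhomBE !mcompE !dsndE dc2 h1.
  rewrite !(lfD, lfN) -chainE.
  by rewrite [X in X - _]addrAC addrK [LHS]addrC.
exists (mk_chain wP); apply/nullP; exists (fun i => mcomp (dinl _ _) (h i)) => i z.
rewrite chainBE chain_compE cinclE -[mk_chain wP (i + 1)]/(w (i + 1)) wE mhomBE !mcompE dsndE !dinlE cone_cdE.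
have e : c (i + 1) z = ((c (i + 1) z).1, (c (i + 1) z).2) by case: (c (i + 1) z).
rewrite [X in X - _]e h1; congr pair; first exact: subr0.
by rewrite lf0 !addr0 -[LHS]/(_ - _) opprB [LHS]addrC subrK.
Qed.

Lemma cone_factor (c : chain_map cone Z) : nullhomotopic (chain_comp c cincl) ->
  exists g : chain_map (shift X) Z, nullhomotopic (c - chain_comp g cproj).
Proof.
case/nullP=> h hE.
pose g i : mhom (shift X i) (Z i) := mcomp (c i) (dinl _ _) - mcomp (h i) (f (i + 1)).
have gE i x : g i x = c i (x, 0) - h i (f (i + 1) x) by rewrite mhomBE !mcompE dinlE.
have gP : is_chain_map g.
  move=> i; apply: mhom_inj => x; rewrite !mcompE !gE shift_dE lfB -chainE cone_cdE /= lf0 addr0.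
  have -> : (- cd X (i + 1) x, f (i + 1) x) = (- cd X (i + 1) x, 0) + cincl (i + 1) (f (i + 1) x).
    by rewrite cinclE; congr pair; rewrite /= ?addr0 ?add0r.
  rewrite lfD -(chain_compE c) hE !lfN opprK -chainE.
  by rewrite -[RHS]addrA; congr (_ + _); rewrite [X in _ = X - _]addrC addrK.
exists (mk_chain gP); apply/nullP; exists (fun i => mcomp (h i) (dsnd _ _)) => i x.
rewrite chainBE chain_compE cprojE -[mk_chain gP (i + 1)]/(g (i + 1)) gE !mcompE !dsndE cone_cdE /=.
have -> : x = (x.1, 0) + cincl (i + 1) x.2.
  by rewrite cinclE; case: x => x y; congr pair; rewrite /= ?addr0 ?add0r.
rewrite lfD -(chain_compE c) hE cinclE /= addr0 add0r lfD.
move: (c _ _) (cd Z i _) (h _ (cd Y _ _)) (h _ (f _ _)) => a d e u.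
by rewrite opprB [LHS]addrC [LHS]addrA subrK [LHS]addrCA.
Qed.

Lemma cproj_factor (u : chain_map (shift X) Z) : nullhomotopic (chain_comp u cproj) ->
  exists g : chain_map (shift Y) Z, nullhomotopic (u - chain_comp g (shift_map f)).
Proof.
case/nullP=> h hE.
pose g i : mhom (shift Y i) (Z i) := mcomp (h i) (dinr _ _).
have gE i y : g i y = h i (0, y) by rewrite mcompE dinrE.
have gP : is_chain_map g.
  move=> i; apply: mhom_inj => y; rewrite !mcompE !dinrE shift_dE.
  have := hE i (0, y); rewrite chain_compE cprojE cone_cdE /= !lf0 oppr0 add0r => e.
  have -> : (0, - cd Y (i + 1) y) = - (0, cd Y (i + 1) y) :> cone (i + 1 + 1).
    by congr pair; rewrite /= oppr0.
  by rewrite lfN; apply/eqP; rewrite eq_sym -addr_eq0 e.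
exists (mk_chain gP); apply/nullP; exists (fun i => mcomp (h i) (dinl _ _)) => i x.
have e := hE i (x, 0); rewrite chain_compE cprojE cone_cdE /= lf0 addr0 in e.
rewrite chainBE chain_compE -[mk_chain gP (i + 1)]/(g (i + 1)) gE !mcompE !dinlE shift_dE e.
rewrite -addrA -lfB; congr (_ + h _ _).
by congr pair; rewrite /= ?subr0 ?subrr.
Qed.
End Cone.
End ChainComplexes.

(** * Quasi-isomorphisms, short exact sequences of complexes and the inverse shift *)

Section QuasiIsomorphisms.
Local Open Scope ring_scope.
Variables (k : fieldType) (A : fdAlgType k).
Implicit Types (W X Y Z : cplx A) (M N : rmod A).

Lemma acyclic_cone X Y (f : chain_map X Y) : quasi_iso f -> acyclic (cone f).
Proof.
move=> qf i [x y]; rewrite cone_cdE /= => -[/eqP]; rewrite oppr_eq0 => /eqP dx e.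
have [|x1 x1E] := (qf (i + 1)).1 x (- y) dx; first by apply/eqP; rewrite lfN -addr_eq0 e.
have [|x2 [y2 [dx2 e2]]] := (qf i).2 (f (i + 1) x1 + y); first by rewrite lfD -chainE -x1E.
exists (- (x1 - x2), y2); rewrite cone_cdE /=; congr pair.
  by rewrite lfN opprK lfB dx2 subr0.
have -> : cd Y i y2 = f (i + 1) x1 + y - f (i + 1) x2 by rewrite e2 [X in X - _]addrC addrK.
by rewrite lfN lfB [X in _ = _ + X]addrAC addrA addNr add0r.
Qed.

Lemma qis_cincl X Y (f : chain_map X Y) : acyclic X -> quasi_iso (cincl f).
Proof.
move=> aX i; split=> [y [x y'] dy|[x y]].
  rewrite cinclE cone_cdE /= => -[/eqP]; rewrite eq_sym oppr_eq0 => /eqP dx ->.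
  have [x' ->] := aX _ x dx; exists (f i x' + y').
  by rewrite lfD chainE.
rewrite cone_cdE /= => -[/eqP]; rewrite oppr_eq0 => /eqP dx e.
have [x' x'E] := aX _ x dx; exists (y + f (i + 1) x'), (- x', 0).
split; first by rewrite lfD -chainE -x'E [LHS]addrC.
rewrite cinclE cone_cdE /=; congr pair; rewrite /= ?add0r ?lfN ?opprK //.
by rewrite lf0 addr0 addrK.
Qed.

Definition ses_cplx X Y Z (i : chain_map X Y) (q : chain_map Y Z) :=
  forall n, [/\ injective (i n), surj (q n) & forall y, q n y = 0 <-> exists x, i n x = y].

Section ShortExact.
Variables (X Y Z : cplx A) (i : chain_map X Y) (q : chain_map Y Z).
Hypothesis ex : ses_cplx i q.
Let qi n x : q n (i n x) = 0.
Proof. by have [_ _ h] := ex n; apply/h; exists x. Qed.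

Fact cone_to_coker_proof : @is_chain_map k A (cone i) Z (fun n => mcomp (q n) (dsnd _ _)).
Proof.
move=> n; apply: mhom_inj => x; rewrite !mcompE !dsndE cone_cdE /= lfD chainE.
by rewrite qi add0r.
Qed.
Definition cone_to_coker : chain_map (cone i) Z := mk_chain cone_to_coker_proof.
Lemma cone_to_cokerE n x : cone_to_coker n x = q n x.2.
Proof. by rewrite mcompE dsndE. Qed.
Lemma qis_cone_to_coker : quasi_iso cone_to_coker.
Proof.
move=> n; have [inj1 su1 ex1] := ex (n + 1); split=> [[a b] y|y dy].
  rewrite cone_cdE cone_to_cokerE /= => -[/eqP]; rewrite oppr_eq0 => /eqP da e1 e2.
  have [_ su ex0] := ex n; have [b' b'E] := su y.
  have /ex1[a' a'E] : q (n + 1) (b - cd Y n b') = 0.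
    by rewrite lfB e2 chainE b'E subrr.
  exists (a', b'); rewrite cone_cdE /= a'E subrK; congr pair.
  have [inj2 _ _] := ex (n + 1 + 1); apply: inj2; rewrite lfN chainE a'E lfB cddE subr0.
  by apply/eqP; rewrite -addr_eq0 e1.
have [b bE] := su1 y.
have [inj2 su2 ex2] := ex (n + 1 + 1).
have /ex2[a aE] : q (n + 1 + 1) (cd Y (n + 1) b) = 0 by rewrite chainE bE.
exists (- a, b), 0; rewrite cone_cdE cone_to_cokerE /= lf0 addr0 bE; split=> //.
rewrite !lfN opprK aE addNr; congr pair.
have [inj3 _ _] := ex (n + 1 + 1 + 1); apply: inj3.
by rewrite lf0 chainE aE cddE.
Qed.

Fact shift_to_cone_proof : @is_chain_map k A (shift X) (cone q) (fun n => mcomp (dinl _ _) (i (n + 1))).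
Proof.
move=> n; apply: mhom_inj => x; rewrite !mcompE !dinlE cone_cdE shift_dE /= lfN (chainE i).
by rewrite qi lf0 addr0.
Qed.
Definition shift_to_cone : chain_map (shift X) (cone q) := mk_chain shift_to_cone_proof.
Lemma shift_to_coneE n x : shift_to_cone n x = (i (n + 1) x, 0).
Proof. by rewrite mcompE dinlE. Qed.
Lemma qis_shift_to_cone : quasi_iso shift_to_cone.
Proof.
move=> n; have [inj1 su1 ex1] := ex (n + 1); have [inj2 su2 ex2] := ex (n + 1 + 1).
split=> [x [y z]|[y z]].
  rewrite shift_dE shift_to_coneE cone_cdE /= => dx -[e1 e2].
  have [_ su ex0] := ex n; have [y' y'E] := su z.
  have /ex1[x' x'E] : q (n + 1) (y + cd Y n y') = 0.
    by rewrite lfD chainE y'E -e2.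
  exists x'; apply: inj2; rewrite shift_dE lfN chainE x'E lfD cddE addr0.
  exact: e1.
rewrite cone_cdE /= => -[/eqP]; rewrite oppr_eq0 => /eqP dy e.
have [y' y'E] := su1 z.
have /ex2[x xE] : q (n + 1 + 1) (y + cd Y (n + 1) y') = 0 by rewrite lfD chainE y'E e.
exists x, (y', 0); rewrite shift_dE shift_to_coneE cone_cdE /=; split.
  have [inj3 _ _] := ex (n + 1 + 1 + 1); apply: inj3.
  by rewrite lfN lf0 chainE xE lfD dy cddE addr0 oppr0.
by congr pair; rewrite /= ?xE ?addrK // lf0 addr0 add0r y'E.
Qed.
End ShortExact.

Lemma shift_full X Y (g : chain_map (shift X) (shift Y)) : exists f : chain_map X Y, shift_map f = g.
Proof.
have [f fE] := @reindex_succ (fun j => mhom (X j) (Y j)) (fun i => g i).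
have fP : is_chain_map f.
  apply: int_succ_ind => i; apply: mhom_inj => x; rewrite !mcompE !fE.
  by have := chainE g x; rewrite !shift_dE lfN => /oppr_inj.
by exists (mk_chain fP); apply: chain_inj => i; apply: fE.
Qed.
Lemma shift_mapE X Y (f : chain_map X Y) i (x : X (i + 1)) : shift_map f i x = f (i + 1) x.
Proof. by []. Qed.
Lemma null_unshift X Y (f : chain_map X Y) : nullhomotopic (shift_map f) -> nullhomotopic f.
Proof.
case/nullP=> h hE.
have [h' h'E] := @reindex_succ (fun j => mhom (X (j + 1)) (Y j)) (fun i => - h i).
apply/nullP; exists h'; apply: int_succ_ind => i x.
have := hE i x; rewrite shift_mapE !shift_dE lfN => ->.
by rewrite !h'E !mhomNE lfN.
Qed.
Lemma shift_map_comp X Y Z (g : chain_map Y Z) (f : chain_map X Y) :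
  shift_map (chain_comp g f) = chain_comp (shift_map g) (shift_map f).
Proof. exact: chain_inj. Qed.
Lemma shift_mapB X Y (g f : chain_map X Y) : shift_map (g - f) = shift_map g - shift_map f.
Proof. exact: chain_inj. Qed.
Lemma qis_unshift X Y (f : chain_map X Y) : quasi_iso (shift_map f) -> quasi_iso f.
Proof.
move=> qf; apply: int_succ_ind => i; have [q1 q2] := qf i; split=> [x y dx fx|y dy].
  have [||x' ->] := q1 x (- y); first by rewrite shift_dE dx oppr0.
    by rewrite shift_mapE fx shift_dE lfN opprK.
  by exists (- x'); rewrite shift_dE lfN.
have [|x [y' [dx yE]]] := q2 y; first by rewrite shift_dE dy oppr0.
exists x, (- y'); split; last by rewrite yE shift_mapE shift_dE lfN.
by move/eqP: dx; rewrite shift_dE oppr_eq0 => /eqP.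
Qed.
Lemma qis_shift X Y (f : chain_map X Y) : quasi_iso f -> quasi_iso (shift_map f).
Proof.
move=> qf i; have [q1 q2] := qf (i + 1); split=> [x y dx fx|y dy].
  have [||x' ->] := q1 x (- y); first by move/eqP: dx; rewrite shift_dE oppr_eq0 => /eqP.
    by move: fx; rewrite shift_mapE shift_dE lfN.
  by exists (- x'); rewrite shift_dE lfN opprK.
have [|x [y' [dx yE]]] := q2 y; first by move/eqP: dy; rewrite shift_dE oppr_eq0 => /eqP.
exists x, (- y'); split; last by rewrite yE shift_mapE shift_dE lfN opprK.
by rewrite shift_dE dx oppr0.
Qed.

Definition chain_iso X Y (u : chain_map X Y) :=
  exists v : chain_map Y X, chain_comp u v = chain_id Y /\ chain_comp v u = chain_id X.

Lemma qis_chain_iso X Y (u : chain_map X Y) : chain_iso u -> quasi_iso u.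
Proof.
case=> v [uv vu].
have uvE i y : u i (v i y) = y by rewrite -chain_compE uv [LHS]midE.
have vuE i y : v i (u i y) = y by rewrite -chain_compE vu [LHS]midE.
move=> i; split=> [x y dx ux|y dy].
  by exists (v i y); rewrite -chainE -ux vuE.
exists (v (i + 1) y), 0; rewrite -chainE dy lf0; split=> //.
by rewrite uvE lf0 addr0.
Qed.

Lemma qis_comp X Y Z (g : chain_map Y Z) (f : chain_map X Y) :
  quasi_iso f -> quasi_iso g -> quasi_iso (chain_comp g f).
Proof.
move=> qf qg i; split=> [x z dx|z dz].
  rewrite chain_compE => gx; have [|y yE] := (qg i).1 (f (i + 1) x) z _ gx; first by rewrite -chainE dx lf0.
  exact: (qf i).1 yE.
have [y [z' [dy zE]]] := (qg i).2 z dz; have [x [y' [dx yE]]] := (qf i).2 y dy.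
exists x, (g i y' + z'); split=> //.
by rewrite zE yE chain_compE !lfD chainE addrA.
Qed.

Section Unshift.
Variable X : cplx A.
(** [X[-1]] has [X (i - 1)] in degree [i], and its differential must end in [X (i + 1 - 1)] instead
    of [X (i - 1 + 1)]; these indices are equal but not convertible. *)
Definition idx_cast i j (e : i = j) : mhom (X i) (X j) :=
  match e in _ = j return mhom (X i) (X j) with erefl => mid (X i) end.
Lemma idx_cast_d i j (e : i = j) (e' : i + 1 = j + 1) :
  mcomp (idx_cast e') (cd X i) = mcomp (cd X j) (idx_cast e).
Proof. by case: j / e e' => e'; rewrite (eq_axiomK e') mcomp1m mcompm1. Qed.
Lemma idx_castK i j (e : i = j) (e' : j = i) : mcomp (idx_cast e') (idx_cast e) = mid (X i).
Proof. by case: j / e e' => e'; rewrite (eq_axiomK e') mcomp1m. Qed.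
Lemma idx_cast_trans i j l (e : i = j) (e' : j = l) (e'' : i = l) :
  mcomp (idx_cast e') (idx_cast e) = idx_cast e''.
Proof. by case: l / e' e''; case: j / e => e''; rewrite (eq_axiomK e'') mcomp1m. Qed.
Let e1 (i : int) : i - 1 + 1 = i + 1 - 1. Proof. lia. Qed.
Definition unshift_ob i := X (i - 1).
Definition unshift_d i : mhom (unshift_ob i) (unshift_ob (i + 1)) :=
  - mcomp (idx_cast (e1 i)) (cd X (i - 1)).
Fact unshift_dd i : mcomp (unshift_d (i + 1)) (unshift_d i) = 0.
Proof.
rewrite /unshift_d mcompNl mcompNr opprK -mcompA (mcompA _ (idx_cast _)).
have e2 : i - 1 + 1 + 1 = i + 1 - 1 + 1 by lia.
by rewrite -(idx_cast_d (e1 i) e2) -(mcompA (idx_cast e2)) cdd !mcomp0.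
Qed.
Fact unshift_bounded :
  exists n : nat, forall i : int, (n < absz i)%N -> forall x : unshift_ob i, x = 0.
Proof. by have [n hn] := cbounded X; exists n.+1 => i hi; apply: hn; lia. Qed.
Definition unshift : cplx A := Cplx unshift_dd unshift_bounded.
Let e3 (i : int) : i + 1 - 1 = i. Proof. lia. Qed.
Let e4 (i : int) : i = i + 1 - 1. Proof. lia. Qed.
Fact unshift_to_proof : @is_chain_map k A (shift unshift) X (fun i => idx_cast (e3 i)).
Proof.
move=> i; have -> : cd (shift unshift) i = mcomp (idx_cast (e1 (i + 1))) (cd X (i + 1 - 1)).
  by rewrite -[LHS]/(- unshift_d (i + 1)) opprK.
have e5 : i + 1 - 1 + 1 = i + 1 by lia.
rewrite mcompA -(idx_cast_d (e3 i) e5); congr mcomp.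
by rewrite idx_cast_trans.
Qed.
End Unshift.
End QuasiIsomorphisms.

Section FunctorDifference.
Local Open Scope ring_scope.
Variables (k : fieldType) (O1 O2 : Type) (C : klcat k O1) (C' : klcat k O2).
Variables (F : O1 -> O2) (Phi : functor C C' F).
Lemma fmapZ X Y c (f : Hom C X Y) : fmap Phi (c *: f) = c *: fmap Phi f.
Proof. by have := fmap_linear Phi c f 0; rewrite fmap0 !addr0. Qed.
Lemma fmapN X Y (f : Hom C X Y) : fmap Phi (- f) = - fmap Phi f.
Proof. by rewrite -scaleN1r fmapZ scaleN1r. Qed.
Lemma fmapB X Y (f g : Hom C X Y) : fmap Phi (f - g) = fmap Phi f - fmap Phi g.
Proof. by rewrite fmapD fmapN. Qed.
End FunctorDifference.

(** * Morphisms of the derived category as fractions, and exactness of Hom along cones *)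

Section DerivedCategory.
Local Open Scope ring_scope.
Variables (k : fieldType) (A : fdAlgType k).
Implicit Types (W X Y Z : cplx A) (M N : rmod A).

Lemma unshift_exists X : exists W (u : chain_map (shift W) X),
  chain_iso u /\ forall i, mzero (X i) -> mzero (W (i + 1)).
Proof.
have e3 (i : int) : i + 1 - 1 = i by lia.
have e4 (i : int) : i = i + 1 - 1 by lia.
exists (unshift X), (mk_chain (@unshift_to_proof _ _ X)); split; last first.
  by move=> i z; rewrite /mzero -[cob _ _]/(X (i + 1 - 1)) e3.
set u := mk_chain _.
pose v i : mhom (X i) (shift (unshift X) i) := idx_cast X (e4 i).
have uv i x : u i (v i x) = x.
  by rewrite -[LHS]/(idx_cast X _ (idx_cast X _ x)) -mcompE idx_castK midE.
have vu i x : v i (u i x) = x.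
  by rewrite -[LHS]/(idx_cast X _ (idx_cast X _ x)) -mcompE idx_castK midE.
have vP : is_chain_map v.
  move=> i; apply: mhom_inj => x; rewrite !mcompE.
  by rewrite -[cd X i x in LHS](congr1 (cd X i) (uv i x)) -chainE vu.
exists (mk_chain vP); split; apply: chain_ext => i x; rewrite chain_compE [RHS]midE.
  exact: uv.
exact: vu.
Qed.

Variable D : derived A.
Local Notation Q f := (fmap (dloc D) f).
Local Notation "g <o> f" := (comp D g f) (at level 40, left associativity).

Lemma Q_comp X Y Z (g : chain_map Y Z) (f : chain_map X Y) : Q (chain_comp g f) = Q g <o> Q f.
Proof. exact: (fmap_comp (dloc D) g f). Qed.
Lemma Q_id X : Q (chain_id X) = idm D X. Proof. exact: (fmap_id (dloc D) X). Qed.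
Lemma QB X Y (f g : chain_map X Y) : Q (f - g) = Q f - Q g.
Proof. exact: (fmapB (dloc D)). Qed.
Lemma Q_null X Y (f : chain_map X Y) : nullhomotopic f -> Q f = 0.
Proof.
move=> n; apply/(dloc_eq0 D); exists X, (chain_id X); split; last by rewrite chain_compm1.
by apply: qis_chain_iso; exists (chain_id X); rewrite !chain_comp1m.
Qed.
Lemma Q_homotopic X Y (f g : chain_map X Y) : nullhomotopic (f - g) -> Q f = Q g.
Proof. by move/Q_null; rewrite QB => /subr0_eq. Qed.

Section Isom.
Variables (O : Type) (C : klcat k O).
Lemma isom_comp (x y z : O) (g : Hom C y z) (f : Hom C x y) : isom f -> isom g -> isom (comp C g f).
Proof.
case=> f' [ff' f'f] [g' [gg' g'g]]; exists (comp C f' g'); split.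
  by rewrite -compA (compA g') gg' comp1m.
by rewrite -compA (compA f) f'f comp1m.
Qed.
Lemma isom_epi (x y z : O) (f : Hom C x y) (g g' : Hom C y z) :
  isom f -> comp C g f = comp C g' f -> g = g'.
Proof.
by case=> f' [_ ff'] e; rewrite -[g]compm1 -[g']compm1 -ff' !compA e.
Qed.
Lemma isom_mono (x y z : O) (f : Hom C y z) (g g' : Hom C x y) :
  isom f -> comp C f g = comp C f g' -> g = g'.
Proof.
by case=> f' [f'f _] e; rewrite -[g]comp1m -[g']comp1m -f'f -!compA e.
Qed.
Lemma isom_factor_r (x y z : O) (f : Hom C x y) (h : Hom C x z) : isom f -> exists g, comp C g f = h.
Proof. by case=> f' [f'f _]; exists (comp C h f'); rewrite -compA f'f compm1. Qed.
Lemma isom_factor_l (x y z : O) (f : Hom C y z) (h : Hom C x z) : isom f -> exists g, comp C f g = h.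
Proof. by case=> f' [_ ff']; exists (comp C f' h); rewrite compA ff' comp1m. Qed.
Lemma iso_obj_sym (x y : O) : iso_obj C x y -> iso_obj C y x.
Proof. by case=> f [g [h1 h2]]; exists g, f. Qed.
Lemma iso_obj_trans (x y z : O) : iso_obj C x y -> iso_obj C y z -> iso_obj C x z.
Proof. by case=> f fi [g gi]; exists (comp C g f); apply: isom_comp. Qed.
Lemma iso_obj_refl (x : O) : iso_obj C x x.
Proof. by exists (idm C x), (idm C x); rewrite !comp1m. Qed.
End Isom.

Lemma fmap_isom (O1 O2 : Type) (C1 : klcat k O1) (C2 : klcat k O2) (F0 : O1 -> O2)
  (F : functor C1 C2 F0) x y (f : Hom C1 x y) : isom f -> isom (fmap F f).
Proof. by case=> g [gf fg]; exists (fmap F g); rewrite -!fmap_comp gf fg !fmap_id. Qed.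

Lemma Q_iso X Y (f : chain_map X Y) : chain_iso f -> isom (Q f).
Proof. by move=> h; apply/(dloc_isom D)/qis_chain_iso. Qed.

(** A quasi-isomorphism [s] to a termwise projective complex has a right inverse [t] up to homotopy,
    because maps from [X] to the acyclic cone of [s] are null-homotopic; the fraction [f s^-1]
    becomes [f t]. *)
Lemma Q_full_proj X Y (h : Hom D X Y) : proj_cplx X -> exists f : chain_map X Y, Q f = h.
Proof.
move=> pX; have [X' [s [f [qs e]]]] := dloc_frac h.
have [t nt] := @cone_lift _ _ _ _ s X (chain_id X) (null_of_proj _ pX (acyclic_cone qs)).
exists (chain_comp f t); rewrite Q_comp -e -compA -Q_comp -(Q_homotopic nt) Q_id.
exact: compm1.
Qed.
Lemma Q_faithful_proj X Y (f : chain_map X Y) : proj_cplx X -> Q f = 0 -> nullhomotopic f.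
Proof.
move=> pX /(dloc_eq0 D)[X' [s [qs nfs]]].
have [t nt] := @cone_lift _ _ _ _ s X (chain_id X) (null_of_proj _ pX (acyclic_cone qs)).
have -> : f = chain_comp f (chain_id X - chain_comp s t) + chain_comp (chain_comp f s) t.
  by apply: chain_ext => i x; rewrite chainDE !chain_compE chainBE !chain_compE lfB midE subrK.
by apply: nullD; [apply: null_compl | apply: null_compr].
Qed.
Lemma inj_shift X : inj_cplx X -> inj_cplx (shift X).
Proof. by move=> h i; apply: h. Qed.
Lemma Q_full_inj X Y (h : Hom D X Y) : inj_cplx Y -> exists f : chain_map X Y, Q f = h.
Proof.
move=> jY; have [X' [s [f [qs e]]]] := dloc_frac h.
have jY' := inj_shift jY.
(* The composite cone(s) -> X'[1] -> Y[1] is null-homotopic, so [f[1]] extends along [s[1]] up to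
   homotopy; the shift is removed afterwards. *)
have [g ng] := cproj_factor (null_of_inj (chain_comp (shift_map f) (cproj s)) (acyclic_cone qs) jY').
have [f' f'E] := shift_full g; exists f'.
apply: (isom_epi (dloc_isom D qs)); rewrite e -Q_comp; apply/esym/Q_homotopic/null_unshift.
by rewrite shift_mapB shift_map_comp f'E.
Qed.
(** The source of the denominator is itself a shift up to isomorphism of complexes, and a chain map
    between shifts is the shift of a chain map; so the whole fraction can be unshifted. *)
Lemma dshift_full X Y (h : Hom D (shift X) (shift Y)) : exists g : Hom D X Y, fmap (dshift D) g = h.
Proof.
have [W [s [f [qs e]]]] := dloc_frac h.
have [W' [u [ui _]]] := unshift_exists W.
have [s' s'E] := shift_full (chain_comp s u); have [f' f'E] := shift_full (chain_comp f u).
have qs' : quasi_iso s' by apply: qis_unshift; rewrite s'E; apply: qis_comp (qis_chain_iso ui) qs.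
have [g gE] := isom_factor_r (Q f') (dloc_isom D qs').
exists g; apply: (isom_epi (dloc_isom D (qis_shift qs'))).
rewrite -(dshiftE D s') -fmap_comp gE dshiftE f'E Q_comp -e -compA -Q_comp -s'E.
by rewrite dshiftE.
Qed.
Lemma dshift_faithful X Y (g : Hom D X Y) : fmap (dshift D) g = 0 -> g = 0.
Proof.
have [X' [s [f [qs e]]]] := dloc_frac g => g0.
apply: (isom_epi (dloc_isom D qs)); rewrite e comp0m.
have /(dloc_eq0 D)[W [t [qt n]]] : Q (shift_map f) = 0.
  by rewrite -dshiftE -e fmap_comp g0 comp0m.
have [W' [u [ui _]]] := unshift_exists W; have [t' t'E] := shift_full (chain_comp t u).
have qt' : quasi_iso t' by apply: qis_unshift; rewrite t'E; apply: qis_comp (qis_chain_iso ui) qt.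
apply: (isom_epi (dloc_isom D qt')); rewrite comp0m -Q_comp; apply/Q_null/null_unshift.
by rewrite shift_map_comp t'E chain_compA; apply: null_compr.
Qed.
Lemma dshift_inj X Y (g g' : Hom D X Y) : fmap (dshift D) g = fmap (dshift D) g' -> g = g'.
Proof.
by move=> e; apply/subr0_eq/dshift_faithful; rewrite fmapB e subrr.
Qed.
Lemma dshift_iso_obj X Y : iso_obj D (shift X) (shift Y) -> iso_obj D X Y.
Proof.
case=> f [g [gf fg]]; have [f' f'E] := dshift_full f; have [g' g'E] := dshift_full g.
by exists f', g'; split; apply: dshift_inj; rewrite fmap_comp f'E g'E fmap_id.
Qed.
Lemma iso_obj_shift X Y : iso_obj D X Y -> iso_obj D (shift X) (shift Y).
Proof. by case=> f fi; exists (fmap (dshift D) f); apply: fmap_isom. Qed.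
Lemma hom0_iso (O : Type) (C : klcat k O) (x x' y y' : O) : iso_obj C x x' -> iso_obj C y y' ->
  (forall h : Hom C x y, h = 0) -> forall h : Hom C x' y', h = 0.
Proof.
move=> [f [f' [_ ff']]] [g [g' [_ gg']]] h0 h.
rewrite -[h]comp1m -gg' -[h]compm1 -ff' -compA (compA g') (compA (comp C g' h)).
by rewrite -(compA g') (h0 (comp C g' (comp C h f))) comp0m compm0.
Qed.

Section DsumComplex.
Variables X Y : cplx A.
Definition dsum_d i : mhom (dsum_mod (X i) (Y i)) (dsum_mod (X (i + 1)) (Y (i + 1))) :=
  col_mhom (mcomp (cd X i) (dfst _ _)) (mcomp (cd Y i) (dsnd _ _)).
Lemma dsum_dE i x : dsum_d i x = (cd X i x.1, cd Y i x.2).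
Proof. by rewrite col_mhomE !mcompE dfstE dsndE. Qed.
Fact dsum_dd i : mcomp (dsum_d (i + 1)) (dsum_d i) = 0.
Proof. by apply: mhom_inj => x; rewrite mcompE !dsum_dE !cddE mhom0E. Qed.
Fact dsum_bounded :
  exists n : nat, forall i : int, (n < absz i)%N -> forall x : dsum_mod (X i) (Y i), x = 0.
Proof.
have [n hn] := cbounded X; have [m hm] := cbounded Y.
exists (n + m)%N => i hi [x y]; rewrite (hn i _ x) ?(hm i _ y) //; lia.
Qed.
Definition dsum_cplx : cplx A := Cplx dsum_dd dsum_bounded.
Lemma dsum_cdE i (x : dsum_cplx i) : cd dsum_cplx i x = (cd X i x.1, cd Y i x.2).
Proof. exact: dsum_dE. Qed.
End DsumComplex.

(* The homotopy pushout of X <- X' -> Y turns a right fraction into a left one. *)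
Section HomotopyPushout.
Variables (X' X Y : cplx A) (s : chain_map X' X) (f : chain_map X' Y).
Fact pushout_map_proof : @is_chain_map k A X' (dsum_cplx X Y) (fun i => col_mhom (s i) (- f i)).
Proof.
move=> i; apply: mhom_inj => x; rewrite !mcompE dsum_cdE !col_mhomE.
by rewrite !mhomNE lfN !chainE.
Qed.
Definition pushout_map : chain_map X' (dsum_cplx X Y) := mk_chain pushout_map_proof.
Definition pushout := cone pushout_map.
Lemma pushout_dE i (z : pushout i) : cd pushout i z =
  (- cd X' (i + 1) z.1, (s (i + 1) z.1 + cd X i z.2.1, - f (i + 1) z.1 + cd Y i z.2.2)).
Proof.
rewrite cone_cdE dsum_cdE.
by rewrite -[pushout_map (i + 1)]/(col_mhom (s (i + 1)) (- f (i + 1))) col_mhomE mhomNE.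
Qed.
Fact pushout_l_proof : @is_chain_map k A X pushout (fun i => mcomp (dinr _ _) (dinl _ _)).
Proof.
move=> i; apply: mhom_inj => x; rewrite !mcompE !dinlE !dinrE pushout_dE /=.
by rewrite !lf0 !oppr0 ?addr0 ?add0r.
Qed.
Definition pushout_l : chain_map X pushout := mk_chain pushout_l_proof.
Fact pushout_r_proof : @is_chain_map k A Y pushout (fun i => mcomp (dinr _ _) (dinr _ _)).
Proof.
move=> i; apply: mhom_inj => x; rewrite !mcompE !dinrE pushout_dE /=.
by rewrite !lf0 !oppr0 ?addr0 ?add0r.
Qed.
Definition pushout_r : chain_map Y pushout := mk_chain pushout_r_proof.
Lemma pushout_lE i x : pushout_l i x = (0, (x, 0)). Proof. by rewrite mcompE dinlE dinrE. Qed.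
Lemma pushout_rE i y : pushout_r i y = (0, (0, y)). Proof. by rewrite mcompE !dinrE. Qed.
Lemma pushout_homotopy : nullhomotopic (chain_comp pushout_l s - chain_comp pushout_r f).
Proof.
apply/nullP; exists (fun i => dinl _ _) => i x.
rewrite chainBE !chain_compE pushout_lE pushout_rE !dinlE pushout_dE /= !lf0 !addr0.
by congr (_, (_, _)); rewrite /= ?subr0 ?sub0r // ?addNr // addr0.
Qed.
Lemma qis_pushout_r : quasi_iso s -> quasi_iso pushout_r.
Proof.
move=> qs i; split=> [y [x' [x y']] dy|[x' [x y]]].
  rewrite pushout_rE pushout_dE /= => -[/eqP]; rewrite eq_sym oppr_eq0 => /eqP dx' e1 e2.
  have [|x'' x''E] := (qs i).1 x' (- x) dx'.
    by apply/eqP; rewrite lfN -addr_eq0 -e1.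
  exists (y' - f i x''); rewrite lfB -chainE -x''E e2; exact: addrC.
rewrite pushout_dE /= => -[/eqP]; rewrite oppr_eq0 => /eqP dx' e1 e2.
have [|x1 x1E] := (qs (i + 1)).1 x' (- x) dx'.
  by apply/eqP; rewrite lfN -addr_eq0 e1.
have [|x2 [x3 [dx2 e3]]] := (qs i).2 (s (i + 1) x1 + x); first by rewrite lfD -chainE -x1E.
exists (y - f (i + 1) (x1 - x2)), (- (x1 - x2), (x3, 0)); split.
  rewrite lfB -chainE lfB -x1E dx2 subr0.
  by rewrite [LHS]addrC e2.
rewrite pushout_rE pushout_dE /=; congr (_, (_, _)); rewrite /=.
- by rewrite add0r lfN opprK lfB dx2 subr0.
- rewrite add0r lfN lfB.
  have -> : cd X i x3 = s (i + 1) x1 + x - s (i + 1) x2 by rewrite e3 [X in X - _]addrC addrK.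
  by rewrite [X in _ = _ + X]addrAC addrA addNr add0r.
by rewrite lfN opprK lf0 addr0 subrK.
Qed.
End HomotopyPushout.

Lemma left_frac X Y (h : Hom D X Y) : exists Y' (t : chain_map Y Y') (g : chain_map X Y'),
  quasi_iso t /\ Q t <o> h = Q g.
Proof.
have [X' [s [f [qs e]]]] := dloc_frac h.
exists (pushout s f), (pushout_r s f), (pushout_l s f); split; first exact: qis_pushout_r.
apply: (isom_epi (dloc_isom D qs)); rewrite -compA e -!Q_comp.
by apply/esym/Q_homotopic/pushout_homotopy.
Qed.
Lemma left_null X Y (f : chain_map X Y) : Q f = 0 ->
  exists Y' (t : chain_map Y Y'), quasi_iso t /\ nullhomotopic (chain_comp t f).
Proof.
case/(dloc_eq0 D)=> X' [s [qs nfs]]; have [c cE] := cone_extend nfs.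
exists (cone c), (cincl c); split; first exact/qis_cincl/acyclic_cone.
by rewrite -cE chain_compA; apply/null_compr/cincl_null.
Qed.

Section Exactness.
Variables (X Y : cplx A) (f : chain_map X Y).

(** The derived category comes without a triangulation. A morphism is written as a fraction, the
    denominator is refined until the vanishing composite is null-homotopic, and the chain-level
    statement is applied. Maps to a cone use right fractions, maps from a cone left ones. *)
Lemma hom_to_cone W (g : Hom D W (cone f)) : Q (cproj f) <o> g = 0 ->
  exists w : Hom D W Y, g = Q (cincl f) <o> w.
Proof.
have [W' [s [c [qs e]]]] := dloc_frac g => g0.
have /(dloc_eq0 D)[V [t [qt n]]] : Q (chain_comp (cproj f) c) = 0.
  by rewrite Q_comp -e compA g0 comp0m.
rewrite -chain_compA in n; have [w nw] := cone_desc_null n.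
have qst := dloc_isom D (qis_comp qt qs).
have [w' w'E] := isom_factor_r (Q w) qst; exists w'; apply: (isom_epi qst).
rewrite -compA w'E -Q_comp -(Q_homotopic nw) !Q_comp -e.
exact: compA.
Qed.
Lemma hom_to_cone0 W (g : Hom D W Y) : Q (cincl f) <o> g = 0 -> exists w : Hom D W X, g = Q f <o> w.
Proof.
have [W' [s [c [qs e]]]] := dloc_frac g => g0.
have /(dloc_eq0 D)[V [t [qt n]]] : Q (chain_comp (cincl f) c) = 0.
  by rewrite Q_comp -e compA g0 comp0m.
rewrite -chain_compA in n; have [w nw] := cone_lift n.
have qst := dloc_isom D (qis_comp qt qs).
have [w' w'E] := isom_factor_r (Q w) qst; exists w'; apply: (isom_epi qst).
rewrite -compA w'E -Q_comp -(Q_homotopic nw) !Q_comp -e.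
exact: compA.
Qed.
Lemma hom_from_cone Z (g : Hom D (cone f) Z) : g <o> Q (cincl f) = 0 ->
  exists w : Hom D (shift X) Z, g = w <o> Q (cproj f).
Proof.
have [Z' [s [c [qs e]]]] := left_frac g => g0.
have /left_null[V [t [qt n]]] : Q (chain_comp c (cincl f)) = 0.
  by rewrite Q_comp -e -compA g0 compm0.
rewrite chain_compA in n; have [w nw] := cone_factor n.
have qst := dloc_isom D (qis_comp qs qt).
have [w' w'E] := isom_factor_l (Q w) qst; exists w'; apply: (isom_mono qst).
rewrite compA w'E -Q_comp -(Q_homotopic nw) !Q_comp -e.
by rewrite -compA.
Qed.
Lemma hom_from_cone0 Z (g : Hom D (shift X) Z) : g <o> Q (cproj f) = 0 ->
  exists w : Hom D (shift Y) Z, g = w <o> Q (shift_map f).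
Proof.
have [Z' [s [c [qs e]]]] := left_frac g => g0.
have /left_null[V [t [qt n]]] : Q (chain_comp c (cproj f)) = 0.
  by rewrite Q_comp -e -compA g0 compm0.
rewrite chain_compA in n; have [w nw] := cproj_factor n.
have qst := dloc_isom D (qis_comp qs qt).
have [w' w'E] := isom_factor_l (Q w) qst; exists w'; apply: (isom_mono qst).
rewrite compA w'E -Q_comp -(Q_homotopic nw) !Q_comp -e.
by rewrite -compA.
Qed.
End Exactness.
End DerivedCategory.

(** * Projective and injective resolutions over a hereditary algebra *)

Section Resolutions.
Local Open Scope ring_scope.
Variables (k : fieldType) (A : fdAlgType k).
Implicit Types (W X Y Z : cplx A) (M N : rmod A).

Lemma sub_cplx Y (S : forall i, Y i -> Prop) :
  (forall i, exists K (j : mhom K (Y i)), injective j /\ forall y, S i y <-> exists x, j x = y) ->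
  (forall i y, S i y -> S (i + 1) (cd Y i y)) ->
  exists X (j : chain_map X Y), forall i, injective (j i) /\ forall y, S i y <-> exists x, j i x = y.
Proof.
move=> h st.
have {h}[K hK] := dep_choice h.
have {hK}[j hj] := dep_choice hK.
have [i|d dE] := @dep_choice _ (fun i => mhom (K i) (K (i + 1)))
    (fun i d => mcomp (j (i + 1)) d = mcomp (cd Y i) (j i)).
  apply: factor_inj; first by have [] := hj (i + 1).
  move=> x; have [_ e] := hj (i + 1); apply/e; rewrite mcompE; apply: st.
  by have [_ e'] := hj i; apply/e'; exists x.
have dd i : mcomp (d (i + 1)) (d i) = 0.
  have [ij _] := hj (i + 1 + 1); apply: (inj_cancel ij).
  by rewrite mcompA dE -mcompA dE mcompA cdd mcomp0l mcomp0.
have bd : exists n : nat, forall i : int, (n < absz i)%N -> forall x : K i, x = 0.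
  have [n hn] := cbounded Y; exists n => i ni x; have [ij _] := hj i.
  by apply: ij; rewrite lf0; apply: hn ni _.
by exists (Cplx dd bd), (@mk_chain _ _ (Cplx dd bd) Y j dE) => i; apply: hj.
Qed.

Lemma quot_cplx X Y (j : chain_map X Y) :
  exists Z (q : chain_map Y Z), forall i, surj (q i) /\ forall y, q i y = 0 <-> exists x, j i x = y.
Proof.
have [C hC] := dep_choice (fun i => cokernel_exists (j i)).
have {hC}[q hq] := dep_choice hC.
have [i|d dE] := @dep_choice _ (fun i => mhom (C i) (C (i + 1)))
    (fun i d => mcomp d (q i) = mcomp (q (i + 1)) (cd Y i)).
  have [qs qE] := hq i; apply: factor_surj qs _ => y /qE[x <-].
  by rewrite mcompE -chainE; have [_ e] := hq (i + 1); apply/e; exists (cd X i x).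
have dd i : mcomp (d (i + 1)) (d i) = 0.
  have [qs _] := hq i; apply: (surj_cancel qs).
  by rewrite -mcompA dE mcompA dE -mcompA cdd mcomp0 mcomp0l.
have bd : exists n : nat, forall i : int, (n < absz i)%N -> forall x : C i, x = 0.
  have [n hn] := cbounded Y; exists n => i ni x; have [qs _] := hq i.
  by have [y <-] := qs x; rewrite (hn i ni y) lf0.
have qP i : mcomp (q (i + 1)) (cd Y i) = mcomp (d i) (q i) by rewrite dE.
by exists (Cplx dd bd), (@mk_chain _ _ Y (Cplx dd bd) q qP) => i; apply: hq.
Qed.

Section FreeResolution.
Variable X : cplx A.
Fact free_dd i : mcomp (free_map (cd X (i + 1))) (free_map (cd X i)) = 0.
Proof. by rewrite -free_map_comp cdd free_map0. Qed.
Fact free_bounded :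
  exists n : nat, forall i : int, (n < absz i)%N -> forall x : free (X i), x = 0.
Proof. by have [n hn] := cbounded X; exists n => i /hn h; apply: free_mzero. Qed.
Definition free_cplx : cplx A := Cplx free_dd free_bounded.
Fact free_ev_proof : @is_chain_map k A free_cplx X (fun i => free_ev (X i)).
Proof. by move=> i; rewrite free_ev_nat. Qed.
Definition free_ev_cplx : chain_map free_cplx X := mk_chain free_ev_proof.

Fact coind_dd i : mcomp (coind_map (cd X (i + 1))) (coind_map (cd X i)) = 0.
Proof. by rewrite -coind_map_comp cdd coind_map0. Qed.
Fact coind_bounded :
  exists n : nat, forall i : int, (n < absz i)%N -> forall x : coind (X i), x = 0.
Proof. by have [n hn] := cbounded X; exists n => i /hn h; apply: coind_mzero. Qed.
Definition coind_cplx : cplx A := Cplx coind_dd coind_bounded.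
Fact coind_unit_proof : @is_chain_map k A X coind_cplx (fun i => coind_unit (X i)).
Proof. by move=> i; rewrite coind_unit_nat. Qed.
Definition coind_unit_cplx : chain_map X coind_cplx := mk_chain coind_unit_proof.
End FreeResolution.

Lemma mzero_dsum M N : mzero M -> mzero N -> mzero (dsum_mod M N).
Proof. by move=> zM zN [x y]; rewrite (zM x) (zN y). Qed.

Section Hereditary.
Hypothesis hA : hereditary A.

(** The kernel of the free cover is termwise projective because [A] is hereditary, so the cone of
    its inclusion is a resolution. Its term in degree [i] depends on [X i] and [X (i + 1)] only;
    this is the source of all bounds on degrees. *)
Lemma proj_resolution X : exists P (s : chain_map P X), [/\ proj_cplx P, quasi_iso s
  & forall i, mzero (X i) -> mzero (X (i + 1)) -> mzero (P i)].
Proof.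
have [i|i y e|K [j hj]] := @sub_cplx (free_cplx X) (fun i y => free_ev (X i) y = 0).
- by have [K [j [ij jE]]] := kernel_exists (free_ev (X i)); exists K, j.
- rewrite -[LHS]/(free_ev_cplx X (i + 1) (cd (free_cplx X) i y)) chainE.
  by rewrite -[free_ev_cplx X i y]/(free_ev (X i) y) e lf0.
have ex : ses_cplx j (free_ev_cplx X).
  by move=> n; have [ij jE] := hj n; split=> //; apply: free_ev_surj.
exists (cone j), (cone_to_coker ex); split; last 1 first.
- move=> i z1 z2; apply: mzero_dsum; last exact: free_mzero.
  by move=> x; have [ij _] := hj (i + 1); apply: ij; rewrite lf0; apply: (free_mzero z2).
- move=> i; apply: proj_dsum; last exact: proj_free.
  by have [ij _] := hj (i + 1); apply: hA ij; apply: proj_free.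
exact: qis_cone_to_coker.
Qed.

(** The resolution is one of [X[1]], since the kernel of a surjection maps to its cone only after a
    shift. *)
Lemma inj_resolution X : exists J (s : chain_map (shift X) J), [/\ inj_cplx J, quasi_iso s
  & forall i, mzero (X i) -> mzero (X (i + 1)) -> mzero (J i)].
Proof.
have [C [q hq]] := quot_cplx (coind_unit_cplx X).
have ex : ses_cplx (coind_unit_cplx X) q.
  by move=> n; have [qs qE] := hq n; split=> //; apply: coind_unit_inj.
exists (cone q), (shift_to_cone ex); split; last 1 first.
- move=> i z1 z2; apply: mzero_dsum; first exact: coind_mzero.
  move=> x; have [qs _] := hq i; have [y <-] := qs x.
  by rewrite (coind_mzero z1 y) lf0.
- move=> i; apply: inj_dsum; first exact: inj_coind.
  by have [qs _] := hq i; apply: (hereditary_inj_quot hA _ qs); apply: inj_coind.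
exact: qis_shift_to_cone.
Qed.
End Hereditary.
End Resolutions.

(** * Modules as a full subcategory of the derived category *)

Section Stalks.
Local Open Scope ring_scope.
Variables (k : fieldType) (A : fdAlgType k).
Implicit Types (W X Y Z : cplx A) (M N L : rmod A).

Lemma stalk_mzero M i : i != 0 -> mzero (stalk M i).
Proof. by case: i => [[|n]|n] // _ x; apply: thinmx0. Qed.
Lemma stalk_ind (Q : int -> Prop) : Q (Posz 0) -> (forall i, i != 0 -> Q i) -> forall i, Q i.
Proof. by move=> h0 h i; have [->|/h] := eqVneq i 0. Qed.
Lemma stalk_d0 M i x : cd (stalk M) i x = 0. Proof. by rewrite mhom0E. Qed.
Lemma proj_stalk M : projective M -> proj_cplx (stalk M).
Proof. by move=> pM; apply: stalk_ind => // i i0; apply/proj_mzero/stalk_mzero. Qed.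
Lemma ses_stalk M N L (i : mhom M N) (q : mhom N L) : injective i -> surj q ->
  (forall y, q y = 0 <-> exists x, i x = y) -> ses_cplx (stalk_map i) (stalk_map q).
Proof.
move=> ii qs ex; apply: stalk_ind => [|n n0]; first by split.
have zM := stalk_mzero (M := M) n0; have zN := stalk_mzero (M := N) n0; have zL := stalk_mzero (M := L) n0.
split=> [x y _|y|y]; first by rewrite (zM x) (zM y).
  by exists 0; rewrite (zL y); apply: zL.
by split=> _; [exists 0; rewrite (zN y); apply: zN | apply: zL].
Qed.
Lemma ses_shift X Y Z (i : chain_map X Y) (q : chain_map Y Z) :
  ses_cplx i q -> ses_cplx (shift_map i) (shift_map q).
Proof. by move=> ex n; apply: ex. Qed.

Variable D : derived A.
Local Notation Q f := (fmap (dloc D) f).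
Local Notation "g <o> f" := (comp D g f) (at level 40, left associativity).

Lemma stalk_cycle M X (s : chain_map X (stalk M)) : quasi_iso s ->
  forall m : M, exists x : X (Posz 0), cd X (Posz 0) x = 0 /\ s (Posz 0) x = m.
Proof.
(* [quasi_iso] speaks of degree [i + 1], and [Negz 0] is -1, so this is the condition in degree
   0. *)
move=> qs m; have [x [y [dx e]]] := (qs (Negz 0)).2 m (stalk_d0 _).
by exists x; split=> //; rewrite e stalk_d0 addr0.
Qed.

Lemma stalk_faithful M N (f : mhom M N) : Q (stalk_map f) = 0 -> f = 0.
Proof.
case/(dloc_eq0 D)=> X [s [qs /nullP[h hE]]]; apply: mhom_inj => m; rewrite mhom0E.
have [x [dx <-]] := stalk_cycle qs m.
have := hE (Negz 0) x; rewrite stalk_d0 add0r => e.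
have e' : f (s (Posz 0) x) = chain_comp (stalk_map f) s (Negz 0 + 1) x by rewrite chain_compE.
by rewrite e' e -[cd X _ x]/(cd X (Posz 0) x) dx lf0.
Qed.

(** [S] is the canonical truncation: everything in negative degrees, the cycles in degree 0, zero
    above. It is quasi-isomorphic to [X] because [X] has the cohomology of a stalk in degree 0. *)
Lemma truncation M X (s : chain_map X (stalk M)) : quasi_iso s ->
  exists W (j : chain_map W X), quasi_iso j /\ forall i, 0 < i -> mzero (W i).
Proof.
move=> qs; pose S i (y : X i) := [\/ i < 0, i = 0 /\ cd X i y = 0 | y = 0].
have S0 i (y : X i) : 0 < i -> S i y -> y = 0 by move=> h [|[]|//]; lia.
have [i|i y|W [j hj]] := @sub_cplx _ _ X S.
- have [lt|gt|e0] := ltrgtP i 0.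
  + exists (X i), (mid (X i)); split=> [x y|y]; first by rewrite !midE.
    by split=> _; [exists y; rewrite midE | constructor 1].
  + exists (zero_mod A), 0; split=> [x y _|y]; first by rewrite (mzero_zero_mod x) (mzero_zero_mod y).
    split=> [/(S0 _ _ gt)->|[x <-]]; first by exists 0; rewrite lf0.
    by rewrite mhom0E; constructor 3.
  have [K [j [ij jE]]] := kernel_exists (cd X i); exists K, j; split=> // y.
  rewrite -jE; split=> [[|[]//|->]|h]; [lia | by rewrite lf0 | by constructor 2].
- case=> [lt|[e0 dy]|->]; last by rewrite lf0; constructor 3.
    have [lt1|e1] : i + 1 < 0 \/ i + 1 = 0 by lia.
      by constructor 1.
    by constructor 2; rewrite cddE.
  by rewrite dy; constructor 3.
exists W, j; split; last first.
  move=> i ip x; have [ij jE] := hj i; apply: ij; rewrite lf0; apply: (S0 _ _ ip).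
  by apply/jE; exists x.
move=> n; have [ij1 jE1] := hj (n + 1); have [ij2 jE2] := hj (n + 1 + 1); split=> [x y dx e|y dy].
  have /jE1[lt|[e0 _]|j0] : exists x', j (n + 1) x' = j (n + 1) x by exists x.
  - have /(hj n).2[x' x'E] : S n y by constructor 1; lia.
    by exists x'; apply: ij1; rewrite chainE x'E.
  - have /(hj n).2[x' x'E] : S n y by constructor 1; lia.
    by exists x'; apply: ij1; rewrite chainE x'E.
  by exists 0; apply: ij1; rewrite j0 !lf0.
have [le|gt] := lerP (n + 1) 0.
  have /jE1[x xE] : S (n + 1) y.
    have [lt|e0] : n + 1 < 0 \/ n + 1 = 0 by lia.
      by constructor 1.
    by constructor 2.
  exists x, 0; rewrite lf0 addr0 xE; split=> //.
  by apply: ij2; rewrite chainE xE lf0.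
have [|x' yE] := (qs n).1 y 0 dy; first by rewrite lf0; apply: stalk_mzero; lia.
by exists 0, x'; rewrite !lf0 add0r.
Qed.

(** After truncation every element in degree 0 is a cycle, so those killed by the denominator are
    boundaries; the numerator vanishes on boundaries and factors through the denominator in degree
    0. *)
Lemma stalk_full M N (h : Hom D (stalk M) (stalk N)) : exists f : mhom M N, Q (stalk_map f) = h.
Proof.
have [X [s [f [qs e]]]] := dloc_frac h; have [W [j [qj zW]]] := truncation qs.
have qsj := qis_comp qj qs; set s' := chain_comp s j in qsj; set f' := chain_comp f j.
have {}e : h <o> Q s' = Q f' by rewrite !Q_comp compA e.
pose p : mhom (W (Posz 0)) M := s' (Posz 0).
have ps : surj p by move=> m; have [x [_ xE]] := stalk_cycle qsj m; exists x.
have [x px|g gE] := @factor_surj _ _ _ _ N p (f' (Posz 0)) ps.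
  have [|x' xE] := (qsj (Negz 0)).1 x 0 (zW (Posz 1) isT _); first by rewrite lf0.
  by rewrite xE; apply: etrans (chainE f' x') (stalk_d0 _).
exists g; apply: (isom_epi (dloc_isom D qsj)); rewrite e -Q_comp; congr (Q _).
apply: chain_inj; apply: stalk_ind => [|i i0]; first exact: gE.
by rewrite [RHS]mzero_hom_to ?[LHS]mzero_hom_to //; apply: stalk_mzero.
Qed.
End Stalks.

(** * Serre duality *)

Section FunctionalExtension.
Local Open Scope ring_scope.
Variables (k : fieldType) (V : lmodType k).
Implicit Types (W : V -> Prop) (phi psi : V -> k^o).

(** The functionals below live on families of maps indexed by all integers, a space without a chosen
    basis. Subspaces are therefore predicates, and [fin_spanned] expresses the finiteness under
    which functionals extend. *)
Definition subspace W := W 0 /\ forall c x y, W x -> W y -> W (c *: x + y).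
Definition linear_on W phi := forall c x y, W x -> W y -> phi (c *: x + y) = c *: phi x + phi y.

Lemma subspaceD W x y : subspace W -> W x -> W y -> W (x + y).
Proof. by move=> [_ h] hx hy; rewrite -[x]scale1r; apply: h. Qed.
Lemma subspaceZ W c x : subspace W -> W x -> W (c *: x).
Proof. by move=> [h0 h] hx; rewrite -[_ *: _]addr0; apply: h. Qed.
Lemma subspaceB W x y : subspace W -> W x -> W y -> W (x - y).
Proof. by move=> sW hx hy; rewrite -scaleN1r; apply: subspaceD => //; apply: subspaceZ. Qed.
Lemma subspace_sum W (I : Type) (r : seq I) (F : I -> V) : subspace W ->
  (forall i, W (F i)) -> W (\sum_(i <- r) F i).
Proof.
move=> sW h; elim: r => [|i r ih]; first by rewrite big_nil; case: sW.
by rewrite big_cons; apply: subspaceD.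
Qed.

Lemma functional_extend1 W phi v : subspace W -> linear_on W phi -> ~ W v -> forall a : k,
  exists W' psi, [/\ subspace W', linear_on W' psi, forall x, W x -> W' x,
    W' v & (forall x, W x -> psi x = phi x) /\ psi v = a].
Proof.
move=> sW lphi nv a; have [W0 Wl] := sW.
have phi0 : phi 0 = 0.
  by have := lphi 1 0 0 W0 W0; rewrite !scale1r addr0 => /eqP; rewrite -subr_eq0 opprD addrA subrr sub0r oppr_eq0 => /eqP.
pose rel x y := exists w c, [/\ W w, x = w + c *: v & y = phi w + c * a].
have uniq x y y' : rel x y -> rel x y' -> y = y'.
  move=> [w [c [Ww -> ->]]] [w' [c' [Ww' e ->]]].
  have [ec|nc] := eqVneq c c'.
    by move: e; rewrite ec => /addIr ->.
  case: nv; have -> : v = (c - c')^-1 *: (w' - w).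
    rewrite -[LHS]scale1r -(mulVf (x := c - c')) ?subr_eq0 // -scalerA; congr (_ *: _).
    have -> : (c - c') *: v = w + c *: v - w - c' *: v by rewrite [w + _]addrC addrK scalerBl.
    by rewrite e addrAC addrK.
  by apply: subspaceZ => //; apply: subspaceB.
pose W' x := exists y, rel x y.
have /choice[psi psiE] x : exists y : k^o, W' x -> rel x y.
  by have [[y h]|n] := pselect (W' x); [exists y | exists 0 => /n].
have psi_rel x y : rel x y -> psi x = y.
  by move=> h; apply: uniq (h); apply: psiE; exists y.
exists W', psi; split.
- split=> [|c x y [x' [w [d [Ww -> _]]]] [y' [w' [d' [Ww' -> _]]]]].
    by exists 0, 0, 0; rewrite scale0r addr0 phi0 mul0r addr0.
  exists (phi (c *: w + w') + (c * d + d') * a), (c *: w + w'), (c * d + d'); split=> //; first exact: Wl.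
  by rewrite scalerDl scalerDr addrACA scalerA.
- move=> c x y [x' [w [d [Ww -> _]]]] [y' [w' [d' [Ww' -> _]]]].
  rewrite (psi_rel (w + d *: v) (phi w + d * a)); last by exists w, d.
  rewrite (psi_rel (w' + d' *: v) (phi w' + d' * a)); last by exists w', d'.
  apply: psi_rel; exists (c *: w + w'), (c * d + d'); split; first exact: Wl.
    by rewrite scalerDl scalerDr addrACA scalerA.
  by rewrite lphi // -![_ *: (_ : k^o)]/(_ * _); ring.
- by move=> x Wx; exists (phi x), x, 0; rewrite scale0r addr0 mul0r addr0.
- by exists a, 0, 1; rewrite scale1r add0r phi0 add0r mul1r.
split=> [x Wx|]; apply: psi_rel.
  by exists x, 0; rewrite scale0r addr0 mul0r addr0.
by exists 0, 1; rewrite scale1r add0r phi0 add0r mul1r.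
Qed.

Definition fin_spanned := exists e : seq V, forall W, subspace W -> (forall x, List.In x e -> W x) -> forall v, W v.

Lemma functional_extend W phi : fin_spanned -> subspace W -> linear_on W phi ->
  exists psi, linear psi /\ forall x, W x -> psi x = phi x.
Proof.
move=> [e he] sW lphi.
suff : forall l, exists W' psi, [/\ subspace W', linear_on W' psi, forall x, W x -> W' x,
    forall x, List.In x l -> W' x & forall x, W x -> psi x = phi x].
  move=> /(_ e)[W' [psi [sW' lpsi WW' eW' E]]]; exists psi; split=> // c x y.
  by apply: lpsi; apply: he.
elim=> [|v l [W' [psi [sW' lpsi WW' lW' E]]]]; first by exists W, phi.
have [W'v|nv] := pselect (W' v).
  by exists W', psi; split=> // x [<-|/lW'].
have [W'' [psi' [sW'' lpsi' W'W'' W''v [E' _]]]] := functional_extend1 sW' lpsi nv 0.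
exists W'', psi'; split=> //; first by move=> x /WW'/W'W''.
  by move=> x [<-|/lW'/W'W''].
by move=> x Wx; rewrite E' ?E //; apply: WW'.
Qed.

Lemma functional_separate W v : fin_spanned -> subspace W -> ~ W v ->
  exists psi, [/\ linear psi, forall x, W x -> psi x = 0 & psi v = 1].
Proof.
move=> fs sW nv.
have l0 : linear_on W (fun=> 0 : k^o) by move=> c x y _ _; rewrite scaler0 addr0.
have [W' [phi [sW' lphi WW' W'v [E Ev]]]] := functional_extend1 sW l0 nv 1.
have [psi [lpsi E']] := functional_extend fs sW' lphi.
exists psi; split=> //; last by rewrite E'.
by move=> x Wx; rewrite E' ?E //; apply: WW'.
Qed.
End FunctionalExtension.

Section Families.
Local Open Scope ring_scope.
Variables (k : fieldType) (A : fdAlgType k).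
Implicit Types (X Y Z P J : cplx A).

Definition fam X Y := dprod (fun i => mhom (X i) (Y i)).
HB.instance Definition _ X Y := GRing.Lmodule.on (fam X Y).

Definition fam0 X Y : fam X Y := 0.
Definition fam_at X Y i (f : mhom (X i) (Y i)) : fam X Y := dfwith (fam0 X Y) f.
Lemma fam_at_in X Y i (f : mhom (X i) (Y i)) : fam_at f i = f.
Proof. exact: dfwith_in. Qed.
Lemma fam_at_out X Y i (f : mhom (X i) (Y i)) j : i != j -> fam_at f j = 0.
Proof. by move=> ij; rewrite /fam_at dfwith_out. Qed.
Lemma fam_ext X Y (u v : fam X Y) : (forall i, u i = v i) -> u = v.
Proof. exact: functional_extensionality_dep. Qed.
Lemma famDE X Y (u v : fam X Y) i : (u + v) i = u i + v i. Proof. by []. Qed.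
Lemma famZE X Y c (u : fam X Y) i : (c *: u) i = c *: u i. Proof. by []. Qed.
Lemma fam_at_linear X Y i : linear (@fam_at X Y i).
Proof.
move=> c f g; apply: fam_ext => j; rewrite famDE famZE.
have [<-|ij] := eqVneq i j; first by rewrite !fam_at_in.
by rewrite !fam_at_out // scaler0 addr0.
Qed.

Definition irange (n : nat) : seq int := [seq m%:Z - n%:Z | m <- iota 0 (n + n + 1)].
Lemma irange_uniq n : uniq (irange n).
Proof. by rewrite map_inj_uniq ?iota_uniq // => x y; lia. Qed.
Lemma mem_irange n i : (i \in irange n) = (absz i <= n)%N.
Proof.
apply/mapP/idP => [[m]|h]; first by rewrite mem_iota => ? ->; lia.
by exists (absz (i + n%:Z)); [rewrite mem_iota | ]; lia.
Qed.

Lemma fam_sumE X Y (I : Type) (r : seq I) (F : I -> fam X Y) i :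
  (\sum_(j <- r) F j) i = \sum_(j <- r) F j i.
Proof. by elim: r => [|j r ih]; rewrite ?big_nil // !big_cons famDE ih. Qed.
Lemma fam_decomp X Y n (v : fam X Y) : (forall i, (n < absz i)%N -> v i = 0) ->
  v = \sum_(i <- irange n) fam_at (v i).
Proof.
move=> h; apply: fam_ext => j; rewrite fam_sumE.
have [jn|nj] := boolP (j \in irange n).
  rewrite (bigD1_seq j jn (irange_uniq n)) /= fam_at_in big1 ?addr0 // => i ij.
  exact: fam_at_out.
rewrite h; last by move: nj; rewrite mem_irange -ltnNge.
rewrite big_seq big1 // => i iin; apply: fam_at_out.
by apply: contraNneq nj => <-.
Qed.

Lemma fam_spanned X Y : fin_spanned (fam X Y).
Proof.
have [n hn] := cbounded X.
have [L LE] : exists L : seq (fam X Y), forall i (b : 'I_(\dim {:mhom (X i) (Y i)})),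
    (i \in irange n) -> List.In (fam_at (vbasis {:mhom (X i) (Y i)})`_b) L.
  elim: (irange n) => [|i r [L LE]]; first by exists [::].
  have [L' L'E] : exists L' : seq (fam X Y), forall b : 'I_(\dim {:mhom (X i) (Y i)}),
      List.In (fam_at (vbasis {:mhom (X i) (Y i)})`_b) L'.
    pose F (b : 'I_(\dim {:mhom (X i) (Y i)})) := fam_at (vbasis {:mhom (X i) (Y i)})`_b.
    exists [seq F b | b <- enum 'I__] => b.
    apply: (List.in_map F); have : b \in enum 'I_(\dim {:mhom (X i) (Y i)}) by rewrite mem_enum.
    elim: (enum _) => //= c s ih; rewrite inE => /orP[/eqP->|/ih]; [by left | by right].
  exists (L' ++ L) => j b; rewrite inE => /orP[/eqP ej|jr]; apply/List.in_or_app.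
    by left; case: i / ej L' L'E => L' L'E; apply: L'E.
  by right; apply: LE.
exists L => W sW h v.
rewrite (fam_decomp (n := n) (v := v)) => [|i /hn z]; last exact: mzero_hom_from.
rewrite big_seq; elim/big_rec: _ => [|i u iin Wu]; first by case: sW.
apply: subspaceD => //; rewrite (coord_vbasis (memvf (v i))).
have [lf] : exists G : {linear mhom (X i) (Y i) -> fam X Y}, G =1 @fam_at X Y i.
  by exists (HB.pack_for {linear mhom (X i) (Y i) -> fam X Y} (@fam_at X Y i)
    (GRing.isLinear.Build k (mhom (X i) (Y i)) (fam X Y) *:%R _ (@fam_at_linear X Y i))).
move=> E; rewrite -E linear_sum; apply: subspace_sum => // b.
by rewrite linearZ E; apply: subspaceZ => //; apply/h/LE.
Qed.

(** Families of this form are always chain maps. The condition is put on arbitrary families because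
    functionals on these can be tested in one degree at a time, which is impossible for chain
    maps. *)
Definition nullfam X Y (v : fam X Y) := exists h : forall i, mhom (X (i + 1)) (Y i),
  forall i, v (i + 1) = mcomp (cd Y i) (h i) + mcomp (h (i + 1)) (cd X (i + 1)).

Lemma nullfam_subspace X Y : subspace (@nullfam X Y).
Proof.
split; first by exists (fun=> 0) => i; rewrite mcomp0 mcomp0l addr0.
move=> c u v [h hE] [h' hE']; exists (fun i => c *: h i + h' i) => i.
by rewrite famDE famZE hE hE' !(mcompDl, mcompDr, mcompZl, mcompZr) scalerDr addrACA.
Qed.

Lemma nullfam_exists X Y (h : forall i, mhom (X (i + 1)) (Y i)) : exists f : chain_map X Y,
  nullhomotopic f /\
  forall i, f (i + 1) = mcomp (cd Y i) (h i) + mcomp (h (i + 1)) (cd X (i + 1)).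
Proof.
have [v vE] := @reindex_succ (fun i => mhom (X i) (Y i))
  (fun i => mcomp (cd Y i) (h i) + mcomp (h (i + 1)) (cd X (i + 1))).
have vP : is_chain_map v.
  apply: int_succ_ind => i; rewrite !vE mcompDl mcompDr -!mcompA !mcompA -(mcompA (h _)) !cdd mcomp0l mcomp0.
  by rewrite addr0 add0r.
by exists (mk_chain vP); split; [exists h | ].
Qed.
End Families.

Section SerreComplexes.
Local Open Scope ring_scope.
Variables (k : fieldType) (A : fdAlgType k).
Implicit Types (X Y Z : cplx A).

(** Summation by parts over a symmetric range, where the boundary terms vanish by the bound on
    [b]. *)
Lemma irange_sum_shift (V : zmodType) n (t a b : int -> V) :
  (forall j, t (j + 1) = b j + a (j + 1)) -> (forall j, (n <= absz j)%N -> b j = 0) ->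
  \sum_(i <- irange n) t i = \sum_(i <- irange n) (b i + a i).
Proof.
move=> tE b0; rewrite /irange !big_map big_split /=.
pose b' m := b (m%:Z - n%:Z - 1).
rewrite (eq_bigr (fun m => b' m + a (m%:Z - n%:Z))) => [|m _]; last first.
  by rewrite -[in LHS](subrK 1 (m%:Z - n%:Z)) tE /b' subrK.
rewrite big_split /=; congr (_ + _).
have -> : iota 0 (n + n + 1) = index_iota 0 (n + n + 1) by rewrite /index_iota subn0.
rewrite addn1 [LHS]big_nat_recl // [RHS]big_nat_recr //= {1}/b' b0 ?add0r; last by lia.
rewrite [X in _ = _ + X]b0 ?addr0; last by lia.
by apply: eq_bigr => m _; rewrite /b'; congr b; lia.
Qed.

(* The sign in [compat] makes the sum of the th i vanish on null-homotopic families. *)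
Variables (P J : cplx A) (th : forall i, 'Hom(mhom (P i) (J i), k^o)).
Hypotheses (np : forall i, npair (th i))
  (compat : forall i (b : mhom (P (i + 1)) (J i)), th i (mcomp b (cd P i)) = - th (i + 1) (mcomp (cd J i) b)).

(** A margin of one degree is kept, because a homotopy at index [i] involves the degrees [i] and
    [i + 1]. *)
Let bound_exists : exists N : nat, forall i, (N <= absz i + 1)%N -> mzero (P i).
Proof. by have [n hn] := cbounded P; exists n.+2 => i h; apply: hn; lia. Qed.
Let N := sval (cid bound_exists).
Let zP i : (N <= absz i + 1)%N -> mzero (P i).
Proof. exact: (svalP (cid bound_exists)). Qed.
Let zJ i : (N <= absz i + 1)%N -> mzero (J i).
Proof.
move=> /zP z; apply/mzeroP; apply: (npair_eqr (np i)) => f.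
by rewrite mcomp1m mcomp0l (mzero_hom_from f z).
Qed.

Definition fam_trace (v : fam P J) : k^o := \sum_(i <- irange N) th i (v i).
Lemma fam_trace_linear : linear fam_trace.
Proof.
move=> c u v; rewrite /fam_trace scaler_sumr -big_split; apply: eq_bigr => i _ /=.
by rewrite lfD lfZ.
Qed.
Lemma fam_trace_null v : nullfam v -> fam_trace v = 0.
Proof.
case=> h hE; rewrite /fam_trace.
pose a i : k^o := th i (mcomp (h i) (cd P i)).
rewrite (@irange_sum_shift _ N _ a (fun i => th (i + 1) (mcomp (cd J i) (h i)))).
- by rewrite big1 // => i _; rewrite /a compat subrr.
- by move=> i; rewrite hE lfD.
move=> i ni; have z : mzero (J i) by apply: zJ; lia.
by rewrite (mzero_hom_to (h i) z) mcomp0 lf0.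
Qed.

Let sum_one (V : zmodType) (f : int -> V) i : (forall j, i != j -> f j = 0) ->
  ((N < absz i)%N -> f i = 0) -> \sum_(j <- irange N) f j = f i.
Proof.
move=> h hi; have [iin|] := boolP (i \in irange N).
  by rewrite (bigD1_seq i iin (irange_uniq N)) /= big1 ?addr0 // => j; rewrite eq_sym => /h.
rewrite mem_irange -ltnNge => lt; rewrite hi // big_seq big1 // => j jin; apply: h.
by apply: contraTneq lt => ->; rewrite -leqNgt -mem_irange.
Qed.

(** Each degree of [psi] is represented through the form [th i]. Applied to the null-homotopic
    families of homotopies concentrated in one degree, the vanishing of [psi] says exactly that the
    representing maps commute with the differentials. *)
Lemma trace_repr_right Y (psi : fam P Y -> k^o) : linear psi -> (forall v, nullfam v -> psi v = 0) ->
  exists g : chain_map Y J, forall v, psi v = fam_trace (fun i => mcomp (g i) (v i)).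
Proof.
move=> lpsi psi0.
have [i|g gE] := @dep_choice _ (fun i => mhom (Y i) (J i))
    (fun i g => forall f : mhom (P i) (Y i), th i (mcomp g f) = psi (fam_at f)).
  have [F FE] : exists F : 'Hom(mhom (P i) (Y i), k^o), forall f, F f = psi (fam_at f).
    by apply: lfun_of => c x y; rewrite fam_at_linear lpsi.
  by have [g gE] := npair_repr (np i) F; exists g => f; rewrite gE FE.
have psiE v : psi v = fam_trace (fun i => mcomp (g i) (v i)).
  rewrite {1}(@fam_decomp _ _ _ _ N v) => [|i ni]; last by apply: mzero_hom_from; apply: zP; lia.
  have lsum r : psi (\sum_(i <- r) fam_at (v i)) = \sum_(i <- r) psi (fam_at (v i)).
    elim: r => [|i r ih]; last by rewrite !big_cons -[fam_at (v i) in LHS]scale1r lpsi scale1r ih.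
    by rewrite !big_nil -[0 in LHS](scaler0 _ 0) -[_ *: _ in LHS]addr0 lpsi scale0r add0r psi0 //;
       apply: (nullfam_subspace P Y).1.
  by rewrite lsum; apply: eq_bigr => i _; rewrite gE.
have gP : is_chain_map g.
  move=> i; apply: (npair_eqr (np (i + 1))) => eta.
  pose h : forall j, mhom (P (j + 1)) (Y j) := dfwith (fun=> 0) eta.
  have hi : h i = eta by apply: dfwith_in.
  have hj j : i != j -> h j = 0 by move=> ij; rewrite /h dfwith_out.
  have [f [nf fE]] := nullfam_exists h.
  have := psiE (fun j => f j); rewrite psi0; last by exists h.
  rewrite /fam_trace.
  rewrite (@irange_sum_shift _ N _ (fun j => th j (mcomp (g j) (mcomp (h j) (cd P j))))
    (fun j => th (j + 1) (mcomp (g (j + 1)) (mcomp (cd Y j) (h j))))); last 2 first.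
  - by move=> j; rewrite fE mcompDr lfD.
  - by move=> j nj; rewrite (mzero_hom_to (g (j + 1))) ?mcomp0l ?lf0 //; apply: zJ; lia.
  rewrite (@sum_one _ _ i) => [|j /hj ->|ni]; last 2 first.
  - by rewrite mcomp0l !mcomp0 !lf0 addr0.
  - have z : mzero (P (i + 1)) by apply: zP; lia.
    by rewrite (mzero_hom_from (h i) z) mcomp0l !mcomp0 !lf0 addr0.
  by rewrite hi !mcompA compat mcompA => /esym/subr0_eq.
by exists (mk_chain gP).
Qed.

Lemma trace_repr_left Y (psi : fam Y J -> k^o) : linear psi -> (forall v, nullfam v -> psi v = 0) ->
  exists f : chain_map P Y, forall v, psi v = fam_trace (fun i => mcomp (v i) (f i)).
Proof.
move=> lpsi psi0.
have [i|g gE] := @dep_choice _ (fun i => mhom (P i) (Y i))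
    (fun i f => forall g : mhom (Y i) (J i), th i (mcomp g f) = psi (fam_at g)).
  have [F FE] : exists F : 'Hom(mhom (Y i) (J i), k^o), forall f, F f = psi (fam_at f).
    by apply: lfun_of => c x y; rewrite fam_at_linear lpsi.
  by have [g gE] := npair_repl (np i) F; exists g => f; rewrite gE FE.
have psiE v : psi v = fam_trace (fun i => mcomp (v i) (g i)).
  rewrite {1}(@fam_decomp _ _ _ _ N v) => [|i ni]; last by apply: mzero_hom_to; apply: zJ; lia.
  have lsum r : psi (\sum_(i <- r) fam_at (v i)) = \sum_(i <- r) psi (fam_at (v i)).
    elim: r => [|i r ih]; last by rewrite !big_cons -[fam_at (v i) in LHS]scale1r lpsi scale1r ih.
    by rewrite !big_nil -[0 in LHS](scaler0 _ 0) -[_ *: _ in LHS]addr0 lpsi scale0r add0r psi0 //;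
       apply: (nullfam_subspace Y J).1.
  by rewrite lsum; apply: eq_bigr => i _; rewrite gE.
have gP : is_chain_map g.
  move=> i; apply: (npair_eql (np i)) => eta.
  pose h : forall j, mhom (Y (j + 1)) (J j) := dfwith (fun=> 0) eta.
  have hi : h i = eta by apply: dfwith_in.
  have hj j : i != j -> h j = 0 by move=> ij; rewrite /h dfwith_out.
  have [f [nf fE]] := nullfam_exists h.
  have := psiE (fun j => f j); rewrite psi0; last by exists h.
  rewrite /fam_trace.
  rewrite (@irange_sum_shift _ N _ (fun j => th j (mcomp (mcomp (h j) (cd Y j)) (g j)))
    (fun j => th (j + 1) (mcomp (mcomp (cd J j) (h j)) (g (j + 1))))); last 2 first.
  - by move=> j; rewrite fE mcompDl lfD.
  - by move=> j nj; rewrite (mzero_hom_to (h j)) ?mcomp0 ?mcomp0l ?lf0 //; apply: zJ; lia.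
  rewrite (@sum_one _ _ i) => [|j /hj ->|ni]; last 2 first.
  - by rewrite mcomp0 !mcomp0l !lf0 addr0.
  - have z : mzero (J i) by apply: zJ; lia.
    by rewrite (mzero_hom_to (h i) z) mcomp0 !mcomp0l !lf0 addr0.
  rewrite hi -!mcompA => e; rewrite (mcompA eta) compat.
  by apply/esym/eqP; rewrite -addr_eq0 [X in X == _]addrC -e.
by exists (mk_chain gP).
Qed.

End SerreComplexes.

(** * Serre duality through trace forms *)

Section SerreForms.
Local Open Scope ring_scope.
Variables (k : fieldType) (O : Type) (C : klcat k O).
Implicit Types X Y Z : O.
Local Notation "g <o> f" := (comp C g f) (at level 40, left associativity).

Lemma compBl X Y Z (f : Hom C X Y) (g g' : Hom C Y Z) : (g - g') <o> f = g <o> f - g' <o> f.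
Proof. by rewrite -scaleN1r compDl compZl scaleN1r. Qed.
Lemma compBr X Y Z (f f' : Hom C X Y) (g : Hom C Y Z) : g <o> (f - f') = g <o> f - g <o> f'.
Proof. by rewrite -scaleN1r compDr compZr scaleN1r. Qed.

(* Z is the image of X under a Serre functor; the Hom spaces of an arbitrary linear category may be
   infinite dimensional, hence the separate surjectivity conditions. *)
Definition perfect_at X Z (th : Hom C X Z -> k^o) Y :=
  [/\ forall f : Hom C X Y, (forall g, th (g <o> f) = 0) -> f = 0,
      forall g : Hom C Y Z, (forall f, th (g <o> f) = 0) -> g = 0,
      forall phi : Hom C Y Z -> k^o, linear phi -> exists f, forall g, th (g <o> f) = phi g
    & forall phi : Hom C X Y -> k^o, linear phi -> exists g, forall f, th (g <o> f) = phi f].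
Definition serre_form X Z (th : Hom C X Z -> k^o) := linear th /\ forall Y, perfect_at th Y.
Definition serre_pair X Z := exists th : Hom C X Z -> k^o, serre_form th.

Lemma linearB0 (V : lmodType k) (th : V -> k^o) : linear th -> forall x y, th (x - y) = th x - th y.
Proof.
by move=> l x y; rewrite -scaleN1r addrC l scaleN1r addrC.
Qed.
Lemma linear00 (V : lmodType k) (th : V -> k^o) : linear th -> th 0 = 0.
Proof. by move=> l; rewrite -(subrr 0) linearB0 // subrr. Qed.

Lemma perfect_iso X Z (th : Hom C X Z -> k^o) Y Y' : iso_obj C Y Y' -> perfect_at th Y -> perfect_at th Y'.
Proof.
move=> [u [v [vu uv]]] [i1 i2 s1 s2]; split=> [f h|g h|phi lphi|phi lphi].
- rewrite -[f]comp1m -uv -compA (i1 (v <o> f)) ?compm0 // => g.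
  by rewrite compA; apply: h.
- rewrite -[g]compm1 -uv compA (i2 (g <o> u)) ?comp0m // => f.
  by rewrite -compA; apply: h.
- have [|f fE] := s1 (fun g => phi (g <o> v)); first by move=> c x y; rewrite compDl compZl lphi.
  by exists (u <o> f) => g; rewrite compA fE -compA uv compm1.
have [|g gE] := s2 (fun f => phi (u <o> f)); first by move=> c x y; rewrite compDr compZr lphi.
by exists (g <o> v) => f; rewrite -compA gE compA uv comp1m.
Qed.

Lemma serre_form_iso X Z (th : Hom C X Z -> k^o) X' Z' (r : Hom C X X') (u : Hom C Z' Z) :
  isom r -> isom u -> serre_form th -> serre_form (fun b : Hom C X' Z' => th (u <o> b <o> r)).
Proof.
move=> [r' [r'r rr']] [u' [u'u uu']] [lth pth]; split.
  by move=> c x y; rewrite compDr compZr compDl compZl lth.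
move=> Y; have [i1 i2 s1 s2] := pth Y; split=> [f h|g h|phi lphi|phi lphi].
- rewrite -[f]compm1 -rr' compA (i1 (f <o> r)) ?comp0m // => g.
  by rewrite -[RHS](h (u' <o> g)) !compA uu' comp1m.
- rewrite -[g]comp1m -u'u -compA (i2 (u <o> g)) ?compm0 // => f.
  by rewrite -[RHS](h (f <o> r')) -!compA r'r compm1.
- have [|f fE] := s1 (fun g => phi (u' <o> g)); first by move=> c x y; rewrite compDr compZr lphi.
  by exists (f <o> r') => g; rewrite -!compA r'r compm1 compA fE compA u'u comp1m.
have [|g gE] := s2 (fun f => phi (f <o> r')); first by move=> c x y; rewrite compDl compZl lphi.
by exists (u' <o> g) => f; rewrite !compA uu' comp1m -compA gE -compA rr' compm1.
Qed.
Lemma serre_pair_iso X Z X' Z' : iso_obj C X X' -> iso_obj C Z Z' -> serre_pair X Z -> serre_pair X' Z'.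
Proof.
move=> [r ri] [u' [u [u'u uu']]] [th sth].
have ui : isom u by exists u'.
by exists (fun b => th (u <o> b <o> r)); apply: serre_form_iso.
Qed.

Section Transpose.
Variables (X Z X' Z' : O) (th : Hom C X Z -> k^o) (th' : Hom C X' Z' -> k^o).
Hypotheses (sf : serre_form th) (sf' : serre_form th').
(** [a'] is the image of [a] under a Serre functor. Existence and uniqueness of transposes make this
    relation serve as a functor before one has been chosen. *)
Definition transpose_rel (a : Hom C X X') (a' : Hom C Z Z') :=
  forall b : Hom C X' Z, th (b <o> a) = th' (a' <o> b).
Lemma transpose_r a : exists a', transpose_rel a a'.
Proof.
have [_ _ _ s2] := sf'.2 Z; have [|a' aE] := s2 (fun b => th (b <o> a)); last by exists a' => b; rewrite aE.
by move=> c x y; rewrite compDl compZl sf.1.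
Qed.
Lemma transpose_l a' : exists a, transpose_rel a a'.
Proof.
have [_ _ s1 _] := sf.2 X'; have [|a aE] := s1 (fun b => th' (a' <o> b)); last by exists a => b; rewrite aE.
by move=> c x y; rewrite compDr compZr sf'.1.
Qed.
Lemma transpose_uniq_r a a1 a2 : transpose_rel a a1 -> transpose_rel a a2 -> a1 = a2.
Proof.
move=> h1 h2; apply/subr0_eq; have [_ i2 _ _] := sf'.2 Z; apply: i2 => b.
by rewrite compDl -scaleN1r compZl scaleN1r (linearB0 sf'.1) -h1 -h2 subrr.
Qed.
Lemma transpose_uniq_l a1 a2 a' : transpose_rel a1 a' -> transpose_rel a2 a' -> a1 = a2.
Proof.
move=> h1 h2; apply/subr0_eq; have [i1 _ _ _] := sf.2 X'; apply: i1 => b.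
by rewrite compDr -scaleN1r compZr scaleN1r (linearB0 sf.1) h1 h2 subrr.
Qed.
Lemma transpose_linear c a1 a2 a1' a2' : transpose_rel a1 a1' -> transpose_rel a2 a2' ->
  transpose_rel (c *: a1 + a2) (c *: a1' + a2').
Proof. by move=> h1 h2 b; rewrite compDr compZr compDl compZl sf.1 sf'.1 h1 h2. Qed.
End Transpose.

Lemma transpose_id X Z (th : Hom C X Z -> k^o) : transpose_rel th th (idm C X) (idm C Z).
Proof. by move=> b; rewrite compm1 comp1m. Qed.
Lemma transpose_comp X Z X' Z' X'' Z'' (th : Hom C X Z -> k^o) (th' : Hom C X' Z' -> k^o)
    (th'' : Hom C X'' Z'' -> k^o) a a' b b' :
  transpose_rel th th' a a' -> transpose_rel th' th'' b b' -> transpose_rel th th'' (b <o> a) (b' <o> a').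
Proof. by move=> h h' c; rewrite compA h compA h' compA. Qed.

Lemma serre_pair_uniq_r X Z Z' : serre_pair X Z -> serre_pair X Z' -> iso_obj C Z Z'.
Proof.
move=> [th sf] [th' sf'].
have [a aE] := transpose_r sf sf' (idm C X); have [b bE] := transpose_r sf' sf (idm C X).
have ab := transpose_comp aE bE; have ba := transpose_comp bE aE; rewrite !comp1m in ab ba.
exists a, b; split.
  exact: (transpose_uniq_r sf ab (@transpose_id _ _ th)).
exact: (transpose_uniq_r sf' ba (@transpose_id _ _ th')).
Qed.
Lemma serre_pair_uniq_l X X' Z : serre_pair X Z -> serre_pair X' Z -> iso_obj C X X'.
Proof.
move=> [th sf] [th' sf'].
have [a aE] := transpose_l sf sf' (idm C Z); have [b bE] := transpose_l sf' sf (idm C Z).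
have ab := transpose_comp aE bE; have ba := transpose_comp bE aE; rewrite !comp1m in ab ba.
exists a, b; split.
  exact: (transpose_uniq_l sf ab (@transpose_id _ _ th)).
exact: (transpose_uniq_l sf' ba (@transpose_id _ _ th')).
Qed.
Lemma serre_pair_hom0 X Z Y : serre_pair X Z ->
  (forall h : Hom C Y Z, h = 0) <-> (forall h : Hom C X Y, h = 0).
Proof.
move=> [th [lth pth]]; have [i1 i2 _ _] := pth Y; split=> h0 h.
  by apply: i1 => g; rewrite (h0 g) comp0m linear00.
by apply: i2 => f; rewrite (h0 f) compm0 linear00.
Qed.
End SerreForms.

Section DerivedSerre.
Local Open Scope ring_scope.
Variables (k : fieldType) (A : fdAlgType k).
Implicit Types (X Y Z : cplx A).
Variable D : derived A.
Local Notation Q f := (fmap (dloc D) f).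
Local Notation "g <o> f" := (comp D g f) (at level 40, left associativity).

Lemma serre_form_unshift X Z (th : Hom D (shift X) (shift Z) -> k^o) : serre_form th ->
  serre_form (fun b : Hom D X Z => th (fmap (dshift D) b)).
Proof.
move=> [lth pth]; split=> [c x y|Y]; first by rewrite fmap_linear lth.
have [i1 i2 s1 s2] := pth (shift Y); split=> [f h|g h|phi lphi|phi lphi].
- apply/dshift_faithful/i1 => g; have [g' <-] := dshift_full g.
  by rewrite -fmap_comp.
- apply/dshift_faithful/i2 => g0; have [g' <-] := dshift_full g0.
  by rewrite -fmap_comp.
- have [G GE] : exists G : Hom D (shift Y) (shift Z) -> k^o, forall g, G (fmap (dshift D) g) = phi g.
    have /choice[G GE] (g' : Hom D (shift Y) (shift Z)) : exists g, fmap (dshift D) g = g' := dshift_full g'.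
    exists (fun g' => phi (G g')) => g.
    by congr phi; apply: dshift_inj; rewrite GE.
  have [|f fE] := s1 G.
    by move=> c x y; have [x' <-] := dshift_full x; have [y' <-] := dshift_full y; rewrite -fmap_linear !GE lphi.
  by have [f' f'E] := dshift_full f; exists f' => g; rewrite fmap_comp f'E fE GE.
have [G GE] : exists G : Hom D (shift X) (shift Y) -> k^o, forall g, G (fmap (dshift D) g) = phi g.
  have /choice[G GE] (g' : Hom D (shift X) (shift Y)) : exists g, fmap (dshift D) g = g' := dshift_full g'.
  exists (fun g' => phi (G g')) => g.
  by congr phi; apply: dshift_inj; rewrite GE.
have [|f fE] := s2 G.
  by move=> c x y; have [x' <-] := dshift_full x; have [y' <-] := dshift_full y; rewrite -fmap_linear !GE lphi.
by have [f' f'E] := dshift_full f; exists f' => g; rewrite fmap_comp f'E fE GE.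
Qed.

Lemma shift_functional X Z (th : Hom D X Z -> k^o) : exists th' : Hom D (shift X) (shift Z) -> k^o,
  forall b, th' (fmap (dshift D) b) = th b.
Proof.
have /choice[G GE] (g' : Hom D (shift X) (shift Z)) : exists g, fmap (dshift D) g = g' := dshift_full g'.
exists (fun g' => th (G g')) => g.
by congr th; apply: dshift_inj; rewrite GE.
Qed.
Lemma serre_form_shift X Z (th : Hom D X Z -> k^o) (th' : Hom D (shift X) (shift Z) -> k^o) :
  (forall b, th' (fmap (dshift D) b) = th b) -> serre_form th -> serre_form th'.
Proof.
move=> E [lth pth]; split=> [c x y|Y].
  have [x' <-] := dshift_full x; have [y' <-] := dshift_full y.
  by rewrite -fmap_linear !E lth.
have [Y0 [u [ui _]]] := unshift_exists Y.
apply: (@perfect_iso _ _ _ _ _ _ (shift Y0)); first by exists (Q u); apply: Q_iso.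
have [i1 i2 s1 s2] := pth Y0; split=> [f h|g h|phi lphi|phi lphi].
- have [f' f'E] := dshift_full f; rewrite -f'E (i1 f') ?fmap0 // => g.
  by rewrite -E fmap_comp f'E.
- have [f' f'E] := dshift_full g; rewrite -f'E (i2 f') ?fmap0 // => g0.
  by rewrite -E fmap_comp f'E.
- have [|f fE] := s1 (fun g => phi (fmap (dshift D) g)); first by move=> c x y; rewrite fmap_linear lphi.
  exists (fmap (dshift D) f) => g; have [g' <-] := dshift_full g.
  by rewrite -fmap_comp E fE.
have [|f fE] := s2 (fun g => phi (fmap (dshift D) g)); first by move=> c x y; rewrite fmap_linear lphi.
exists (fmap (dshift D) f) => g; have [g' <-] := dshift_full g.
by rewrite -fmap_comp E fE.
Qed.
Lemma serre_pair_shift X Z : serre_pair D X Z -> serre_pair D (shift X) (shift Z).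
Proof.
move=> [th sf]; have [th' E] := shift_functional th.
by exists th'; apply: serre_form_shift E sf.
Qed.
Lemma serre_pair_unshift X Z : serre_pair D (shift X) (shift Z) -> serre_pair D X Z.
Proof. by move=> [th sf]; exists (fun b => th (fmap (dshift D) b)); apply: serre_form_unshift. Qed.

(** [phi] is pulled back to the chain maps and extended from this subspace to all families. The
    extension kills null-homotopic families since these are chain maps that vanish in the derived
    category. *)
Lemma chain_functional X Y (phi : Hom D X Y -> k^o) : linear phi ->
  exists psi : fam X Y -> k^o, [/\ linear psi, forall f : chain_map X Y, psi (chain_val f) = phi (Q f)
    & forall v, nullfam v -> psi v = 0].
Proof.
move=> lphi; pose W (v : fam X Y) := exists f : chain_map X Y, chain_val f = v.
have Wf f : W (chain_val f) by exists f.
have [F FE] : exists F : fam X Y -> k^o, forall f : chain_map X Y, F (chain_val f) = phi (Q f).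
  have /choice[F FE] (v : fam X Y) : exists y : k^o, forall f : chain_map X Y, chain_val f = v -> y = phi (Q f).
    have [[f fv]|n] := pselect (W v); last by exists 0 => f fv; case: n; exists f.
    by exists (phi (Q f)) => g gv; congr (phi (Q _)); apply: val_inj; rewrite /= fv gv.
  by exists F => f; apply: FE.
have sW : subspace W.
  by split=> [|c x y [f <-] [g <-]]; [exists 0 | exists (c *: f + g)].
have lF : linear_on W F.
  move=> c x y [f <-] [g <-]; rewrite -[c *: chain_val f + chain_val g]/(chain_val (c *: f + g)) !FE.
  by rewrite -lphi; congr phi; apply: (fmap_linear (dloc D)).
have [psi [lpsi E]] := functional_extend (@fam_spanned _ _ X Y) sW lF.
exists psi; split=> // [f|v [h hE]]; first by rewrite E.
have [f [nf fE]] := nullfam_exists h.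
have <- : chain_val f = v.
  by apply: functional_extensionality_dep; apply: int_succ_ind => i; rewrite hE -fE.
by rewrite E // FE Q_null // linear00.
Qed.

Section FromComplexes.
Variables (P J : cplx A) (th : forall i, 'Hom(mhom (P i) (J i), k^o)).
Hypotheses (np : forall i, npair (th i))
  (compat : forall i (b : mhom (P (i + 1)) (J i)), th i (mcomp b (cd P i)) = - th (i + 1) (mcomp (cd J i) b)).
Let pP : proj_cplx P. Proof. by move=> i; apply: npair_proj (np i). Qed.
Let jJ : inj_cplx J. Proof. by move=> i; apply: npair_inj (np i). Qed.

(** Morphisms out of [P] and morphisms into [J] are homotopy classes of chain maps, so [fam_trace]
    descends to a form. It is nondegenerate: a chain map that is not null-homotopic is separated
    from the null-homotopic families by a functional, which is represented by a chain map on the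
    other side and takes the value 1. *)
Lemma serre_form_complexes : exists theta : Hom D P J -> k^o, serre_form theta /\
  forall f : chain_map P J, theta (Q f) = fam_trace th (chain_val f).
Proof.
have [theta E] : exists theta : Hom D P J -> k^o,
    forall f : chain_map P J, theta (Q f) = fam_trace th (chain_val f).
  have /choice[F FE] (b : Hom D P J) : exists y : k^o, forall f, Q f = b -> y = fam_trace th (chain_val f).
    have [f <-] := Q_full_proj b pP; exists (fam_trace th (chain_val f)) => g e.
    have : nullhomotopic (f - g) by apply: (Q_faithful_proj pP (D := D)); rewrite QB e subrr.
    by move/(fam_trace_null np compat); rewrite (linearB0 (fam_trace_linear th)) => /subr0_eq.
  by exists F => f; apply: FE.
exists theta; split=> //; split.
  move=> c x y; have [f <-] := Q_full_proj x pP; have [g <-] := Q_full_proj y pP.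
  rewrite !E -(fam_trace_linear th); rewrite -[RHS](E (c *: f + g)).
  by congr theta; apply/esym/(fmap_linear (dloc D)).
move=> Y; split=> [h h0|h h0|phi lphi|phi lphi].
- have [f fE] := Q_full_proj h pP; rewrite -fE in h0 *; apply: Q_null; apply: contrapT => nf.
  have [psi [lpsi psi0 psi1]] := functional_separate (@fam_spanned _ _ P Y) (@nullfam_subspace _ _ P Y) nf.
  have [g gE] := trace_repr_right np compat lpsi psi0.
  move: psi1; rewrite gE -[fam_trace _ _]/(fam_trace th (chain_val (chain_comp g f))) -E Q_comp h0.
  by move/esym/eqP; rewrite oner_eq0.
- have [f fE] := Q_full_inj h jJ; rewrite -fE in h0 *; apply: Q_null; apply: contrapT => nf.
  have [psi [lpsi psi0 psi1]] := functional_separate (@fam_spanned _ _ Y J) (@nullfam_subspace _ _ Y J) nf.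
  have [g gE] := trace_repr_left np compat lpsi psi0.
  move: psi1; rewrite gE -[fam_trace _ _]/(fam_trace th (chain_val (chain_comp f g))) -E Q_comp h0.
  by move/esym/eqP; rewrite oner_eq0.
- have [psi [lpsi psiE psi0]] := chain_functional lphi.
  have [f fE] := trace_repr_left np compat lpsi psi0.
  exists (Q f) => g; have [g' <-] := Q_full_inj g jJ.
  by rewrite -Q_comp E -psiE fE.
have [psi [lpsi psiE psi0]] := chain_functional lphi.
have [f fE] := trace_repr_right np compat lpsi psi0.
exists (Q f) => g; have [g' <-] := Q_full_proj g pP.
by rewrite -Q_comp E -psiE fE.
Qed.
End FromComplexes.
End DerivedSerre.

Section NakayamaComplexes.
Local Open Scope ring_scope.
Variables (k : fieldType) (A : fdAlgType k).
Implicit Types (X Y Z : cplx A) (M N : rmod A).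

Lemma nu_mzero M : mzero M -> mzero (nu M).
Proof.
move=> z phi; apply/lfunP => h; rewrite (mzero_hom_from h z) lf0 zero_lfunE //.
Qed.
Lemma nuinv_mzero M : mzero M -> mzero (nuinv M).
Proof. by move=> z phi; apply: (mzero_hom_to phi z). Qed.

(* The sign of the differentials replaces the signs (-1)^i that the degreewise trace forms of P^i
   and nu P^i would otherwise need. *)
Section Nu.
Variable X : cplx A.
Fact nu_cplx_dd i : mcomp (- nu_map (cd X (i + 1))) (- nu_map (cd X i)) = 0.
Proof. by rewrite mcompNl mcompNr opprK -nu_map_comp cdd nu_map0. Qed.
Fact nu_cplx_bounded : exists n : nat, forall i : int, (n < absz i)%N -> forall x : nu (X i), x = 0.
Proof. by have [n hn] := cbounded X; exists n => i hi; apply: nu_mzero; apply: hn. Qed.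
Definition nu_cplx : cplx A := Cplx nu_cplx_dd nu_cplx_bounded.
Fact nuinv_cplx_dd i : mcomp (- nuinv_map (cd X (i + 1))) (- nuinv_map (cd X i)) = 0.
Proof. by rewrite mcompNl mcompNr opprK -nuinv_map_comp cdd nuinv_map0. Qed.
Fact nuinv_cplx_bounded : exists n : nat, forall i : int, (n < absz i)%N -> forall x : nuinv (X i), x = 0.
Proof. by have [n hn] := cbounded X; exists n => i hi; apply: nuinv_mzero; apply: hn. Qed.
Definition nuinv_cplx : cplx A := Cplx nuinv_cplx_dd nuinv_cplx_bounded.
End Nu.

Variable D : derived A.
Lemma serre_pair_nu X : proj_cplx X -> serre_pair D X (nu_cplx X).
Proof.
move=> pX; have [||th [sth _]] := @serre_form_complexes _ _ D X (nu_cplx X) (fun i => nu_theta (pX i)).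
- by move=> i; apply: npair_nu.
- by move=> i b; rewrite mcompNl lfN opprK; apply: nu_theta_nat.
by exists th.
Qed.
Lemma serre_pair_nuinv X : inj_cplx X -> serre_pair D (nuinv_cplx X) X.
Proof.
move=> jX; have [||th [sth _]] := @serre_form_complexes _ _ D (nuinv_cplx X) X (fun i => nuinv_theta (jX i)).
- by move=> i; apply: npair_nuinv.
- by move=> i b; rewrite mcompNr lfN; congr (- _); apply: nuinv_theta_nat.
by exists th.
Qed.

Lemma qis_iso_obj X Y (s : chain_map X Y) : quasi_iso s -> iso_obj D X Y.
Proof. by move=> qs; exists (fmap (dloc D) s); apply: dloc_isom. Qed.
Lemma unshift_obj X : exists W, iso_obj D (shift W) X /\ forall i, mzero (X i) -> mzero (W (i + 1)).
Proof.
have [W [u [ui z]]] := unshift_exists X; exists W; split=> //.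
by exists (fmap (dloc D) u); apply: Q_iso.
Qed.

Hypothesis hA : hereditary A.
(** The Serre image is presented as a shift because tau is to satisfy tau[1] = S. *)
Lemma serre_right X : exists W, serre_pair D X (shift W).
Proof.
have [P [s [pP qs _]]] := proj_resolution hA X; have [W [wi _]] := unshift_obj (nu_cplx P).
exists W; apply: serre_pair_iso (qis_iso_obj qs) (iso_obj_sym wi) (serre_pair_nu pP).
Qed.
Lemma serre_left Z : exists W, serre_pair D W Z.
Proof.
have [J [s [jJ qs _]]] := inj_resolution hA Z; have [W [wi _]] := unshift_obj (nuinv_cplx J).
exists W; apply: serre_pair_unshift.
exact: serre_pair_iso (iso_obj_sym wi) (iso_obj_sym (qis_iso_obj qs)) (serre_pair_nuinv jJ).
Qed.
End NakayamaComplexes.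

(** * Equivalences and adjoint quasi-inverses *)

Section FullyFaithful.
Local Open Scope ring_scope.
Variables (k : fieldType) (O : Type) (C : klcat k O) (F0 : O -> O) (F : functor C C F0).
Local Notation "g <o> f" := (comp C g f) (at level 40, left associativity).

Definition fully_faithful :=
  (forall X Y (h : Hom C (F0 X) (F0 Y)), exists g : Hom C X Y, fmap F g = h) /\
  (forall X Y (g : Hom C X Y), fmap F g = 0 -> g = 0).
Definition ess_surjective := forall Z, exists X, iso_obj C (F0 X) Z.

Lemma ff_inj : fully_faithful -> forall X Y (g g' : Hom C X Y), fmap F g = fmap F g' -> g = g'.
Proof. by move=> [_ fa] X Y g g' e; apply/subr0_eq/fa; rewrite fmapB e subrr. Qed.

(** The unit at [X] is defined as the preimage under [F] of the counit at [F0 X]. This is the first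
    triangle identity; the second one follows after applying the faithful functor [F]. *)
Lemma quasi_inverse_exists : fully_faithful -> ess_surjective -> exists Q : quasi_inverse F, True.
Proof.
move=> ff eso; have inj := ff_inj ff; have [ful _] := ff.
have [G0 G0P] := choice eso.
have [e eP] := dep_choice G0P.
have [e' e'P] := @dep_choice _ (fun Z => Hom C Z (F0 (G0 Z)))
  (fun Z x => x <o> e Z = idm C _ /\ e Z <o> x = idm C _) eP.
have e1 Z := (e'P Z).1; have e2 Z := (e'P Z).2.
pose G X Y (f : Hom C X Y) := sval (cid (ful _ _ (e' Y <o> (f <o> e X)))).
have GE X Y f : fmap F (@G X Y f) = e' Y <o> (f <o> e X) by rewrite /G; case: cid.
have Glin X Y : linear (@G X Y).
  move=> c f g; apply: inj; rewrite fmap_linear !GE compDl compZl compDr compZr //.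
have Gid X : G X X (idm C X) = idm C (G0 X) by apply: inj; rewrite GE fmap_id comp1m e1.
have Gcomp X Y Z (g : Hom C Y Z) (f : Hom C X Y) : G X Z (g <o> f) = G Y Z g <o> G X Y f.
  by apply: inj; rewrite fmap_comp !GE -!compA (compA (e Y)) e2 comp1m.
pose GF : functor C C G0 := Functor Glin Gid Gcomp.
pose eta X := sval (cid (ful _ _ (e (F0 X)))).
have etaE X : fmap F (eta X) = e (F0 X) by rewrite /eta; case: cid.
have cn X Y (f : Hom C X Y) :
    e Y <o> fmap (functor_comp GF F) f = fmap (functor_id C) f <o> e X.
  by rewrite -[fmap (functor_comp GF F) f]/(fmap F (G X Y f)) GE !compA e2 comp1m.
pose counit : nat_iso (functor_comp GF F) (functor_id C) := NatIso eP cn.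
have etai X : isom (eta X).
  have [h hE] := ful _ _ (e' (F0 X)); exists h.
  by split; apply: inj; rewrite fmap_comp fmap_id etaE hE ?e1 ?e2.
have un X Y (f : Hom C X Y) :
    eta Y <o> fmap (functor_comp F GF) f = fmap (functor_id C) f <o> eta X.
  apply: inj; rewrite !fmap_comp !etaE -[fmap (functor_comp F GF) f]/(G _ _ (fmap F f)) GE.
  by rewrite !compA e2 comp1m.
pose unit : nat_iso (functor_comp F GF) (functor_id C) := NatIso etai un.
have tG X : fmap GF (counit X) = unit (G0 X).
  apply: inj; rewrite -[fmap GF _]/(G _ _ (e X)) -[nat_map unit _]/(eta (G0 X)) GE etaE.
  by rewrite compA e1 comp1m.
by exists (@QuasiInverse _ _ _ _ F G0 GF counit unit etaE tG).
Qed.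
End FullyFaithful.

Section QuasiInverse.
Local Open Scope ring_scope.
Variables (k : fieldType) (O : Type) (C : klcat k O) (F0 : O -> O) (F : functor C C F0).
Local Notation "g <o> f" := (comp C g f) (at level 40, left associativity).
Variable Q : quasi_inverse F.
Lemma qinv_counit_nat X Y (f : Hom C X Y) :
  qinv_counit Q Y <o> fmap F (fmap (qinv Q) f) = f <o> qinv_counit Q X.
Proof. exact: (nat_comm (qinv_counit Q) f). Qed.
Lemma qinv_unit_nat X Y (f : Hom C X Y) :
  qinv_unit Q Y <o> fmap (qinv Q) (fmap F f) = f <o> qinv_unit Q X.
Proof. exact: (nat_comm (qinv_unit Q) f). Qed.

Lemma qinv_ff : fully_faithful (qinv Q).
Proof.
split=> [X Y h|X Y g g0].
  have [v [v1 v2]] := nat_isom (qinv_counit Q) X.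
  exists (qinv_counit Q Y <o> fmap F h <o> v); rewrite !fmap_comp qinv_triangleG qinv_unit_nat.
  by rewrite -qinv_triangleG -compA -fmap_comp v2 fmap_id compm1.
have := qinv_counit_nat g; rewrite g0 fmap0 compm0 => /esym h.
have [v [v1 v2]] := nat_isom (qinv_counit Q) X.
by rewrite -[g]compm1 -v2 compA h comp0m.
Qed.
Lemma qinv_eso : ess_surjective C (qinv0 Q).
Proof. by move=> Z; exists (F0 Z); exists (qinv_unit Q Z); apply: (nat_isom (qinv_unit Q)). Qed.
End QuasiInverse.

Section ClusterData.
Local Open Scope ring_scope.
Variables (k : fieldType) (A : fdAlgType k) (D : derived A).
Implicit Types X Y Z : cplx A.
Local Notation "g <o> f" := (comp D g f) (at level 40, left associativity).
Hypothesis hA : hereditary A.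

(** Pairing with the identity of [X] turns the bilinear form [spair] back into a trace form. *)
Definition serre_data (S : cluster_data D) :=
  forall X, serre_form (fun g : Hom D X (shift (ctau0 S X)) => spair (ctau_serre S) (idm D X) g).
(** On objects tau is chosen together with a trace form, on morphisms it is the transpose.
    Uniqueness of transposes gives functoriality and faithfulness, their existence gives fullness,
    and [serre_left] gives essential surjectivity. *)
Lemma cluster_data_exists : exists S : cluster_data D, serre_data S.
Proof.
have [tt0 ttP] := @dep_choice _ (fun X => {W : cplx A & Hom D X (shift W) -> k^o})
  (fun X p => serre_form (projT2 p))
  (fun X => let: ex_intro W (ex_intro th sth) := serre_right D hA X in
            ex_intro _ (existT _ W th) sth).
pose t0 X := projT1 (tt0 X); pose th X : Hom D X (shift (t0 X)) -> k^o := projT2 (tt0 X).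
have sth X : serre_form (th X) := ttP X.
have tex X Y (f : Hom D X Y) : exists g : Hom D (t0 X) (t0 Y), transpose_rel (th X) (th Y) f (fmap (dshift D) g).
  by have [f' f'E] := transpose_r (sth X) (sth Y) f; have [g gE] := dshift_full f'; exists g; rewrite gE.
pose t X Y (f : Hom D X Y) := sval (cid (tex X Y f)).
have tE X Y f : transpose_rel (th X) (th Y) f (fmap (dshift D) (t X Y f)) by rewrite /t; case: cid.
have tuniq X Y (f : Hom D X Y) g : transpose_rel (th X) (th Y) f (fmap (dshift D) g) -> t X Y f = g.
  by move=> h; apply/dshift_inj/(transpose_uniq_r (sth Y) (tE X Y f) h).
have tlin X Y : linear (t X Y).
  by move=> c f g; apply: tuniq; rewrite fmap_linear; apply: (transpose_linear (sth X) (sth Y)); apply: tE.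
have tid X : t X X (idm D X) = idm D (t0 X).
  by apply: tuniq; rewrite fmap_id; apply: transpose_id.
have tcomp X Y Z (g : Hom D Y Z) (f : Hom D X Y) : t X Z (g <o> f) = t Y Z g <o> t X Y f.
  by apply: tuniq; rewrite fmap_comp; apply: transpose_comp (tE _ _ _) (tE _ _ _).
pose T : functor D D t0 := Functor tlin tid tcomp.
have tff : fully_faithful T.
  split=> [X Y h|X Y g g0].
    have [a aE] := transpose_l (sth X) (sth Y) (fmap (dshift D) h).
    by exists a; apply: tuniq.
  apply: (transpose_uniq_l (sth X) (tE X Y g)) => b.
  rewrite [t _ _ _]g0 fmap0 compm0 comp0m (linear00 (sth X).1) (linear00 (sth Y).1) //.
have teso : ess_surjective D t0.
  move=> Z; have [X XZ] := serre_left D hA (shift Z); exists X.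
  by apply: dshift_iso_obj; apply: serre_pair_uniq_r XZ; exists (th X).
pose sp X Y (f : Hom D X Y) (g : Hom D Y (shift (t0 X))) : k^o := th X (g <o> f).
have sl X Y g : linear (fun f : Hom D X Y => sp X Y f g).
  by move=> c f f'; rewrite /sp compDr compZr (sth X).1.
have sr X Y f : linear (@sp X Y f).
  by move=> c g g'; rewrite /sp compDl compZl (sth X).1.
have si X Y (f : Hom D X Y) : (forall g, sp X Y f g = 0) -> f = 0.
  by case: ((sth X).2 Y) => i1 _ _ _ h; apply: i1.
have ss X Y (phi : Hom D Y (shift (t0 X)) -> k^o) : linear phi ->
    exists f : Hom D X Y, forall g, sp X Y f g = phi g.
  by case: ((sth X).2 Y) => _ _ s1 _; apply: s1.
have nr X Y Y' (f : Hom D X Y) (h : Hom D Y Y') (g : Hom D Y' (shift (t0 X))) :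
    sp X Y' (h <o> f) g = sp X Y f (g <o> h) by rewrite /sp compA.
have nl X X' Y (f : Hom D X Y) (h : Hom D X' X) (g : Hom D Y (shift (t0 X'))) :
    sp X' Y (f <o> h) g = sp X Y f (fmap (functor_comp T (dshift D)) h <o> g).
  by rewrite /sp compA tE -compA.
pose SD : serre_duality (functor_comp T (dshift D)) := SerreDuality sl sr si ss nr nl.
have [Qt _] := quasi_inverse_exists tff teso.
have [|Z|QF _] := @quasi_inverse_exists _ _ _ _ (functor_comp (qinv Qt) (dshift D)).
- have [ful fa] := qinv_ff Qt; split=> [X Y h|X Y g g0].
    have [h' <-] := dshift_full h; have [g <-] := ful _ _ h'; by exists g.
  exact/fa/dshift_faithful.
- have [W [wi _]] := unshift_obj D Z; have [X Xi] := qinv_eso Qt W.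
  by exists X; apply: iso_obj_trans wi; apply: iso_obj_shift.
exists (@ClusterData _ _ D t0 T SD Qt QF) => X.
rewrite (_ : (fun g => _) = th X) //; apply: functional_extensionality_dep => g.
exact: (congr1 (th X) (compm1 g)).
Qed.
End ClusterData.

(** * Degree bounds for the powers of F and vanishing of Hom spaces *)

Section Amplitude.
Local Open Scope ring_scope.
Variables (k : fieldType) (A : fdAlgType k) (D : derived A).
Implicit Types (X Y Z : cplx A) (M N : rmod A).
Local Notation Q f := (fmap (dloc D) f).
Local Notation "g <o> f" := (comp D g f) (at level 40, left associativity).

Lemma hom0_shift X Y : (forall h : Hom D X Y, h = 0) -> forall h : Hom D (shift X) (shift Y), h = 0.
Proof. by move=> h0 h; have [g <-] := dshift_full h; rewrite (h0 g) fmap0. Qed.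
Lemma hom0_unshift X Y : (forall h : Hom D (shift X) (shift Y), h = 0) -> forall h : Hom D X Y, h = 0.
Proof. by move=> h0 h; exact/dshift_faithful/h0. Qed.
Lemma serre_hom0_r X Y Z : serre_pair D X Z -> (forall h : Hom D Y Z, h = 0) -> forall h : Hom D X Y, h = 0.
Proof. by move=> sp; apply: (@serre_pair_hom0 _ _ _ X Z Y sp).1. Qed.
Lemma serre_hom0_l X Y Z : serre_pair D X Z -> (forall h : Hom D X Y, h = 0) -> forall h : Hom D Y Z, h = 0.
Proof. by move=> sp; apply: (@serre_pair_hom0 _ _ _ X Z Y sp).2. Qed.

(* The aisles of the standard t-structure. F lowers and F^-1 raises degrees by at least one. *)
Definition Le (a : int) X := exists Y, iso_obj D X Y /\ forall i : int, a < i -> mzero (Y i).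
Definition Ge (a : int) X := exists Y, iso_obj D X Y /\ forall i : int, i < a -> mzero (Y i).

Lemma Le_iso a X X' : iso_obj D X X' -> Le a X -> Le a X'.
Proof. by move=> i [Y [i' z]]; exists Y; split=> //; apply: iso_obj_trans i'; apply: iso_obj_sym. Qed.
Lemma Ge_iso a X X' : iso_obj D X X' -> Ge a X -> Ge a X'.
Proof. by move=> i [Y [i' z]]; exists Y; split=> //; apply: iso_obj_trans i'; apply: iso_obj_sym. Qed.
Lemma Le_weak a b X : a <= b -> Le a X -> Le b X.
Proof. by move=> ab [Y [i z]]; exists Y; split=> // j bj; apply: z; lia. Qed.
Lemma Ge_weak a b X : b <= a -> Ge a X -> Ge b X.
Proof. by move=> ab [Y [i z]]; exists Y; split=> // j bj; apply: z; lia. Qed.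
Lemma Le_shift a X : Le a X -> Le (a - 1) (shift X).
Proof.
move=> [Y [i z]]; exists (shift Y); split; first exact: iso_obj_shift.
by move=> j aj; apply: (z (j + 1)); lia.
Qed.
Lemma Ge_shift a X : Ge a X -> Ge (a - 1) (shift X).
Proof.
move=> [Y [i z]]; exists (shift Y); split; first exact: iso_obj_shift.
by move=> j aj; apply: (z (j + 1)); lia.
Qed.
Lemma Ge_unshift a X : Ge a (shift X) -> Ge (a + 1) X.
Proof.
move=> [Y [i z]]; have [W [wi zW]] := unshift_obj D Y; exists W; split.
  by apply: dshift_iso_obj; apply: iso_obj_trans i _; apply: iso_obj_sym.
apply: int_succ_ind => j aj; apply: zW; apply: z; lia.
Qed.
Lemma Le_stalk M : Le 0 (stalk M).
Proof. by exists (stalk M); split=> [|i i0]; [apply: iso_obj_refl | apply: stalk_mzero; lia]. Qed.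
Lemma Ge_stalk M : Ge 0 (stalk M).
Proof. by exists (stalk M); split=> [|i i0]; [apply: iso_obj_refl | apply: stalk_mzero; lia]. Qed.

Lemma hom_proj_zero X Y : proj_cplx X -> (forall i, mzero (X i) \/ mzero (Y i)) ->
  forall h : Hom D X Y, h = 0.
Proof.
move=> pX z h; have [f <-] := Q_full_proj h pX; rewrite (_ : f = 0) ?fmap0 //.
apply: chain_inj => i; have [zX|zY] := z i.
  by rewrite [f i](mzero_hom_from _ zX) [RHS](mzero_hom_from _ zX).
by rewrite [f i](mzero_hom_to _ zY) [RHS](mzero_hom_to _ zY).
Qed.
Lemma proj_hom_Le P Y : projective P -> Le (-1) Y -> forall h : Hom D (stalk P) Y, h = 0.
Proof.
move=> pP [Z [i z]]; apply/(hom0_iso (iso_obj_refl D _) (iso_obj_sym i)).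
apply: hom_proj_zero (proj_stalk pP) _ => j; have [->|j0] := eqVneq j 0; last by left; apply: stalk_mzero.
by right; apply: z.
Qed.

Section StalkForm.
Variables (P J : rmod A) (th : 'Hom(mhom P J, k^o)).
Definition stalk_form i : 'Hom(mhom (stalk P i) (stalk J i), k^o) :=
  match i with Posz 0 => th | _ => 0 end.
Lemma npair_stalk : npair th -> forall i, npair (stalk_form i).
Proof. by move=> np; case=> [[|i]|i] //; apply: npair_mzero; apply: mzero_zero_mod. Qed.
Lemma stalk_form_compat i (b : mhom (stalk P (i + 1)) (stalk J i)) :
  stalk_form i (mcomp b (cd (stalk P) i)) = - stalk_form (i + 1) (mcomp (cd (stalk J) i) b).
Proof.
have -> : mcomp b (cd (stalk P) i) = 0 by exact: mcomp0.
have -> : mcomp (cd (stalk J) i) b = 0 by exact: mcomp0l.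
by rewrite [LHS]linear0 [X in - X]linear0 oppr0.
Qed.
End StalkForm.
Lemma serre_pair_stalk P : projective P -> serre_pair D (stalk P) (stalk (nu P)).
Proof.
move=> pP; have [||th [sth _]] := @serre_form_complexes _ _ D (stalk P) (stalk (nu P)) (stalk_form (nu_theta pP)).
- by apply: npair_stalk; apply: npair_nu.
- exact: stalk_form_compat.
by exists th.
Qed.

Section ExtOfSequence.
Variables (L F M N : rmod A) (j : mhom L F) (p : mhom F M).
Hypotheses (ij : injective j) (pF : projective F) (ps : surj p)
  (ex : forall y, p y = 0 <-> exists x, j x = y).
(** As [F] is projective, a map from [M] to [N[1]] comes from some [c : L -> N] through the
    connecting map, and the connecting map kills every [c] that extends to [F]. *)
Lemma ses_ext1_0 : (forall c : mhom L N, exists e : mhom F N, mcomp e j = c) ->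
  forall h : Hom D (stalk M) (shift (stalk N)), h = 0.
Proof.
move=> e; have ses := ses_stalk ij ps ex.
apply/(hom0_iso (qis_iso_obj D (qis_cone_to_coker ses)) (iso_obj_refl D _)) => h.
have [|w ->] := hom_from_cone (Z := shift (stalk N)) (g := h).
  exact: (proj_hom_Le pF (Le_shift (Le_stalk N))).
have [w1 <-] := dshift_full w; have [c <-] := stalk_full w1.
have [c' <-] := e c.
rewrite dshiftE -Q_comp.
by rewrite stalk_comp shift_map_comp -chain_compA; apply/Q_null/null_compl/cproj_null.
Qed.
Lemma ses_ext2_0 : (forall h : Hom D (stalk L) (shift (stalk N)), h = 0) ->
  forall h : Hom D (stalk M) (shift (shift (stalk N))), h = 0.
Proof.
move=> e; have ses := ses_stalk ij ps ex.
apply/(hom0_iso (qis_iso_obj D (qis_cone_to_coker ses)) (iso_obj_refl D _)) => h.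
have [|w ->] := hom_from_cone (Z := shift (shift (stalk N))) (g := h).
  by apply: (proj_hom_Le pF); apply: Le_weak (Le_shift (Le_shift (Le_stalk N))); lia.
by rewrite (hom0_shift e w) comp0m.
Qed.
End ExtOfSequence.

Hypothesis hA : hereditary A.
(** The projective resolution of a module lives in degrees -1 and 0, which explains the bound -2
    here and the bound 1 in the next lemma. *)
Lemma stalk_hom_Le M Y : Le (-2) Y -> forall h : Hom D (stalk M) Y, h = 0.
Proof.
move=> [Z [i z]]; have [P [s [pP qs zP]]] := proj_resolution hA (stalk M).
apply/(hom0_iso (qis_iso_obj D qs) (iso_obj_sym i)).
apply: hom_proj_zero pP _ => j; have [h|h] := boolP ((j == 0) || (j == -1)).
  by right; apply: z; lia.
by left; apply: zP; apply: stalk_mzero; lia.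
Qed.
Lemma stalk_hom_Ge M Y : Ge 1 Y -> forall h : Hom D (stalk M) Y, h = 0.
Proof.
move=> [Z [i z]]; have [P [s [pP qs zP]]] := proj_resolution hA (stalk M).
apply/(hom0_iso (qis_iso_obj D qs) (iso_obj_sym i)).
apply: hom_proj_zero pP _ => j; have [h|h] := boolP ((j == 0) || (j == -1)).
  by right; apply: z; lia.
by left; apply: zP; apply: stalk_mzero; lia.
Qed.
Lemma ext_hom0 M N : extz M N -> forall h : Hom D (stalk M) (shift (stalk N)), h = 0.
Proof.
move=> e; have [K [j kj]] := kernel_exists (free_ev M).
have pF : projective (free M) by exact: proj_free.
have sF : surj (free_ev M) by exact: free_ev_surj.
by apply: (ses_ext1_0 kj.1 pF sF kj.2) => c; apply: e kj sF c.
Qed.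

Variable S : cluster_data D.
Hypothesis hS : serre_data S.
Local Notation F0 := (fun X => shift (qinv0 (ctau_inv S) X)).
Local Notation G0 := (qinv0 (cF_inv S)).
(** S(F Y) = tau(tau^-1 Y[1])[1] = Y[2]. Thus Serre duality alone describes [F] on objects, up to
    isomorphism. *)
Lemma F_serre Y : serre_pair D (F0 Y) (shift (shift Y)).
Proof.
apply: serre_pair_shift; have [f fi] : iso_obj D (ctau0 S (qinv0 (ctau_inv S) Y)) Y.
  by exists (qinv_counit (ctau_inv S) Y); apply: (nat_isom (qinv_counit (ctau_inv S))).
apply: serre_pair_iso (iso_obj_refl D _) (iso_obj_shift (ex_intro _ f fi)) _.
exists (fun g => spair (ctau_serre S) (idm D _) g); exact: hS.
Qed.
Lemma G_serre Y : serre_pair D Y (shift (shift (G0 Y))).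
Proof.
apply: serre_pair_iso (iso_obj_refl D _) (F_serre (G0 Y)).
by exists (qinv_counit (cF_inv S) Y); apply: (nat_isom (qinv_counit (cF_inv S))).
Qed.

(** An injective resolution of [Y[1]] may reach up to degree [a], one more than [Y[1]] itself; one
    further shift leads from its image under [nuinv] to [F Y]. *)
Lemma Le_F a Y : Le a Y -> Le (a - 1) (F0 Y).
Proof.
move=> [Z [i z]]; have [J [s [jJ qs zJ]]] := inj_resolution hA Z.
have p : serre_pair D (shift (nuinv_cplx J)) (shift (shift Y)).
  apply/serre_pair_shift; apply: serre_pair_iso (iso_obj_refl D _) _ (serre_pair_nuinv D jJ).
  apply: iso_obj_trans (iso_obj_sym (qis_iso_obj D qs)) (iso_obj_shift (iso_obj_sym i)).
apply: Le_iso (serre_pair_uniq_l p (F_serre Y)) _; apply: Le_shift.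
exists (nuinv_cplx J); split=> [|j aj]; first exact: iso_obj_refl.
by apply: nuinv_mzero; apply: zJ; apply: z; lia.
Qed.
Lemma Ge_G a Y : Ge a Y -> Ge (a + 1) (G0 Y).
Proof.
move=> [Z [i z]]; have [P [s [pP qs zP]]] := proj_resolution hA Z.
have p : serre_pair D Y (nu_cplx P).
  apply: serre_pair_iso _ (iso_obj_refl D _) (serre_pair_nu D pP).
  exact: iso_obj_trans (qis_iso_obj D qs) (iso_obj_sym i).
rewrite (_ : a + 1 = a - 1 + 1 + 1); last by lia.
do 2!apply: Ge_unshift; apply: Ge_iso (serre_pair_uniq_r p (G_serre Y)) _.
exists (nu_cplx P); split=> [|j aj]; first exact: iso_obj_refl.
by apply: nu_mzero; apply: zP; apply: z; lia.
Qed.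
Lemma Le_fpow n a Y : Le a Y -> Le (a - n%:Z) (fpow (cF_inv S) (Posz n) Y).
Proof.
elim: n => [|n ih] h; first by rewrite subr0.
rewrite (_ : a - n.+1%:Z = a - n%:Z - 1); last by lia.
exact: Le_F (ih h).
Qed.
Lemma Ge_fpow n a Y : Ge a Y -> Ge (a + n%:Z + 1) (fpow (cF_inv S) (Negz n) Y).
Proof.
elim: n => [|n ih] h; first by rewrite addr0; apply: Ge_G.
rewrite (_ : a + n.+1%:Z + 1 = a + n%:Z + 1 + 1); last by lia.
exact: Ge_G (ih h).
Qed.
Lemma fpow_recr n Y : fpow (cF_inv S) (Negz n.+1) Y = fpow (cF_inv S) (Negz n) (G0 Y).
Proof. by rewrite /fpow iterSr. Qed.
(** For [P[1]] the first step gains one degree over the general bound, since F^-1(P[1]) = nu P[-1]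
    sits in degree 1. *)
Lemma Ge_fpow_proj n P : projective P ->
  Ge (n%:Z + 1) (fpow (cF_inv S) (Negz n) (shift (stalk P))).
Proof.
move=> pP; have g : Ge 1 (G0 (shift (stalk P))).
  rewrite (_ : 1 = -1 + 1 + 1); last by lia.
  do 2!apply: Ge_unshift; apply: Ge_iso (serre_pair_uniq_r (serre_pair_shift (serre_pair_stalk pP)) (G_serre _)) _.
  exact: Ge_shift (Ge_stalk _).
case: n => [|n]; first by rewrite add0r.
by rewrite fpow_recr; apply: Ge_weak (Ge_fpow n g); lia.
Qed.
Lemma G_proj2 P : projective P -> iso_obj D (stalk (nu P)) (G0 (shift (shift (stalk P)))).
Proof.
move=> pP; do 2!apply: dshift_iso_obj.
exact: serre_pair_uniq_r (serre_pair_shift (serre_pair_shift (serre_pair_stalk pP))) (G_serre _).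
Qed.

Variables T P : rmod A.
Hypotheses (eT : extz T T) (pP : projective P) (hPT : forall f : mhom P T, f = 0) (eNT : extz (nu P) T).
Local Notation Fp := (fpow (cF_inv S)).
Local Notation sT := (stalk T).
Local Notation sP := (shift (stalk P)).
Let LT : Le 0 sT := Le_stalk T.
Let GT : Ge 0 sT := Ge_stalk T.
Let LP : Le (-1) sP := Le_shift (Le_stalk P).
Lemma proj_shift_hom_Le Y : Le (-2) Y -> forall h : Hom D sP Y, h = 0.
Proof.
move=> l; have [W [wi _]] := unshift_obj D Y.
apply/(hom0_iso (iso_obj_refl D _) wi); apply: hom0_shift; apply: proj_hom_Le pP _.
have [Z [i z]] := Le_iso (iso_obj_sym wi) l.
have [V [vi zV]] := unshift_obj D Z; exists V; split.
  by apply: dshift_iso_obj; apply: iso_obj_trans i (iso_obj_sym vi).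
by apply: int_succ_ind => j aj; apply: zV; apply: z; lia.
Qed.
Lemma proj_shift_hom_Ge Y : Ge 0 Y -> forall h : Hom D sP Y, h = 0.
Proof.
move=> g; have [W [wi _]] := unshift_obj D Y.
apply/(hom0_iso (iso_obj_refl D _) wi); apply: hom0_shift; apply: stalk_hom_Ge.
by apply: (@Ge_unshift 0); apply: Ge_iso (iso_obj_sym wi) g.
Qed.
Lemma hom_proj_stalk0 : forall h : Hom D (stalk P) sT, h = 0.
Proof. by move=> h; have [f <-] := stalk_full h; rewrite (hPT f) [stalk_map _](fmap0 (stalk_functor A)) fmap0. Qed.

Lemma hom_TFT i : i != 0 -> i != 1 -> forall h : Hom D sT (Fp i sT), h = 0.
Proof.
case: i => [[|[|n]]|n] // _ _.
  by apply: stalk_hom_Le; apply: Le_weak (Le_fpow n.+2 LT); lia.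
by apply: stalk_hom_Ge; apply: Ge_weak (Ge_fpow n GT); lia.
Qed.
Lemma hom_PFT i : forall h : Hom D sP (Fp i sT), h = 0.
Proof.
case: i => [[|[|n]]|n].
- exact: proj_shift_hom_Ge.
(* Serre duality twice: Hom(P[1], F T) is dual to Hom(F T, nu P[1]), which is dual to Hom(nu P[1],
   T[2]) = Ext^1(nu P, T). *)
- apply: serre_hom0_r (serre_pair_shift (serre_pair_stalk pP)) _.
  by apply: serre_hom0_r (F_serre sT) _; apply: hom0_shift; apply: ext_hom0.
- by apply: proj_shift_hom_Le; apply: Le_weak (Le_fpow n.+2 LT); lia.
by apply: proj_shift_hom_Ge; apply: Ge_weak (Ge_fpow n GT); lia.
Qed.
Lemma hom_TFP i : i != 0 -> forall h : Hom D sT (Fp i sP), h = 0.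
Proof.
case: i => [[|n]|n] // _.
  by apply: stalk_hom_Le; apply: Le_weak (Le_fpow n.+1 LP); lia.
by apply: stalk_hom_Ge; apply: Ge_weak (Ge_fpow_proj n pP); lia.
Qed.
Lemma hom_PFP i : i != 0 -> forall h : Hom D sP (Fp i sP), h = 0.
Proof.
case: i => [[|n]|n] // _.
  by apply: proj_shift_hom_Le; apply: Le_weak (Le_fpow n.+1 LP); lia.
by apply: proj_shift_hom_Ge; apply: Ge_weak (Ge_fpow_proj n pP); lia.
Qed.
Lemma hom_TFTs i : forall h : Hom D sT (Fp i (shift sT)), h = 0.
Proof.
case: i => [[|n]|[|n]].
- exact: ext_hom0.
- by apply: stalk_hom_Le; apply: Le_weak (Le_fpow n.+1 (Le_shift LT)); lia.
(* Since T[1] has the Serre image (F^-1 T[1])[2], up to isomorphism, Hom(T, F^-1 T[1]) is dual to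
   Ext^1(T, T). *)
- do 2!apply: hom0_unshift; apply: serre_hom0_l (G_serre (shift sT)) _; apply: hom0_shift.
  exact: ext_hom0.
by apply: stalk_hom_Ge; apply: Ge_weak (Ge_fpow n.+1 (Ge_shift GT)); lia.
Qed.
Lemma hom_TFPs i : forall h : Hom D sT (Fp i (shift sP)), h = 0.
Proof.
case: i => [n|[|n]].
- by apply: stalk_hom_Le; apply: Le_weak (Le_fpow n (Le_shift LP)); lia.
(* F^-1(P[2]) = nu P, and Hom(T, nu P) is dual to Hom(P, T). *)
- apply/(hom0_iso (iso_obj_refl D _) (G_proj2 pP)).
  by apply: serre_hom0_l (serre_pair_stalk pP) _; apply: hom_proj_stalk0.
rewrite fpow_recr; apply: stalk_hom_Ge; apply: Ge_weak (Ge_fpow n (Ge_iso (G_proj2 pP) (Ge_stalk _))); lia.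
Qed.
Lemma hom_PFTs i : forall h : Hom D sP (Fp i (shift sT)), h = 0.
Proof.
case: i => [[|n]|n].
- by apply: hom0_shift; apply: hom_proj_stalk0.
- by apply: proj_shift_hom_Le; apply: Le_weak (Le_fpow n.+1 (Le_shift LT)); lia.
by apply: proj_shift_hom_Ge; apply: Ge_weak (Ge_fpow n (Ge_shift GT)); lia.
Qed.
Lemma hom_PFPs i : forall h : Hom D sP (Fp i (shift sP)), h = 0.
Proof.
case: i => [n|[|n]].
- by apply: proj_shift_hom_Le; apply: Le_weak (Le_fpow n (Le_shift LP)); lia.
- by apply: proj_shift_hom_Ge; apply: Ge_iso (G_proj2 pP) (Ge_stalk _).
rewrite fpow_recr; apply: proj_shift_hom_Ge; apply: Ge_weak (Ge_fpow n (Ge_iso (G_proj2 pP) (Ge_stalk _))); lia.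
Qed.
End Amplitude.

(** * Two-step extensions of DB by B *)

Section LinearDuality.
Local Open Scope ring_scope.
Variables (k : fieldType) (U V : vectType k) (f : 'Hom(U, V)).
Lemma lfun_factor (l : 'Hom(U, k^o)) : (forall x, f x = 0 -> l x = 0) ->
  exists l' : 'Hom(V, k^o), forall x, l' (f x) = l x.
Proof.
move=> h; exists (l \o f^-1)%VF => x; rewrite comp_lfunE; apply/subr0_eq; rewrite -linearB; apply: h.
by rewrite linearB /= limg_lfunVK ?memv_img ?memvf // subrr.
Qed.
Lemma lfun_surj_dual : (forall l : 'Hom(V, k^o), (forall x, l (f x) = 0) -> l = 0) ->
  forall y, exists x, f x = y.
Proof.
move=> h y; suff /memv_imgP[x _ ->] : y \in limg f by exists x.
suff -> : y = projv (limg f) y by apply: memv_proj.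
apply/subr0_eq/functional_eq0 => l.
have := h (l \o (\1 - projv (limg f)))%VF _; rewrite -[y - _]/(y - projv _ y) => e.
have {}e : (l \o (\1 - projv (limg f)))%VF y = 0.
  rewrite e ?zero_lfunE // => x; rewrite comp_lfunE add_lfunE opp_lfunE id_lfunE.
  by rewrite projv_id ?memv_img ?memvf // subrr linear0.
by rewrite -e comp_lfunE add_lfunE opp_lfunE id_lfunE.
Qed.
End LinearDuality.

(** * From minimal presentations and tau to vanishing of Ext^1 *)

Section TauFacts.
Local Open Scope ring_scope.
Variables (k : fieldType) (A : fdAlgType k).
Implicit Types M N L K Q J X Y Z : rmod A.
Hypothesis hA : hereditary A.

(** The kernel of [p0] is projective, so its projective cover [q] splits; minimality makes the
    section surjective, and [q] is an isomorphism. *)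
Lemma min_pres_kernel Q1 Q0 M (p1 : mhom Q1 Q0) (p0 : mhom Q0 M) : min_proj_pres p1 p0 ->
  [/\ projective Q1, projective Q0, surj p0 & is_kernel p1 p0].
Proof.
move=> [[pQ0 p0s _] [K [i [q [[ii iE] [pQ1 qs mq] p1E]]]]]; split=> //.
have pK : projective K := hA pQ0 ii.
have [s sE] := pK _ _ q (mid K) qs.
have qsE x : q (s x) = x by rewrite -mcompE sE midE.
have ss : surj s by apply: mq => y; exists y; rewrite mcompE qsE.
have qi : injective q by move=> x y; have [x' <-] := ss x; have [y' <-] := ss y; rewrite !qsE => ->.
rewrite p1E; split=> [x y|x]; first by rewrite !mcompE => /ii/qi.
split=> [/iE[y <-]|[y <-]]; last by apply/iE; exists (q y); rewrite mcompE.
by have [z <-] := qs y; exists z; rewrite mcompE.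
Qed.
Lemma min_copres_exact M J0 J1 (i0 : mhom M J0) (i1 : mhom J0 J1) : min_inj_copres i0 i1 ->
  [/\ injective_mod J0, injective_mod J1, injective i0, surj i1 & forall y, i1 y = 0 <-> exists x, i0 x = y].
Proof.
move=> [[jJ0 i0i _] [K [q [j [[qs qE] [jJ1 ji mj] i1E]]]]].
have jK : injective_mod K := hereditary_inj_quot hA jJ0 qs.
have [r rE] := jK _ _ j (mid K) ji.
have rjE x : r (j x) = x by rewrite -mcompE rE midE.
have ri : injective r by apply: mj => x y; rewrite !mcompE !rjE.
have js : surj j by move=> y; exists (r y); apply: ri; rewrite rjE.
split=> //; rewrite i1E.
  by move=> y; have [x <-] := js y; have [z <-] := qs x; exists z; rewrite mcompE.
move=> y; rewrite mcompE; split=> [e|/qE->]; last by rewrite lf0.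
by apply/qE/ji; rewrite e lf0.
Qed.

Lemma tau_rigid_pres T Q1 Q0 (p1 : mhom Q1 Q0) N (i : mhom N (nu Q1)) :
  is_kernel i (nu_map p1) -> (forall f : mhom T N, f = 0) ->
  forall g : mhom T (nu Q1), mcomp (nu_map p1) g = 0 -> g = 0.
Proof.
move=> [ii iE] h g g0; have [|g' <-] := factor_inj (f := g) ii.
  by move=> x; apply/iE; rewrite -mcompE g0 mhom0E.
by rewrite (h g') mcomp0.
Qed.

Section Presentation.
Variables (T Q1 Q0 : rmod A) (p1 : mhom Q1 Q0) (p0 : mhom Q0 T).
Hypotheses (pQ1 : projective Q1) (pQ0 : projective Q0) (p0s : surj p0) (kp : is_kernel p1 p0)
  (nui : forall g : mhom T (nu Q1), mcomp (nu_map p1) g = 0 -> g = 0).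

(** The Auslander-Reiten formula in this situation: precomposition with [p1] on maps to [T] is dual
    to composition with [nu_map p1] on maps from [T], and the latter is injective by hypothesis. *)
Lemma presentation_surj (c : mhom Q1 T) : exists e : mhom Q0 T, mcomp e p1 = c.
Proof.
have [|e eE] := @lfun_surj_dual _ _ _ (precomp T p1) _ c; last by exists e; rewrite -eE precompE.
move=> l l0; have [g gE] := npair_repr (npair_nu pQ1) l.
have g0 : g = 0.
  apply: nui; apply: (npair_nu pQ0).2 => e.
  by rewrite -mcompA -nu_theta_nat -mcompA gE -precompE l0.
by apply/lfunP => x; rewrite -gE g0 mcomp0l lf0 zero_lfunE.
Qed.
Lemma presentation_extz : extz T T.
Proof. by apply: (@extz_retract _ _ T T T Q1 Q0 p1 p0 (mid T) (mid T)) => //; [apply: mcomp1m | apply: presentation_surj]. Qed.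
End Presentation.

Section Copresentation.
Variables (T J0 J1 : rmod A) (i0 : mhom T J0) (i1 : mhom J0 J1).
Hypotheses (jJ0 : injective_mod J0) (jJ1 : injective_mod J1) (i0i : injective i0) (i1s : surj i1)
  (ex : forall y, i1 y = 0 <-> exists x, i0 x = y).

(** Ext^1(M, T) is the cokernel of Hom(M, J0) -> Hom(M, J1). *)
Lemma lift_extz M : (forall g : mhom M J1, exists g' : mhom M J0, mcomp i1 g' = g) -> extz M T.
Proof.
move=> h K Q i p pQ ki ps c; have [e eE] := jJ0 (mcomp i0 c) ki.1.
have [|g gE] := factor_surj (f := mcomp i1 e) ps.
  move=> x /ki.2[y <-]; rewrite mcompE -[e _]mcompE eE mcompE.
  by apply/ex; exists (c y).
have [g' g'E] := h g; have [|e' e'E] := factor_inj (f := e - mcomp g' p) i0i.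
  move=> x; apply/ex; rewrite -mcompE mcompBr mcompA g'E gE subrr mhom0E //.
exists e'; apply: (inj_cancel i0i); rewrite mcompA e'E mcompBl eE -mcompA.
have -> : mcomp p i = 0 by apply: mhom_inj => x; rewrite mcompE mhom0E; apply/ki.2; exists x.
by rewrite mcomp0 subr0.
Qed.

Variables (P N : rmod A) (qN : mhom (nuinv J1) N) (a b : nat).
Hypotheses (eT : extz T T) (pP : projective P) (hPT : forall f : mhom P T, f = 0)
  (nT : nsummands (modcat A) T a) (nP : nsummands (modcat A) P b)
  (nA : nsummands (modcat A) (regular A) (a + b))
  (cN : is_cokernel qN (nuinv_map i1)) (hPN : forall f : mhom P N, f = 0).

(* By the duality nuinv, the obstruction to lifting lies in Hom(nuinv Z, N) with N = tau^-1 T, which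
   vanishes since Hom(nuinv Z, T) is dual to Hom(T, Z). This is where Hom(P, tau^-1 T) = 0 enters. *)
Lemma inj_hom_lift Z : injective_mod Z -> (forall f : mhom T Z, f = 0) ->
  forall g : mhom Z J1, exists g' : mhom Z J0, mcomp i1 g' = g.
Proof.
move=> jZ hTZ g; have npZ := npair_nuinv jZ; pose th := nuinv_theta jZ.
have pV : projective (nuinv Z) := npair_proj npZ.
have hVT (f : mhom (nuinv Z) T) : f = 0.
  by apply: npZ.1 => h; rewrite (hTZ h) mcomp0l lf0.
have hVN := proj_orthogonal hA eT pP hPT nT nP nA pV hVT hPN.
have [u uE] := npair_hatl (nuinv_theta jJ1) g npZ.
have [|c cE] := proj_lift (g := nuinv_map i1) (f := u) pV.
  by move=> x; apply/cN.2; rewrite -mcompE (hVN (mcomp qN u)) mhom0E.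
have [g' g'E] := npair_hatr th c (npair_nuinv jJ0).
exists g'; apply: (npair_eqr (npair_nuinv jJ1)) => f.
by rewrite -uE -cE [mcomp f _]mcompA g'E [mcomp g' _]mcompA nuinv_theta_nat mcompA.
Qed.
(** Hom(T, nu P) is dual to Hom(P, T) = 0, so every map from [nu P] to [J1] lifts to [J0]. *)
Lemma extz_nu : extz (nu P) T.
Proof.
apply/lift_extz/inj_hom_lift; first exact: npair_inj (npair_nu pP).
move=> f; apply: (npair_nu pP).2 => h.
by rewrite (hPT h) mcomp0 lf0.
Qed.
End Copresentation.
End TauFacts.

(** * Maps of cones, their trace forms and classes in Ext^2 *)

Section ConeMaps.
Local Open Scope ring_scope.
Variables (k : fieldType) (A : fdAlgType k).
Implicit Types (W X Y Z : cplx A) (M N : rmod A).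

Section Map.
Variables (X Y X' Y' : cplx A) (f : chain_map X Y) (f' : chain_map X' Y')
  (a : chain_map X X') (b : chain_map Y Y').
Definition cone_map_fun i : mhom (cone f i) (cone f' i) :=
  col_mhom (mcomp (a (i + 1)) (dfst _ _)) (mcomp (b i) (dsnd _ _)).
Lemma cone_map_funE i x : cone_map_fun i x = (a (i + 1) x.1, b i x.2).
Proof. by rewrite col_mhomE !mcompE dfstE dsndE. Qed.
Hypothesis sq : chain_comp b f = chain_comp f' a.
Fact cone_map_proof : @is_chain_map k A (cone f) (cone f') cone_map_fun.
Proof.
move=> i; apply: mhom_inj => x; rewrite !mcompE cone_map_funE cone_map_funE !cone_cdE /=.
rewrite lfN lfD !(chainE a) !(chainE b) -!chain_compE sq //.
Qed.
Definition cone_map : chain_map (cone f) (cone f') := mk_chain cone_map_proof.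
Lemma cone_mapE i x : cone_map i x = (a (i + 1) x.1, b i x.2).
Proof. exact: cone_map_funE. Qed.
Lemma cproj_cone_map : chain_comp (cproj f') cone_map = chain_comp (shift_map a) (cproj f).
Proof. by apply: chain_ext => i x; rewrite !chain_compE cprojE cone_mapE /= shift_mapE cprojE. Qed.
Lemma cone_map_cincl : chain_comp cone_map (cincl f) = chain_comp (cincl f') b.
Proof. by apply: chain_ext => i x; rewrite !chain_compE cone_mapE !cinclE /= lf0. Qed.
End Map.
Arguments cone_map {X Y X' Y' f f' a b} sq.

Variable D : derived A.
Local Notation Q f := (fmap (dloc D) f).
Local Notation "g <o> f" := (comp D g f) (at level 40, left associativity).

Section ConeForm.
Variables (X1 X0 Z1 Z0 : cplx A) (u : chain_map X1 X0) (v : chain_map Z1 Z0)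
  (s : forall i, 'Hom(mhom (X1 i) (Z1 i), k^o)) (t : forall i, 'Hom(mhom (X0 i) (Z0 i), k^o)).
Hypotheses (ns : forall i, npair (s i)) (nt : forall i, npair (t i))
  (cs : forall i b, s i (mcomp b (cd X1 i)) = - s (i + 1) (mcomp (cd Z1 i) b))
  (ct : forall i b, t i (mcomp b (cd X0 i)) = - t (i + 1) (mcomp (cd Z0 i) b))
  (cst : forall i b, s i (mcomp b (u i)) = t i (mcomp (v i) b)).
(** The sign on the second summand makes the mixed terms [s (b u)] and [t (v b)] appear with equal
    signs in [compat], as [cst] requires. *)
Let th i : 'Hom(mhom (cone u i) (cone v i), k^o) := pair_dsum (s (i + 1)) (- t i).
Let thE i b : th i b = s (i + 1) (mcomp (dfst _ _) (mcomp b (dinl _ _))) - t i (mcomp (dsnd _ _) (mcomp b (dinr _ _))).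
Proof. by rewrite /th pair_dsumE opp_lfunE. Qed.
Let nth' i : npair (th i).
Proof.
apply: npair_dsum => //; split=> [Z f h|Z g h].
  by apply: (nt i).1 => g; have := h g; rewrite opp_lfunE => /eqP; rewrite oppr_eq0 => /eqP.
by apply: (nt i).2 => f; have := h f; rewrite opp_lfunE => /eqP; rewrite oppr_eq0 => /eqP.
Qed.
Let compat i (b : mhom (cone u (i + 1)) (cone v i)) :
  th i (mcomp b (cd (cone u) i)) = - th (i + 1) (mcomp (cd (cone v) i) b).
Proof.
rewrite !thE.
pose b11 := mcomp (dfst _ _) (mcomp b (dinl _ _)).
pose b10 := mcomp (dfst _ _) (mcomp b (dinr _ _)).
pose b00 := mcomp (dsnd _ _) (mcomp b (dinr _ _)).
have -> : mcomp (dfst _ _) (mcomp (mcomp b (cd (cone u) i)) (dinl _ _)) =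
    - mcomp b11 (cd X1 (i + 1)) + mcomp b10 (u (i + 1)).
  apply: mhom_inj => x; rewrite mhomDE mhomNE !mcompE dinlE cone_cdE /= !lf0 addr0.
  rewrite dinlE dinrE -!lfN -!lfD; congr (dfst _ _ (b _)); congr pair; rewrite /= ?addr0 ?add0r ?oppr0 ?add0r ?lfN //.
have -> : mcomp (dsnd _ _) (mcomp (mcomp b (cd (cone u) i)) (dinr _ _)) = mcomp b00 (cd X0 i).
  apply: mhom_inj => x; rewrite !mcompE !dinrE cone_cdE /= !lf0 oppr0 add0r //.
have -> : mcomp (dfst _ _) (mcomp (mcomp (cd (cone v) i) b) (dinl _ _)) = - mcomp (cd Z1 (i + 1)) b11.
  by apply: mhom_inj => x; rewrite mhomNE !mcompE !dfstE cone_cdE.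
have -> : mcomp (dsnd _ _) (mcomp (mcomp (cd (cone v) i) b) (dinr _ _)) = mcomp (v (i + 1)) b10 + mcomp (cd Z0 i) b00.
  by apply: mhom_inj => x; rewrite mhomDE !mcompE !dfstE !dsndE cone_cdE.
rewrite !lfD !lfN cs cst ct; ring.
Qed.

(** The form is recorded together with transposes of maps of cones: degreewise transposes induce a
    transpose on the cones. This makes the action of End(T) on S T computable. *)
Lemma cone_serre_form : exists theta : Hom D (cone u) (cone v) -> k^o, serre_form theta /\
  forall (a1 : chain_map X1 X1) (a0 : chain_map X0 X0) (a1' : chain_map Z1 Z1) (a0' : chain_map Z0 Z0)
    (sq : chain_comp a0 u = chain_comp u a1) (sq' : chain_comp a0' v = chain_comp v a1'),
    (forall i b, s i (mcomp b (a1 i)) = s i (mcomp (a1' i) b)) ->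
    (forall i b, t i (mcomp b (a0 i)) = t i (mcomp (a0' i) b)) ->
    transpose_rel theta theta (Q (cone_map sq)) (Q (cone_map sq')).
Proof.
have [theta [sf E]] := serre_form_complexes D nth' compat.
exists theta; split=> // a1 a0 a1' a0' sq sq' h1 h0 b.
have [|g <-] := Q_full_proj b; first by move=> i; apply: npair_proj (nth' i).
rewrite -!Q_comp !E; apply: eq_bigr => i _.
rewrite -[chain_val (chain_comp g _) i]/(mcomp (g i) (cone_map sq i)).
rewrite -[chain_val (chain_comp _ g) i]/(mcomp (cone_map sq' i) (g i)) !thE.
have -> : mcomp (dfst _ _) (mcomp (mcomp (g i) (cone_map sq i)) (dinl _ _)) =
    mcomp (mcomp (dfst _ _) (mcomp (g i) (dinl _ _))) (a1 (i + 1)).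
  by apply: mhom_inj => x; rewrite !mcompE !dinlE cone_mapE /= lf0.
have -> : mcomp (dsnd _ _) (mcomp (mcomp (g i) (cone_map sq i)) (dinr _ _)) =
    mcomp (mcomp (dsnd _ _) (mcomp (g i) (dinr _ _))) (a0 i).
  by apply: mhom_inj => x; rewrite !mcompE !dinrE cone_mapE /= lf0.
have -> : mcomp (dfst _ _) (mcomp (mcomp (cone_map sq' i) (g i)) (dinl _ _)) =
    mcomp (a1' (i + 1)) (mcomp (dfst _ _) (mcomp (g i) (dinl _ _))).
  by apply: mhom_inj => x; rewrite !mcompE !dfstE cone_mapE.
have -> : mcomp (dsnd _ _) (mcomp (mcomp (cone_map sq' i) (g i)) (dinr _ _)) =
    mcomp (a0' i) (mcomp (dsnd _ _) (mcomp (g i) (dinr _ _))).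
  by apply: mhom_inj => x; rewrite !mcompE !dsndE cone_mapE.
by rewrite h1 h0.
Qed.
End ConeForm.

Lemma stalkB M N (f g : mhom M N) : stalk_map (f - g) = stalk_map f - stalk_map g.
Proof. exact: (fmapB (stalk_functor A)). Qed.

(* kappa phi represents U1[1] -> V1[1] as a map from the cone of u to the cone of v[1], which are
   coker u and (ker v)[2] when u is injective and v is surjective. *)
Section Kappa.
Variables (U1 U0 V0 V1 : rmod A) (u : mhom U1 U0) (v : mhom V0 V1).
Local Notation su := (stalk_map u).
Local Notation sv := (shift_map (stalk_map v)).
Definition kappa (phi : mhom U1 V1) : Hom D (cone su) (cone sv) :=
  Q (cincl sv) <o> Q (shift_map (stalk_map phi)) <o> Q (cproj su).
Lemma kappa_linear : linear kappa.
Proof.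
move=> c f g; rewrite /kappa.
have -> : shift_map (stalk_map (c *: f + g)) = c *: shift_map (stalk_map f) + shift_map (stalk_map g).
  by rewrite (stalk_linear c f g); apply: chain_ext => i x; rewrite !(chainDE, chainZE, shift_mapE).
rewrite (_ : Q (_ + _) = c *: Q (shift_map (stalk_map f)) + Q (shift_map (stalk_map g))).
  by rewrite compDr compZr compDl compZl.
exact: (fmap_linear (dloc D)).
Qed.
Lemma kappa_v psi : kappa (mcomp v psi) = 0.
Proof.
rewrite /kappa stalk_comp shift_map_comp Q_comp !compA -Q_comp.
by rewrite (Q_null _ (cincl_null sv)) !comp0m.
Qed.
Lemma kappa_u chi : kappa (mcomp chi u) = 0.
Proof.
rewrite /kappa stalk_comp shift_map_comp Q_comp -!compA -Q_comp.
by rewrite (Q_null _ (cproj_null su)) !compm0.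
Qed.

Hypotheses (e01 : forall h : Hom D (stalk U0) (shift (stalk V1)), h = 0)
  (e10 : forall h : Hom D (stalk U1) (shift (stalk V0)), h = 0)
  (e00 : forall h : Hom D (stalk U0) (shift (stalk V0)), h = 0)
  (e002 : forall h : Hom D (stalk U0) (shift (shift (stalk V0))), h = 0).
(** By [e002] and [e01] there is no nonzero map from [U0] to the second cone, so [g] factors through
    [U1[1]]; by [e10] the resulting map factors through [V1[1]]. *)
Lemma kappa_surj g : exists phi, kappa phi = g.
Proof.
have [|w e1] := hom_to_cone (g := g <o> Q (cincl su)); first exact: e002.
have [|g' gE] := hom_from_cone (g := g); first by rewrite e1 (e01 w) compm0.
have [|w' g'E] := hom_to_cone (g := g'); first by apply: (hom0_shift e10).
have [w1 w1E] := dshift_full w'; have [phi phiE] := stalk_full w1.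
by exists phi; rewrite gE g'E -w1E -phiE dshiftE.
Qed.
(** The image of [phi] in the second cone extends along [u] to [U0[1]], and by [e00] the extension
    is induced by some [chi]. Then [phi - chi u] dies in the cone of [v[1]], so it factors through
    [v]. *)
Lemma kappa_ker phi : kappa phi = 0 -> exists chi psi, phi = mcomp v psi + mcomp chi u.
Proof.
move=> /hom_from_cone0[w wE].
have [|w1 w1E] := hom_to_cone (g := w); first by apply: (hom0_shift e00).
have [w2 w2E] := dshift_full w1; have [chi chiE] := stalk_full w2.
have [|y yE] := @hom_to_cone0 _ _ D _ _ sv _ (Q (shift_map (stalk_map (phi - mcomp chi u)))).
  rewrite (stalkB phi) shift_mapB QB compBr wE w1E -w2E -chiE dshiftE stalk_comp shift_map_comp Q_comp compA subrr //.
have [y1 y1E] := dshift_full y; have [psi psiE] := stalk_full y1.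
exists chi, psi; apply/eqP; rewrite -subr_eq; apply/eqP/subr0_eq.
apply: (stalk_faithful (D := D)); apply: dshift_faithful.
rewrite dshiftE stalkB shift_mapB QB yE -y1E -psiE dshiftE -Q_comp -shift_map_comp -stalk_comp subrr //.
Qed.
End Kappa.

Lemma kappa_natl U1 U0 U1' U0' V0 V1 (u : mhom U1 U0) (u' : mhom U1' U0') (v : mhom V0 V1)
    (a1 : mhom U1 U1') (a0 : mhom U0 U0')
    (sq : chain_comp (stalk_map a0) (stalk_map u) = chain_comp (stalk_map u') (stalk_map a1)) phi :
  kappa u' v phi <o> Q (cone_map sq) = kappa u v (mcomp phi a1).
Proof.
rewrite /kappa -!compA -Q_comp cproj_cone_map Q_comp stalk_comp shift_map_comp (Q_comp _ (shift_map _)).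
by rewrite -!compA.
Qed.
Lemma kappa_natr U1 U0 V0 V1 V0' V1' (u : mhom U1 U0) (v : mhom V0 V1) (v' : mhom V0' V1')
    (b0 : mhom V0 V0') (b1 : mhom V1 V1')
    (sq : chain_comp (shift_map (stalk_map b1)) (shift_map (stalk_map v)) =
      chain_comp (shift_map (stalk_map v')) (shift_map (stalk_map b0))) phi :
  Q (cone_map sq) <o> kappa u v phi = kappa u v' (mcomp b1 phi).
Proof.
rewrite /kappa !compA -Q_comp cone_map_cincl Q_comp stalk_comp shift_map_comp (Q_comp _ (shift_map _)).
by rewrite -!compA.
Qed.
End ConeMaps.
Arguments cone_map {k A X Y X' Y' f f' a b} sq.

(** * The functor Hom(T, -) to modules over B = End(T) *)

Section HomFunctor.
Local Open Scope ring_scope.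
Variables (k : fieldType) (A : fdAlgType k) (T : rmod A).
Implicit Types M N L K Q J X Y Z : rmod A.
Local Notation B := (mendo T).

Definition hom_mod Y : rmod B :=
  @RMod k B (mhom T Y) (fun f b => mcomp f b) (fun b => @mcomp_linl k A T T Y b)
    (fun f => @mcomp_linr k A T T Y f) (@mcompm1 k A T Y) (fun f a b => mcompA f a b).
Definition hom_map Y Y' (g : mhom Y Y') : mhom (hom_mod Y) (hom_mod Y') :=
  @mk_mhom k B (hom_mod Y) (hom_mod Y') _ (@mcomp_linr k A T Y Y' g) (fun f b => mcompA g f b).
Lemma hom_mapE Y Y' (g : mhom Y Y') (f : mhom T Y) : mhom_lfun (hom_map g) f = mcomp g f.
Proof. exact: (@mk_mhomE k B (hom_mod Y) (hom_mod Y')). Qed.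
Lemma hom_map_comp X Y Z (g : mhom Y Z) (f : mhom X Y) :
  hom_map (mcomp g f) = mcomp (hom_map g) (hom_map f).
Proof. by apply: mhom_inj => x; rewrite mcompE !hom_mapE mcompA. Qed.
Lemma hom_mapD X Y (g f : mhom X Y) : hom_map (g + f) = hom_map g + hom_map f.
Proof. by apply: mhom_inj => x; rewrite mhomDE !hom_mapE mcompDl. Qed.
Lemma hom_mapB X Y (g f : mhom X Y) : hom_map (g - f) = hom_map g - hom_map f.
Proof. by apply: mhom_inj => x; rewrite mhomDE mhomNE !hom_mapE mcompBl. Qed.
Lemma hom_map_linear X Y : linear (@hom_map X Y).
Proof. by move=> c g f; apply: mhom_inj => x; rewrite mhomDE mhomZE !hom_mapE mcompDl mcompZl. Qed.

Lemma mcomp_sumr (I : Type) (r : seq I) M N L (g : mhom N L) (F : I -> mhom M N) :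
  mcomp g (\sum_(i <- r) F i) = \sum_(i <- r) mcomp g (F i).
Proof. by apply: mhom_inj => x; rewrite mcompE !mhom_sumE lf_sum; apply: eq_bigr => i _; rewrite mcompE. Qed.
Lemma mpow_id M m : \sum_i mcomp (pin M i) (ppr M i) = mid (mpow M m).
Proof.
apply: mhom_inj => x; apply: mpowP => j; rewrite midE mhom_sumE lf_sum (bigD1 j) //= big1 ?addr0.
  by rewrite mcompE -mcompE ppr_pin eqxx midE.
by move=> i ij; rewrite mcompE -mcompE ppr_pin eq_sym (negbTE ij) mhom0E.
Qed.
Lemma hom_mod_proj m : projective (hom_mod (mpow T m)).
Proof.
move=> M N p f ps.
have /choice[y yE] (i : 'I_m) : exists y, p y = f (pin T i : hom_mod (mpow T m)) by apply: ps.
pose g (h : hom_mod (mpow T m)) : M := \sum_i mact M (y i) (mcomp (ppr T i) h : B).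
have gl : linear g.
  move=> c h h'; rewrite /g scaler_sumr -big_split; apply: eq_bigr => i _ /=.
  by rewrite -mact_linr; congr (mact M _ _); rewrite mcompDr mcompZr.
have ga h b : g (mact (hom_mod (mpow T m)) h b) = mact M (g h) b.
  rewrite /g -[RHS]/(ractl M b _) linear_sum; apply: eq_bigr => i _ /=.
  by rewrite -mactM; congr (mact M _ _); apply: mcompA.
exists (mk_mhom gl ga); apply: mhom_inj => h; rewrite mcompE mk_mhomE /g lf_sum.
under eq_bigr do rewrite mhomP yE -mhomP.
rewrite -lf_sum; congr (mhom_lfun f _).
rewrite -[RHS](mcomp1m (h : mhom T _)) -mpow_id mcomp_suml; apply: eq_bigr => i _.
by rewrite -mcompA.
Qed.

Variable P : rmod A.
Hypotheses (hA : hereditary A) (eT : extz T T) (pP : projective P) (hPT : forall f : mhom P T, f = 0).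
Variables a b : nat.
Hypotheses (nT : nsummands (modcat A) T a) (nP : nsummands (modcat A) P b)
  (nA : nsummands (modcat A) (regular A) (a + b)).

(** [g] itself need not be surjective: Hom(T, g) is, and that yields the exact sequence 0 -> Hom(T,
    K) -> B^m -> Hom(T, Y) -> 0. The conditions on [K] are those under which [tilting_generated]
    applies to it. *)
Definition approx_ses Y m (g : mhom (mpow T m) Y) K (j : mhom K (mpow T m)) :=
  [/\ is_kernel j g, forall f : mhom T Y, exists f', mcomp g f' = f & extz T K /\ forall f : mhom P K, f = 0].
Lemma approx_ses_exists Y : exists m (g : mhom (mpow T m) Y) K (j : mhom K (mpow T m)), approx_ses g j.
Proof.
have [m [g gs]] := approximation T Y; have [K [j kj]] := kernel_exists g.
exists m, g, K, j; split=> //; split=> [K' Q i p pQ ki ps c|f]; last first.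
  apply: (inj_cancel kj.1); rewrite mcomp0 -[LHS]mcomp1m -mpow_id mcomp_suml big1 // => l _.
  by rewrite -mcompA (hPT (mcomp (ppr T l) _)) mcomp0.
have [e eE] := (@extz_mpow _ _ _ _ m eT) _ _ _ _ pQ ki ps (mcomp j c).
have pi x : p (i x) = 0 by apply/ki.2; exists x.
have gj x : g (j x) = 0 by apply/kj.2; exists x.
have [|h hE] := factor_surj (f := mcomp g e) ps.
  by move=> x /ki.2[y <-]; rewrite mcompE -[e _]mcompE eE mcompE gj.
have [h' h'E] := gs h; have [|e' e'E] := factor_inj (f := e - mcomp h' p) kj.1.
  by move=> x; apply/kj.2; rewrite -mcompE mcompBr mcompA h'E hE subrr mhom0E.
exists e'; apply: (inj_cancel kj.1); apply: mhom_inj => x.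
rewrite [mcomp j (mcomp _ _)]mcompA e'E mcompE mhomDE mhomNE mcompE pi lf0 oppr0 addr0.
by rewrite -mcompE eE.
Qed.
Lemma approx_inj Y m (g : mhom (mpow T m) Y) K (j : mhom K (mpow T m)) : approx_ses g j -> injective (hom_map j).
Proof. by move=> [[ij _] _ _] x y; rewrite !hom_mapE; apply: inj_cancel. Qed.
Lemma approx_surj Y m (g : mhom (mpow T m) Y) K (j : mhom K (mpow T m)) : approx_ses g j -> surj (hom_map g).
Proof. by move=> [_ gs _] y; have [x <-] := gs y; exists x; rewrite hom_mapE. Qed.
Lemma hom_map_exact X Y Z (i : mhom X Y) (p : mhom Y Z) : injective i ->
  (forall y, p y = 0 <-> exists x, i x = y) ->
  forall y, hom_map p y = 0 <-> exists x, hom_map i x = y.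
Proof.
move=> ii ex y; rewrite hom_mapE; split=> [e|[x <-]].
  have [|x xE] := factor_inj (f := y : mhom T Y) ii; last by exists x; rewrite hom_mapE.
  by move=> t; apply/ex; rewrite -mcompE e mhom0E.
rewrite hom_mapE; apply: mhom_inj => t; rewrite !mcompE mhom0E; apply/ex.
by exists (mhom_lfun (x : mhom T X) t).
Qed.

(* The kernel K of an approximation T^m -> Y is generated by T, so that a map T^m -> J killing
   Hom(T, K) factors through the image of T^m in Y. *)
Lemma hom_map_full Y J (z : mhom (hom_mod Y) (hom_mod J)) : injective_mod J ->
  exists g : mhom Y J, hom_map g = z.
Proof.
move=> jJ; have [m [g [K [j [kj gs [eK hPK]]]]]] := approx_ses_exists Y.
have [m' [g' gs']] := approximation T K.
have g's := tilting_generated hA eT pP hPT nT nP nA eK hPK gs'.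
pose c := prow (fun i : 'I_m => z (mcomp g (pin T i) : hom_mod Y) : mhom T J).
have cE (x : mhom T (mpow T m)) : mcomp c x = z (mcomp g x : hom_mod Y).
  have xE : mcomp g x = \sum_i mcomp (mcomp g (pin T i)) (mcomp (ppr T i) x).
    rewrite -[x in LHS](mcomp1m x) -mpow_id mcomp_suml mcomp_sumr; apply: eq_bigr => i _.
    by rewrite -!mcompA.
  rewrite xE [X in mhom_lfun z X](_ : _ =
    \sum_i mact (hom_mod Y) (mcomp g (pin T i) : hom_mod Y) (mcomp (ppr T i) x : B)) //.
  rewrite lf_sum /c /prow mcomp_suml; apply: eq_bigr => i _.
  by rewrite mhomP -mcompA.
have cj : mcomp c j = 0.
  apply: (surj_cancel g's); rewrite mcomp0l -[LHS]mcompm1 -mpow_id mcomp_sumr big1 // => i _.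
  have e : mcomp (mcomp c j) (mcomp g' (pin T i)) = 0; last by rewrite mcompA -(mcompA (mcomp c j)) e mcomp0l.
  rewrite -mcompA cE -[RHS](lf0 z); congr (mhom_lfun z _); rewrite mcompA.
  have -> : mcomp g j = 0 by apply: mhom_inj => x; rewrite mcompE mhom0E; apply/kj.2; exists x.
  exact: mcomp0l.
have [|h hE] := inj_extend (i := g) (f := c) jJ.
  by move=> x /kj.2[y <-]; rewrite -mcompE cj mhom0E.
exists h; apply: mhom_inj => f; rewrite hom_mapE; have [f' <-] := gs f.
by rewrite mcompA hE cE.
Qed.

Variable D : derived B.
(** In the projective presentation given by an approximation of [Y], a B-linear map from Hom(T, K)
    to Hom(T, J) is induced by a map from [K] to [J], which extends to T^m. As the syzygy Hom(T, K)
    is of the same kind, Ext^2 follows by dimension shift. *)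
Lemma hom_mod_ext1 Y J : injective_mod J ->
  forall h : Hom D (stalk (hom_mod Y)) (shift (stalk (hom_mod J))), h = 0.
Proof.
move=> jJ; have [m [g [K [j ap]]]] := approx_ses_exists Y; have [kj _ _] := ap.
apply: ses_ext1_0 (approx_inj ap) (@hom_mod_proj m) (approx_surj ap) (hom_map_exact kj.1 kj.2) _ => c.
have [c0 <-] := hom_map_full c jJ; have [e eE] := jJ _ _ j c0 kj.1.
by exists (hom_map e); rewrite -hom_map_comp eE.
Qed.
Lemma hom_mod_ext2 Y J : injective_mod J ->
  forall h : Hom D (stalk (hom_mod Y)) (shift (shift (stalk (hom_mod J)))), h = 0.
Proof.
move=> jJ; have [m [g [K [j ap]]]] := approx_ses_exists Y; have [kj _ _] := ap.
apply: ses_ext2_0 (approx_inj ap) (@hom_mod_proj m) (approx_surj ap) (hom_map_exact kj.1 kj.2) _.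
exact: hom_mod_ext1.
Qed.

Variables (J0 J1 : rmod A) (i1 : mhom J0 J1).
Hypothesis lift : forall Z, injective_mod Z -> (forall f : mhom T Z, f = 0) ->
  forall g : mhom Z J1, exists g' : mhom Z J0, mcomp i1 g' = g.
(* d factors through the quotient of Y by the trace of T, which is injective as A is hereditary. *)
Lemma hom_map0_lift Y (d : mhom Y J1) : injective_mod Y -> hom_map d = 0 ->
  exists g : mhom Y J0, mcomp i1 g = d.
Proof.
move=> jY d0; have [m [g gs]] := approximation T Y.
have [I [q [mI [qs mi mqE]]]] := image_exists g; have [Z [c [cs cE]]] := cokernel_exists g.
have cE' y : c y = 0 <-> exists x, mI x = y.
  rewrite cE; split=> [[x <-]|[x <-]]; first by exists (q x); rewrite -mcompE mqE.
  by have [w <-] := qs x; exists w; rewrite -mcompE mqE.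
have hTZ (f : mhom T Z) : f = 0.
  have [f' <-] := extz_lift hA (extz_quot hA qs (@extz_mpow _ _ _ _ m eT)) cs cE' f.
  by have [f'' <-] := gs f'; apply: mhom_inj => x; rewrite !mcompE mhom0E; apply/cE; exists (f'' x).
have [|u uE] := factor_surj (f := d) cs.
  have dg : mcomp d g = 0.
    rewrite -[LHS]mcompm1 -mpow_id mcomp_sumr big1 // => i _; rewrite mcompA -[mcomp (mcomp d g) _]mcompA.
    by rewrite -hom_mapE d0 mhom0E mcomp0l.
  by move=> y /cE[x <-]; rewrite -mcompE dg mhom0E.
have [u' u'E] := lift (hereditary_inj_quot hA jY cs) hTZ u.
by exists (mcomp u' c); rewrite mcompA u'E.
Qed.
End HomFunctor.

Section ClusterForms.
Local Open Scope ring_scope.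
Variables (k : fieldType) (A : fdAlgType k) (D : derived A) (S : cluster_data D).
Hypothesis hS : serre_data S.
Local Notation "g <o> f" := (comp D g f) (at level 40, left associativity).
Local Notation G := (qinv (ctau_inv S)).
Local Notation sh f := (fmap (dshift D) f).

(** A form for [F_serre] that also records naturality in the endomorphisms of [X]. [th1] belongs to
    tau^-1 X, [th2] moves its target along the counit tau tau^-1 X = X, and [th3] is the shifted
    form. *)
Lemma F_form X : exists th : Hom D (shift (qinv0 (ctau_inv S) X)) (shift (shift X)) -> k^o,
  serre_form th /\ forall e : Hom D X X, transpose_rel th th (sh (fmap G e)) (sh (sh e)).
Proof.
pose ep : Hom D (ctau0 S (qinv0 (ctau_inv S) X)) X := qinv_counit (ctau_inv S) X.
have [ep' [e1 e2]] : isom ep by exact: (nat_isom (qinv_counit (ctau_inv S))).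
pose W := qinv0 (ctau_inv S) X.
pose th1 (g : Hom D W (shift (ctau0 S W))) : k^o := spair (ctau_serre S) (idm D W) g.
pose th2 (b : Hom D W (shift X)) := th1 (sh ep' <o> b <o> idm D W).
have sf2 : serre_form th2.
  apply: serre_form_iso (hS W); first by exists (idm D W); rewrite !comp1m.
  by apply: fmap_isom; exists ep.
have tr1 (h : Hom D W W) c : th1 (c <o> h) = th1 (sh (fmap (ctau S) h) <o> c).
  by rewrite /th1 -spair_natr compm1 -[h in LHS]comp1m spair_natl.
have tr2 e : transpose_rel th2 th2 (fmap G e) (sh e).
  move=> b; rewrite /th2 !compm1 compA tr1 compA -fmap_comp compA -fmap_comp.
  have -> : fmap (ctau S) (fmap G e) <o> ep' = ep' <o> e; last by [].
  rewrite -[LHS]comp1m -e1 -compA (compA ep) (qinv_counit_nat (ctau_inv S)) -/ep.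
  by rewrite -compA e2 compm1.
have [th3 E] := shift_functional th2.
exists th3; split=> [|e b]; first exact: serre_form_shift E sf2.
by have [b' <-] := dshift_full b; rewrite -!fmap_comp !E tr2.
Qed.
End ClusterForms.

Section ConeNaturality.
Local Open Scope ring_scope.
Variables (k : fieldType) (A : fdAlgType k).
Variables (X Y Z : cplx A) (i : chain_map X Y) (q : chain_map Y Z) (ex : ses_cplx i q)
  (a : chain_map X X) (b : chain_map Y Y) (c : chain_map Z Z).
Lemma cone_to_coker_nat (sq : chain_comp b i = chain_comp i a) : chain_comp c q = chain_comp q b ->
  chain_comp c (cone_to_coker ex) = chain_comp (cone_to_coker ex) (cone_map sq).
Proof.
by move=> e; apply: chain_ext => n x; rewrite !chain_compE !cone_to_cokerE cone_mapE /= -!chain_compE e.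
Qed.
Lemma shift_to_cone_nat (sq : chain_comp c q = chain_comp q b) : chain_comp b i = chain_comp i a ->
  chain_comp (cone_map sq) (shift_to_cone ex) = chain_comp (shift_to_cone ex) (shift_map a).
Proof.
move=> e; apply: chain_ext => n x; rewrite !chain_compE !shift_to_coneE cone_mapE /= lf0 shift_mapE.
by congr pair; rewrite /= -!chain_compE e.
Qed.
End ConeNaturality.

Section Lifts.
Local Open Scope ring_scope.
Variables (k : fieldType) (A : fdAlgType k) (T : rmod A).
Variables (Q1 Q0 J0 J1 : rmod A) (p1 : mhom Q1 Q0) (p0 : mhom Q0 T) (i0 : mhom T J0) (i1 : mhom J0 J1).
Hypotheses (pQ1 : projective Q1) (pQ0 : projective Q0) (p0s : surj p0) (kp : is_kernel p1 p0)
  (jJ0 : injective_mod J0) (jJ1 : injective_mod J1) (i0i : injective i0) (i1s : surj i1)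
  (ex : forall y, i1 y = 0 <-> exists x, i0 x = y).
Local Notation B := (mendo T).

Definition pres_lift (b : mhom T T) (c1 : mhom Q1 Q1) (c0 : mhom Q0 Q0) :=
  mcomp p0 c0 = mcomp b p0 /\ mcomp c0 p1 = mcomp p1 c1.
Definition copres_lift (b : mhom T T) (d0 : mhom J0 J0) (d1 : mhom J1 J1) :=
  mcomp d0 i0 = mcomp i0 b /\ mcomp d1 i1 = mcomp i1 d0.
Lemma pres_lift_exists b : exists c1 c0, pres_lift b c1 c0.
Proof.
have [c0 c0E] := pQ0 (mcomp b p0) p0s.
have [|c1 c1E] := factor_inj (f := mcomp c0 p1) kp.1; last by exists c1, c0.
move=> x; apply/kp.2; rewrite mcompE -mcompE c0E mcompE (_ : p0 (p1 x) = 0) ?lf0 //.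
by apply/kp.2; exists x.
Qed.
Lemma copres_lift_exists b : exists d0 d1, copres_lift b d0 d1.
Proof.
have [d0 d0E] := jJ0 (mcomp i0 b) i0i.
have [|d1 d1E] := factor_surj (f := mcomp i1 d0) i1s; last by exists d0, d1.
move=> x /ex[y <-]; rewrite mcompE -[d0 _]mcompE d0E mcompE.
by apply/ex; exists (b y).
Qed.

Hypothesis nui : forall g : mhom T (nu Q1), mcomp (nu_map p1) g = 0 -> g = 0.
Local Notation th0 := (nu_theta pQ0).
Local Notation th1 := (nu_theta pQ1).
Let wfun (g : mhom T (nu Q0)) (b : B) : k^o := th0 (mcomp (mcomp g b) p0).
Let wfun_lin g : linear (wfun g).
Proof. by move=> c b b'; rewrite /wfun mcompDr mcompZr mcompDl mcompZl lfD lfZ. Qed.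
Let w (g : hom_mod T (nu Q0)) : dual B := sval (cid (lfun_of (wfun_lin g))).
Let wE g b : (w g : 'Hom(B, k^o)) b = th0 (mcomp (mcomp g b) p0).
Proof. by rewrite /w; case: cid => l lE; apply: lE. Qed.
Let w_linear : linear w.
Proof.
move=> c g h; apply: dualP => b; rewrite -[RHS]/(((c *: w g : 'Hom(B, k^o)) + w h) b).
by rewrite add_lfunE scale_lfunE !wE !mcompDl !mcompZl lfD lfZ.
Qed.
Let w_act g b : w (mact (hom_mod T (nu Q0)) g b) = mact (dual B) (w g) b.
Proof. by apply: dualP => x; rewrite dual_actE !wE -[mact _ g b]/(mcomp g b) -[b ** x]/(mcomp b x) !mcompA. Qed.
(** With Hom(T, nu Q0) read as D Hom(Q0, T), this is the dual of the embedding of [B] into Hom(Q0,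
    T) by precomposition with [p0]. *)
Definition dual_map : mhom (hom_mod T (nu Q0)) (dual B) := mk_mhom w_linear w_act.
Lemma dual_mapE (g : mhom T (nu Q0)) b : (mhom_lfun dual_map g : 'Hom(B, k^o)) b = th0 (mcomp (mcomp g b) p0).
Proof. by rewrite /dual_map mk_mhomE wE. Qed.

Lemma dual_map_surj : surj dual_map.
Proof.
move=> phi.
have [|l lE] := @lfun_factor _ _ _ (precomp T p0) (phi : 'Hom(B, k^o)).
  move=> x; rewrite precompE => x0; rewrite (_ : x = 0) ?linear0 //.
  by apply: (surj_cancel p0s); rewrite x0 mcomp0l.
have [g gE] := npair_repr (npair_nu pQ0) l.
by exists g; apply: dualP => b; rewrite dual_mapE -mcompA gE -precompE lE.
Qed.
(** Dual to the exactness of B -> Hom(Q0, T) -> Hom(Q1, T) in the middle. *)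
Lemma dual_map_ker g : dual_map g = 0 <-> exists x, hom_map T (nu_map p1) x = g.
Proof.
split=> [g0|[x <-]]; last first.
  apply: dualP => b; rewrite dual_mapE hom_mapE zero_lfunE -!mcompA -nu_theta_nat -!mcompA.
  rewrite (_ : mcomp p0 p1 = 0) ?mcomp0 ?lf0 //.
  by apply: mhom_inj => y; rewrite mcompE mhom0E; apply/kp.2; exists y.
have [ph phE] : exists ph : 'Hom(mhom Q0 T, k^o), forall e, ph e = th0 (mcomp g e).
  by apply: lfun_of => c x y; rewrite mcompDr mcompZr lfD lfZ.
have [|l lE] := @lfun_factor _ _ _ (precomp T p1) ph.
  move=> e; rewrite precompE phE => e0.
  have [|b <-] := factor_surj (f := e) p0s.
    by move=> x /kp.2[y <-]; rewrite -mcompE e0 mhom0E.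
  by rewrite mcompA -dual_mapE g0 zero_lfunE.
have [g1 g1E] := npair_repr (npair_nu pQ1) l; exists g1; rewrite hom_mapE.
apply: (npair_eqr (npair_nu pQ0)) => e.
by rewrite -mcompA -nu_theta_nat -mcompA g1E -precompE lE phE.
Qed.
Lemma dual_map_inj : injective (hom_map T (nu_map p1)).
Proof.
move=> x y; rewrite !hom_mapE => e; apply/subr0_eq/nui.
by rewrite mcompBr e subrr.
Qed.
Lemma dual_map_nat b c1 c0 : pres_lift b c1 c0 ->
  mcomp (dual_lmul (b : B)) dual_map = mcomp dual_map (hom_map T (nu_map c0)).
Proof.
move=> [e _]; apply: mhom_inj => g; rewrite !mcompE; apply: dualP => x.
rewrite dual_lmul_appE !dual_mapE hom_mapE -[mcomp (mcomp (nu_map c0) _) x]mcompA -[mcomp (mcomp (nu_map c0) _) p0]mcompA.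
by rewrite -(nu_theta_nat pQ0 pQ0) -!mcompA e.
Qed.

Definition unit_map : mhom (regular B) (hom_mod T J0) :=
  @mk_mhom k B (regular B) (hom_mod T J0) _ (@mcomp_linr k A T T J0 i0) (fun f b => mcompA i0 f b).
Lemma unit_mapE (b : B) : mhom_lfun unit_map b = mcomp i0 b.
Proof. exact: (@mk_mhomE k B (regular B) (hom_mod T J0)). Qed.
Lemma unit_map_inj : injective unit_map.
Proof. by move=> x y; rewrite !unit_mapE; apply: inj_cancel. Qed.
Lemma unit_map_ker g : hom_map T i1 g = 0 <-> exists x, unit_map x = g.
Proof.
rewrite hom_mapE; split=> [e|[x <-]].
  have [|x xE] := factor_inj (f := g : mhom T J0) i0i; last by exists x; rewrite unit_mapE.
  by move=> t; apply/ex; rewrite -mcompE e mhom0E.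
rewrite unit_mapE; apply: mhom_inj => t; rewrite !mcompE mhom0E; apply/ex.
by exists (mhom_lfun (x : mhom T T) t).
Qed.
Lemma unit_map_surj : hereditary A -> extz T T -> surj (hom_map T i1).
Proof. by move=> hA eT y; have [g <-] := extz_lift hA eT i1s ex y; exists g; rewrite hom_mapE. Qed.
Lemma unit_map_nat b d0 d1 : copres_lift b d0 d1 ->
  mcomp (hom_map T d0) unit_map = mcomp unit_map (lmul (b : B)).
Proof.
move=> [e _]; apply: mhom_inj => x; rewrite !mcompE hom_mapE lmulE !unit_mapE.
by rewrite mcompA e -mcompA.
Qed.
End Lifts.

Section StalkSquares.
Local Open Scope ring_scope.
Variables (k : fieldType) (A : fdAlgType k).
Lemma stalk_square (M N M' N' : rmod A) (f : mhom M N) (f' : mhom M' N') (a : mhom M M') (b : mhom N N') :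
  mcomp b f = mcomp f' a -> chain_comp (stalk_map b) (stalk_map f) = chain_comp (stalk_map f') (stalk_map a).
Proof. by move=> e; rewrite -!stalk_comp e. Qed.
Lemma shift_square (M N M' N' : cplx A) (f : chain_map M N) (f' : chain_map M' N') (a : chain_map M M')
    (b : chain_map N N') : chain_comp b f = chain_comp f' a ->
  chain_comp (shift_map b) (shift_map f) = chain_comp (shift_map f') (shift_map a).
Proof. by move=> e; rewrite -!shift_map_comp e. Qed.
Lemma ext_inj M J : injective_mod J -> extz (A := A) M J.
Proof. by move=> jJ K Q i p _ ki _ c; apply: jJ c ki.1. Qed.
End StalkSquares.

Section CokernelRelation.
Local Open Scope ring_scope.
Variables (k : fieldType) (A : fdAlgType k) (D : derived A).
Local Notation Q f := (fmap (dloc D) f).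
Local Notation "g <o> f" := (comp D g f) (at level 40, left associativity).
Local Notation sh f := (fmap (dshift D) f).
Variables (M U1 U0 N V0 V1 : rmod A) (u : mhom U1 U0) (q : mhom U0 M) (i : mhom N V0) (v : mhom V0 V1).
Hypotheses (ui : injective u) (qs : surj q) (qE : forall y, q y = 0 <-> exists x, u x = y)
  (ii : injective i) (vs : surj v) (vE : forall y, v y = 0 <-> exists x, i x = y).
Hypotheses (e01 : forall h : Hom D (stalk U0) (shift (stalk V1)), h = 0)
  (e10 : forall h : Hom D (stalk U1) (shift (stalk V0)), h = 0)
  (e00 : forall h : Hom D (stalk U0) (shift (stalk V0)), h = 0)
  (e002 : forall h : Hom D (stalk U0) (shift (shift (stalk V0))), h = 0).

Definition coker_map : chain_map (cone (stalk_map u)) (stalk M) := cone_to_coker (ses_stalk ui qs qE).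
Definition ker_map : chain_map (shift (shift (stalk N))) (cone (shift_map (stalk_map v))) :=
  shift_to_cone (ses_shift (ses_stalk ii vs vE)).
Lemma coker_map_isom : isom (Q coker_map).
Proof. by apply: dloc_isom; apply: qis_cone_to_coker. Qed.
Lemma ker_map_isom : isom (Q ker_map).
Proof. by apply: dloc_isom; apply: qis_shift_to_cone. Qed.

Lemma coker_map_nat (c1 : mhom U1 U1) (c0 : mhom U0 U0) (c : mhom M M)
    (sq : chain_comp (stalk_map c0) (stalk_map u) = chain_comp (stalk_map u) (stalk_map c1)) :
  mcomp c q = mcomp q c0 -> Q (stalk_map c) <o> Q coker_map = Q coker_map <o> Q (cone_map sq).
Proof. by move=> e; rewrite -!Q_comp (cone_to_coker_nat _ sq) //; apply: stalk_square. Qed.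
Lemma ker_map_nat (d0 : mhom V0 V0) (d1 : mhom V1 V1) (d : mhom N N)
    (sq : chain_comp (shift_map (stalk_map d1)) (shift_map (stalk_map v)) =
      chain_comp (shift_map (stalk_map v)) (shift_map (stalk_map d0))) :
  mcomp d0 i = mcomp i d -> Q ker_map <o> sh (sh (Q (stalk_map d))) = Q (cone_map sq) <o> Q ker_map.
Proof.
move=> e; rewrite !dshiftE -!Q_comp /ker_map.
by rewrite -(shift_to_cone_nat (ses_shift (ses_stalk ii vs vE)) sq (shift_square (stalk_square e))).
Qed.

(* e, a map M -> N[2] up to coker_map, is the class of phi. *)
Definition ext2_rel (phi : mhom U1 V1) (e : Hom D (cone (stalk_map u)) (shift (shift (stalk N)))) :=
  Q ker_map <o> e = kappa D u v phi.
Lemma ext2_rel_r phi : exists e, ext2_rel phi e.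
Proof. exact: isom_factor_l ker_map_isom. Qed.
Lemma ext2_rel_l e : exists phi, ext2_rel phi e.
Proof. by have [phi h] := kappa_surj e01 e10 e002 (Q ker_map <o> e); exists phi. Qed.
Lemma ext2_rel_linear c phi e phi' e' : ext2_rel phi e -> ext2_rel phi' e' ->
  ext2_rel (c *: phi + phi') (c *: e + e').
Proof. by move=> h h'; rewrite /ext2_rel kappa_linear compDr compZr h h'. Qed.
Lemma ext2_rel_ker phi : ext2_rel phi 0 <-> exists chi psi, phi = mcomp v psi + mcomp chi u.
Proof.
rewrite /ext2_rel compm0; split=> [/esym/(kappa_ker e00)//|[chi [psi ->]]].
have := kappa_linear D u v 1 (mcomp v psi) (mcomp chi u).
by rewrite !scale1r kappa_u kappa_v addr0 => ->.
Qed.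
Lemma ext2_rel_uniq phi e e' : ext2_rel phi e -> ext2_rel phi e' -> e = e'.
Proof. by move=> h h'; apply: (isom_mono ker_map_isom); rewrite h h'. Qed.
Lemma ext2_rel_natl (c1 : mhom U1 U1) (c0 : mhom U0 U0)
    (sq : chain_comp (stalk_map c0) (stalk_map u) = chain_comp (stalk_map u) (stalk_map c1)) phi e :
  ext2_rel phi e -> ext2_rel (mcomp phi c1) (e <o> Q (cone_map sq)).
Proof. by move=> h; rewrite /ext2_rel compA h kappa_natl. Qed.
Lemma ext2_rel_natr (d0 : mhom V0 V0) (d1 : mhom V1 V1) (d : mhom N N) phi e :
  mcomp d0 i = mcomp i d -> mcomp d1 v = mcomp v d0 ->
  ext2_rel phi e -> ext2_rel (mcomp d1 phi) (sh (sh (Q (stalk_map d))) <o> e).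
Proof.
move=> e0 e1 h; have sq := shift_square (stalk_square e1).
by rewrite /ext2_rel compA (ker_map_nat sq e0) -compA h kappa_natr.
Qed.
End CokernelRelation.

(** * The bimodule isomorphism between Ext^2_B(DB, B) and Hom(T, F T) *)

Section Bimodule.
Local Open Scope ring_scope.
Variables (k : fieldType) (A : fdAlgType k) (D : derived A) (S : cluster_data D).
Hypotheses (hS : serre_data S) (hA : hereditary A).
Variables (T P : rmod A) (a b : nat).
Hypotheses (eT : extz T T) (pP : projective P) (hPT : forall f : mhom P T, f = 0)
  (nT : nsummands (modcat A) T a) (nP : nsummands (modcat A) P b)
  (nA : nsummands (modcat A) (regular A) (a + b)).
Variables (Q1 Q0 J0 J1 : rmod A) (p1 : mhom Q1 Q0) (p0 : mhom Q0 T) (i0 : mhom T J0) (i1 : mhom J0 J1).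
Hypotheses (pQ1 : projective Q1) (pQ0 : projective Q0) (p0s : surj p0) (kp : is_kernel p1 p0)
  (nui : forall g : mhom T (nu Q1), mcomp (nu_map p1) g = 0 -> g = 0)
  (jJ0 : injective_mod J0) (jJ1 : injective_mod J1) (i0i : injective i0) (i1s : surj i1)
  (ex : forall y, i1 y = 0 <-> exists x, i0 x = y)
  (lift : forall Z, injective_mod Z -> (forall f : mhom T Z, f = 0) ->
    forall g : mhom Z J1, exists g' : mhom Z J0, mcomp i1 g' = g).
Local Notation B := (mendo T).
Variable DB : derived B.
Local Notation Q f := (fmap (dloc D) f).
Local Notation QB f := (fmap (dloc DB) f).
Local Notation "g <o> f" := (comp D g f) (at level 40, left associativity).
Local Notation "g <b> f" := (comp DB g f) (at level 40, left associativity).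
Local Notation sh f := (fmap (dshift D) f).
Local Notation shB f := (fmap (dshift DB) f).
Local Notation FT := (shift (qinv0 (ctau_inv S) (stalk T))).
Local Notation Fm e := (sh (fmap (qinv (ctau_inv S)) e)).
Local Notation sT := (stalk T).
Local Notation np1 := (nu_map p1).

Let jnu (X : rmod A) (pX : projective X) : injective_mod (nu X) := npair_inj (npair_nu pX).
Let h1 (M J : rmod A) : injective_mod J -> forall h : Hom D (stalk M) (shift (stalk J)), h = 0.
Proof. by move=> jJ; apply: ext_hom0 => //; apply: ext_inj. Qed.
Let h2 (M N : rmod A) : forall h : Hom D (stalk M) (shift (shift (stalk N))), h = 0.
Proof. by apply: stalk_hom_Le => //; apply: (Le_shift (Le_shift (Le_stalk D N))). Qed.
Let RH := @ext2_rel _ _ D _ _ _ _ _ np1 _ _ i0i i1s ex.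
Let RB := @ext2_rel _ _ DB _ _ _ _ _ (hom_map T np1) _ _ (unit_map_inj i0i)
  (unit_map_surj i1s ex hA eT) (unit_map_ker i0i ex).
Let alH := coker_map kp.1 p0s kp.2.
Let alB := coker_map (dual_map_inj nui) (dual_map_surj pQ0 p0s) (dual_map_ker pQ1 pQ0 p0s kp).

(* By Serre duality Hom(T, FT) is Hom(S T, T[2]); both this space and Ext^2_B(DB, B) are quotients of
   Hom(nu Q1, J1), the latter because Hom(T, -) is full on maps to injectives. *)
Lemma ext2_bimodule_iso : exists Psi : Hom DB (stalk (dual B)) (shift (shift (stalk (regular B)))) -> Hom D sT FT,
  [/\ linear Psi, injective Psi /\ (forall f, exists e, Psi e = f),
      forall (c : B) e, Psi (shB (shB (QB (stalk_map (lmul c)))) <b> e) = Fm (Q (stalk_map c)) <o> Psi e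
    & forall (c : B) e, Psi (e <b> QB (stalk_map (dual_lmul c))) = Psi e <o> Q (stalk_map c)].
Proof.
have [|||||th [sth thE]] := @cone_serre_form _ _ D _ _ _ _ (stalk_map p1) (stalk_map np1)
  (stalk_form (nu_theta pQ1)) (stalk_form (nu_theta pQ0)).
- by apply: npair_stalk; apply: npair_nu.
- by apply: npair_stalk; apply: npair_nu.
- exact: stalk_form_compat.
- exact: stalk_form_compat.
- by case=> [[|i]|i] c /=; [apply: nu_theta_nat| rewrite !zero_lfunE | rewrite !zero_lfunE].
have [th3 [sth3 th3E]] := F_form hS sT.
(* [f] and [e] correspond when a common [phi] represents both of them. The relation is linear, every
   [f] and every [e] occurs, and 0 on one side forces 0 on the other, so it is the graph of a linear
   bijection. *)
pose R (phi : mhom (nu Q1) J1) (f : Hom D sT FT) (e : Hom DB (stalk (dual B)) (shift (shift (stalk (regular B))))) :=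
  (exists2 f', transpose_rel th th3 (f <o> Q alH) f' & RH phi f') /\ RB (hom_map T phi) (e <b> QB alB).
have kerH := ext2_rel_ker np1 i0i i1s ex (h1 jJ0).
have kerB := ext2_rel_ker (hom_map T np1) (unit_map_inj i0i) (unit_map_surj i1s ex hA eT) (unit_map_ker i0i ex)
  (hom_mod_ext1 hA eT pP hPT nT nP nA (D := DB) (Y := nu Q0) jJ0).
have full Y J (z : mhom (hom_mod T Y) (hom_mod T J)) (jJ : injective_mod J) :=
  hom_map_full hA eT pP hPT nT nP nA z jJ.
have Rlin c phi f e phi' f' e' : R phi f e -> R phi' f' e' -> R (c *: phi + phi') (c *: f + f') (c *: e + e').
  move=> [[g tg rg] re] [[g' tg' rg'] re']; split.
    exists (c *: g + g'); last exact: ext2_rel_linear.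
    by rewrite compDl compZl; apply: (transpose_linear sth sth3).
  by rewrite hom_map_linear compDl compZl; apply: ext2_rel_linear.
have R0f phi e : R phi 0 e -> e = 0.
  move=> [[g tg rg] re].
  have g0 : g = 0.
    have [_ i2 _ _] := sth3.2 (cone (stalk_map np1)); apply: i2 => c.
    by rewrite -tg comp0m compm0 (linear00 sth.1).
  move: rg; rewrite g0 => /kerH[chi [psi phiE]].
  have r0 : RB (hom_map T phi) 0.
    apply/kerB; exists (hom_map T chi), (hom_map T psi).
    by rewrite phiE hom_mapD !hom_map_comp.
  apply: (isom_epi (coker_map_isom DB (dual_map_inj nui) (dual_map_surj pQ0 p0s) (dual_map_ker pQ1 pQ0 p0s kp))).
  by rewrite comp0m; apply: ext2_rel_uniq re r0.
(* The delicate direction. The B-linear maps through which Hom(T, phi) decomposes come from maps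
   [chi] and [psi], but [phi] agrees with the resulting sum only up to a map killed by Hom(T, -);
   that difference factors through [i1] by [hom_map0_lift]. *)
have Re0 phi f : R phi f 0 -> f = 0.
  move=> [[g tg rg] re].
  have /kerB[chi' [psi' e]] : RB (hom_map T phi) 0 by move: re; rewrite comp0m.
  have [chi chiE] := full _ _ chi' jJ1; have [psi psiE] := full _ _ psi' jJ0.
  have [|y yE] := @hom_map0_lift _ _ T hA eT _ _ i1 lift _ (phi - mcomp i1 psi - mcomp chi np1) (jnu pQ1).
    by rewrite !hom_mapB !hom_map_comp chiE psiE e -addrA -opprD subrr.
  have r0 : RH phi 0.
    apply/kerH; exists chi, (psi + y); rewrite mcompDr yE.
    by rewrite [X in X + _]addrA [mcomp i1 psi + _]addrC !subrK.
  have g0 : g = 0 by apply: ext2_rel_uniq rg r0.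
  apply: (isom_epi (coker_map_isom D kp.1 p0s kp.2)); rewrite comp0m.
  have [i1' _ _ _] := sth.2 FT; apply: i1' => c.
  by rewrite tg g0 comp0m (linear00 sth3.1).
have RTf f : exists phi e, R phi f e.
  have [f' tf] := transpose_r sth sth3 (f <o> Q alH).
  have [phi rphi] := ext2_rel_l i0i i1s ex (h1 jJ1) (h1 jJ0) (@h2 _ _) f'.
  have [e' re'] := ext2_rel_r DB (hom_map T np1) (unit_map_inj i0i) (unit_map_surj i1s ex hA eT)
    (unit_map_ker i0i ex) (hom_map T phi).
  have [e eE] := isom_factor_r e' (coker_map_isom DB (dual_map_inj nui) (dual_map_surj pQ0 p0s)
    (dual_map_ker pQ1 pQ0 p0s kp)).
  by exists phi, e; split; [exists f' | rewrite eE].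
have RTe e : exists phi f, R phi f e.
  have [phi' rphi'] := ext2_rel_l (unit_map_inj i0i) (unit_map_surj i1s ex hA eT) (unit_map_ker i0i ex)
    (hom_mod_ext1 hA eT pP hPT nT nP nA jJ1) (hom_mod_ext1 hA eT pP hPT nT nP nA jJ0)
    (hom_mod_ext2 hA eT pP hPT nT nP nA jJ0) (e <b> QB alB).
  have [phi phiE] := full _ _ phi' jJ1.
  have [f' rf'] := ext2_rel_r D np1 i0i i1s ex phi.
  have [g tg] := transpose_l sth sth3 f'.
  have [f fE] := isom_factor_r g (coker_map_isom D kp.1 p0s kp.2).
  exists phi, f; split; last by rewrite phiE.
  by exists f' => //; rewrite fE.
have /choice[Psi PsiR] e : exists f, exists phi, R phi f e.
  by have [phi [f r]] := RTe e; exists f, phi.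
have uniq phi phi' f f' e : R phi f e -> R phi' f' e -> f = f'.
  move=> r r'; have := Rlin (-1) _ _ _ _ _ _ r' r; rewrite !scaleN1r addNr => /Re0 /eqP.
  by rewrite addrC subr_eq0 => /eqP.
exists Psi; split.
- move=> c e e'; have [phi r] := PsiR e; have [phi' r'] := PsiR e'; have [phi'' r''] := PsiR (c *: e + e').
  exact: uniq r'' (Rlin c _ _ _ _ _ _ r r').
- split=> [e e' E|f].
    have [phi r] := PsiR e; have [phi' r'] := PsiR e'; rewrite E in r.
    have := Rlin (-1) _ _ _ _ _ _ r' r; rewrite !scaleN1r addNr => /R0f /eqP.
    by rewrite addrC subr_eq0 => /eqP.
  have [phi [e r]] := RTf f; exists e; have [phi' r'] := PsiR e.
  exact: uniq r' r.
- move=> c e; have [phi r] := PsiR e; have [phi' r'] := PsiR (shB (shB (QB (stalk_map (lmul c)))) <b> e).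
  (* The left action of [c] is carried to representatives by a lift [d1] to the injective
     copresentation; the right action, treated last, by a lift [c1] to the projective
     presentation. *)
  have [d0 [d1 [dE0 dE1]]] := copres_lift_exists jJ0 i0i i1s ex c.
  apply: uniq r' (_ : R (mcomp d1 phi) _ _); case: r => [[g tg rg] re]; split.
    exists (sh (sh (Q (stalk_map c))) <o> g); last exact: ext2_rel_natr dE0 dE1 rg.
    by rewrite -compA; apply: transpose_comp tg (th3E _).
  rewrite hom_map_comp -compA; apply: (ext2_rel_natr (unit_map_nat (conj dE0 dE1)) _ re).
  by rewrite -!hom_map_comp dE1.
move=> c e; have [phi r] := PsiR e; have [phi' r'] := PsiR (e <b> QB (stalk_map (dual_lmul c))).
have [c1 [c0 pc]] := pres_lift_exists pQ0 p0s kp c; have [cE0 cE1] := pc.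
have ncE : mcomp (nu_map c0) np1 = mcomp np1 (nu_map c1) by rewrite -!nu_map_comp cE1.
have hcE : mcomp (hom_map T (nu_map c0)) (hom_map T np1) = mcomp (hom_map T np1) (hom_map T (nu_map c1)).
  by rewrite -!hom_map_comp ncE.
have sq := stalk_square cE1; have sqn := stalk_square ncE; have sqB := stalk_square hcE.
apply: uniq r' (_ : R (mcomp phi (nu_map c1)) _ _); case: r => [[g tg rg] re]; split.
  exists (g <o> Q (cone_map sqn)); last exact: ext2_rel_natl.
  rewrite -compA (coker_map_nat D _ _ _ sq) ?compA; last by rewrite cE0.
  apply: transpose_comp _ tg; apply: thE.
    by case=> [[|i]|i] x /=; [apply: nu_theta_nat| rewrite !zero_lfunE | rewrite !zero_lfunE].
  by case=> [[|i]|i] x /=; [apply: nu_theta_nat| rewrite !zero_lfunE | rewrite !zero_lfunE].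
rewrite hom_map_comp -compA (coker_map_nat DB _ _ _ sqB) ?compA; first exact: ext2_rel_natl.
exact: dual_map_nat pc.
Qed.
End Bimodule.

(** * The cluster-tilting object *)

Section SplitIdempotents.
Local Open Scope ring_scope.
Variables (k : fieldType) (O : Type) (C : klcat k O).
Local Notation "g <o> f" := (comp C g f) (at level 40, left associativity).

(** The mixed composites need not be assumed zero: multiplying the sum formula by [b] and [i] gives
    [b i = b i + b i], and likewise for [p a]. *)
Lemma retract_dsum (Z Y W : O) (a : Hom C Y Z) (b : Hom C Z Y) (i : Hom C W Z) (p : Hom C Z W) :
  b <o> a = idm C Y -> p <o> i = idm C W -> a <o> b + i <o> p = idm C Z -> is_dsum C Z Y W.
Proof.
move=> ba pi e; exists a, i, b, p; split=> //.
  have : b <o> i = b <o> (a <o> b + i <o> p) <o> i by rewrite e compm1.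
  rewrite compDr compDl !compA ba comp1m -(compA (b <o> i)) pi compm1 => /eqP.
  by rewrite -subr_eq subrr => /eqP.
have : p <o> a = p <o> (a <o> b + i <o> p) <o> a by rewrite e compm1.
rewrite compDr compDl !compA pi comp1m -(compA (p <o> a)) ba compm1 => /eqP.
by rewrite addrC -subr_eq subrr => /eqP.
Qed.

Variables (X : O).
Lemma zero_retract (Y : O) (i : Hom C Y X) (p : Hom C X Y) : p <o> i = idm C Y ->
  (zero_obj C Y <-> i <o> p = 0).
Proof.
move=> pi; split=> [z|ip0]; first by rewrite -[i]compm1 z compm0 comp0m.
by rewrite /zero_obj -pi -[i]compm1 -pi (compA i) ip0 comp0m compm0.
Qed.

Section Side.
Variables (A : fdAlgType k) (M M' : rmod A) (pi : Hom C X X -> mhom M M) (pi' : Hom C X X -> mhom M' M').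
Hypotheses (piB : forall f g, pi (f - g) = pi f - pi g) (piM : forall f g, pi (f <o> g) = mcomp (pi f) (pi g))
  (piB' : forall f g, pi' (f - g) = pi' f - pi' g) (piM' : forall f g, pi' (f <o> g) = mcomp (pi' f) (pi' g))
  (ker2 : forall x y, pi x = 0 -> pi' x = 0 -> pi y = 0 -> pi' y = 0 -> x <o> y = 0).

Lemma idem_ker e : e <o> e = e -> pi e = 0 -> pi' e = 0 -> e = 0.
Proof. by move=> ee h h'; rewrite -ee; apply: ker2. Qed.

(** [pi] and [pi'] are the projections of End(X) to End(T) and End(P), in either order. A
    decomposition of [Y] gives complementary idempotents below [i p]; their compression to the
    indecomposable module [U] is trivial, and an idempotent killed by both projections is 0. *)
Lemma side_indec U (io : mhom U M) (r : mhom M U) Y (i : Hom C Y X) (p : Hom C X Y) :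
  mcomp r io = mid U -> indecomposable (modcat A) U -> p <o> i = idm C Y ->
  pi (i <o> p) = mcomp io r -> pi' (i <o> p) = 0 -> indecomposable C Y.
Proof.
move=> rio iU pi_ E E'; split.
  move/(zero_retract pi_) => z; have [nU _] := iU; apply: nU.
  rewrite /zero_obj -[LHS]rio -[io]mcompm1 -rio (mcompA io) -E z.
  by rewrite -(subrr 0) piB subrr mcomp0l mcomp0.
move=> Z1 Z2 [j1 [j2 [q1 [q2 [q1j1 q2j2 q1j2 q2j1 e]]]]].
have z1 : q1 <o> p <o> (i <o> j1) = idm C Z1 by rewrite -compA (compA p) pi_ comp1m.
have z2 : q2 <o> p <o> (i <o> j2) = idm C Z2 by rewrite -compA (compA p) pi_ comp1m.
pose e1 := i <o> j1 <o> (q1 <o> p); pose e2 := i <o> j2 <o> (q2 <o> p).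
have e1e : e1 <o> e1 = e1 by rewrite {1}/e1 -compA (compA (q1 <o> p)) z1 comp1m.
have e2e : e2 <o> e2 = e2 by rewrite {1}/e2 -compA (compA (q2 <o> p)) z2 comp1m.
have h W (j : Hom C W Y) (q : Hom C Y W) : i <o> j <o> (q <o> p) = i <o> (j <o> q) <o> p by rewrite !compA.
have e12 : e2 = i <o> p - e1.
  have <- : e1 + e2 = i <o> p by rewrite /e1 /e2 !h -compDl -compDr e compm1.
  by rewrite addrAC subrr add0r.
have e1l : i <o> p <o> e1 = e1 by rewrite /e1 -!compA (compA p) pi_ comp1m.
have e1r : e1 <o> (i <o> p) = e1 by rewrite /e1 -!compA (compA p) pi_ comp1m.
have b1E : pi e1 = mcomp io (mcomp (mcomp r (mcomp (pi e1) io)) r).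
  have ee : e1 = i <o> p <o> (e1 <o> (i <o> p)) by rewrite e1r e1l.
  by rewrite [in LHS]ee piM (piM e1) E -!mcompA.
have h1E : pi' e1 = 0 by rewrite -e1l piM' E' mcomp0l.
have idb : mcomp (mcomp r (mcomp (pi e1) io)) (mcomp r (mcomp (pi e1) io)) = mcomp r (mcomp (pi e1) io).
  have eb : mcomp (pi e1) (mcomp (mcomp io r) (pi e1)) = pi e1 by rewrite -E -piM e1l -piM e1e.
  by rewrite -[in RHS]eb -!mcompA.
have [b0|b1] := indec_idem iU idb.
  left; apply/(zero_retract z1)/(idem_ker e1e) => //.
  by rewrite b1E b0 mcomp0l mcomp0.
right; apply/(zero_retract z2)/(idem_ker e2e).
  by rewrite -/e2 e12 piB E b1E b1 mcomp1m subrr.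
by rewrite -/e2 e12 piB' E' h1E subrr.
Qed.

Lemma side_iso U (io : mhom U M) (r : mhom M U) Y (i : Hom C Y X) (p : Hom C X Y)
    U' (io' : mhom U' M) (r' : mhom M U') Y' (i' : Hom C Y' X) (p' : Hom C X Y') :
  mcomp r io = mid U -> mcomp r' io' = mid U' -> p <o> i = idm C Y -> p' <o> i' = idm C Y' ->
  pi (i <o> p) = mcomp io r -> pi (i' <o> p') = mcomp io' r' -> iso_obj C Y Y' -> iso_obj (modcat A) U U'.
Proof.
move=> rio rio' pi_ pi_' E E' [f [g [gf fg]]].
pose x := i' <o> f <o> p; pose y := i <o> g <o> p'.
have yx : y <o> x = i <o> p.
  by rewrite /x /y -!compA (compA p') pi_' comp1m (compA g) gf comp1m.
have xy : x <o> y = i' <o> p'.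
  by rewrite /x /y -!compA (compA p) pi_ comp1m (compA f) fg comp1m.
exists (mcomp r' (mcomp (pi x) io)); apply/misomP.
exists (mcomp r (mcomp (pi y) io')); split.
  rewrite -!mcompA (mcompA io' r') -E' -xy piM -!mcompA (mcompA (pi y) (pi x)) -piM yx E.
  by rewrite (mcompA (pi y)) -piM yx E -!mcompA rio mcompm1 rio mcompm1.
rewrite -!mcompA (mcompA io r) -E -yx piM -!mcompA (mcompA (pi x) (pi y)) -piM xy E'.
by rewrite (mcompA (pi x)) -piM xy E' -!mcompA rio' mcompm1 rio' mcompm1.
Qed.

Lemma side_not_iso U (io : mhom U M) (r : mhom M U) Y (i : Hom C Y X) (p : Hom C X Y)
    Y' (i' : Hom C Y' X) (p' : Hom C X Y') :
  mcomp r io = mid U -> p <o> i = idm C Y -> p' <o> i' = idm C Y' ->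
  pi (i <o> p) = mcomp io r -> pi (i' <o> p') = 0 -> iso_obj C Y Y' -> zero_obj (modcat A) U.
Proof.
move=> rio pi_ pi_' E E' [f [g [gf fg]]].
have : i <o> p = i <o> g <o> p' <o> (i' <o> p') <o> (i' <o> f <o> p).
  rewrite -!compA (compA p' i') pi_' comp1m (compA p' i') pi_' comp1m (compA g) gf comp1m //.
move/(congr1 pi); rewrite !piM E E' mcomp0 mcomp0l => e.
by rewrite /zero_obj -[LHS]rio -[io]mcompm1 -rio (mcompA io) e mcomp0l mcomp0.
Qed.

Hypothesis splitX : forall e : Hom C X X, e <o> e = e ->
  exists Y (i : Hom C Y X) (p : Hom C X Y), p <o> i = idm C Y /\ i <o> p = e.
Variable t : mhom M M -> Hom C X X.
Hypothesis pit : forall b, pi (t b) = b.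

Lemma split_retract Z (i : Hom C Z X) (p : Hom C X Z) (e : Hom C Z Z) :
  p <o> i = idm C Z -> e <o> e = e ->
  exists Y (j : Hom C Y Z) (q : Hom C Z Y), q <o> j = idm C Y /\ j <o> q = e.
Proof.
move=> pi_ ee; have [|W [j [q [qj jq]]]] := splitX (e := i <o> e <o> p).
  by rewrite -!compA (compA p) pi_ comp1m (compA e) ee.
exists W, (p <o> j), (q <o> i); split.
  have qE : q <o> (i <o> e <o> p) = q by rewrite -jq compA qj comp1m.
  have gi : i <o> e <o> p <o> i = i <o> e by rewrite -compA pi_ compm1.
  by rewrite -qE -(compA q) gi compA -(compA q (i <o> e)) qE qj.
by rewrite -!compA (compA j) jq -!compA pi_ compm1 compA pi_ comp1m.
Qed.

(** [a] and [b] lift [al] and [be], so that [b a] is [1 + v] with [v v = 0]. Composing [b] with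
    [1 - v] makes [Y] a retract of the indecomposable object [Z]; the complement is zero because [Y]
    is not. *)
Lemma side_complete Z (i : Hom C Z X) (p : Hom C X Z) U Y (io : mhom U M) (r : mhom M U)
    (i' : Hom C Y X) (p' : Hom C X Y) (al : mhom U M) (be : mhom M U) :
  indecomposable C Z -> p <o> i = idm C Z ->
  mcomp r io = mid U -> indecomposable C Y -> p' <o> i' = idm C Y ->
  pi (i' <o> p') = mcomp io r -> pi' (i' <o> p') = 0 ->
  mcomp be (mcomp (pi (i <o> p)) al) = mid U -> iso_obj C Z Y.
Proof.
move=> [nZ iZ] pi_ rio [nY _] pi_' E E' bal.
pose a := p <o> t (mcomp al r) <o> i'; pose b := p' <o> t (mcomp io be) <o> i.
pose n := i' <o> (b <o> a) <o> p' - i' <o> p'.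
have pn : pi n = 0.
  rewrite /n piB; have -> : i' <o> (b <o> a) <o> p' =
      i' <o> p' <o> t (mcomp io be) <o> (i <o> p) <o> t (mcomp al r) <o> (i' <o> p').
    by rewrite /a /b !compA.
  rewrite !piM !pit E -!mcompA (mcompA r io) rio mcomp1m (mcompA r io) rio mcomp1m.
  by rewrite (mcompA (pi _) al) (mcompA be) bal mcomp1m subrr.
have pn' : pi' n = 0.
  rewrite /n piB'; have -> : i' <o> (b <o> a) <o> p' =
      i' <o> p' <o> (i' <o> (b <o> a) <o> p').
    by rewrite -!compA (compA p' i') pi_' comp1m.
  by rewrite piM' E' mcomp0l subrr.
have nn : n <o> (i' <o> p') <o> n = 0 by apply: ker2; rewrite ?piM ?piM' ?pn ?pn' ?mcomp0l.
pose v := p' <o> n <o> i'.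
have vE : b <o> a = idm C Y + v.
  have h c : p' <o> (i' <o> c <o> p') <o> i' = c by rewrite -!compA pi_' compm1 compA pi_' comp1m.
  have h1 : p' <o> (i' <o> p') <o> i' = idm C Y by rewrite compA pi_' comp1m pi_'.
  by rewrite /v /n compBr compBl h h1 addrC subrK.
have vv : v <o> v = 0.
  have -> : v <o> v = p' <o> (n <o> (i' <o> p') <o> n) <o> i' by rewrite /v !compA.
  by rewrite nn compm0 comp0m.
pose b' := (idm C Y - v) <o> b.
have ba : b' <o> a = idm C Y.
  by rewrite /b' -compA vE compBl comp1m compDr compm1 vv addr0 addrK.
have id' : (idm C Z - a <o> b') <o> (idm C Z - a <o> b') = idm C Z - a <o> b'.
  rewrite compBl comp1m compBr compm1 -compA (compA b') ba comp1m subrr subr0 //.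
have [W [j [q [qj jq]]]] := split_retract pi_ id'.
have ds : is_dsum C Z Y W by apply: retract_dsum ba qj _; rewrite jq addrC subrK.
case: (iZ _ _ ds) => // zW.
exists b', a; split=> //; have : j <o> q = 0 by rewrite -[j]compm1 zW compm0 comp0m.
by rewrite jq => /eqP; rewrite subr_eq0 => /eqP.
Qed.
End Side.
End SplitIdempotents.

(** * Lifting summands modulo a square-zero kernel *)

Section LiftedSummands.
Local Open Scope ring_scope.
Variables (k : fieldType) (O : Type) (C : klcat k O) (X : O) (A : fdAlgType k) (T P : rmod A).
Local Notation "g <o> f" := (comp C g f) (at level 40, left associativity).
Variables (pi1 : Hom C X X -> mhom T T) (pi2 : Hom C X X -> mhom P P) (s : mhom T T -> mhom P P -> Hom C X X).
Hypotheses (pi1B : forall f g, pi1 (f - g) = pi1 f - pi1 g) (pi1M : forall f g, pi1 (f <o> g) = mcomp (pi1 f) (pi1 g))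
  (pi2B : forall f g, pi2 (f - g) = pi2 f - pi2 g) (pi2M : forall f g, pi2 (f <o> g) = mcomp (pi2 f) (pi2 g))
  (pi11 : pi1 (idm C X) = mid T)
  (ker2 : forall x y, pi1 x = 0 -> pi2 x = 0 -> pi1 y = 0 -> pi2 y = 0 -> x <o> y = 0)
  (pis1 : forall b h, pi1 (s b h) = b) (pis2 : forall b h, pi2 (s b h) = h)
  (split_s : forall T' P' (io : mhom T' T) (r : mhom T T') (io' : mhom P' P) (r' : mhom P P'),
    mcomp r io = mid T' -> mcomp r' io' = mid P' ->
    exists Y (i : Hom C Y X) (p : Hom C X Y), p <o> i = idm C Y /\ i <o> p = s (mcomp io r) (mcomp io' r')).

(** [1 - n] equals [e0 e + (1 - e0) (1 - e)], which intertwines [e] and [e0]; its inverse is [1 + n]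
    because [n] lies in the square-zero kernel. *)
Lemma idem_conj e e0 : e <o> e = e -> e0 <o> e0 = e0 -> pi1 e = pi1 e0 -> pi2 e = pi2 e0 ->
  exists u v, [/\ u <o> v = idm C X, v <o> u = idm C X & u <o> e = e0 <o> u].
Proof.
move=> ee ee0 h1 h2; pose c := e0 <o> e; pose n := (e0 - c) - (c - e).
have nn : n <o> n = 0.
  apply: ker2; rewrite /n /c ?pi1B ?pi1M ?pi2B ?pi2M ?h1 ?h2 -?pi1M -?pi2M ee0 !subrr //.
exists (idm C X - n), (idm C X + n); split.
- by rewrite compBl comp1m compDr compm1 nn addr0 addrK.
- by rewrite compBr compm1 compDl comp1m nn addr0 addrK.
have ce : c <o> e = c by rewrite /c -compA ee.
have ec : e0 <o> c = c by rewrite /c compA ee0.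
rewrite compBl compBr comp1m compm1 /n !compBl !compBr ce ec ee ee0 -/c !subrr sub0r subr0 opprK.
by rewrite addrC subrK subKr.
Qed.

(** The splitting is found in module categories: the two images of [e] split there, [split_s] lifts
    this to a splitting of a diagonal idempotent, and [e] is conjugate to that one. *)
Lemma split_idem e : e <o> e = e -> exists Y (i : Hom C Y X) (p : Hom C X Y), p <o> i = idm C Y /\ i <o> p = e.
Proof.
move=> ee; have [|T' [io [r [rio ior]]]] := @idem_image _ _ _ (pi1 e); first by rewrite -pi1M ee.
have [|P' [io' [r' [rio' ior']]]] := @idem_image _ _ _ (pi2 e); first by rewrite -pi2M ee.
have [Y [i [p [pi_ ip]]]] := split_s rio rio'; rewrite ior ior' in ip.
have [|||u [v [uv vu uE]]] := @idem_conj e (s (pi1 e) (pi2 e)) ee; rewrite ?pis1 ?pis2 //.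
  by rewrite -ip -compA (compA p) pi_ comp1m.
exists Y, (v <o> i), (p <o> u); split.
  by rewrite -compA (compA u) uv comp1m.
by rewrite -compA (compA i) ip -uE compA vu comp1m.
Qed.
Lemma retract_is_summand Y (i : Hom C Y X) (p : Hom C X Y) : p <o> i = idm C Y -> is_summand C Y X.
Proof.
move=> pi_; have [|W [j [q [qj jq]]]] := split_idem (e := idm C X - i <o> p).
  by rewrite compBl comp1m compBr compm1 -compA (compA p) pi_ comp1m subrr subr0.
by exists W; apply: retract_dsum pi_ qj _; rewrite jq addrC subrK.
Qed.

(** The equation makes the image of [b] a retract of the complementary summand, so this image occurs
    twice in [M]. *)
Lemma basic_idem (M : rmod A) (b x y : mhom M M) : basic (modcat A) M -> mcomp b b = b ->
  mcomp x (mcomp (mid M - b) y) = b -> b = 0.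
Proof.
move=> bM bb e; have [Y [i [p [pi_ ip]]]] := idem_image bb.
have [Z [i2 [p2 D]]] := retract_mdsum pi_.
have [_ _ _ _ D5] := D; rewrite ip in D5.
have i2p2 : mcomp i2 p2 = mid M - b by rewrite -D5 addrC addrA addNr add0r.
have [|W [j [q D']]] := @retract_mdsum _ _ Z Y (mcomp p2 (mcomp y i)) (mcomp p (mcomp x i2)).
  by rewrite -!mcompA (mcompA i2) i2p2 (mcompA _ y) (mcompA x) e -ip -mcompA pi_ mcompm1 pi_.
have z : zero_obj (modcat A) Y by apply: (bM Y Z W); apply/is_dsumP; do 4!eexists; eassumption.
by rewrite -ip -[p]mcomp1m [mid Y]z mcomp0l mcomp0.
Qed.

Hypothesis pi21 : pi2 (idm C X) = mid P.
Lemma lifted_basic : basic (modcat A) T -> basic (modcat A) P -> basic C X.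
Proof.
move=> bT bP Y W Z [i1 [i2 [p1 [p2 [pi1_ pi2_ _ _ e]]]]] [j1 [_ [q1 [_ [qj _ _ _ _]]]]].
pose ep := i1 <o> p1; have ee : ep <o> ep = ep by rewrite /ep -compA (compA p1) pi1_ comp1m.
have e2 : idm C X - ep = i2 <o> p2 by rewrite -e addrAC subrr add0r.
pose x := i1 <o> q1 <o> p2; pose y := i2 <o> j1 <o> p1.
have xy : x <o> ((idm C X - ep) <o> y) = ep.
  rewrite e2 /x /y -!compA (compA p2 i2) pi2_ comp1m (compA p2 i2) pi2_ comp1m (compA q1) qj comp1m //.
apply/(zero_retract pi1_); rewrite -/ep -ee; apply: ker2.
- by apply: (basic_idem (x := pi1 x) (y := pi1 y) bT); rewrite -?pi11 -?pi1B -!pi1M ?xy ?ee.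
- by apply: (basic_idem (x := pi2 x) (y := pi2 y) bP); rewrite -?pi21 -?pi2B -!pi2M ?xy ?ee.
- by apply: (basic_idem (x := pi1 x) (y := pi1 y) bT); rewrite -?pi11 -?pi1B -!pi1M ?xy ?ee.
by apply: (basic_idem (x := pi2 x) (y := pi2 y) bP); rewrite -?pi21 -?pi2B -!pi2M ?xy ?ee.
Qed.

Definition lifts_left U Y := exists (io : mhom U T) (r : mhom T U) (i : Hom C Y X) (p : Hom C X Y),
  [/\ mcomp r io = mid U, p <o> i = idm C Y, pi1 (i <o> p) = mcomp io r & pi2 (i <o> p) = 0].
Definition lifts_right U Y := exists (io : mhom U P) (r : mhom P U) (i : Hom C Y X) (p : Hom C X Y),
  [/\ mcomp r io = mid U, p <o> i = idm C Y, pi2 (i <o> p) = mcomp io r & pi1 (i <o> p) = 0].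

Let zero_split (M : rmod A) : mcomp (0 : mhom M (zero_mod A)) (0 : mhom (zero_mod A) M) = mid (zero_mod A).
Proof. by apply: mhom_inj => x; rewrite [LHS](mzero_zero_mod _) [RHS](mzero_zero_mod _). Qed.
Lemma lifts_left_exists U : is_summand (modcat A) U T -> exists Y, lifts_left U Y.
Proof.
move=> /summand_retract[io [r rio]]; have [Y [i [p [pi_ ip]]]] := split_s rio (zero_split P).
by exists Y, io, r, i, p; split; rewrite ?ip ?pis1 ?pis2 ?mcomp0.
Qed.
Lemma lifts_right_exists U : is_summand (modcat A) U P -> exists Y, lifts_right U Y.
Proof.
move=> /summand_retract[io [r rio]]; have [Y [i [p [pi_ ip]]]] := split_s (zero_split T) rio.
by exists Y, io, r, i, p; split; rewrite ?ip ?pis1 ?pis2 ?mcomp0.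
Qed.
Let ker2' x y : pi2 x = 0 -> pi1 x = 0 -> pi2 y = 0 -> pi1 y = 0 -> x <o> y = 0.
Proof. by move=> *; apply: ker2. Qed.

Lemma indec_summand_idem (M : rmod A) (b : mhom M M) a (U : 'I_a -> rmod A) : mcomp b b = b -> b != 0 ->
  (forall Z, indecomposable (modcat A) Z -> is_summand (modcat A) Z M -> exists i, iso_obj (modcat A) Z (U i)) ->
  exists j (al : mhom (U j) M) (be : mhom M (U j)), mcomp be (mcomp b al) = mid (U j).
Proof.
move=> bb bn0 cU; have [Y [io [r [rio ior]]]] := idem_image bb.
have n0 : mid Y != 0.
  by apply: contraNneq bn0 => z; rewrite -ior -[r]mcomp1m z mcomp0l mcomp0.
have [U0 [i0 [p0 [iU0 pi0 _]]]] := indec_retract_nonzero n0.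
have e0 : mcomp (mcomp p0 r) (mcomp io i0) = mid U0 by rewrite -mcompA (mcompA r) rio mcomp1m.
have [j [f /misomP[g [gf fg]]]] := cU U0 iU0 (retract_summand e0).
exists j, (mcomp (mcomp io i0) g), (mcomp f (mcomp p0 r)).
rewrite -ior -!mcompA (mcompA r io) rio mcomp1m (mcompA r io) rio mcomp1m.
by rewrite (mcompA p0) pi0 mcomp1m fg.
Qed.

Lemma lifted_nsummands a b : nsummands (modcat A) T a -> nsummands (modcat A) P b -> nsummands C X (a + b).
Proof.
move=> [U [iU nU cU]] [V [iV nV cV]].
have /choice[YT YTP] i : exists Y, lifts_left (U i) Y by apply/lifts_left_exists/(iU i).2.
have /choice[YP YPP] j : exists Y, lifts_right (V j) Y by apply/lifts_right_exists/(iV j).2.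
have indT i : indecomposable C (YT i).
  have [io [r [iy [py [rio pi_ E E']]]]] := YTP i.
  exact: (side_indec pi1B pi1M pi2B pi2M ker2 rio (iU i).1 pi_ E E').
have indP j : indecomposable C (YP j).
  have [io [r [iy [py [rio pi_ E E']]]]] := YPP j.
  exact: (side_indec pi2B pi2M pi1B pi1M ker2' rio (iV j).1 pi_ E E').
have nTP i j : ~ iso_obj C (YT i) (YP j).
  have [io [r [iy [py [rio pi_ E E']]]]] := YTP i; have [io' [r' [iy' [py' [rio' pi_' F F']]]]] := YPP j.
  by move=> h; have [[+ _] _] := iU i; apply; apply: (side_not_iso pi1M rio pi_ pi_' E F' h).
exists (fun l => match split l with inl i => YT i | inr j => YP j end); split.
- move=> l; case: (split l) => [i|j]; split=> //.
    by have [io [r [iy [py [rio pi_ E E']]]]] := YTP i; apply: retract_is_summand pi_.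
  by have [io [r [iy [py [rio pi_ E E']]]]] := YPP j; apply: retract_is_summand pi_.
- move=> l l' h; apply: (can_inj (@splitK a b)); move: h.
  case: (split l) => i; case: (split l') => j h; [congr inl| | |congr inr].
  + have [io [r [iy [py [rio pi_ E E']]]]] := YTP i; have [io' [r' [iy' [py' [rio' pi_' F F']]]]] := YTP j.
    exact/nU/(side_iso pi1M rio rio' pi_ pi_' E F h).
  + by case: (nTP i j).
  + by case: (nTP j i); apply: iso_obj_sym.
  have [io [r [iy [py [rio pi_ E E']]]]] := YPP i; have [io' [r' [iy' [py' [rio' pi_' F F']]]]] := YPP j.
  exact/nV/(side_iso pi2M rio rio' pi_ pi_' E F h).
move=> Z iZ [W [i [_ [p [_ [pi_ _ _ _ _]]]]]].
have ee : i <o> p <o> (i <o> p) = i <o> p by rewrite -compA (compA p) pi_ comp1m.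
have [z1|n1] := eqVneq (pi1 (i <o> p)) 0; last first.
  have [|j [al [be ab]]] := indec_summand_idem _ n1 cU; first by rewrite -pi1M ee.
  have [io [r [iy [py [rio pi_' E E']]]]] := YTP j.
  exists (unsplit (inl j)); rewrite unsplitK.
  exact: (side_complete pi1B pi1M pi2B pi2M ker2 split_idem (t := fun b => s b 0) (fun b => pis1 b 0)
    iZ pi_ rio (indT j) pi_' E E' ab).
have [z2|n2] := eqVneq (pi2 (i <o> p)) 0; last first.
  have [|j [al [be ab]]] := indec_summand_idem _ n2 cV; first by rewrite -pi2M ee.
  have [io [r [iy [py [rio pi_' E E']]]]] := YPP j.
  exists (unsplit (inr j)); rewrite unsplitK.
  exact: (side_complete pi2B pi2M pi1B pi1M ker2' split_idem (t := fun b => s 0 b) (fun b => pis2 0 b)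
    iZ pi_ rio (indP j) pi_' E E' ab).
case: iZ => nZ _; case: nZ; apply/(zero_retract pi_); rewrite -ee; exact: ker2.
Qed.
End LiftedSummands.

(** * Direct sums, and orbit morphisms in degrees 0 and 1 *)

Section DirectSums.
Local Open Scope ring_scope.
Variable k : fieldType.

Lemma functor_dsum (O1 O2 : Type) (C1 : klcat k O1) (C2 : klcat k O2) (F0 : O1 -> O2) (F : functor C1 C2 F0) X Y Z :
  is_dsum C1 X Y Z -> is_dsum C2 (F0 X) (F0 Y) (F0 Z).
Proof.
move=> [i1 [i2 [p1 [p2 [e1 e2 e3 e4 e5]]]]]; exists (fmap F i1), (fmap F i2), (fmap F p1), (fmap F p2).
by split; rewrite -!fmap_comp -?fmapD ?e1 ?e2 ?e3 ?e4 ?e5 ?fmap_id ?fmap0.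
Qed.

Section Hom0.
Variables (O : Type) (C : klcat k O).
Local Notation "g <o> f" := (comp C g f) (at level 40, left associativity).
Lemma hom0_dsum X Y1 Y2 X' Y1' Y2' : is_dsum C X Y1 Y2 -> is_dsum C X' Y1' Y2' ->
  (forall h : Hom C Y1 Y1', h = 0) -> (forall h : Hom C Y1 Y2', h = 0) ->
  (forall h : Hom C Y2 Y1', h = 0) -> (forall h : Hom C Y2 Y2', h = 0) -> forall h : Hom C X X', h = 0.
Proof.
move=> [i1 [i2 [p1 [p2 [_ _ _ _ e]]]]] [i1' [i2' [p1' [p2' [_ _ _ _ e']]]]] h11 h12 h21 h22 h.
rewrite -[h]comp1m -[h]compm1 -e -e' !compDl !compDr -!compA.
have z (W W' : O) (i : Hom C W X) (p' : Hom C X' W') : (forall g : Hom C W W', g = 0) ->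
  forall p i', i' <o> (p' <o> (h <o> (i <o> p))) = 0 :> Hom C X X'.
  by move=> z p i'; rewrite (compA h) (compA p') (z (p' <o> (h <o> i))) comp0m compm0.
by rewrite !z // !addr0.
Qed.

Fixpoint iter_functor (F0 : O -> O) (F : functor C C F0) n : functor C C (iter n F0) :=
  match n with 0 => functor_id C | n'.+1 => functor_comp (iter_functor F n') F end.
Lemma fpow_dsum (F0 : O -> O) (F : functor C C F0) (Q : quasi_inverse F) n X Y Z :
  is_dsum C X Y Z -> is_dsum C (fpow Q n X) (fpow Q n Y) (fpow Q n Z).
Proof.
case: n => n; first exact: (functor_dsum (iter_functor F n)).
exact: (functor_dsum (iter_functor (qinv Q) n.+1)).
Qed.

Section Orbit.
Variables (F0 : O -> O) (F : functor C C F0) (Q : quasi_inverse F).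
Definition two_degree_fun X Y (g0 : Hom C X Y) (g1 : Hom C X (F0 Y)) : dprod (fun i => Hom C X (fpow Q i Y)) :=
  fun i => match i with Posz 0 => g0 | Posz 1 => g1 | _ => 0 end.
Fact two_degree_supp X Y (g0 : Hom C X Y) (g1 : Hom C X (F0 Y)) : two_degree_fun g0 g1 \in @fin_supp _ _ _ _ _ Q X Y.
Proof. by apply/asboolP; exists [:: Posz 0; Posz 1] => -[[|[|n]]|n]. Qed.
Definition two_degree X Y g0 g1 : orbit_hom Q X Y := OrbitHom (two_degree_supp g0 g1).
Lemma two_degree_linear X Y c (g0 g0' : Hom C X Y) g1 g1' :
  two_degree (c *: g0 + g0') (c *: g1 + g1') = c *: two_degree g0 g1 + two_degree g0' g1'.
Proof.
apply: orbit_inj => i; rewrite -[RHS]/(c *: two_degree_fun g0 g1 i + two_degree_fun g0' g1' i).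
by case: i => [[|[|n]]|n] //=; rewrite -[LHS]/(0) scaler0 addr0.
Qed.
Lemma two_degree_comp0 X Y Z (f : Hom C X Y) (g : Hom C Y Z) :
  orbit_comp (two_degree g 0) (two_degree f 0) = two_degree (g <o> f) 0.
Proof.
apply: orbit_inj => n; rewrite (@orbit_compE _ _ _ _ _ _ _ _ _ _ _ [:: Posz 0]) //; last by case=> [[|[|m]]|m].
by rewrite big_seq1; case: n => [[|[|n]]|n] //; apply: comp0m.
Qed.
Lemma two_degree_id X : two_degree (idm C X) 0 = orbit_id Q X.
Proof. by apply: orbit_inj => -[[|[|n]]|n]. Qed.

Variable X : O.
Hypothesis hX : forall n, n != 0 -> n != 1 -> forall h : Hom C X (fpow Q n X), h = 0.
(** The multiplication of a trivial extension: the product of the degree 1 parts lies in degree 2,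
    where there are no nonzero maps. *)
Lemma two_degree_comp (g0 f0 : Hom C X X) g1 f1 :
  orbit_comp (two_degree g0 g1) (two_degree f0 f1) = two_degree (g0 <o> f0) (g1 <o> f0 + fmap F g0 <o> f1).
Proof.
apply: orbit_inj => n; have [n0|n0] := eqVneq n 0; last have [n1|n1] := eqVneq n 1.
- rewrite n0 (@orbit_compE _ _ _ _ _ _ _ _ _ _ _ [:: Posz 0; Posz 1]) //; last by case=> [[|[|m]]|m].
  rewrite big_cons big_seq1 -[RHS]addr0; congr (_ + _).
  (* [f1] contributes to degree 0 through the component of the first factor in degree -1, which is
     0. *)
  rewrite -[orbit_ext _ _ _]/(fpow_up Q 0 X <o> fmap F 0) fmap0 compm0; exact: comp0m.
- rewrite n1 (@orbit_compE _ _ _ _ _ _ _ _ _ _ _ [:: Posz 0; Posz 1]) //; last by case=> [[|[|m]]|m].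
  rewrite big_cons big_seq1; congr (_ + _).
  by rewrite -[orbit_ext _ _ _]/(idm C _ <o> fmap F g0) comp1m.
by rewrite [LHS]hX // [RHS]hX.
Qed.
Lemma two_degreeE (g : orbit_hom Q X X) : g = two_degree (g (Posz 0)) (g (Posz 1)).
Proof.
apply: orbit_inj => n; have [->//|n0] := eqVneq n 0; have [->//|n1] := eqVneq n 1.
by rewrite [LHS]hX // [RHS]hX.
Qed.
End Orbit.
End Hom0.

Lemma dsum_cplx_dsum (A : fdAlgType k) (D : derived A) (X Y : cplx A) : is_dsum D (dsum_cplx X Y) X Y.
Proof.
have c1 : @is_chain_map k A X (dsum_cplx X Y) (fun i => dinl _ _).
  by move=> i; apply: mhom_inj => x; rewrite !mcompE !dinlE dsum_cdE /= lf0.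
have c2 : @is_chain_map k A Y (dsum_cplx X Y) (fun i => dinr _ _).
  by move=> i; apply: mhom_inj => x; rewrite !mcompE !dinrE dsum_cdE /= lf0.
have c3 : @is_chain_map k A (dsum_cplx X Y) X (fun i => dfst _ _).
  by move=> i; apply: mhom_inj => x; rewrite !mcompE !dfstE dsum_cdE.
have c4 : @is_chain_map k A (dsum_cplx X Y) Y (fun i => dsnd _ _).
  by move=> i; apply: mhom_inj => x; rewrite !mcompE !dsndE dsum_cdE.
apply: (functor_dsum (dloc D)).
exists (mk_chain c1), (mk_chain c2), (mk_chain c3), (mk_chain c4).
split; apply: chain_inj => i; apply: mhom_inj => x.
- by rewrite [LHS]mcompE dinlE dfstE midE.
- by rewrite [LHS]mcompE dinrE dsndE midE.
- by rewrite [LHS]mcompE dinrE dfstE [RHS]mhom0E.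
- by rewrite [LHS]mcompE dinlE dsndE [RHS]mhom0E.
rewrite midE; apply: etrans (mhomDE _ _ _) _; rewrite [X in X + _]mcompE [X in _ + X]mcompE.
rewrite dinlE dinrE dfstE dsndE; case: x => x y; by congr pair; rewrite /= ?addr0 ?add0r.
Qed.
End DirectSums.

Section Blocks.
Local Open Scope ring_scope.
Variables (k : fieldType) (O : Type) (C : klcat k O).
Local Notation "g <o> f" := (comp C g f) (at level 40, left associativity).
Variables (X A1 A2 : O) (i1 : Hom C A1 X) (i2 : Hom C A2 X) (p1 : Hom C X A1) (p2 : Hom C X A2).
Hypotheses (e11 : p1 <o> i1 = idm C A1) (e22 : p2 <o> i2 = idm C A2) (e12 : p1 <o> i2 = 0)
  (e21 : p2 <o> i1 = 0) (es : i1 <o> p1 + i2 <o> p2 = idm C X).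
Definition lower_block (b : Hom C A1 A1) (m : Hom C A1 A2) (h : Hom C A2 A2) : Hom C X X :=
  i1 <o> b <o> p1 + i2 <o> m <o> p1 + i2 <o> h <o> p2.
Lemma lower_block_linear c b m h b' m' h' :
  lower_block (c *: b + b') (c *: m + m') (c *: h + h') = c *: lower_block b m h + lower_block b' m' h'.
Proof.
rewrite /lower_block !compDr !compDl !compZr !compZl !scalerDr.
by rewrite [X in X + _ = _]addrACA [LHS]addrACA.
Qed.
Lemma lower_block_r1 b m h W (f : Hom C W A1) : lower_block b m h <o> (i1 <o> f) = i1 <o> (b <o> f) + i2 <o> (m <o> f).
Proof. by rewrite /lower_block !compDl -!compA !(compA p1) !(compA p2) e11 e21 comp1m comp0m !compm0 addr0. Qed.
Lemma lower_block_r2 b m h W (f : Hom C W A2) : lower_block b m h <o> (i2 <o> f) = i2 <o> (h <o> f).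
Proof. by rewrite /lower_block !compDl -!compA !(compA p1) !(compA p2) e12 e22 comp1m comp0m !compm0 !add0r. Qed.
Lemma lower_block_comp b m h b' m' h' :
  lower_block b m h <o> lower_block b' m' h' = lower_block (b <o> b') (m <o> b' + h <o> m') (h <o> h').
Proof.
rewrite {2}/lower_block !compDr -!compA lower_block_r1 !lower_block_r2 /lower_block.
by rewrite !compDr !compDl -!compA !addrA.
Qed.
Lemma lower_block1 : lower_block (idm C A1) 0 (idm C A2) = idm C X.
Proof. by rewrite /lower_block !compm1 compm0 comp0m addr0. Qed.
Lemma lower_blockP (g : Hom C X X) : p1 <o> g <o> i2 = 0 ->
  lower_block (p1 <o> g <o> i1) (p2 <o> g <o> i1) (p2 <o> g <o> i2) = g.
Proof.
move=> z; rewrite -[RHS]comp1m -[in RHS]es compDl -[X in _ = X + _]compm1 -[X in _ = _ + X]compm1 -es !compDr.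
have -> : i1 <o> p1 <o> g <o> (i2 <o> p2) = 0 by rewrite compA -(compA i1) -(compA i1) z compm0 comp0m.
by rewrite addr0 /lower_block !compA addrA.
Qed.
Lemma lower_block_entries b m h : [/\ p1 <o> lower_block b m h <o> i1 = b,
  p2 <o> lower_block b m h <o> i1 = m & p2 <o> lower_block b m h <o> i2 = h].
Proof.
have l1 := lower_block_r1 b m h (idm C A1); have l2 := lower_block_r2 b m h (idm C A2).
rewrite !compm1 in l1 l2; rewrite -!compA l1 l2 !compDr !compA e11 e12 e21 e22.
by rewrite !comp1m !comp0m addr0 add0r.
Qed.
End Blocks.

(** * The endomorphism algebra of T + P[1] in the cluster category *)

Section EndomorphismAlgebra.
Local Open Scope ring_scope.
Variables (k : fieldType) (A : fdAlgType k) (D : derived A) (S : cluster_data D).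
Hypotheses (hS : serre_data S) (hA : hereditary A).
Variables T P : rmod A.
Hypotheses (eT : extz T T) (pP : projective P) (hPT : forall f : mhom P T, f = 0) (eNT : extz (nu P) T).
Variable DB : derived (mendo T).
Local Notation "g <o> f" := (comp D g f) (at level 40, left associativity).
Local Notation F := (functor_comp (qinv (ctau_inv S)) (dshift D)).
Local Notation FT := (shift (qinv0 (ctau_inv S) (stalk T))).
Local Notation sT := (stalk T).
Local Notation sP := (shift (stalk P)).
Local Notation E := (ext2_bimod DB).
Local Notation M := (ext1_bimod D T P).
Local Notation Lam := (tri_alg (bimod_restr M (triv_ext_proj E))).
Local Notation CC := (cluster_cat S).
Variable Psi : E -> Hom D sT FT.
Hypotheses (Psi_lin : linear Psi) (Psi_inj : injective Psi) (Psi_surj : forall f, exists e, Psi e = f)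
  (Psi_l : forall (c : mendo T) e, Psi (lact E c e) = fmap F (fmap (dstalk D) c) <o> Psi e)
  (Psi_r : forall (c : mendo T) e, Psi (ract E e c) = Psi e <o> fmap (dstalk D) c).
Local Notation X := (dsum_cplx sT sP).
Variables (i1 : Hom D sT X) (i2 : Hom D sP X) (p1 : Hom D X sT) (p2 : Hom D X sP).
Hypotheses (e11 : p1 <o> i1 = idm D sT) (e22 : p2 <o> i2 = idm D sP) (e12 : p1 <o> i2 = 0)
  (e21 : p2 <o> i1 = 0) (es : i1 <o> p1 + i2 <o> p2 = idm D X).

Let Psi0 : Psi 0 = 0. Proof. by have := Psi_lin (-1) 0 0; rewrite scaleN1r oppr0 addr0 scaleN1r addNr. Qed.
Let dX : is_dsum D X sT sP. Proof. by exists i1, i2, p1, p2. Qed.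
Let hT1 := hom_TFP hA hS (T := T) pP (i := 1) isT.
Let hP1 := hom_PFT hA hS pP eNT (i := 1).
Let hP0 := hom_PFT hA hS pP eNT (i := 0).
Let hPP1 := hom_PFP hA hS pP (i := 1) isT.

Lemma self_hom0 n : n != 0 -> n != 1 -> forall h : Hom D X (fpow (cF_inv S) n X), h = 0.
Proof.
move=> n0 n1; apply: (hom0_dsum dX (fpow_dsum (cF_inv S) n dX)).
- exact: hom_TFT.
- exact: hom_TFP.
- exact: hom_PFT.
exact: hom_PFP.
Qed.
Lemma self_ext0 (f : Hom CC X (shift X)) : f = 0.
Proof.
apply: orbit_inj => n; rewrite [RHS]/=; apply: (hom0_dsum dX (fpow_dsum (cF_inv S) n (functor_dsum (dshift D) dX))).
- exact: hom_TFTs.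
- exact: hom_TFPs.
- exact: hom_PFTs.
exact: hom_PFPs.
Qed.

Definition diag_part (b : mhom T T) (m : Hom D sT sP) (h : mhom P P) : Hom D X X :=
  lower_block i1 i2 p1 p2 (fmap (dstalk D) b) m (fmap (dstalk_shift D 1) h).
Definition theta (x : Lam) : endo CC X :=
  let y : triv_ext E := x.1.1 in
  two_degree (cF_inv S) (diag_part y.1 x.1.2 x.2) (fmap F i1 <o> Psi y.2 <o> p1).
Lemma thetaE (b : mendo T) (e : E) (m : M) (h : mendo P) :
  theta ((((b, e) : triv_ext E), m : bimod_restr M (triv_ext_proj E)), h) =
  two_degree (cF_inv S) (diag_part b m h) (fmap F i1 <o> Psi e <o> p1).
Proof. by []. Qed.

Lemma theta_linear : linear theta.
Proof.
move=> c [[[b e] m] h] [[[b' e'] m'] h'].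
rewrite -[LHS]/(two_degree (cF_inv S) (diag_part (c *: b + b') (c *: m + m') (c *: h + h'))
  (fmap F i1 <o> Psi (c *: e + e') <o> p1)).
rewrite /diag_part (fmap_linear (dstalk D)) (fmap_linear (dstalk_shift D 1)) lower_block_linear Psi_lin.
by rewrite compDr compZr compDl compZl two_degree_linear.
Qed.
Lemma theta1 : theta (aone Lam) = aone (endo CC X).
Proof.
rewrite -[LHS]/(two_degree (cF_inv S) (diag_part (mid T) 0 (mid P)) (fmap F i1 <o> Psi 0 <o> p1)).
rewrite Psi0 compm0 comp0m /diag_part (fmap_id (dstalk D)) (fmap_id (dstalk_shift D 1)).
rewrite -[aone _]/(orbit_id _ _) -two_degree_id; congr two_degree.
exact: lower_block1 es.
Qed.
Lemma thetaM : {morph theta : x y / x ** y}.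
Proof.
move=> [[[b e] m] h] [[[b' e'] m'] h'].
rewrite -[LHS]/(two_degree (cF_inv S) (diag_part (mcomp b b')
  (m <o> fmap (dstalk D) b' + fmap (dstalk_shift D 1) h <o> m') (mcomp h h'))
  (fmap F i1 <o> Psi (lact E b e' + ract E e b') <o> p1)).
rewrite -[RHS]/(orbit_comp (two_degree (cF_inv S) (diag_part b m h) (fmap F i1 <o> Psi e <o> p1))
  (two_degree (cF_inv S) (diag_part b' m' h') (fmap F i1 <o> Psi e' <o> p1))).
rewrite (two_degree_comp self_hom0) /diag_part (lower_block_comp e11 e22 e12 e21).
rewrite -(fmap_comp (dstalk D)) -(fmap_comp (dstalk_shift D 1)); congr two_degree.
have -> : Psi (lact E b e' + ract E e b') = Psi (lact E b e') + Psi (ract E e b').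
  by have := Psi_lin 1 (lact E b e') (ract E e b'); rewrite !scale1r.
rewrite Psi_l Psi_r compDr compDl addrC; congr (_ + _).
  have pb : p1 <o> lower_block i1 i2 p1 p2 (fmap (dstalk D) b') m' (fmap (dstalk_shift D 1) h') =
      fmap (dstalk D) b' <o> p1.
    by rewrite /lower_block !compDr !compA e11 e12 !comp0m !addr0 comp1m.
  by rewrite -!compA pb.
have bi : lower_block i1 i2 p1 p2 (fmap (dstalk D) b) m (fmap (dstalk_shift D 1) h) <o> i1 =
    i1 <o> fmap (dstalk D) b + i2 <o> m.
  have := lower_block_r1 i2 e11 e21 (fmap (dstalk D) b) m (fmap (dstalk_shift D 1) h) (idm D _).
  by rewrite !compm1.
have Fbi : fmap F (lower_block i1 i2 p1 p2 (fmap (dstalk D) b) m (fmap (dstalk_shift D 1) h)) <o> fmap F i1 =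
    fmap F i1 <o> fmap F (fmap (dstalk D) b) + fmap F i2 <o> fmap F m.
  by rewrite -(fmap_comp F) bi (fmapD F) !(fmap_comp F).
(* The product of [m] with an element of the ideal is a map from T to F(P[1]), hence zero;
   correspondingly, Ext^2 acts on [M] through the projection to [B]. *)
rewrite !compA Fbi !compDl -(compA (fmap F i2)) (hT1 (fmap F m <o> Psi e')) compm0 comp0m addr0 //.
Qed.

Lemma theta_inj x : theta x = 0 -> x = 0.
Proof.
case: x => [[[b e] m] h] x0.
have g0 : diag_part b m h = 0 by exact: (congr1 (fun f : orbit_hom (cF_inv S) X X => f (Posz 0)) x0).
have g1 : fmap F i1 <o> Psi e <o> p1 = 0 by exact: (congr1 (fun f : orbit_hom (cF_inv S) X X => f (Posz 1)) x0).
have [eb em eh] := lower_block_entries e11 e22 e12 e21 (fmap (dstalk D) b) m (fmap (dstalk_shift D 1) h).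
rewrite -/(diag_part b m h) g0 !compm0 !comp0m in eb em eh.
have b0 : b = 0 by apply: (stalk_faithful (D := D)); rewrite -[LHS]eb.
have h0 : h = 0 by apply: (stalk_faithful (D := D)); apply: dshift_faithful; rewrite -[LHS]eh.
have e0 : e = 0.
  apply: Psi_inj; rewrite Psi0 -[LHS]comp1m -[LHS]compm1 -(fmap_id F) -e11 fmap_comp.
  by rewrite -!compA (compA (Psi e)) (compA (fmap F i1)) (compA (fmap F i1)) g1 comp0m compm0.
by rewrite b0 e0 -em h0.
Qed.
Lemma theta_surj g : exists x, theta x = g.
Proof.
have [b bE] := stalk_full (p1 <o> g (Posz 0) <o> i1).
have [h' h'E] := dshift_full (p2 <o> g (Posz 0) <o> i2); have [h hE] := stalk_full h'.
have [e eE] := Psi_surj (fmap F p1 <o> g (Posz 1) <o> i1).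
exists ((((b, e) : triv_ext E), (p2 <o> g (Posz 0) <o> i1 : M) : bimod_restr M (triv_ext_proj E)), h).
rewrite thetaE [RHS](two_degreeE self_hom0); congr two_degree.
  (* In degree 0 the block from P[1] to T vanishes, so the matrix is triangular. *)
  rewrite /diag_part -[RHS](lower_blockP es (hP0 (p1 <o> g (Posz 0) <o> i2))).
  congr lower_block; first exact: bE.
  by rewrite -h'E -hE.
have fs : fmap F i1 <o> fmap F p1 + fmap F i2 <o> fmap F p2 = idm D _.
  by rewrite -!(fmap_comp F) -(fmapD F) es (fmap_id F).
rewrite eE -[RHS]comp1m -fs compDl -[X in _ = X + _]compm1 -[X in _ = _ + X]compm1 -es !compDr.
have z (W W' : cplx A) (i : Hom D W X) (p' : Hom D _ W') : (forall f : Hom D W W', f = 0) ->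
    forall p i', i' <o> p' <o> g (Posz 1) <o> (i <o> p) = 0 :> Hom D X _.
  by move=> w p i'; rewrite compA -2!(compA i') (w (p' <o> _ <o> i)) compm0 comp0m.
(* In degree 1 the three blocks that involve P[1] vanish, and only T -> F T is left. *)
rewrite (z _ _ _ i2 (fmap F p1) hP1) (z _ _ _ i1 (fmap F p2) hT1) (z _ _ _ i2 (fmap F p2) hPP1) !addr0.
by rewrite !compA.
Qed.
End EndomorphismAlgebra.

Section ClusterTilting.
Local Open Scope ring_scope.

Lemma diag_comp (k : fieldType) (O : Type) (C : klcat k O) (X Y Z A1 A2 B1 B2 C1 C2 : O)
    (q1 : Hom C Y B1) (q2 : Hom C Y B2) (j1 : Hom C B1 Y) (j2 : Hom C B2 Y)
    (i1 : Hom C C1 Z) (i2 : Hom C C2 Z) (p1 : Hom C X A1) (p2 : Hom C X A2)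
    (f1 : Hom C B1 C1) (f2 : Hom C B2 C2) (g1 : Hom C A1 B1) (g2 : Hom C A2 B2) :
  comp C q1 j1 = idm C B1 -> comp C q2 j2 = idm C B2 -> comp C q1 j2 = 0 -> comp C q2 j1 = 0 ->
  comp C (comp C i1 (comp C f1 q1) + comp C i2 (comp C f2 q2))
         (comp C j1 (comp C g1 p1) + comp C j2 (comp C g2 p2)) =
  comp C i1 (comp C (comp C f1 g1) p1) + comp C i2 (comp C (comp C f2 g2) p2).
Proof.
move=> e1 e2 e3 e4; rewrite !compDr !compDl -!compA !(compA q1) !(compA q2) e1 e2 e3 e4.
by rewrite !comp1m !comp0m !compm0 addr0 add0r.
Qed.

Lemma lact0l (k : fieldType) (L R : pzAlgType k) (M : bimod L R) (x : M) : lact M 0 x = 0.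
Proof. by have := @lact_linl _ _ _ M x (-1) 0 0; rewrite scaleN1r oppr0 addr0 scaleN1r addNr. Qed.
Lemma ract0r (k : fieldType) (L R : pzAlgType k) (M : bimod L R) (x : M) : ract M x 0 = 0.
Proof. by have := @ract_linr _ _ _ M x (-1) 0 0; rewrite scaleN1r oppr0 addr0 scaleN1r addNr. Qed.

Variables (k : fieldType) (A : fdAlgType k) (D : derived A) (S : cluster_data D).
Hypotheses (hS : serre_data S) (hA : hereditary A).
Variables T P : rmod A.
Hypotheses (eT : extz T T) (pP : projective P) (hPT : forall f : mhom P T, f = 0) (eNT : extz (nu P) T).
Variable DB : derived (mendo T).
Local Notation "g <o> f" := (comp D g f) (at level 40, left associativity).
Local Notation F := (functor_comp (qinv (ctau_inv S)) (dshift D)).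
Local Notation FT := (shift (qinv0 (ctau_inv S) (stalk T))).
Local Notation sT := (stalk T).
Local Notation sP := (shift (stalk P)).
Local Notation E := (ext2_bimod DB).
Local Notation M := (ext1_bimod D T P).
Local Notation Lam := (tri_alg (bimod_restr M (triv_ext_proj E))).
Local Notation CC := (cluster_cat S).
Variable Psi : E -> Hom D sT FT.
Hypotheses (Psi_lin : linear Psi) (Psi_inj : injective Psi) (Psi_surj : forall f, exists e, Psi e = f)
  (Psi_l : forall (c : mendo T) e, Psi (lact E c e) = fmap F (fmap (dstalk D) c) <o> Psi e)
  (Psi_r : forall (c : mendo T) e, Psi (ract E e c) = Psi e <o> fmap (dstalk D) c).
Local Notation X := (dsum_cplx sT sP).

Lemma cluster_tilted_endo a b : basic (modcat A) T -> basic (modcat A) P ->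
  nsummands (modcat A) T a -> nsummands (modcat A) P b -> nsummands (modcat A) (regular A) (a + b) ->
  cluster_tilted Lam.
Proof.
move=> bT bP nT nP nA.
have [i1 [i2 [p1 [p2 [e11 e22 e12 e21 es]]]]] := dsum_cplx_dsum D sT sP.
pose th : Lam -> endo CC X := theta Psi i1 i2 p1 p2.
have thlin : linear th := theta_linear Psi_lin i1 i2 p1 p2.
have thM : {morph th : x y / x ** y} := thetaM hS hA pP eNT Psi_lin Psi_l Psi_r e11 e22 e12 e21 es.
have th1 : th (aone Lam) = aone (endo CC X) := theta1 Psi_lin es.
have thB x y : th (x - y) = th x - th y by rewrite addrC -scaleN1r thlin scaleN1r [LHS]addrC.
have /choice[inv thK] : forall g, exists x, th x = g :=
  theta_surj hS hA pP eNT Psi_surj e11 e22 e12 e21 es.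
have th_inj : injective th.
  move=> x y e; apply/eqP; rewrite -subr_eq0; apply/eqP.
  apply: (theta_inj (Psi := Psi) Psi_lin Psi_inj e11 e22 e12 e21).
  by rewrite -[theta _ _ _ _ _ _]/(th (x - y)) thB e subrr.
have invK : cancel th inv by move=> x; apply: th_inj; rewrite thK.
have invM f g : inv (comp CC f g) = inv f ** inv g.
  by apply: th_inj; rewrite thM !thK.
have invB f g : inv (f - g) = inv f - inv g.
  by apply: th_inj; rewrite thB !thK.
have inv1 : inv (idm CC X) = aone Lam by apply: th_inj; rewrite thK th1.
have th0 : th 0 = 0 by rewrite -(subrr 0) thB subrr.
pose pi1 (g : Hom CC X X) : mhom T T := (inv g).1.1.1.
pose pi2 (g : Hom CC X X) : mhom P P := (inv g).2.
pose s (c : mhom T T) (h : mhom P P) : Hom CC X X :=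
  th (((((c : mendo T), 0 : E) : triv_ext E), (0 : bimod_restr M (triv_ext_proj E))), (h : mendo P)).
have pi1B f g : pi1 (f - g) = pi1 f - pi1 g by rewrite /pi1 invB.
have pi2B f g : pi2 (f - g) = pi2 f - pi2 g by rewrite /pi2 invB.
have pi1M f g : pi1 (comp CC f g) = mcomp (pi1 f) (pi1 g) by rewrite /pi1 invM.
have pi2M f g : pi2 (comp CC f g) = mcomp (pi2 f) (pi2 g) by rewrite /pi2 invM.
have pi11 : pi1 (idm CC X) = mid T by rewrite /pi1 inv1.
have pi21 : pi2 (idm CC X) = mid P by rewrite /pi2 inv1.
have pis1 c h : pi1 (s c h) = c by rewrite /pi1 /s invK.
have pis2 c h : pi2 (s c h) = h by rewrite /pi2 /s invK.
have ker2 x y : pi1 x = 0 -> pi2 x = 0 -> pi1 y = 0 -> pi2 y = 0 -> comp CC x y = 0.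
  (* Elements with zero diagonal have only an [Ext^2] and an [M] component; each term of a product
     of two of them contains a diagonal entry. *)
  rewrite /pi1 /pi2 => x1 x2 y1 y2.
  have : inv x ** inv y = 0.
    move: x1 x2 y1 y2; case: (inv x) => [[[c e] m] h]; case: (inv y) => [[[c' e'] m'] h'] /=.
    move=> -> -> -> ->; congr (_, _, _).
    - congr (_, _); first exact: mcomp0.
      exact: etrans (congr2 +%R (lact0l (M := E) e') (ract0r (M := E) e)) (addr0 _).
    - exact: etrans (congr2 +%R (ract0r (M := M) m) (lact0l (M := M) m')) (addr0 _).
    exact: mcomp0.
  by rewrite -invM => e; rewrite -[LHS]thK e th0.
have split_s T' P' (io : mhom T' T) (r : mhom T T') (io' : mhom P' P) (r' : mhom P P') :
    mcomp r io = mid T' -> mcomp r' io' = mid P' ->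
    exists Y (i : Hom CC Y X) (p : Hom CC X Y),
      comp CC p i = idm CC Y /\ comp CC i p = s (mcomp io r) (mcomp io' r').
  move=> rio rio'.
  (* A diagonal idempotent splits in degree 0, through the object T' + P'[1]. *)
  have [j1 [j2 [q1 [q2 [f11 f22 f12 f21 fs]]]]] := dsum_cplx_dsum D (stalk T') (shift (stalk P')).
  exists (dsum_cplx (stalk T') (shift (stalk P'))).
  exists (two_degree (cF_inv S) (i1 <o> (fmap (dstalk D) io <o> q1) + i2 <o> (fmap (dstalk_shift D 1) io' <o> q2)) 0).
  exists (two_degree (cF_inv S) (j1 <o> (fmap (dstalk D) r <o> p1) + j2 <o> (fmap (dstalk_shift D 1) r' <o> p2)) 0).
  split; rewrite [LHS]two_degree_comp0 diag_comp // -(fmap_comp (dstalk D)) -(fmap_comp (dstalk_shift D 1)).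
    rewrite -[idm CC _]/(orbit_id _ _) -two_degree_id; congr two_degree.
    rewrite -[comp (modcat A) r io]/(mcomp r io) -[comp (modcat A) r' io']/(mcomp r' io') rio rio'.
    by rewrite (fmap_id (dstalk D)) (fmap_id (dstalk_shift D 1)) !comp1m.
  rewrite /s /th thetaE; congr two_degree.
    by rewrite /diag_part /lower_block compm0 comp0m addr0 !compA.
  have -> : Psi 0 = 0 by have := Psi_lin (-1) 0 0; rewrite scaleN1r oppr0 addr0 scaleN1r addNr.
  by rewrite compm0 comp0m.
exists A, D, S, X; split=> //.
- split; first exact: (self_ext0 hS hA eT pP hPT e11 e22 e12 e21 es).
  exists (a + b)%N; split=> //.
  exact: (lifted_nsummands pi1B pi1M pi2B pi2M ker2 pis1 pis2 split_s nT nP).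
- exact: (lifted_basic pi1B pi1M pi2B pi2M pi11 ker2 pi21 bT bP).
exists (@AlgHom k Lam (endo CC X) th thlin th1 thM).
by exists inv.
Qed.
End ClusterTilting.

Theorem theorem1p2 (k : closedFieldType) (H : fdAlgType k) (T P : rmod H)
    (DbH : derived H) (DbB : derived (mendo T)) :
  hereditary H ->
  basic (modcat H) T -> basic (modcat H) P ->
  support_tau_tilting T P ->
  let M : bimod (mendo P) (mendo T) := ext1_bimod DbH T P in
  let E : bimod (mendo T) (mendo T) := ext2_bimod DbB in
  silted_wrt DbH T P (tri_alg M) ->
  (exists N : rmod H, is_tauinv T N /\ forall f : mhom P N, f = 0%R) ->
  cluster_tilted (tri_alg (bimod_restr M (triv_ext_proj E))).
Proof.
move=> hH bT bP [[N' [[Q1 [Q0 [p1 [p0 [i [mp ki]]]]]] hTN]] pP hPT [a [b [nT nP nA]]]] M E _.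
move=> [N [[J0 [J1 [i0 [i1 [q [mi cq]]]]]] hPN]].
have [pQ1 pQ0 p0s kp] := min_pres_kernel hH mp.
have [jJ0 jJ1 i0i i1s ex] := min_copres_exact hH mi.
have nui := tau_rigid_pres ki hTN.
have eT := presentation_extz pQ1 pQ0 p0s kp nui.
have lift := inj_hom_lift hH jJ0 jJ1 eT pP hPT nT nP nA cq hPN.
have eNT := extz_nu hH jJ0 jJ1 i0i ex eT pP hPT nT nP nA cq hPN.
(* A cluster category of [H] has to be exhibited; the translation built from transposes comes with
   the trace forms on which the comparison of bimodules rests. *)
have [S hS] := cluster_data_exists DbH hH.
have [Psi [Psil [Psii Psis] PsiL PsiR]] := ext2_bimodule_iso hS hH eT pP hPT nT nP nA pQ1 pQ0 p0s kp nui
  jJ0 jJ1 i0i i1s ex lift DbB.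
exact: (cluster_tilted_endo hS hH eT pP hPT eNT Psil Psii Psis PsiL PsiR bT bP nT nP nA).
Qed.
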